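(* Let $X$ be a compact Riemann surface of genus $g\geq 2$, let $L\to X$ be a holomorphic line bundle of degree $d_L$, and let $n\geq 1$ be an integer. If $d_L$ is even, then for any real $\alpha<\alpha_M=\frac{d_L}{2}$ the moduli space $\mathcal{N}_\alpha(n,nd_L/2)$ of $\alpha$-polystable $L$-quadric bundles over $X$ of rank $n$ and degree $nd_L/2$ is isomorphic to the moduli space $M_{\mathrm{O}(n,\mathbb{C})}$ of rank $n$ orthogonal vector bundles over $X$.
   Context: An $L$-quadric bundle over $X$ is a pair $(V,\gamma)$ with $V$ a holomorphic vector bundle on $X$ and $\gamma$ a non-zero holomorphic section of $S^2V^*\otimes L$, viewed also as a symmetric map $\gamma:V\to V^*\otimes L$. Its type is $(n,d)$ if $n=\mathrm{rk}(V)$ and $d=\deg(V)$. Two quadric bundles $(V_1,\gamma_1)$, $(V_2,\gamma_2)$ are isomorphic if there is an isomorphism $f:V_1\to V_2$ with $(f^t\otimes \mathrm{Id}_L)\gamma_2 f=\gamma_1$. For a subbundle $V'\subseteq V$, $V'^\perp$ denotes the kernel of $V^*\to V'^*$. Below, proper subbundles are non-zero and different from $V$, and $\alpha\in\mathbb{R}$. Semistability. $(V,\gamma)$ of type $(n,d)$ is $\alpha$-semistable if $\alpha\leq d/n$ and: (1) for any proper subbundle $V'\subsetneq V$: (a) if $\gamma(V')\not\subseteq V'^\perp\otimes L$, then $\deg(V')\leq d+\alpha(\mathrm{rk}(V')-n)$; (b) if $\gamma(V')\subseteq V'^\perp\otimes L$, then $\deg(V')\leq \frac d2+\alpha(\mathrm{rk}(V')-\frac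 n2)$; (c) if $\gamma(V')=0$, then $\deg(V')\leq\alpha\,\mathrm{rk}(V')$; (2) for any strict filtration $0\subsetneq V'\subsetneq V''\subsetneq V$ by subbundles with $\gamma(V')\subseteq V''^\perp\otimes L$ and $\gamma(V'')\not\subseteq V''^\perp\otimes L$, one has $\deg(V')+\deg(V'')\leq d+\alpha(\mathrm{rk}(V')+\mathrm{rk}(V'')-n)$. Polystability. $(V,\gamma)$ is $\alpha$-polystable if it is $\alpha$-semistable and: (1) for any proper subbundle $V'\subsetneq V$: (a) if $\gamma(V')\not\subseteq V'^\perp\otimes L$ and equality holds in (1)(a), then there is a subbundle $V''\subsetneq V$ with $V\cong V'\oplus V''$ and $\gamma=\left(\begin{smallmatrix}\gamma'&0\\0&0\end{smallmatrix}\right)$ with $0\neq\gamma'\in H^0(X,S^2V'^*\otimes L)$; (b) if $\gamma(V')\subseteq V'^\perp\otimes L$ and equality holds in (1)(b), then there is a subbundle $V''\subsetneq V$ with $V\cong V'\oplus V''$ and $\gamma=\left(\begin{smallmatrix}0&\gamma'\\ \gamma'^t&0\end{smallmatrix}\right)$ with $0\neq\gamma'\in H^0(X,V'^*\otimes V''^*\otimes L)$; (c) if $\gamma(V')=0$ and equality holds in (1)(c), then there is a subbundle $V''\subsetneq V$ with $V\cong V'\oplus V''$ and $\gamma=\left(\begin{smallmatrix}0&0\\0&\gamma'\end{smallmatrix}\right)$ with $0\neq\gamma'\in H^0(X,S^2V''^*\otimes L)$; (2) if a filtration as in (2) of semistability attains equality, then $V\cong V'\oplus V''/V'\oplus V/V''$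 and $\gamma=\left(\begin{smallmatrix}0&0&\gamma'^t\\0&\gamma''&0\\ \gamma'&0&0\end{smallmatrix}\right)$ with $\gamma'\in H^0(X,V'^*\otimes (V/V'')^*\otimes L)$ and $\gamma''\in H^0(X,S^2(V''/V')^*\otimes L)$, not both zero. $\mathcal{N}_\alpha(n,d)$ is the moduli space of $\alpha$-polystable $L$-quadric bundles over $X$ of type $(n,d)$ (constructed by Gómez–Sols and Schmitt); its points are the isomorphism classes of such quadric bundles. An orthogonal vector bundle over $X$ is a pair $(W,q)$ with $W$ a holomorphic vector bundle and $q:W\otimes W\to\mathcal{O}_X$ a nowhere degenerate symmetric quadratic form. It is semistable if every isotropic subbundle of $W$ has non-positive degree. $M_{\mathrm{O}(n,\mathbb{C})}$ is the moduli space of (semistable, equivalently represented by polystable) rank $n$ orthogonal vector bundles over $X$, where the topological type is not fixed (so all topological types are included). *)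

(* Defs.v *)
From HB Require Import structures.
From mathcomp Require Import all_boot all_order all_algebra.
From mathcomp Require Import all_classical all_reals all_analysis.
From mathcomp Require Import complex.

Set Implicit Arguments.
Unset Strict Implicit.
Unset Printing Implicit Defensive.

Import Order.TTheory GRing.Theory Num.Theory.
Import numFieldNormedType.Exports.

Local Open Scope classical_set_scope.
Local Open Scope ring_scope.

Section Spaces.
Context {R : realType}.
Local Notation C := R[i].

(* Differentiability is over the field C, so this is holomorphy near [w], in
   one or several variables. *)
Definition holo_near (W : normedModType C) (F : W -> C^o) (w : W) : Prop :=
  \forall v \near w, differentiable F v.

(* A topological space with a notion of "[f] is holomorphic near [y]", closed
   under composition with holomorphic functions of several variables (taking
   one variable and the identity, under equality near [y]).  Spaces locally
   modelled on analytic sets are singled out by [complex_space] below. *)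
Record cspace := CSpace {
  points :> topologicalType;
  hol : points -> (points -> C) -> Prop;
  hol_cst : forall y (c : C), hol y (fun=> c);
  hol_comp : forall y m (c : 'I_m.+1 -> points -> C) (F : 'rV[C]_m.+1 -> C^o)
      (f : points -> C),
    (forall i, hol y (c i)) -> holo_near F (\row_i c i y) ->
    (\forall y' \near y, f y' = F (\row_i c i y')) -> hol y f }.

Definition holmx (Y : cspace) (y : Y) m n (A : Y -> 'M[C]_(m, n)) : Prop :=
  forall i j, hol y (fun y' => A y' i j).

Definition hol_map (S T : cspace) (h : S -> T) : Prop :=
  continuous h /\ forall s f, hol (h s) f -> hol s (f \o h).

Definition biholomorphic (S T : cspace) : Prop :=
  exists (h : S -> T) (k : T -> S),
    [/\ hol_map h, hol_map k, cancel h k & cancel k h].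

(* [phi] identifies the open set [U], with its holomorphic functions, with the
   subspace [phi @` U] of [W], with the functions that extend locally to
   holomorphic functions on [W]. *)
Definition chart (Y : cspace) (W : normedModType C) (U : set Y) (phi : Y -> W) :
    Prop :=
  [/\ open U,
      set_inj U phi,
      forall y, U y -> {for y, continuous phi},
      forall V, open V -> V `<=` U ->
        exists2 B, open B & phi @` V = phi @` U `&` B
    & forall y, U y -> forall f, hol y f <->
        exists2 F : W -> C^o, holo_near F (phi y) &
          \forall y' \near y, f y' = F (phi y') ].

Definition affine (N : nat) : normedModType C := 'rV[C]_N.+1.

(* Reduced Hausdorff complex space: locally the zero locus of finitely many
   holomorphic functions on an open subset of some C^(N+1). *)
Definition complex_space (Y : cspace) : Prop :=
  hausdorff_space Y /\
  forall y : Y, exists N (U : set Y) (phi : Y -> affine N)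
      (D : set (affine N)) k (G : 'I_k -> affine N -> C^o),
    [/\ U y, chart U phi, open D,
        forall i v, D v -> differentiable (G i) v
      & phi @` U = [set v | D v /\ forall i, G i v = 0] ].

Definition coordinate (Y : cspace) (U : set Y) (z : Y -> C^o) : Prop :=
  chart U z /\ open (z @` U).

Definition compact_riemann_surface (X : cspace) : Prop :=
  [/\ hausdorff_space X, connected [set: X], compact [set: X]
    & forall x : X, exists (U : set X) (z : X -> C^o), U x /\ coordinate U z].

(* A holomorphic 1-form, given by its coefficient [w U z] with respect to [dz]
   for every coordinate [(U, z)]. *)
Definition one_form (X : cspace) (w : set X -> (X -> C^o) -> X -> C) : Prop :=
  (forall U z x, coordinate U z -> U x -> hol x (w U z)) /\
  (forall U z V z' x (F : C^o -> C^o),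
     coordinate U z -> coordinate V z' -> U x -> V x ->
     holo_near F (z' x) -> (\forall y \near x, z y = F (z' y)) ->
     w V z' x = 'D_1 F (z' x) * w U z x).

(* [g] is the dimension of the space of holomorphic 1-forms. *)
Definition has_genus (X : cspace) (g : nat) : Prop :=
  exists2 w : 'I_g -> set X -> (X -> C^o) -> X -> C,
    forall i, one_form (w i) &
    forall eta, one_form eta ->
      exists! c : 'rV[C]_g, forall U z x, coordinate U z -> U x ->
        eta U z x = \sum_i c 0 i * w i U z x.

Section Product.
Variables S T : cspace.

Inductive prod_hol (y : S * T) : (S * T -> C) -> Prop :=
| prod_hol_cst c : prod_hol y (fun=> c)
| prod_hol_fst a : hol y.1 a -> prod_hol y (a \o fst)
| prod_hol_snd b : hol y.2 b -> prod_hol y (b \o snd)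
| prod_hol_comp m (c : 'I_m.+1 -> S * T -> C) (F : 'rV[C]_m.+1 -> C^o) f :
    (forall i, prod_hol y (c i)) -> holo_near F (\row_i c i y) ->
    (\forall y' \near y, f y' = F (\row_i c i y')) -> prod_hol y f.

Definition cprod : cspace :=
  @CSpace (S * T)%type prod_hol prod_hol_cst prod_hol_comp.

Lemma hol_map_fst : @hol_map cprod S fst.
Proof. by split=> [y|s f]; [exact: cvg_fst | exact: prod_hol_fst]. Qed.

Lemma hol_map_slice (t : T) : @hol_map S cprod (pair^~ t).
Proof.
have ct : continuous (fun s : S => (s, t)).
  by move=> s; apply: cvg_pair => //; exact: cvg_cst.
split=> // s f; set y := (s, t) => fy.
elim: fy => [c|a ha|b hb|m c F h _ IH hF hE].
- exact: (hol_cst s c).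
- exact: ha.
- exact: (hol_cst s (b t)).
- apply: (hol_comp IH hF); exact: (ct s _ hE).
Qed.

End Product.
End Spaces.

Arguments cspace R : clear implicits.

Section Bundles.
Context {R : realType}.
Local Notation C := R[i].

(* A holomorphic vector bundle of rank [n].  As a mere set each fibre is C^n
   (row vectors); the topology and the holomorphic structure are those given
   by the local frames, the rows of [frame i y] being a basis of the fibre at
   [y].  No relation between the fibre identifications at different points is
   assumed, so every bundle is of this form up to isomorphism, and the
   holomorphic transition functions are [frame i *m invmx (frame j)]. *)
Record bundle (Y : cspace R) (n : nat) := Bundle {
  frame_index : Type;
  dom : frame_index -> set Y;
  frame : frame_index -> Y -> 'M[C]_n;
  dom_open : forall i, open (dom i);
  dom_cover : forall y, exists i, dom i y;
  frame_unit : forall i y, dom i y -> frame i y \in unitmx;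
  frame_trans : forall i j y, dom i y -> dom j y ->
    holmx y (fun y' => frame i y' *m invmx (frame j y')) }.

Arguments dom {Y n} E i _ : rename.
Arguments frame {Y n} E i _ : rename.

Section Trivial.
Variable Y : cspace R.

Lemma trivial_trans (i j : unit) (y : Y) : [set: Y] y -> [set: Y] y ->
  holmx y (fun y' => (1%:M : 'M[C]_1) *m invmx 1%:M).
Proof. by move=> _ _ a b; exact: hol_cst. Qed.

Definition trivial_bundle : bundle Y 1 :=
  @Bundle Y 1 unit (fun=> setT) (fun _ _ => 1%:M) (fun=> openT)
    (fun y => ex_intro _ tt I) (fun _ _ _ => unitmx1 _ _) trivial_trans.

End Trivial.

Section Pullback.
Variables (S T : cspace R) (h : S -> T) (hh : hol_map h) (n : nat).
Variable E : bundle T n.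

Lemma pullback_open i : open (h @^-1` dom E i).
Proof.
by apply: open_comp; [move=> s _; exact: hh.1 | exact: dom_open].
Qed.

Lemma pullback_trans i j s : dom E i (h s) -> dom E j (h s) ->
  holmx s (fun s' => frame E i (h s') *m invmx (frame E j (h s'))).
Proof. by move=> hi hj a b; exact: (hh.2 _ _ (frame_trans hi hj a b)). Qed.

Definition pullback : bundle S n :=
  @Bundle S n (frame_index E) (fun i => h @^-1` dom E i) (fun i => frame E i \o h)
    pullback_open (fun s => dom_cover E (h s))
    (fun i s => @frame_unit _ _ E i (h s)) pullback_trans.

End Pullback.

(* Holomorphic bundle maps; [f y] acts on row vectors from the right. *)
Definition hol_hom (Y : cspace R) m n (E : bundle Y m) (F : bundle Y n)
    (f : Y -> 'M[C]_(m, n)) : Prop :=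
  forall i j y, dom E i y -> dom F j y ->
    holmx y (fun y' => frame E i y' *m f y' *m invmx (frame F j y')).

Record subbundle (Y : cspace R) n (E : bundle Y n) (r : nat) := Subbundle {
  sub_bundle :> bundle Y r;
  embed : Y -> 'M[C]_(r, n);
  embed_hol : hol_hom sub_bundle E embed;
  embed_free : forall y, row_free (embed y) }.

Definition order_at (X : cspace R) (x : X) (f : X -> C) (k : int) : Prop :=
  exists (U : set X) (z : X -> C^o) (u : X -> C),
    [/\ coordinate U z, U x, hol x u, u x != 0
      & \forall y \near x^', f y = u y * (z y - z x : C) ^ k ].

(* [d] is the degree of the divisor of a meromorphic section of [det E], not
   identically zero: [s] is its coefficient in the standard basis of the fibres
   C^n and [s / \det (frame i)] its coefficient in the local frame. *)
Definition is_degree (X : cspace R) n (E : bundle X n) (d : int) : Prop :=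
  exists (s : X -> C) (m : X -> int),
    [/\ forall i x, dom E i x ->
          order_at x (fun y => s y / \det (frame E i y)) (m x),
        finite_set [set x | m x != 0]
      & d = \sum_(x \in [set: X]) m x ].

(* On a compact Riemann surface there is exactly one [d] with [is_degree E d]. *)
Definition deg (X : cspace R) n (E : bundle X n) : int :=
  xget 0 [set d | is_degree E d].

(* A bundle [qb] with bilinear forms [u *m qf y *m v^T] on the fibres. *)
Record qpair (Y : cspace R) (n : nat) := QPair {
  qb :> bundle Y n;
  qf : Y -> 'M[C]_n }.

Definition qpullback (S T : cspace R) (h : S -> T) (hh : hol_map h) n
    (Q : qpair T n) : qpair S n :=
  QPair (pullback hh Q) (qf Q \o h).

(* [qf Q] is a holomorphic section of S^2 V^* (x) L. *)
Definition sym_form (Y : cspace R) (L : bundle Y 1) n (Q : qpair Y n) : Prop :=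
  (forall y, (qf Q y)^T = qf Q y) /\
  (forall i a y, dom Q i y -> dom L a y ->
     holmx y (fun y' => (frame L a y' 0 0)^-1 *:
                        (frame Q i y' *m qf Q y' *m (frame Q i y')^T))).

Definition qiso (Y : cspace R) n (Q1 Q2 : qpair Y n) : Prop :=
  exists f : Y -> 'M[C]_n,
    [/\ hol_hom Q1 Q2 f, forall y, f y \in unitmx
      & forall y, f y *m qf Q2 y *m (f y)^T = qf Q1 y].

Definition quadric_bundle (X : cspace R) (L : bundle X 1) n (Q : qpair X n) :
    Prop :=
  sym_form L Q /\ exists x, qf Q x != 0.

(* [gamma V1] is contained in [V2^perp (x) L]. *)
Definition orthogonal_to (X : cspace R) n (Q : qpair X n) r1 r2
    (V1 : subbundle Q r1) (V2 : subbundle Q r2) : Prop :=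
  forall x, embed V1 x *m qf Q x *m (embed V2 x)^T = 0.

Definition in_kernel (X : cspace R) n (Q : qpair X n) r
    (V1 : subbundle Q r) : Prop :=
  forall x, embed V1 x *m qf Q x = 0.

Definition sub_le (X : cspace R) n (E : bundle X n) r1 r2
    (V1 : subbundle E r1) (V2 : subbundle E r2) : Prop :=
  forall x, (embed V1 x <= embed V2 x)%MS.

Definition direct_sum (X : cspace R) n (E : bundle X n) r1 r2
    (V1 : subbundle E r1) (V2 : subbundle E r2) : Prop :=
  (r1 + r2 = n)%N /\ forall x, row_full (col_mx (embed V1 x) (embed V2 x)).

Definition semistable (X : cspace R) (L : bundle X 1) (alpha : R) n
    (Q : qpair X n) : Prop :=
  let d : R := (deg Q)%:~R in
  [/\ quadric_bundle L Q,
      alpha <= d / n%:R,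
      forall r (V1 : subbundle Q r), (0 < r < n)%N ->
        [/\ ~ orthogonal_to V1 V1 ->
              (deg V1)%:~R <= d + alpha * (r%:R - n%:R),
            orthogonal_to V1 V1 ->
              (deg V1)%:~R <= d / 2 + alpha * (r%:R - n%:R / 2)
          & in_kernel V1 -> (deg V1)%:~R <= alpha * r%:R ]
    & forall r1 r2 (V1 : subbundle Q r1) (V2 : subbundle Q r2),
        (0 < r1 < r2)%N -> (r2 < n)%N -> sub_le V1 V2 ->
        orthogonal_to V1 V2 -> ~ orthogonal_to V2 V2 ->
        (deg V1)%:~R + (deg V2)%:~R <= d + alpha * (r1%:R + r2%:R - n%:R) ].

(* In the last clause [A] and [B] are lifts to V of V''/V' and V/V''; the
   conditions read off the blocks of gamma on V' (+) A (+) B. *)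
Definition polystable (X : cspace R) (L : bundle X 1) (alpha : R) n
    (Q : qpair X n) : Prop :=
  let d : R := (deg Q)%:~R in
  [/\ semistable L alpha Q,
      forall r (V1 : subbundle Q r), (0 < r < n)%N ->
        [/\ ~ orthogonal_to V1 V1 ->
            (deg V1)%:~R = d + alpha * (r%:R - n%:R) ->
              exists V2 : subbundle Q (n - r),
                [/\ direct_sum V1 V2, in_kernel V2 & ~ orthogonal_to V1 V1],
            orthogonal_to V1 V1 ->
            (deg V1)%:~R = d / 2 + alpha * (r%:R - n%:R / 2) ->
              exists V2 : subbundle Q (n - r),
                [/\ direct_sum V1 V2, orthogonal_to V1 V1,
                    orthogonal_to V2 V2 & ~ orthogonal_to V1 V2]
          & in_kernel V1 ->
            (deg V1)%:~R = alpha * r%:R ->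
              exists V2 : subbundle Q (n - r),
                [/\ direct_sum V1 V2, in_kernel V1 & ~ orthogonal_to V2 V2] ]
    & forall r1 r2 (V1 : subbundle Q r1) (V2 : subbundle Q r2),
        (0 < r1 < r2)%N -> (r2 < n)%N -> sub_le V1 V2 ->
        orthogonal_to V1 V2 -> ~ orthogonal_to V2 V2 ->
        (deg V1)%:~R + (deg V2)%:~R = d + alpha * (r1%:R + r2%:R - n%:R) ->
        exists (A : subbundle Q (r2 - r1)) (B : subbundle Q (n - r2)),
          [/\ forall x, (col_mx (embed V1 x) (embed A x) == embed V2 x)%MS,
              direct_sum V2 B,
              orthogonal_to V1 V1 /\ orthogonal_to V1 A,
              orthogonal_to A B /\ orthogonal_to B B
            & ~ (orthogonal_to B V1 /\ orthogonal_to A A)] ].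

Definition orthogonal_bundle (X : cspace R) n (W : qpair X n) : Prop :=
  sym_form (trivial_bundle X) W /\ forall x, qf W x \in unitmx.

Definition orth_semistable (X : cspace R) n (W : qpair X n) : Prop :=
  orthogonal_bundle W /\
  forall r (F : subbundle W r), orthogonal_to F F -> deg F <= 0.

(* Every isotropic [F] of degree 0 has an isotropic [F'] paired perfectly with
   it, i.e. [W = F^perp (+) F']. *)
Definition orth_polystable (X : cspace R) n (W : qpair X n) : Prop :=
  orth_semistable W /\
  forall r (F : subbundle W r), (0 < r)%N -> orthogonal_to F F -> deg F = 0 ->
  exists2 F' : subbundle W r, orthogonal_to F' F' &
    forall x, embed F x *m qf W x *m (embed F' x)^T \in unitmx.

End Bundles.

Section Moduli.
Context {R : realType}.

Record moduli_problem := ModuliProblem {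
  object : Type;
  isom : object -> object -> Prop;
  sst : set object;
  pst : set object;
  family_over : cspace R -> Type;
  is_family : forall T, set (family_over T);
  fibre : forall T, family_over T -> T -> object }.

(* [cl] is constant on isomorphism classes and turns every family of semistable
   objects into a holomorphic map. *)
Definition classifies (P : moduli_problem) (M : cspace R)
    (cl : object P -> M) : Prop :=
  (forall a b, sst a -> sst b -> isom a b -> cl a = cl b) /\
  (forall (T : cspace R) (E : family_over P T), complex_space T -> is_family E ->
     (forall t, sst (fibre E t)) -> hol_map (fun t => cl (fibre E t))).

(* [M] corepresents the functor of families of semistable objects, and its
   points are the isomorphism classes of polystable objects (which makes the
   map [h] below unique). *)
Definition moduli_space (P : moduli_problem) (M : cspace R)
    (cl : object P -> M) : Prop :=
  [/\ complex_space M,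
      classifies cl,
      forall (N : cspace R) (cl' : object P -> N),
        complex_space N -> classifies cl' ->
        exists2 h : M -> N, hol_map h & forall a, sst a -> cl' a = h (cl a),
      forall a b, pst a -> pst b -> cl a = cl b -> isom a b
    & forall x : M, exists2 a, pst a & cl a = x ].

Definition quadric_moduli (X : cspace R) (L : bundle X 1) (alpha : R)
    (n : nat) (d : int) : moduli_problem :=
  @ModuliProblem (qpair X n) (@qiso R X n)
    [set Q | semistable L alpha Q /\ deg Q = d]
    [set Q | polystable L alpha Q /\ deg Q = d]
    (fun T => qpair (cprod X T) n)
    (fun T => [set E | sym_form (pullback (hol_map_fst X T) L) E])
    (fun T E t => qpullback (hol_map_slice X t) E).

Definition orthogonal_moduli (X : cspace R) (n : nat) : moduli_problem :=
  @ModuliProblem (qpair X n) (@qiso R X n)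
    [set W | orth_semistable W]
    [set W | orth_polystable W]
    (fun T => qpair (cprod X T) n)
    (fun T => [set E | sym_form (trivial_bundle (cprod X T)) E])
    (fun T E t => qpullback (hol_map_slice X t) E).

End Moduli.

(* Main.v *)
(** Let [K] be a square root of [L].  An [L]-valued form on [V] is the same thing as
    an O-valued form on [V (x) K^-1], so it suffices to see that alpha-semistability
    of [(V, gamma)] of degree [n deg L / 2] amounts to semistability of the orthogonal
    bundle; the two moduli spaces then corepresent isomorphic functors.

    If [N] is the kernel of [gamma], the determinant of the form induced on [V / N]
    is a section of [det (V / N)^-2 (x) L^rk(V / N)], so that
    [2 deg V <= 2 deg N + rk(V / N) deg L].  For [alpha < deg L / 2], clause (1c) then
    forces [N = 0], equality holds, and [gamma] is nowhere degenerate.  For an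
    isotropic [V'], clause (2) for [V' <= V'^perp] (clause (1b) if they are equal),
    with [deg V'^perp = deg V + deg V' - rk V' deg L], says [deg V' <= rk V' deg L / 2].
    Conversely every subbundle [F] of a semistable orthogonal bundle has degree at
    most that of the kernel of the induced form on [F], which is isotropic, so
    [deg F <= 0], and all clauses follow from [alpha < deg L / 2].

    The analytic input is that bundles have a well-defined degree and that [L] has a
    square root.  Bounded Cech cocycles are split on charts by Cauchy integrals, and
    Montel's theorem makes the obstruction to a global splitting finite dimensional;
    hence there are meromorphic sections with prescribed poles and zeros as soon as
    the poles outnumber the zeros by a constant.  If a meromorphic function [f] had
    more zeros than poles, a function [s] with poles at the zeros of [f^M] (one
    less at one point) and zeros at its poles would give a holomorphic, hence
    constant, function [s f^M] with a zero.  For nearby points, O(p - q) has a square root given by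
    a branch of [(z / (z - z q))^(1/2)] away from [p] and [q]; connectedness and
    [deg L] even do the rest. *)

Require Import Defs.
From HB Require Import structures.
From mathcomp Require Import all_boot all_order all_algebra perm.
From mathcomp Require Import all_classical all_reals all_analysis.
From mathcomp Require Import complex.
From mathcomp Require Import ring lra zify.
Set Implicit Arguments.
Unset Strict Implicit.
Unset Printing Implicit Defensive.
Import Order.TTheory GRing.Theory Num.Theory.
Import numFieldNormedType.Exports.
Local Open Scope classical_set_scope.
Local Open Scope ring_scope.

(** A bundle is given by frames of the fixed fibres C^n, with no relation between the
    identifications at different points. Twisting by a line bundle therefore only rescales frames:
    matrices of forms and embeddings do not change, and the fibre of a twisted family equals the
    twisted fibre. The same freedom makes pointwise choices legitimate: a square root of a number, a
    basis of a kernel or a complement may be picked at each point without continuity, as long as the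
    resulting transition functions or sections are holomorphic.

    The degree refers to an arbitrary meromorphic section of the determinant, so both its existence
    and its independence are global statements about [X]. They rest on a bound for the number of
    linear conditions that does not depend on the orders of the poles. This bound is obtained by
    iteration: modulo coboundaries a bounded cocycle is within 1/2 of one of finitely many cocycles,
    and repeating this on the remainder gives a geometric series whose coefficients involve only
    those finitely many.

    Universal properties give morphisms both ways between the moduli spaces; that they are inverse
    is checked on points, each the class of an object. *)

Ltac slra :=
  repeat match goal with
  | H : forall _, _ |- _ => clear H
  | H : _ /\ _ |- _ => clear H
  | H : ex _ |- _ => clear H
  end; lra.

(** * Complex differentiability *)

Section Modulus.
Context {R : realType}.
Local Notation C := R[i].
Implicit Types z w : C.

(** The norm of [R[i]] takes its values in [R[i]]; a modulus with values in [R] makes estimates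
    linear inequalities over an ordered field. *)
Definition nm z : R := ComplexField.Normc.normc z.

Lemma normE z : `|z| = (nm z)%:C%C. Proof. by []. Qed.

Lemma nm_ge0 z : 0 <= nm z.
Proof. by rewrite -lecR -normE normr_ge0. Qed.

Lemma nm0 : nm 0 = 0. Proof. exact: ComplexField.Normc.normc0. Qed.

Lemma nm1 : nm 1 = 1. Proof. exact: ComplexField.Normc.normc1. Qed.

Lemma nmM z w : nm (z * w) = nm z * nm w.
Proof. exact: ComplexField.Normc.normcM. Qed.

Lemma nmV z : nm z^-1 = (nm z)^-1.
Proof. exact: ComplexField.Normc.normcV. Qed.

Lemma nmN z : nm (- z) = nm z. Proof. exact: normcN. Qed.

Lemma nmD z w : nm (z + w) <= nm z + nm w. Proof. exact: le_normcD. Qed.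

Lemma nmB z w : nm (z - w) <= nm z + nm w.
Proof. by rewrite -(nmN w) nmD. Qed.

Lemma nmX z n : nm (z ^+ n) = nm z ^+ n.
Proof. by elim: n => [|n IH]; rewrite ?nm1// !exprS nmM IH. Qed.

Lemma nm_distC z w : nm (z - w) = nm (w - z).
Proof. by rewrite -nmN opprB. Qed.

Lemma nm_eq0 z : (nm z == 0) = (z == 0).
Proof.
by apply/eqP/eqP => [/ComplexField.Normc.eq0_normc//|->]; exact: nm0.
Qed.

Lemma nm_gt0 z : (0 < nm z) = (z != 0).
Proof. by rewrite lt_neqAle nm_ge0 andbT eq_sym nm_eq0. Qed.

Lemma nmR (r : R) : nm r%:C%C = `|r|.
Proof.
by apply: (@complexI R); rewrite -normE normc_def/= expr0n/= addr0 sqrtr_sqr.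
Qed.

Lemma nm2 : nm 2 = 2.
Proof. by have -> : (2 : C) = (2 : R)%:C%C; [rewrite rmorph_nat | rewrite nmR ger0_norm]. Qed.

Lemma Re_nm z : `|complex.Re z| <= nm z.
Proof. by rewrite -lecR -normE normc_ge_Re. Qed.

Lemma nm_i : nm 'i%C = 1.
Proof.
by apply: (@complexI R); rewrite -normE normc_def/= expr0n/= add0r expr1n sqrtr1.
Qed.

Lemma Im_nm z : `|complex.Im z| <= nm z.
Proof.
have := Re_nm (z * 'i%C); rewrite ReiNIm normrN nmM nm_i mulr1; exact.
Qed.

Lemma nm_ReIm z : nm z <= `|complex.Re z| + `|complex.Im z|.
Proof.
rewrite {1}[z]complexE (le_trans (nmD _ _))// nmM nm_i mul1r !nmR//.
Qed.

Lemma nm_tri z w u : nm (z - w) <= nm (z - u) + nm (u - w).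
Proof. by have := nmD (z - u) (u - w); rewrite addrA subrK. Qed.

Lemma nm_sum (I : Type) (r : seq I) (P : pred I) (F : I -> C) :
  nm (\sum_(i <- r | P i) F i) <= \sum_(i <- r | P i) nm (F i).
Proof.
elim/big_rec2: _ => [|i y x _ le]; first by rewrite nm0.
by rewrite (le_trans (nmD _ _))// lerD2l.
Qed.

Lemma near_nm (P : set C^o) (w : C^o) :
  (\forall z \near w, P z) <->
  exists2 e : R, 0 < e & forall z : C, nm (z - w) < e -> P z.
Proof.
split.
  move=> /nbhs_ballP[e /= e0 eP]; exists (complex.Re e).
    by move: e0; rewrite ltcE => /andP[_].
  move=> z ze; apply: eP; rewrite /ball/= distrC normE.
  move: e0; rewrite !ltcE/= => /andP[/eqP -> _]; by rewrite eqxx.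
move=> [e e0 eP]; apply/nbhs_ballP; exists e%:C%C; first by rewrite /= ltcR.
by move=> z; rewrite /ball/= distrC normE ltcR; exact: eP.
Qed.

Lemma open_nm (U : set C^o) : open U <->
  forall w, U w -> exists2 e : R, 0 < e & forall z : C, nm (z - w) < e -> U z.
Proof.
rewrite openE; split=> h w Uw; first by apply/near_nm; exact: h.
by apply/near_nm; exact: h.
Qed.


Lemma near_disc (w : C^o) (r : R) : 0 < r -> \forall z \near w, nm (z - w : C) < r.
Proof. by move=> r0; apply/near_nm; exists r. Qed.

End Modulus.

Section Differentiability.
Context {R : realType}.
Local Notation C := R[i].
Implicit Types (f g : C -> C) (z w c : C).

Definition cdiff f z : Prop := differentiable (f : C^o -> C^o) (z : C^o).

(** The difference quotient is multiplied out into a first-order expansion with explicit error; in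
    this form the derivative can be integrated, composed and subtracted. *)
Lemma cdiffP f z : cdiff f z <->
  exists c, forall e : R, 0 < e -> exists2 d : R, 0 < d & forall w,
    nm (w - z) < d -> nm (f w - f z - c * (w - z)) <= e * nm (w - z).
Proof.
split.
  move=> df.
  have dg := (@derivable1_diffP _ _ (f : C^o -> C^o) z).2 df.
  exists ('D_1 (f : C^o -> C^o) (z : C^o)) => e e0.
  move/cvgrPdist_le : dg => /(_ e%:C%C); rewrite ltcR => /(_ e0).
  rewrite /at_right/= /dnbhs => /near_nm [d d0 dP].
  exists d => // w wz.
  have [->|wz0] := eqVneq w z; first by rewrite !subrr mulr0 subrr nm0 mulr0.
  have := dP (w - z); rewrite subr0 => /(_ wz) /=.
  rewrite subr_eq0 => /(_ wz0).
  rewrite normE lecR /GRing.scale/= mulr1 subrK => H.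
  have wz1 : w - z != 0 by rewrite subr_eq0.
  rewrite (_ : f w - f z - _ = - (('D_1 (f : C^o -> C^o) (z : C^o) - (w - z)^-1 * (f w - f z)) * (w - z))).
    by rewrite nmN nmM ler_wpM2r// nm_ge0.
  rewrite mulrBl mulrAC mulVf// mul1r opprB//.
move=> [c fc]; apply/derivable1_diffP; apply/cvg_ex; exists c.
apply/cvgrPdist_le => e e0.
have [d d0 dP] := fc (complex.Re e) ltac:(by move: e0; rewrite ltcE => /andP[_]).
rewrite /dnbhs; apply/near_nm; exists d => // h; rewrite subr0 => hd /= h0.
have := dP (h + z); rewrite addrK => /(_ hd) H.
rewrite /GRing.scale/= mulr1.
rewrite (_ : c - _ = - (h^-1 * (f (h + z) - f z - c * h))); last first.
  by field.
rewrite normrN normrM normfV ler_pdivrMl ?normr_gt0// mulrC.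
rewrite !normE.
move: e0; rewrite ltcE/= => /andP[/eqP e0 _].
have -> : e = (complex.Re e)%:C%C by case: (e) e0 => a b /= ->.
have -> : (nm h)%:C%C * (complex.Re e)%:C%C = (complex.Re e * nm h)%:C%C.
  by rewrite rmorphM mulrC.
by rewrite lecR [h * c]mulrC.
Qed.

Lemma cdiff_ext f g z : (\forall w \near (z : C^o), f w = g w) ->
  cdiff f z -> cdiff g z.
Proof.
move=> /near_nm[r r0 rP] /cdiffP[c fc]; apply/cdiffP; exists c => e e0.
have [d d0 dP] := fc _ e0; exists (Num.min d r); first by rewrite lt_min d0.
move=> w; rewrite lt_min => /andP[wd wr].
by rewrite -!rP ?dP// subrr nm0.
Qed.

Definition holo1 f z : Prop := \forall w \near (z : C^o), cdiff f w.

Lemma holo1_ext f g z : (\forall w \near (z : C^o), f w = g w) ->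
  holo1 f z -> holo1 g z.
Proof.
rewrite /holo1 => fg df.
have := nbhs_interior fg; rewrite /= => fg'.
near=> w; apply: (@cdiff_ext f); first by near: w.
by near: w.
Unshelve. all: by end_near.
Qed.

Lemma cdiff_cvg f z (e : R) : cdiff f z -> 0 < e ->
  exists2 d : R, 0 < d & forall w, nm (w - z) < d -> nm (f w - f z) < e.
Proof.
move=> /cdiffP[c fc] e0; have [d d0 dP] := fc 1 ltr01.
have c1 : 0 < nm c + 1 by have := nm_ge0 c; lra.
exists (Num.min d (e / (nm c + 1))); first by rewrite lt_min d0 divr_gt0.
move=> w; rewrite lt_min => /andP[/dP wd]; rewrite ltr_pdivlMr// => we.
have := nmD (f w - f z - c * (w - z)) (c * (w - z)); rewrite subrK nmM.
by move: we wd; rewrite mulrDr mulr1 mul1r [nm c * _]mulrC; lra.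
Qed.

End Differentiability.

Section DifferentiabilityRules.
Context {R : realType}.
Local Notation C := R[i].
Implicit Types (f g : C -> C) (z w c : C).

Lemma cdiff_cst c z : cdiff (fun=> c) z.
Proof. exact: differentiable_cst. Qed.

Lemma cdiff_id z : cdiff id z.
Proof.
apply/cdiffP; exists 1 => e e0; exists 1 => // w _.
by rewrite mul1r subrr nm0 mulr_ge0 ?nm_ge0// ltW.
Qed.

Lemma cdiffD f g z : cdiff f z -> cdiff g z -> cdiff (fun w => f w + g w) z.
Proof. exact: differentiableD. Qed.

Lemma cdiffN f z : cdiff f z -> cdiff (fun w => - f w) z.
Proof. exact: differentiableN. Qed.

Lemma cdiffB f g z : cdiff f z -> cdiff g z -> cdiff (fun w => f w - g w) z.
Proof. by move=> df dg; exact: (cdiffD df (cdiffN dg)). Qed.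

Lemma cdiffM f g z : cdiff f z -> cdiff g z -> cdiff (fun w => f w * g w) z.
Proof. exact: (@differentiableM _ C^o). Qed.

Lemma cdiffZ c f z : cdiff f z -> cdiff (fun w => c * f w) z.
Proof. by move=> df; apply: cdiffM => //; exact: cdiff_cst. Qed.

Lemma cdiffX f n z : cdiff f z -> cdiff (fun w => f w ^+ n) z.
Proof.
move=> df; elim: n => [|n IH]; first exact: cdiff_cst.
have -> : (fun w => f w ^+ n.+1) = (fun w => f w * f w ^+ n).
  by apply/funext => w; rewrite exprS.
exact: cdiffM.
Qed.

Lemma cdiffV f z : cdiff f z -> f z != 0 -> cdiff (fun w => (f w)^-1) z.
Proof. by move=> df fz; exact: (@differentiableV _ C^o). Qed.

Lemma cdiff_sum (I : Type) (r : seq I) (F : I -> C -> C) z :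
  (forall i, cdiff (F i) z) -> cdiff (fun w => \sum_(i <- r) F i w) z.
Proof.
move=> dF; elim: r => [|i r IH].
  rewrite (_ : (fun _ => _) = fun=> 0); first exact: cdiff_cst.
  by apply/funext => w; rewrite big_nil.
rewrite (_ : (fun _ => _) = fun w => F i w + \sum_(j <- r) F j w).
  exact: cdiffD.
by apply/funext => w; rewrite big_cons.
Qed.

Lemma cdiff_comp f g z : cdiff f z -> cdiff g (f z) -> cdiff (fun w => g (f w)) z.
Proof.
move=> df /cdiffP[cg dg]; have /cdiffP[cf df'] := df.
apply/cdiffP; exists (cg * cf) => e e0.
have := nm_ge0 cf; have := nm_ge0 cg => cg0 cf0.
have e1 : 0 < e / 2 / (nm cf + 1) by apply: divr_gt0; lra.
have e2 : 0 < Num.min 1 (e / 2 / (nm cg + 1)).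
  by rewrite lt_min ltr01/=; apply: divr_gt0; lra.
have [d1 d10 d1P] := dg _ e1; have [d2 d20 d2P] := df' _ e2.
have [d3 d30 d3P] := cdiff_cvg df d10.
exists (Num.min d2 d3); first by rewrite lt_min d20.
move=> w; rewrite lt_min => /andP[/d2P w2 /d3P/d1P w1].
set h := nm (w - z) in w2 *; have h0 : 0 <= h by exact: nm_ge0.
have fw : nm (f w - f z) <= (nm cf + 1) * h.
  have := nmD (f w - f z - cf * (w - z)) (cf * (w - z)); rewrite subrK nmM -/h.
  have : Num.min 1 (e / 2 / (nm cg + 1)) * h <= 1 * h.
    by rewrite ler_wpM2r// ge_min lexx.
  by lra.
have -> : g (f w) - g (f z) - cg * cf * (w - z) =
  (g (f w) - g (f z) - cg * (f w - f z)) + cg * (f w - f z - cf * (w - z)) by ring.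
apply: le_trans (nmD _ _) _; rewrite nmM (splitr e) mulrDl lerD//.
  apply: le_trans w1 _; apply: le_trans (ler_wpM2l (ltW e1) fw) _.
  by rewrite mulrA divfK// gt_eqF//; lra.
apply: le_trans (ler_wpM2l cg0 w2) _.
rewrite mulrA ler_wpM2r//.
apply: (@le_trans _ _ (nm cg * (e / 2 / (nm cg + 1)))).
  by rewrite ler_wpM2l// ge_min lexx orbT.
rewrite mulrA ler_pdivrMr; last lra.
rewrite mulrC ler_wpM2l//; lra.
Qed.

Lemma cdiff_near f z (P : C -> Prop) : cdiff f z ->
  (\forall w \near (f z : C^o), P w) -> \forall w \near (z : C^o), P (f w).
Proof.
move=> df /near_nm[e e0 eP].
have [d d0 dP] := cdiff_cvg df e0.
by apply/near_nm; exists d => // w /dP; exact: eP.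
Qed.

Lemma cdiff_neq0 f z : cdiff f z -> f z != 0 ->
  \forall w \near (z : C^o), f w != 0.
Proof.
move=> df fz; apply: (@cdiff_near f z (fun u => u != 0) df); apply/near_nm.
exists (nm (f z)); first by rewrite nm_gt0.
move=> w; apply: contraTneq => ->.
by rewrite sub0r nmN ltxx.
Qed.

Lemma holo1W f z : holo1 f z -> cdiff f z.
Proof. exact: nbhs_singleton. Qed.

Lemma holo1_near f z : holo1 f z -> \forall w \near (z : C^o), holo1 f w.
Proof. exact: nbhs_interior. Qed.

End DifferentiabilityRules.

(** * Integrals of complex functions over segments *)

Section PathIntegral.
Context {R : realType}.
Local Notation C := R[i].
Local Notation mu := (@lebesgue_measure R).
Implicit Types (f g : R -> C) (a b x : R).

Definition ccont f x : Prop := forall e : R, 0 < e ->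
  exists2 d : R, 0 < d & forall y, `|y - x| < d -> nm (f y - f x) < e.

Definition cint f a b : C :=
  Complex (\int[mu]_(x in `[a, b]) complex.Re (f x))
    (\int[mu]_(x in `[a, b]) complex.Im (f x)).

Definition ccont_on f a b := forall x, a <= x <= b -> ccont f x.

Lemma ccontRe f x : ccont f x -> {for x, continuous (fun y => complex.Re (f y) : R^o)}.
Proof.
move=> cf; apply/cvgrPdist_lt => e e0.
have [d d0 dP] := cf _ e0; near=> y.
have /dP : `|y - x| < d by rewrite distrC; near: y; exact: cvgr_dist_lt.
apply: le_lt_trans; rewrite nm_distC (le_trans _ (Re_nm _))// raddfB//.
Unshelve. all: by end_near.
Qed.

Lemma ccontIm f x : ccont f x -> {for x, continuous (fun y => complex.Im (f y) : R^o)}.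
Proof.
move=> cf; apply/cvgrPdist_lt => e e0.
have [d d0 dP] := cf _ e0; near=> y.
have /dP : `|y - x| < d by rewrite distrC; near: y; exact: cvgr_dist_lt.
apply: le_lt_trans; rewrite nm_distC (le_trans _ (Im_nm _))// raddfB//.
Unshelve. all: by end_near.
Qed.

Lemma continuous_seg_integrable (h : R -> R^o) a b :
  (forall x, a <= x <= b -> {for x, continuous h}) ->
  mu.-integrable `[a, b] (EFin \o h).
Proof.
move=> hc; apply: continuous_compact_integrable; first exact: segment_compact.
apply: continuous_in_subspaceT => x; rewrite inE/= in_itv/= => xab.
exact: hc.
Qed.

Lemma cintRe_int f a b : ccont_on f a b ->
  mu.-integrable `[a, b] (EFin \o (fun x => complex.Re (f x))).
Proof. by move=> cf; apply: continuous_seg_integrable => x /cf; exact: ccontRe. Qed.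

Lemma cintIm_int f a b : ccont_on f a b ->
  mu.-integrable `[a, b] (EFin \o (fun x => complex.Im (f x))).
Proof. by move=> cf; apply: continuous_seg_integrable => x /cf; exact: ccontIm. Qed.

Lemma eq_cint f g a b : (forall x, a <= x <= b -> f x = g x) ->
  cint f a b = cint g a b.
Proof.
by move=> fg; rewrite /cint; congr Complex; apply: eq_Rintegral => x;
  rewrite inE/= in_itv/= => /fg ->.
Qed.

Lemma cintD f g a b : ccont_on f a b -> ccont_on g a b ->
  cint (fun x => f x + g x) a b = cint f a b + cint g a b.
Proof.
move=> cf cg; rewrite /cint/=.
transitivity (Complex (\int[mu]_(x in `[a, b]) (complex.Re (f x) + complex.Re (g x)))
    (\int[mu]_(x in `[a, b]) (complex.Im (f x) + complex.Im (g x)))).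
  by congr Complex; apply: eq_Rintegral => x _; rewrite raddfD.
rewrite !RintegralD//; try exact: cintRe_int; exact: cintIm_int.
Qed.

Lemma cintZ c f a b : ccont_on f a b ->
  cint (fun x => c * f x) a b = c * cint f a b.
Proof.
move=> cf; rewrite /cint/=; case: c => u v.
have iR := cintRe_int cf; have iI := cintIm_int cf.
transitivity (Complex
    (\int[mu]_(x in `[a, b]) (u * complex.Re (f x) - v * complex.Im (f x)))
    (\int[mu]_(x in `[a, b]) (u * complex.Im (f x) + v * complex.Re (f x)))).
  by congr Complex; apply: eq_Rintegral => x _; case: (f x).
have iZ r (h : R -> R) : mu.-integrable `[a, b] (EFin \o h) ->
    mu.-integrable `[a, b] (EFin \o (fun x => r * h x)).
  move=> ih; rewrite (_ : EFin \o _ = fun x => (r%:E * (EFin \o h) x)%E).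
    exact: integrableZl.
  by apply/funext => x; rewrite /= EFinM.
rewrite RintegralB ?RintegralD//; try exact: iZ.
by rewrite !RintegralZl.
Qed.

Lemma ccontN f x : ccont f x -> ccont (fun y => - f y) x.
Proof.
move=> cf e /cf[d d0 dP]; exists d => // y /dP.
by rewrite -nmN opprB opprK addrC.
Qed.

Lemma cintB f g a b : ccont_on f a b -> ccont_on g a b ->
  cint (fun x => f x - g x) a b = cint f a b - cint g a b.
Proof.
move=> cf cg; rewrite cintD//; last by move=> x /cg; exact: ccontN.
congr (_ + _); rewrite -mulN1r -cintZ//; apply: eq_cint => x _.
by rewrite mulN1r.
Qed.

(** The factor 2 comes from estimating the real and the imaginary part separately. *)
Lemma cint_norm f a b (M : R) : a <= b -> ccont_on f a b ->
  (forall x, a <= x <= b -> nm (f x) <= M) ->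
  nm (cint f a b) <= 2 * M * (b - a).
Proof.
move=> ab cf fM.
have H (h : R -> R) : mu.-integrable `[a, b] (EFin \o h) ->
    (forall x, a <= x <= b -> `|h x| <= M) ->
    `|\int[mu]_(x in `[a, b]) h x| <= M * (b - a).
  move=> ih hM.
  have mab : measurable (`[a, b] : set R) by exact: measurable_itv.
  apply: (le_trans (le_normr_Rintegral _ ih)) => //.
  have <- : \int[mu]_(x in `[a, b]) M = M * (b - a).
    rewrite Rintegral_cst//= lebesgue_measure_itv/= lte_fin.
    by move: ab; rewrite le_eqVlt => /predU1P[->|->]//; rewrite ltxx subrr.
  apply: le_Rintegral => //.
  - exact: (integrable_norm ih).
  - by apply: continuous_seg_integrable => x _; exact: cvg_cst.
have HR := H _ (cintRe_int cf) (fun x xab => le_trans (Re_nm _) (fM x xab)).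
have HI := H _ (cintIm_int cf) (fun x xab => le_trans (Im_nm _) (fM x xab)).
apply: le_trans (nm_ReIm _) _.
have -> : 2 * M * (b - a) = M * (b - a) + M * (b - a) by ring.
exact: lerD.
Qed.

Lemma cint_split f a m b : a <= m -> m <= b -> ccont_on f a b ->
  cint f a b = cint f a m + cint f m b.
Proof.
move=> am mb cf.
have H (h : R -> R) : (mu.-integrable `[a, b] (EFin \o h) ->
    \int[mu]_(x in `[a, b]) h x =
    \int[mu]_(x in `[a, m]) h x + \int[mu]_(x in `[m, b]) h x).
  move=> ih; rewrite -(@Rintegral_itv_obnd_cbnd _ m).
    by rewrite -(@Rintegral_itvB _ _ _ _ m ih) ?bnd_simp// addrC subrK.
  apply: integrableS ih => //=.
  by apply: subset_itv; rewrite bnd_simp.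
by rewrite /cint (H _ (cintRe_int cf)) (H _ (cintIm_int cf)).
Qed.

Lemma cint_cst c a b : a <= b -> cint (fun=> c) a b = c * (b - a)%:C%C.
Proof.
move=> ab; rewrite /cint !Rintegral_cst//= lebesgue_measure_itv/= lte_fin.
have -> : fine (if a < b then (b%:E - a%:E)%E else 0%E) = b - a.
  by move: ab; rewrite le_eqVlt => /predU1P[->|->]//; rewrite ltxx subrr.
by case: c => u v; apply/eqP; rewrite eq_complex/= !mulr0 subr0 add0r !eqxx.
Qed.

Lemma cint_id a b : a <= b ->
  cint (fun x => x%:C%C) a b = ((b ^+ 2 - a ^+ 2) / 2)%:C%C.
Proof.
move=> ab; rewrite /cint/= Rintegral_cst//= mul0r; congr Complex.
move: ab; rewrite le_eqVlt => /predU1P[->|ab].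
  by rewrite set_itv1 Rintegral_set1 subrr mul0r.
have cF x : {for x, continuous (fun y : R => y ^+ 2 / 2 : R^o)}.
  by apply: differentiable_continuous; apply/(@derivable1_diffP R R^o).
have dF x : derivable (fun y : R => y ^+ 2 / 2 : R^o) x 1 by [].
rewrite /Rintegral (@continuous_FTC2 _ _ (fun x => x ^+ 2 / 2))//.
- by rewrite /= -mulrBl.
- by apply: continuous_subspaceT => x; exact: cvg_id.
- split => //.
  + by apply: cvg_at_right_filter; exact: cF.
  + by apply: cvg_at_left_filter; exact: cF.
- move=> x _.
  have dx : is_derive x 1 (fun y : R => y ^+ 2 / 2 : R^o) x.
    apply: is_derive_eq.
    by rewrite /GRing.scale/=; field.
  by rewrite derive1E derive_val.
Qed.

End PathIntegral.

(** * Cauchy's theorem on rectangles *)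

Section Rectangles.
Context {R : realType}.
Local Notation C := R[i].
Implicit Types (f g : C -> C) (a b c d x y : R) (z w : C).

Definition hpath f (y a b : R) : C := cint (fun x => f (Complex x y)) a b.
Definition vpath f (x c d : R) : C := cint (fun y => f (Complex x y)) c d.

(** The integral over the boundary of the rectangle, counterclockwise: bottom, right, top, left,
    with dz = i dy on the vertical sides. *)
Definition oint f a b c d : C :=
  hpath f c a b + 'i%C * vpath f b c d - hpath f d a b - 'i%C * vpath f a c d.

Definition in_rect a b c d z : Prop :=
  (a <= complex.Re z <= b) /\ (c <= complex.Im z <= d).

Definition on_border a b c d z : Prop :=
  in_rect a b c d z /\ [\/ complex.Re z = a, complex.Re z = b,
    complex.Im z = c | complex.Im z = d].

Definition czcont f z : Prop := forall e : R, 0 < e ->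
  exists2 r : R, 0 < r & forall w, nm (w - z) < r -> nm (f w - f z) < e.

Lemma cdiff_czcont f z : cdiff f z -> czcont f z.
Proof. by move=> df e e0; exact: cdiff_cvg. Qed.

Lemma czcont_h f x y : czcont f (Complex x y) -> ccont (fun t => f (Complex t y)) x.
Proof.
move=> cf e /cf[d d0 dP]; exists d => // t td; apply: dP.
by rewrite (_ : _ - _ = (t - x)%:C%C) ?nmR//; congr Complex; rewrite subrr.
Qed.

Lemma nm_iR (r : R) : nm (Complex 0 r) = `|r|.
Proof.
rewrite -[RHS]mul1r -nm_i -nmR -nmM; congr nm.
by apply/eqP; rewrite eq_complex/= !mul0r mulr0 mul1r subrr add0r !eqxx.
Qed.

Lemma czcont_v f x y : czcont f (Complex x y) -> ccont (fun t => f (Complex x t)) y.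
Proof.
move=> cf e /cf[d d0 dP]; exists d => // t td; apply: dP.
by rewrite (_ : _ - _ = Complex 0 (t - y)) ?nm_iR//; congr Complex; rewrite subrr.
Qed.

Definition border_cont f a b c d :=
  forall z, on_border a b c d z -> czcont f z.

Section Border.
Variables (f : C -> C) (a b c d : R).
Hypotheses (ab : a <= b) (cd : c <= d) (cf : border_cont f a b c d).

Lemma border_h1 : ccont_on (fun x => f (Complex x c)) a b.
Proof.
by move=> x xab; apply/czcont_h/cf; split; [split=> //=; rewrite lexx|constructor 3].
Qed.
Lemma border_h2 : ccont_on (fun x => f (Complex x d)) a b.
Proof.
by move=> x xab; apply/czcont_h/cf; split;
  [split=> //=; rewrite lexx andbT|constructor 4].
Qed.
Lemma border_v1 : ccont_on (fun y => f (Complex a y)) c d.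
Proof.
by move=> x xab; apply/czcont_v/cf; split; [split=> //=; rewrite lexx|constructor 1].
Qed.
Lemma border_v2 : ccont_on (fun y => f (Complex b y)) c d.
Proof.
by move=> x xab; apply/czcont_v/cf; split;
  [split=> //=; rewrite lexx andbT|constructor 2].
Qed.

(** Each side costs [2 * M] times its length, and every length occurs twice. *)
Lemma oint_norm (M : R) : (forall z, on_border a b c d z -> nm (f z) <= M) ->
  nm (oint f a b c d) <= 4 * M * ((b - a) + (d - c)).
Proof.
move=> fM.
have H1 : nm (hpath f c a b) <= 2 * M * (b - a).
  apply: cint_norm => //; first exact: border_h1.
  by move=> x xab; apply: fM; split; [split=> //=; rewrite lexx|constructor 3].
have H2 : nm (hpath f d a b) <= 2 * M * (b - a).
  apply: cint_norm => //; first exact: border_h2.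
  by move=> x xab; apply: fM; split; [split=> //=; rewrite lexx andbT|constructor 4].
have H3 : nm (vpath f b c d) <= 2 * M * (d - c).
  apply: cint_norm => //; first exact: border_v2.
  by move=> x xab; apply: fM; split; [split=> //=; rewrite lexx andbT|constructor 2].
have H4 : nm (vpath f a c d) <= 2 * M * (d - c).
  apply: cint_norm => //; first exact: border_v1.
  by move=> x xab; apply: fM; split; [split=> //=; rewrite lexx|constructor 1].
have -> : 4 * M * (b - a + (d - c)) =
  2 * M * (b - a) + 2 * M * (d - c) + 2 * M * (b - a) + 2 * M * (d - c) by ring.
rewrite /oint; do 2 (apply: le_trans (nmB _ _) _; rewrite lerD// ?nmM ?nm_i ?mul1r//).
by apply: le_trans (nmD _ _) _; rewrite lerD// nmM nm_i mul1r.
Qed.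

End Border.

Lemma oint_splith f a m b c d : a <= m -> m <= b ->
  ccont_on (fun x => f (Complex x c)) a b ->
  ccont_on (fun x => f (Complex x d)) a b ->
  oint f a b c d = oint f a m c d + oint f m b c d.
Proof.
move=> am mb h1 h2.
rewrite /oint /hpath (cint_split am mb h1) (cint_split am mb h2); ring.
Qed.

Lemma oint_splitv f a b c m d : c <= m -> m <= d ->
  ccont_on (fun y => f (Complex a y)) c d ->
  ccont_on (fun y => f (Complex b y)) c d ->
  oint f a b c d = oint f a b c m + oint f a b m d.
Proof.
move=> am mb h1 h2.
rewrite /oint /vpath (cint_split am mb h1) (cint_split am mb h2); ring.
Qed.

Lemma ointB f g a b c d : a <= b -> c <= d -> border_cont f a b c d ->
  border_cont g a b c d ->
  oint (fun z => f z - g z) a b c d = oint f a b c d - oint g a b c d.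
Proof.
move=> ab cd cf cg; rewrite /oint /hpath /vpath.
rewrite !cintB; [ring|..].
- exact: (border_v1 ab cf).
- exact: (border_v1 ab cg).
- exact: (border_h2 cd cf).
- exact: (border_h2 cd cg).
- exact: (border_v2 ab cf).
- exact: (border_v2 ab cg).
- exact: (border_h1 cd cf).
- exact: (border_h1 cd cg).
Qed.

Lemma ointZ (k : C) f a b c d : a <= b -> c <= d -> border_cont f a b c d ->
  oint (fun z => k * f z) a b c d = k * oint f a b c d.
Proof.
move=> ab cd cf; rewrite /oint /hpath /vpath.
rewrite !cintZ; [ring|..].
- exact: (border_v1 ab cf).
- exact: (border_h2 cd cf).
- exact: (border_v2 ab cf).
- exact: (border_h1 cd cf).
Qed.

Lemma eq_oint f g a b c d : a <= b -> c <= d ->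
  (forall z, on_border a b c d z -> f z = g z) ->
  oint f a b c d = oint g a b c d.
Proof.
move=> ab cd fg; rewrite /oint /hpath /vpath; congr (_ + _ * _ - _ - _ * _);
  apply: eq_cint => x xab; apply: fg; split; try by split=> //=; rewrite lexx ?ab ?cd.
all: by [constructor 1|constructor 2|constructor 3|constructor 4].
Qed.

Lemma oint_affine (u v : C) a b c d : a <= b -> c <= d ->
  oint (fun z => u + v * z) a b c d = 0.
Proof.
move=> ab cd; rewrite /oint /hpath /vpath.
have cR t : ccont (fun x : R => x%:C%C) t.
  move=> e e0; exists e => // s; rewrite -rmorphB nmR//.
have cC (k : C) t : ccont (fun=> k) t.
  by move=> e e0; exists e => // s _; rewrite subrr nm0.
have cZ (k : C) t : ccont (fun x : R => k * x%:C%C) t.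
  move=> e e0; exists (e / (nm k + 1)) => [|s].
    by rewrite divr_gt0// ltr_pwDr// nm_ge0.
  rewrite ltr_pdivlMr ?ltr_pwDr ?nm_ge0// => H.
  rewrite -mulrBr nmM -rmorphB nmR; apply: le_lt_trans H.
  by rewrite mulrC ler_wpM2l// lerDl.
have Hh y s t : s <= t -> cint (fun x => u + v * (Complex x y)) s t =
    (u + v * ('i%C * y%:C%C)) * (t - s)%:C%C + v * ((t ^+ 2 - s ^+ 2) / 2)%:C%C.
  move=> st.
  rewrite (_ : (fun x => _) = fun x : R => (u + v * ('i%C * y%:C%C)) + v * x%:C%C).
    by rewrite cintD// ?cint_cst// cintZ// cint_id.
  by apply/funext => x; rewrite [Complex x y]complexE/=; ring.
have Hv x s t : s <= t -> cint (fun y => u + v * (Complex x y)) s t =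
    (u + v * x%:C%C) * (t - s)%:C%C + v * 'i%C * ((t ^+ 2 - s ^+ 2) / 2)%:C%C.
  move=> st.
  rewrite (_ : (fun y => _) = fun y : R => (u + v * x%:C%C) + (v * 'i%C) * y%:C%C).
    by rewrite cintD// ?cint_cst// cintZ// cint_id.
  by apply/funext => y; rewrite [Complex x y]complexE/=; ring.
rewrite !Hh// !Hv// !rmorphB/=.
set A := a%:C%C; set B := b%:C%C; set D := d%:C%C; set E := c%:C%C.
have i2 : 'i%C * 'i%C = -1 :> C by rewrite -expr2 sqr_i.
transitivity (v * (B - A) * (D - E) * (-'i%C + 'i%C)); last by rewrite addNr mulr0.
ring.
Qed.

End Rectangles.

(** * Bisection of rectangles *)

Section Bisection.
Context {R : realType}.
Implicit Types (a b c d x y : R).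

Lemma halving_small (W e : R) : 0 < e -> exists n, W / 2 ^+ n < e.
Proof.
move=> e0; exists (Num.bound (W / e)).
rewrite ltr_pdivrMr ?exprn_gt0// mulrC -ltr_pdivrMr//.
apply: le_lt_trans (ler_norm _) _.
apply: lt_trans (archi_boundP (normr_ge0 _)) _.
rewrite -natrX ltr_nat.
apply: leq_ltn_trans (ltn_expl _ (isT : (1 < 2)%N)).
rewrite /Num.bound normr_id//.
Qed.

Lemma nested_point (u : nat -> R) (w : nat -> R) :
  (forall n, u n <= u n.+1) -> (forall n, u n.+1 + w n.+1 <= u n + w n) ->
  (forall n, 0 <= w n) ->
  exists x, forall n, u n <= x <= u n + w n.
Proof.
move=> u1 u2 w0.
have mono n k : u n <= u (n + k)%N.
  by elim: k => [|k IH]; rewrite ?addn0// addnS (le_trans IH).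
have mono2 n k : u (n + k)%N + w (n + k)%N <= u n + w n.
  by elim: k => [|k IH]; rewrite ?addn0// addnS (le_trans (u2 _)).
have cross m n : u m <= u n + w n.
  apply: le_trans (mono m n) _; rewrite addnC.
  by apply: le_trans (mono2 n m); rewrite lerDl.
have hs : has_sup (range u).
  by split; [exists (u 0%N), 0%N | exists (u 0%N + w 0%N) => _ [m _ <-]].
exists (sup (range u)) => n; apply/andP; split.
  by apply: ub_le_sup; [exact: hs.2 | exists n].
by apply: ge_sup; [exact: hs.1 | move=> _ [m _ <-]].
Qed.

(** If [P] failed, it would fail on one quarter, on a quarter of that, and so on; these shrink to a
    point, where the local hypothesis gives [P]. The same principle serves Goursat's theorem and the
    Cousin problem. The local hypothesis may also assume that the small rectangle has the shape of
    the large one, which allows the square of a perimeter to be compared with an area. *)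
Lemma rect_bisect (P : R -> R -> R -> R -> Prop) a0 b0 c0 d0 :
  a0 < b0 -> c0 < d0 ->
  (forall a m b c d, a0 <= a -> a < m -> m < b -> b <= b0 ->
     c0 <= c -> c < d -> d <= d0 -> P a m c d -> P m b c d -> P a b c d) ->
  (forall a b c m d, a0 <= a -> a < b -> b <= b0 ->
     c0 <= c -> c < m -> m < d -> d <= d0 -> P a b c m -> P a b m d -> P a b c d) ->
  (forall x y, a0 <= x <= b0 -> c0 <= y <= d0 -> exists2 e, 0 < e &
     forall a b c d, a0 <= a -> a <= x <= b -> b <= b0 ->
       c0 <= c -> c <= y <= d -> d <= d0 -> a < b -> c < d ->
       b - a < e -> d - c < e -> (b - a) * (d0 - c0) = (d - c) * (b0 - a0) ->
       P a b c d) ->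
  P a0 b0 c0 d0.
Proof.
move=> ab0 cd0 Ph Pv Ploc; apply: contrapT => nP.
pose W n := (b0 - a0) / 2 ^+ n; pose H n := (d0 - c0) / 2 ^+ n.
have W0 n : 0 < W n by rewrite divr_gt0 ?subr_gt0// exprn_gt0.
have H0 n : 0 < H n by rewrite divr_gt0 ?subr_gt0// exprn_gt0.
have WS n : W n = W n.+1 + W n.+1.
  rewrite /W exprS; by field; rewrite expf_neq0.
have HS n : H n = H n.+1 + H n.+1.
  rewrite /H exprS; by field; rewrite expf_neq0.
pose bad n (p : R * R) := [/\ a0 <= p.1, p.1 + W n <= b0, c0 <= p.2,
  p.2 + H n <= d0 & ~ P p.1 (p.1 + W n) p.2 (p.2 + H n)].
have step n p : bad n p -> exists q, [/\ bad n.+1 q, p.1 <= q.1,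
    q.1 + W n.+1 <= p.1 + W n, p.2 <= q.2 & q.2 + H n.+1 <= p.2 + H n].
  case: p => a c [/= aa bb cc dd nPp].
  have := W0 n.+1; have := H0 n.+1; have := WS n; have := HS n.
  set w := W n.+1; set h := H n.+1; move=> hE wE h0 w0.
  apply: contrapT => nq; apply: nPp.
  have Q a' c' : a <= a' -> a' + w <= a + W n -> c <= c' -> c' + h <= c + H n ->
      P a' (a' + w) c' (c' + h).
    move=> h1 h2 h3 h4; apply: contrapT => nPq; apply: nq.
    exists (a', c'); split=> //=; split=> //=; rewrite -/w -/h; slra.
  rewrite wE hE !addrA.
  apply: (Ph a (a + w)); [slra|slra|slra|slra|slra|slra|slra| |].
    apply: (Pv a (a + w) c (c + h)); [slra|slra|slra|slra|slra|slra|slra| |].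
      by apply: Q; slra.
    by apply: Q; slra.
  apply: (Pv (a + w) (a + w + w) c (c + h)); [slra|slra|slra|slra|slra|slra|slra| |].
    by apply: Q; slra.
  by apply: Q; slra.
have bad0 : bad 0%N (a0, c0).
  by split=> //=; rewrite /W /H expr0 !divr1 ?[_ + (_ - _)]addrC ?subrK.
have next n p : {q | bad n p -> [/\ bad n.+1 q, p.1 <= q.1,
    q.1 + W n.+1 <= p.1 + W n, p.2 <= q.2 & q.2 + H n.+1 <= p.2 + H n]}.
  apply: cid; have [/step[q qP]|nb] := pselect (bad n p); last by exists p.
  by exists q.
pose fix u n := if n is m.+1 then sval (next m (u m)) else (a0, c0).
have ub n : bad n (u n).
  by elim: n => [//|n IH]; rewrite /=; case: (svalP (next n (u n)) IH).
have us n := svalP (next n (u n)) (ub n).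
have [x xP] : exists x, forall n, (u n).1 <= x <= (u n).1 + W n.
  by apply: nested_point => n; [case: (us n)|case: (us n)|exact: ltW].
have [y yP] : exists y, forall n, (u n).2 <= y <= (u n).2 + H n.
  by apply: nested_point => n; [case: (us n)|case: (us n)|exact: ltW].
have bnd n : [/\ a0 <= (u n).1, (u n).1 + W n <= b0, c0 <= (u n).2 &
    (u n).2 + H n <= d0] by case: (ub n).
have [e e0 eP] : exists2 e, 0 < e &
     forall a b c d, a0 <= a -> a <= x <= b -> b <= b0 ->
       c0 <= c -> c <= y <= d -> d <= d0 -> a < b -> c < d ->
       b - a < e -> d - c < e -> (b - a) * (d0 - c0) = (d - c) * (b0 - a0) ->
       P a b c d.
  have [h1 h2 h3 h4] := bnd 0%N; have := xP 0%N; have := yP 0%N => h5 h6.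
  by apply: Ploc; [move: h6|move: h5] => /andP[h7 h8]; apply/andP; split; slra.
have [n1 n1P] := halving_small (b0 - a0) e0.
have [n2 n2P] := halving_small (d0 - c0) e0.
have mono (w : R) n m : 0 < w -> (n <= m)%N -> w / 2 ^+ m <= w / 2 ^+ n.
  move=> w0 nm; apply: ler_wpM2l; first exact: ltW.
  rewrite lef_pV2 ?posrE ?exprn_gt0//.
  by rewrite ler_eXn2l// ltr1n.
pose n := maxn n1 n2.
have [h1 h2 h3 h4 nPn] := ub n; apply: nPn.
apply: eP => //; rewrite ?ltrDl ?W0 ?H0//; try by rewrite addrC addKr.
- rewrite addrC addKr; apply: le_lt_trans n1P; apply: mono; last exact: leq_maxl.
  by rewrite subr_gt0.
- rewrite addrC addKr; apply: le_lt_trans n2P; apply: mono; last exact: leq_maxr.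
  by rewrite subr_gt0.
- rewrite ![_ + _ - _]addrC !addKr /W /H; ring.
Qed.

End Bisection.

(** * Goursat's theorem and deformation of contours *)

Section Goursat.
Context {R : realType}.
Local Notation C := R[i].
Implicit Types (f g : C -> C) (a b c d : R) (z w : C).

Lemma on_border_rect a b c d z : on_border a b c d z -> in_rect a b c d z.
Proof. by case. Qed.

Lemma nm_rect a b c d z w : in_rect a b c d z -> in_rect a b c d w ->
  nm (w - z) <= (b - a) + (d - c).
Proof.
move=> [/andP[z1 z2] /andP[z3 z4]] [/andP[w1 w2] /andP[w3 w4]].
apply: le_trans (nm_ReIm _) _; rewrite !raddfB/=.
apply: lerD; rewrite ler_norml; apply/andP; split; slra.
Qed.

Lemma czcontB f g z : czcont f z -> czcont g z -> czcont (fun w => f w - g w) z.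
Proof.
move=> cf cg e e0; have e2 : 0 < e / 2 by slra.
have [d d0 dP] := cf _ e2; have [d' d0' dP'] := cg _ e2.
exists (Num.min d d'); first by rewrite lt_min d0.
move=> w; rewrite lt_min => /andP[/dP h1 /dP' h2].
have -> : f w - g w - (f z - g z) = (f w - f z) - (g w - g z) by ring.
by apply: le_lt_trans (nmB _ _) _; slra.
Qed.

Lemma goursat f a b c d : a < b -> c < d ->
  (forall z, in_rect a b c d z -> cdiff f z) -> oint f a b c d = 0.
Proof.
move=> ab cd df.
(* For sides [p], [q] in the fixed ratio, [4 * (p + q) ^+ 2 = K * (p * q)], since (p + q)^2 / (p q)
   = p / q + 2 + q / p. *)
pose K := 4 * ((b - a) / (d - c) + 2 + (d - c) / (b - a)).
have K0 : 0 <= K.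
  have : 0 <= (b - a) / (d - c) by rewrite divr_ge0// subr_ge0 ltW.
  have : 0 <= (d - c) / (b - a) by rewrite divr_ge0// subr_ge0 ltW.
  by rewrite /K; slra.
have dfb a' b' c' d' : a <= a' -> b' <= b -> c <= c' -> d' <= d ->
    border_cont f a' b' c' d'.
  move=> h1 h2 h3 h4 z [[/andP[z1 z2] /andP[z3 z4]] _].
  by apply/cdiff_czcont/df; split; apply/andP; split; slra.
(* A bound proportional to the area is additive, hence inherited by a rectangle from its two
   halves. *)
have main e : 0 < e -> nm (oint f a b c d) <= e * (K * ((b - a) * (d - c))).
  move=> e0; apply: (@rect_bisect _ (fun a b c d =>
    nm (oint f a b c d) <= e * (K * ((b - a) * (d - c)))) a b c d) => //.
  - move=> a' m b' c' d' h1 h2 h3 h4 h5 h6 h7 P1 P2.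
    have bc := dfb _ _ _ _ h1 h4 h5 h7.
    rewrite (@oint_splith _ f a' m b' c' d' (ltW h2) (ltW h3)); last 2 first.
      by apply: border_h1 bc; slra.
      by apply: border_h2 bc; slra.
    apply: le_trans (nmD _ _) _; apply: le_trans (lerD P1 P2) _.
    rewrite -mulrDr; rewrite le_eqVlt; apply/orP; left; apply/eqP; congr (_ * _); ring.
  - move=> a' b' c' m d' h1 h2 h3 h4 h5 h6 h7 P1 P2.
    have bc := dfb _ _ _ _ h1 h3 h4 h7.
    rewrite (@oint_splitv _ f a' b' c' m d' (ltW h5) (ltW h6)); last 2 first.
      by apply: border_v1 bc; slra.
      by apply: border_v2 bc; slra.
    apply: le_trans (nmD _ _) _; apply: le_trans (lerD P1 P2) _.
    rewrite -mulrDr; rewrite le_eqVlt; apply/orP; left; apply/eqP; congr (_ * _); ring.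
  - move=> x y xab ycd; set z := Complex x y.
    have /cdiffP[k /(_ _ e0)[r r0 rP]] : cdiff f z by apply: df.
    exists (r / 2); first slra.
    move=> a' b' c' d' h1 h2 h3 h4 h5 h6 h7 h8 h9 h10 shape.
    have bc := dfb _ _ _ _ h1 h3 h4 h6.
    have zin : in_rect a' b' c' d' z by [].
    have aff w : czcont (fun w => (f z - k * z) + k * w) w.
      by apply: cdiff_czcont; apply: cdiffD; [exact: cdiff_cst|
        apply: cdiffZ; exact: cdiff_id].
    (* The affine part of the expansion at [z] integrates to 0, so only the error term of size [e]
       times the diameter remains. *)
    have -> : oint f a' b' c' d' =
        oint (fun w => f w - ((f z - k * z) + k * w)) a' b' c' d'.
      rewrite (ointB (ltW h7) (ltW h8) bc); last by move=> *; exact: aff.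
      by rewrite (oint_affine _ _ (ltW h7) (ltW h8)) subr0.
    have bnd w : on_border a' b' c' d' w ->
        nm (f w - (f z - k * z + k * w)) <= e * ((b' - a') + (d' - c')).
      move=> /on_border_rect win.
      have wz := nm_rect zin win.
      have -> : f w - (f z - k * z + k * w) = f w - f z - k * (w - z) by ring.
      apply: le_trans (rP _ _) _; first by slra.
      by rewrite ler_wpM2l// ltW.
    apply: (le_trans (oint_norm (ltW h7) (ltW h8) _ bnd)).
      move=> w wb; apply: czcontB; [exact: bc | exact: aff].
    rewrite -mulrA mulrCA -!mulrA; apply: ler_wpM2l; first exact: ltW.
    set p := b' - a' in shape *; set q := d' - c' in shape *.
    have W0 : b - a != 0 by rewrite subr_eq0 gt_eqF.
    have H0 : d - c != 0 by rewrite subr_eq0 gt_eqF.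
    have pE : p = q * (b - a) / (d - c) by rewrite -shape mulfK.
    rewrite [X in X <= _](_ : _ = 4 * (((b - a) / (d - c) + 2 + (d - c) / (b - a)) * (p * q)))//.
    by rewrite pE; field; rewrite W0 H0.
apply/eqP; rewrite -nm_eq0 eq_le nm_ge0 andbT; apply/ler_addgt0Pl => e e0.
rewrite addr0; set A := K * ((b - a) * (d - c)) in main.
have A0 : 0 <= A by rewrite mulr_ge0// mulr_ge0// subr_ge0 ltW.
apply: le_trans (main (e / (A + 1)) _) _; first by rewrite divr_gt0//; slra.
rewrite mulrAC ler_pdivrMr; last slra.
by apply: ler_wpM2l; [exact: ltW | slra].
Qed.

(** Lines along the sides of the inner rectangle cut off four rectangles, left, right, below and
    above, none of which meets the open inner one; [goursat] applies to each. *)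
Lemma oint_deform f a b c d a' b' c' d' : a < a' -> a' < b' -> b' < b ->
  c < c' -> c' < d' -> d' < d ->
  (forall z, in_rect a b c d z ->
     ~ ((a' < complex.Re z < b') /\ (c' < complex.Im z < d')) -> cdiff f z) ->
  oint f a b c d = oint f a' b' c' d'.
Proof.
move=> h1 h2 h3 h4 h5 h6 df.
have ch x0 x1 y : a <= x0 -> x1 <= b -> c <= y <= d -> (y <= c') || (d' <= y) ->
    ccont_on (fun x => f (Complex x y)) x0 x1.
  move=> k1 k2 k3 k4 x /andP[x1' x2]; apply/czcont_h/cdiff_czcont/df.
    by split=> //=; apply/andP; split; slra.
  by move=> [_ /= /andP[k5 k6]]; move: k4; rewrite !leNgt k5 k6.
have cv x y0 y1 : c <= y0 -> y1 <= d -> a <= x <= b -> (x <= a') || (b' <= x) ->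
    ccont_on (fun y => f (Complex x y)) y0 y1.
  move=> k1 k2 k3 k4 x' /andP[x1' x2]; apply/czcont_v/cdiff_czcont/df.
    by split=> //=; apply/andP; split; slra.
  by move=> [/= /andP[k5 k6] _]; move: k4; rewrite !leNgt k5 k6.
rewrite (@oint_splith _ f a a' b); [|slra|slra| |]; last 2 first.
- by apply: ch; rewrite ?lexx//; slra.
- by apply: ch; rewrite ?lexx ?orbT//; slra.
rewrite (@oint_splith _ f a' b' b); [|slra|slra| |]; last 2 first.
- by apply: ch; rewrite ?lexx//; slra.
- by apply: ch; rewrite ?lexx ?orbT//; slra.
rewrite (@oint_splitv _ f a' b' c c' d); [|slra|slra| |]; last 2 first.
- by apply: cv; rewrite ?lexx//; slra.
- by apply: cv; rewrite ?lexx ?orbT//; slra.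
rewrite (@oint_splitv _ f a' b' c' d' d); [|slra|slra| |]; last 2 first.
- by apply: cv; rewrite ?lexx//; slra.
- by apply: cv; rewrite ?lexx ?orbT//; slra.
rewrite (@goursat f a a' c d); [|slra|slra|]; last first.
  move=> z [/andP[z1 z2] z3]; apply: df; first by split=> //; apply/andP; split; slra.
  by move=> [/andP[z4 _] _]; slra.
rewrite (@goursat f b' b c d); [|slra|slra|]; last first.
  move=> z [/andP[z1 z2] z3]; apply: df; first by split=> //; apply/andP; split; slra.
  by move=> [/andP[_ z4] _]; slra.
rewrite (@goursat f a' b' c c'); [|slra|slra|]; last first.
  move=> z [/andP[z1 z2] /andP[z3 z4]]; apply: df.
    by split=> //; apply/andP; split; slra.
  by move=> [_ /andP[z5 _]]; slra.
rewrite (@goursat f a' b' d' d); [|slra|slra|]; last first.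
  move=> z [/andP[z1 z2] /andP[z3 z4]]; apply: df.
    by split=> //; apply/andP; split; slra.
  by move=> [_ /andP[_ z5]]; slra.
by rewrite !add0r !addr0.
Qed.

End Goursat.

(** * Differentiation of Cauchy-type integrals *)

Section IntegralContinuity.
Context {R : realType}.
Local Notation C := R[i].
Implicit Types (f g : R -> C) (a b x : R).

Lemma ccontP f x : ccont f x <-> {for x, continuous (f : R -> C^o)}.
Proof.
split=> [cf|cf].
  apply/cvgrPdist_lt => e e0.
  have e1 : 0 < complex.Re e by move: e0; rewrite ltcE => /andP[].
  have [d d0 dP] := cf _ e1; near=> y.
  have -> : e = (complex.Re e)%:C%C.
    by move: e0; rewrite ltcE/= => /andP[/eqP]; case: (e) => u v /= ->.
  rewrite distrC normE ltcR; apply: dP; rewrite distrC; near: y.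
  exact: cvgr_dist_lt.
move=> e e0; move/cvgrPdist_lt : cf => /(_ e%:C%C); rewrite ltcR => /(_ e0).
move=> /nbhs_ballP[d /= d0 dP]; exists d => // y yd.
have := dP y; rewrite /ball/= distrC => /(_ yd).
by rewrite distrC normE ltcR.
Unshelve. all: by end_near.
Qed.

Lemma ccontM f g x : ccont f x -> ccont g x -> ccont (fun y => f y * g y) x.
Proof.
move=> cf cg e e0; have := nm_ge0 (f x); have := nm_ge0 (g x) => g0 f0.
have e1 : 0 < Num.min 1 (e / (nm (f x) + nm (g x) + 2)).
  by rewrite lt_min ltr01/=; apply: divr_gt0; slra.
have [d d0 dP] := cf _ e1; have [d' d0' dP'] := cg _ e1.
exists (Num.min d d'); first by rewrite lt_min d0.
move=> y; rewrite lt_min => /andP[/dP h1 /dP' h2].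
set r := Num.min _ _ in e1 h1 h2.
have r1 : r <= 1 by rewrite ge_min lexx.
have re : r * (nm (f x) + nm (g x) + 2) <= e.
  by rewrite -ler_pdivlMr ?ge_min ?lexx ?orbT//; slra.
have -> : f y * g y - f x * g x = (f y - f x) * (g y - g x) +
  (f x * (g y - g x) + g x * (f y - f x)) by ring.
have b1 : nm ((f y - f x) * (g y - g x)) <= r * 1.
  rewrite nmM; apply: ler_pM; rewrite ?nm_ge0//; slra.
have b2 : nm (f x * (g y - g x)) <= r * nm (f x).
  by rewrite nmM mulrC; apply: ler_wpM2r => //; exact: ltW.
have b3 : nm (g x * (f y - f x)) <= r * nm (g x).
  by rewrite nmM mulrC; apply: ler_wpM2r => //; exact: ltW.
apply: le_lt_trans (nmD _ _) _; have := nmD (f x * (g y - g x)) (g x * (f y - f x)).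
move: re b1 b2 b3; rewrite !mulrDr !mulr1; slra.
Qed.

Lemma ccontD f g x : ccont f x -> ccont g x -> ccont (fun y => f y + g y) x.
Proof.
move=> cf cg e e0; have e1 : 0 < e / 2 by slra.
have [d d0 dP] := cf _ e1; have [d' d0' dP'] := cg _ e1.
exists (Num.min d d'); first by rewrite lt_min d0.
move=> y; rewrite lt_min => /andP[/dP h1 /dP' h2].
have -> : f y + g y - (f x + g x) = (f y - f x) + (g y - g x) by ring.
by apply: le_lt_trans (nmD _ _) _; slra.
Qed.

Lemma ccontV f x : ccont f x -> f x != 0 -> ccont (fun y => (f y)^-1) x.
Proof. by move=> /ccontP cf fx; apply/ccontP; exact: (@cvgV C). Qed.

Lemma ccont_cst (c : C) x : ccont (fun=> c) x.
Proof. by move=> e e0; exists 1 => // y _; rewrite subrr nm0. Qed.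

Lemma ccontB f g x : ccont f x -> ccont g x -> ccont (fun y => f y - g y) x.
Proof. by move=> cf cg; apply: ccontD => //; exact: ccontN. Qed.

Lemma ccont_on_bounded f a b : ccont_on f a b ->
  exists2 M : R, 0 < M & forall x, a <= x <= b -> nm (f x) <= M.
Proof.
move=> cf.
have H (h : R -> R^o) : (forall x, a <= x <= b -> {for x, continuous h}) ->
    exists2 M : R, 0 < M & forall x, a <= x <= b -> `|h x| <= M.
  move=> ch.
  have cw : {within `[a, b], continuous h}.
    apply: continuous_in_subspaceT => x; rewrite inE/= in_itv/=; exact: ch.
  have /compact_bounded[M [_ MP]] :=
    continuous_compact cw (@segment_compact _ a b).
  exists (`|M| + 1) => [|x xab]; first by rewrite ltr_pwDr.
  apply: (MP (`|M| + 1)); first by have := ler_norm M; slra.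
  by exists x => //=; rewrite in_itv.
have [M1 M10 M1P] := H _ (fun x xab => ccontRe (cf x xab)).
have [M2 M20 M2P] := H _ (fun x xab => ccontIm (cf x xab)).
exists (M1 + M2) => [|x xab]; first slra.
by apply: le_trans (nm_ReIm _) _; apply: lerD; [exact: M1P | exact: M2P].
Qed.

(** The derivative is found by expanding the kernel: 1/(s - w) - 1/(s - z) - (w - z)/(s - z)^2 = (w
    - z)^2 / ((s - z)^2 (s - w)). The remainder is quadratic in [w - z], and [K] bounds its integral
    because each of the three denominators is at least [r / 2]. Only continuity of the density [phi]
    enters, so the lemma produces holomorphic functions out of continuous data. *)
Lemma cauchy_type_cdiff (phi gam : R -> C) a b (z : C) (r : R) : a <= b ->
  ccont_on phi a b -> ccont_on gam a b -> 0 < r ->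
  (forall x, a <= x <= b -> r <= nm (gam x - z)) ->
  cdiff (fun w => cint (fun x => phi x / (gam x - w)) a b) z.
Proof.
move=> ab cphi cgam r0 far.
have [M M0 MP] := ccont_on_bounded cphi.
have farw w x : nm (w - z) <= r / 2 -> a <= x <= b -> r / 2 <= nm (gam x - w).
  move=> wz /far h; have := nm_tri (gam x) z w; slra.
have neq w x : nm (w - z) <= r / 2 -> a <= x <= b -> gam x - w != 0.
  move=> wz xab; rewrite -nm_gt0; apply: lt_le_trans (farw _ _ wz xab); slra.
have cq w : nm (w - z) <= r / 2 -> ccont_on (fun x => (gam x - w)^-1) a b.
  move=> wz x xab; apply: ccontV; last exact: neq.
  by apply: ccontB; [exact: cgam | exact: ccont_cst].
have zz : nm (z - z) <= r / 2 by rewrite subrr nm0; slra.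
have c1 w : nm (w - z) <= r / 2 -> ccont_on (fun x => phi x / (gam x - w)) a b.
  by move=> wz x xab; apply: ccontM; [exact: cphi | exact: cq].
have c2 : ccont_on (fun x => phi x / (gam x - z) / (gam x - z)) a b.
  by move=> x xab; apply: ccontM; [exact: c1 | exact: cq].
apply/cdiffP; exists (cint (fun x => phi x / (gam x - z) / (gam x - z)) a b) => e e0.
pose K := 2 * (M * (2 / r) * (2 / r) * (2 / r)) * (b - a) + 1.
have K0 : 0 < K.
  rewrite /K; suff : 0 <= 2 * (M * (2 / r) * (2 / r) * (2 / r)) * (b - a) by slra.
  have r20 : 0 <= 2 / r by rewrite divr_ge0// ltW.
  by rewrite !mulr_ge0//; slra.
exists (Num.min (r / 2) (e / K)); first by rewrite lt_min !divr_gt0.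
move=> w; rewrite lt_min => /andP[/ltW wz we].
have -> : cint (fun x => phi x / (gam x - w)) a b -
    cint (fun x => phi x / (gam x - z)) a b -
    cint (fun x => phi x / (gam x - z) / (gam x - z)) a b * (w - z) =
    (w - z) ^+ 2 *
    cint (fun x => phi x / (gam x - z) / (gam x - z) / (gam x - w)) a b.
  rewrite -cintB//; [|exact: c1|exact: c1].
  rewrite (_ : cint _ a b * (w - z) =
      cint (fun x => (w - z) * (phi x / (gam x - z) / (gam x - z))) a b); last first.
    by rewrite mulrC cintZ.
  rewrite -cintB; last 2 first.
  - by move=> x xab; apply: ccontB; exact: c1.
  - by move=> x xab; apply: ccontM; [exact: ccont_cst | exact: c2].
  rewrite -cintZ; last first.
    by move=> x xab; apply: ccontM; [exact: c2 | exact: cq].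
  apply: eq_cint => x xab; field.
  by rewrite (neq _ _ zz xab) (neq _ _ wz xab).
rewrite nmM nmX expr2 -mulrA mulrC; apply: ler_wpM2r; first exact: nm_ge0.
have B : nm (cint (fun x => phi x / (gam x - z) / (gam x - z) / (gam x - w)) a b)
    <= K.
  have h : forall x, a <= x <= b ->
      nm (phi x / (gam x - z) / (gam x - z) / (gam x - w)) <=
      M * (2 / r) * (2 / r) * (2 / r).
    move=> x xab.
    have inv w' : nm (w' - z) <= r / 2 -> nm (gam x - w')^-1 <= 2 / r.
      move=> w'z; rewrite nmV -[2 / r]invrK invf_div.
      rewrite lef_pV2 ?posrE; [exact: farw|rewrite nm_gt0; exact: neq|slra].
    rewrite !nmM; apply: ler_pM; rewrite ?mulr_ge0 ?nm_ge0//; last exact: inv.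
    apply: ler_pM; rewrite ?mulr_ge0 ?nm_ge0//; last exact: inv.
    apply: ler_pM; rewrite ?nm_ge0//; [exact: MP | exact: inv].
  apply: le_trans (cint_norm ab _ h) _; last by rewrite /K; slra.
  by move=> x xab; apply: ccontM; [exact: c2 | exact: cq].
apply: le_trans (ler_wpM2l (nm_ge0 _) B) _.
by move: we; rewrite ltr_pdivlMr// => /ltW.
Qed.

End IntegralContinuity.

(** * Cauchy's integral formula *)

Section CauchyFormula.
Context {R : realType}.
Local Notation C := R[i].
Implicit Types (f g : C -> C) (a b c d : R) (z w : C).

(** This is 2 pi i. It may stay an unevaluated integral because the formulas only divide by it. *)
Definition kappa : C := oint (fun w : C => w^-1) (-1) 1 (-1) 1.

Lemma cint_Re_ge (f : R -> C) a b (m : R) : a <= b -> ccont_on f a b ->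
  (forall x, a <= x <= b -> m <= complex.Re (f x)) ->
  m * (b - a) <= complex.Re (cint f a b).
Proof.
move=> ab cf fm; rewrite /cint/=.
have <- : \int[@lebesgue_measure R]_(x in `[a, b]) m = m * (b - a).
  rewrite Rintegral_cst//= lebesgue_measure_itv/= lte_fin.
  by move: ab; rewrite le_eqVlt => /predU1P[->|->]//; rewrite ltxx subrr.
apply: le_Rintegral => //; last exact: cintRe_int.
by apply: continuous_seg_integrable => x _; exact: cvg_cst.
Qed.

Lemma cint_Im_ge (f : R -> C) a b (m : R) : a <= b -> ccont_on f a b ->
  (forall x, a <= x <= b -> m <= complex.Im (f x)) ->
  m * (b - a) <= complex.Im (cint f a b).
Proof.
move=> ab cf fm; rewrite -[complex.Im _]opprK -ReiNIm [_ * 'i%C]mulrC.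
have cN : ccont_on (fun x => - 'i%C * f x) a b.
  by move=> x xab; apply: ccontM; [exact: ccont_cst | exact: cf].
have -> : - complex.Re ('i%C * cint f a b) = complex.Re (cint (fun x => - 'i%C * f x) a b).
  by rewrite cintZ// mulNr raddfN.
apply: cint_Re_ge => // x /fm fx.
by rewrite mulNr raddfN/= mulrC ReiNIm opprK.
Qed.

(** On each side the relevant part of the integrand is 1 / (t^2 + 1), at least 1/2 on an interval of
    length 2, so every side adds at least 1 to the imaginary part. *)
Lemma kappa_neq0 : kappa != 0.
Proof.
suff : 4 <= complex.Im kappa.
  by apply: contraTneq => ->; rewrite /= -ltNge.
have cR t : ccont (fun x : R => x%:C%C) t.
  by move=> e e0; exists e => // s; rewrite -rmorphB nmR.
have hE (y : R) : (fun x => Complex x y) = (fun x : R => x%:C%C + Complex 0 y).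
  by apply/funext => x; apply/eqP; rewrite eq_complex/= addr0 add0r !eqxx.
have vE (x : R) : (fun y => Complex x y) = (fun y : R => 'i%C * y%:C%C + x%:C%C).
  by apply/funext => y; rewrite [LHS]complexE addrC.
have ch (y t : R) : ccont (fun x => Complex x y) t.
  by rewrite hE; apply: ccontD => //; exact: ccont_cst.
have cv (x t : R) : ccont (fun y => Complex x y) t.
  by rewrite vE; apply: ccontD; [apply: ccontM|]; try exact: ccont_cst.
have ic (g : R -> C) t : ccont g t -> complex.Re (g t) != 0 \/ complex.Im (g t) != 0 ->
    ccont (fun x => (g x)^-1) t.
  move=> cg g0; apply: ccontV => //.
  by apply/eqP => g00; move: g0; rewrite g00/= eqxx; case.
have Nh (g : R -> C) : ccont_on g (-1) 1 -> - cint g (-1) 1 = cint (fun x => - 1 * g x) (-1) 1.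
  by move=> cg; rewrite cintZ// mulN1r.
have N1 : (-1 : R) != 0 by rewrite oppr_eq0 oner_eq0.
have half (x : R) : -1 <= x <= 1 -> 2^-1 <= (x ^+ 2 + 1)^-1.
  move=> /andP[x1 x2]; rewrite lef_pV2 ?posrE//; last by have := sqr_ge0 x; slra.
  have : 0 <= (1 - x) * (1 + x) by rewrite mulr_ge0; slra.
  by rewrite expr2; slra.
rewrite /kappa /oint /hpath /vpath.
have q1 : ccont_on (fun x : R => (Complex x (-1))^-1) (-1) 1.
  by move=> x _; apply: ic => //=; right.
have q2 : ccont_on (fun x : R => (Complex x 1)^-1) (-1) 1.
  by move=> x _; apply: ic => //=; right; exact: oner_neq0.
have q3 : ccont_on (fun x : R => (Complex 1 x)^-1) (-1) 1.
  by move=> x _; apply: ic => //=; left; exact: oner_neq0.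
have q4 : ccont_on (fun x : R => (Complex (-1) x)^-1) (-1) 1.
  by move=> x _; apply: ic => //=; left.
have two : 2^-1 * (1 - -1) = 1 :> R by field.
have b1 : 1 <= complex.Im (cint (fun x : R => (Complex x (-1))^-1) (-1) 1).
  rewrite -{1}two; apply: cint_Im_ge => // x xab.
  rewrite /= (_ : - (_ / _) = (x ^+ 2 + 1)^-1); first exact: half.
  by rewrite sqrrN expr1n; field; have := sqr_ge0 x; slra.
have b2 : 1 <= complex.Im (- cint (fun x : R => (Complex x 1)^-1) (-1) 1).
  rewrite Nh// -{1}two; apply: cint_Im_ge => // x xab.
    by apply: ccontM; [exact: ccont_cst | exact: q2].
  rewrite mulN1r raddfN/= opprK expr1n div1r; exact: half.
have b3 : 1 <= complex.Im ('i%C * cint (fun x : R => (Complex 1 x)^-1) (-1) 1).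
  rewrite mulrC ImiRe -{1}two; apply: cint_Re_ge => // x xab.
  by rewrite /= expr1n div1r addrC; exact: half.
have b4 : 1 <= complex.Im (- ('i%C * cint (fun x : R => (Complex (-1) x)^-1) (-1) 1)).
  rewrite -mulrN mulrC ImiRe Nh// -{1}two; apply: cint_Re_ge => // x xab.
    by apply: ccontM; [exact: ccont_cst | exact: q4].
  rewrite mulN1r raddfN/= sqrrN expr1n mulN1r opprK addrC; exact: half.
have sum4 (p q r s : C) : 1 <= complex.Im p -> 1 <= complex.Im q ->
    1 <= complex.Im r -> 1 <= complex.Im s -> 4 <= complex.Im (p + q + r + s).
  by clear; case: p q r s => [p1 p2] [q1 q2] [r1 r2] [s1 s2] /=; slra.
exact: sum4.
Qed.

Lemma inv_cdiff z w : w != z -> cdiff (fun u => (u - z)^-1) w.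
Proof.
move=> wz; apply: cdiffV; last by rewrite subr_eq0.
by apply: cdiffB; [exact: cdiff_id | exact: cdiff_cst].
Qed.

Lemma kappaE a b c d z : a < complex.Re z -> complex.Re z < b ->
  c < complex.Im z -> complex.Im z < d ->
  oint (fun w => (w - z)^-1) a b c d = kappa.
Proof.
move=> h1 h2 h3 h4.
pose N0 : R := 2 + `|a| + `|b| + `|c| + `|d| + nm z.
have big N : N0 <= N -> oint (fun w => (w - z)^-1) a b c d - kappa =
    oint (fun w => (w - z)^-1 - w^-1) (-N) N (-N) N.
  rewrite /N0 => hN.
  have [n1 n2 n3 n4 n5] : [/\ 0 <= `|a|, 0 <= `|b|, 0 <= `|c|, 0 <= `|d| & 0 <= nm z].
    by rewrite !normr_ge0 nm_ge0.
  have abs (t : R) : `|t| < N -> - N < t /\ t < N by rewrite ltr_norml => /andP.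
  have [p1 _] := abs a ltac:(slra); have [_ p2] := abs b ltac:(slra).
  have [p3 _] := abs c ltac:(slra); have [_ p4] := abs d ltac:(slra).
  have p5 : 1 < N by slra.
  clear n1 n2 n3 n4 n5 hN.
  have ab := lt_trans h1 h2; have cd := lt_trans h3 h4.
  have p6 : - N < -1 by slra.
  have m11 : -1 < 1 :> R by slra.
  rewrite ointB; [|slra|slra| |]; last 2 first.
  - move=> w [_ wb]; apply/cdiff_czcont/inv_cdiff.
    by apply/eqP => wz; subst w; case: wb; slra.
  - move=> w [_ wb]; apply/cdiff_czcont.
    rewrite -[X in cdiff X](_ : (fun u => (u - 0)^-1) = _).
      apply/inv_cdiff; apply/eqP => wz; subst w.
      by case: wb => /=; slra.
    by apply/funext => u; rewrite subr0.
  congr (_ - _).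
    rewrite (@oint_deform _ _ (-N) N (-N) N a b c d); [|slra|slra|slra|slra|slra|slra|].
      by [].
    move=> w _ out; apply: inv_cdiff; apply/eqP => wz; apply: out; subst w.
    by split; apply/andP.
  rewrite /kappa (@oint_deform _ _ (-N) N (-N) N (-1) 1 (-1) 1); [|slra|slra|slra|slra|slra|slra|].
    by [].
  move=> w _ out; rewrite -[X in cdiff X](_ : (fun u => (u - 0)^-1) = _).
    apply: inv_cdiff; apply/eqP => wz; apply: out; subst w => /=.
    by split; apply/andP; split; slra.
  by apply/funext => u; rewrite subr0.
apply/eqP; rewrite -subr_eq0 -nm_eq0 eq_le nm_ge0 andbT.
apply/ler_addgt0Pl => e e0; rewrite addr0.
(* Chosen so that the final bound [16 * nm z / (N - nm z)] is at most [e]. *)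
pose N : R := N0 + 16 * nm z / e + nm z.
have z0 := nm_ge0 z.
have q0 : 0 <= 16 * nm z / e by rewrite divr_ge0 ?mulr_ge0// ltW.
have N00 : 2 <= N0.
  rewrite /N0; have := normr_ge0 a; have := normr_ge0 b; have := normr_ge0 c.
  by have := normr_ge0 d; slra.
have NN : N0 <= N by rewrite /N; slra.
rewrite (big _ NN).
have Nz : 0 < N - nm z by rewrite /N; slra.
have Npos : 0 < N by rewrite /N; slra.
have wN w : on_border (-N) N (-N) N w -> N <= nm w.
  move=> [_ wb]; have hR := Re_nm w; have hI := Im_nm w.
  by case: wb hR hI => ->; rewrite ?normrN (gtr0_norm Npos).
have w0 w : on_border (-N) N (-N) N w -> w != 0.
  by move=> /wN wn; rewrite -nm_gt0; slra.
have wz w : on_border (-N) N (-N) N w -> w - z != 0.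
  move=> /wN wn; rewrite subr_eq0; apply/eqP => wz; move: wn Nz; rewrite wz; slra.
have bnd w : on_border (-N) N (-N) N w ->
    nm ((w - z)^-1 - w^-1) <= nm z / (N * (N - nm z)).
  move=> wb; have w1 := wN _ wb.
  have -> : (w - z)^-1 - w^-1 = z / (w * (w - z)).
    by field; rewrite ?(wz _ wb) ?(w0 _ wb).
  rewrite nmM nmV nmM; apply: ler_wpM2l => //.
  rewrite lef_pV2 ?posrE ?mulr_gt0 ?nm_gt0 ?(w0 _ wb) ?(wz _ wb)//.
  apply: ler_pM => //; try slra.
  have := nmD (w - z) z; rewrite subrK; slra.
have NN2 : - N <= N by slra.
apply: le_trans (oint_norm NN2 NN2 _ bnd) _.
  move=> w wb; apply/cdiff_czcont/cdiffB.
    by apply: inv_cdiff; rewrite -subr_eq0 wz.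
  rewrite -[X in cdiff X](_ : (fun u => (u - 0)^-1) = _).
    by apply: inv_cdiff; rewrite w0.
  by apply/funext => u; rewrite subr0.
have -> : 4 * (nm z / (N * (N - nm z))) * (N - - N + (N - - N)) =
    16 * nm z / (N - nm z).
  by field; rewrite !gt_eqF.
rewrite ler_pdivrMr//.
rewrite -ler_pdivrMl// mulrC /N; slra.
Qed.

(** The difference quotient [g] stays bounded near [z], so its integral over a square of half-width
    [s] about [z] is O(s); by deformation it does not depend on [s] and is 0. What is left is [f z]
    times the integral of 1/(w - z). *)
Lemma cauchy_formula f a b c d z : a < complex.Re z -> complex.Re z < b ->
  c < complex.Im z -> complex.Im z < d ->
  (forall w, in_rect a b c d w -> cdiff f w) ->
  oint (fun w => f w / (w - z)) a b c d = kappa * f z.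
Proof.
move=> h1 h2 h3 h4 df.
have zin : in_rect a b c d z by split; apply/andP; split; exact: ltW.
have neb w : on_border a b c d w -> w != z.
  by move=> [_ wb]; apply/eqP => wz; subst w; case: wb; slra.
have ab : a <= b by slra.
have cd : c <= d by slra.
pose g w := (f w - f z) / (w - z).
have dg w : in_rect a b c d w -> w != z -> cdiff g w.
  move=> win wz; apply: cdiffM; last exact: inv_cdiff.
  by apply: cdiffB; [exact: df | exact: cdiff_cst].
have g0 : oint g a b c d = 0.
  have /cdiffP[k /(_ _ ltr01)[r r0 rP]] := df _ zin.
  apply/eqP; rewrite -nm_eq0 eq_le nm_ge0 andbT.
  apply/ler_addgt0Pl => e e0; rewrite addr0.
  have k0 := nm_ge0 k.
  pose K := 16 * (nm k + 1).
  have K0 : 0 < K by rewrite /K; slra.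
  have eK : 0 < e / K by rewrite divr_gt0.
  have [s [s0 sr se [s1 s2] [s3 s4]]] : exists s : R, [/\ 0 < s, s < r / 2, s <= e / K,
    a < complex.Re z - s /\ complex.Re z + s < b &
    c < complex.Im z - s /\ complex.Im z + s < d].
    pose m1 := Num.min (r / 2) (e / K).
    pose m2 := Num.min (complex.Re z - a) (b - complex.Re z).
    pose m3 := Num.min (complex.Im z - c) (d - complex.Im z).
    have m0 : 0 < Num.min m1 (Num.min m2 m3) by rewrite /m1 /m2 /m3 !lt_min; slra.
    exists (Num.min m1 (Num.min m2 m3) / 2).
    have : Num.min m1 (Num.min m2 m3) <= Num.min m1 (Num.min m2 m3) by [].
    rewrite {2}/m1 {2}/m2 {2}/m3 !le_min => /andP[/andP[q1 q2] /andP[/andP[q3 q4] /andP[q5 q6]]].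
    move: m0 q1 q2 q3 q4 q5 q6; generalize (Num.min m1 (Num.min m2 m3)) => t.
    by clear=> *; split; [| | |split|split]; lra.
  set x := complex.Re z in h1 h2 s1 s2 *; set y := complex.Im z in h3 h4 s3 s4 *.
  rewrite (@oint_deform _ g a b c d (x - s) (x + s) (y - s) (y + s)); try slra; last first.
    move=> w win out; apply: dg => //; apply/eqP => wz; apply: out; subst w.
    by rewrite -/x -/y; split; apply/andP; split; slra.
  have bd w : on_border (x - s) (x + s) (y - s) (y + s) w -> w != z.
    by move=> [_ wb]; apply/eqP => wz; subst w; rewrite -/x -/y in wb; case: wb; slra.
  have inside w : on_border (x - s) (x + s) (y - s) (y + s) w -> in_rect a b c d w.
    move=> [[/andP[k1 k2] /andP[k3 k4]] _].
    by clear -k1 k2 k3 k4 s1 s2 s3 s4; split; apply/andP; split; lra.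
  have bnd w : on_border (x - s) (x + s) (y - s) (y + s) w -> nm (g w) <= nm k + 1.
    move=> wb; have wz := bd _ wb.
    have wz0 : 0 < nm (w - z) by rewrite nm_gt0 subr_eq0.
    rewrite nmM nmV ler_pdivrMr//.
    have wr : nm (w - z) < r.
      case: wb => -[/andP[w1 w2] /andP[w3 w4]] _.
      apply: le_lt_trans (nm_ReIm _) _; rewrite !raddfB/= -/x -/y.
      have : `|complex.Re w - x| <= s by rewrite ler_norml; apply/andP; split; slra.
      have : `|complex.Im w - y| <= s by rewrite ler_norml; apply/andP; split; slra.
      slra.
    have := rP _ wr; rewrite mul1r => H.
    have := nmD (f w - f z - k * (w - z)) (k * (w - z)); rewrite subrK nmM.
    by rewrite mulrDl mul1r; slra.
  apply: le_trans (oint_norm _ _ _ bnd) _; try slra.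
    by move=> w wb; apply/cdiff_czcont/dg; [exact: inside | exact: bd].
  have -> : 4 * (nm k + 1) * (x + s - (x - s) + (y + s - (y - s))) = K * s.
    by rewrite /K; ring.
  by rewrite mulrC -ler_pdivlMr.
rewrite -(kappaE h1 h2 h3 h4) mulrC -ointZ//; last first.
  by move=> w wb; apply/cdiff_czcont/inv_cdiff; exact: neb.
apply/eqP; rewrite -subr_eq0 -ointB//; last 2 first.
- move=> w wb; apply/cdiff_czcont/cdiffM; first by apply: df; case: wb.
  by apply: inv_cdiff; exact: neb.
- move=> w wb; apply/cdiff_czcont/cdiffZ.
  by apply: inv_cdiff; exact: neb.
rewrite -g0; apply/eqP; apply: eq_oint => // w _.
by rewrite -mulrBl.
Qed.

End CauchyFormula.

(** * Local theory of holomorphic functions *)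

Section LocalTheory.
Context {R : realType}.
Local Notation C := R[i].
Implicit Types (f g : C -> C) (a b c d : R) (z w u : C).

(** Squares replace discs because the Cauchy theory above is for rectangles; [square_nm] and
    [nm_square] translate between the two. *)
Definition square z (r : R) : C -> Prop :=
  in_rect (complex.Re z - r) (complex.Re z + r) (complex.Im z - r) (complex.Im z + r).

Definition sq_oint f z (r : R) : C :=
  oint f (complex.Re z - r) (complex.Re z + r) (complex.Im z - r) (complex.Im z + r).

Lemma square_nm z (r : R) w : square z r w -> nm (w - z) <= 2 * r.
Proof.
move=> [/andP[w1 w2] /andP[w3 w4]]; apply: le_trans (nm_ReIm _) _.
rewrite !raddfB/= (_ : 2 * r = r + r); last by ring.
by apply: lerD; rewrite ler_norml; apply/andP; split; slra.
Qed.

Lemma nm_square z (r : R) w : nm (w - z) <= r -> square z r w.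
Proof.
move=> wr; have := Re_nm (w - z); have := Im_nm (w - z); rewrite !raddfB/= => h1 h2.
by have := le_trans h1 wr; have := le_trans h2 wr; rewrite !ler_norml =>
  /andP[? ?] /andP[? ?]; split; apply/andP; split; slra.
Qed.

Lemma border_far a b c d (r : R) u w : on_border a b c d u ->
  a + r <= complex.Re w <= b - r -> c + r <= complex.Im w <= d - r ->
  r <= nm (u - w).
Proof.
move=> [_ ub] /andP[w1 w2] /andP[w3 w4].
have := Re_nm (u - w); have := Im_nm (u - w); rewrite !raddfB/=.
have := ler_norm (complex.Re u - complex.Re w).
have := ler_norm (complex.Im u - complex.Im w).
have := ler_norm (- (complex.Re u - complex.Re w)).
have := ler_norm (- (complex.Im u - complex.Im w)).
by rewrite !normrN => ? ? ? ? ? ?; case: ub => ?; slra.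
Qed.

Lemma square_border_far z (r s : R) u w : on_border (complex.Re z - r)
    (complex.Re z + r) (complex.Im z - r) (complex.Im z + r) u ->
  nm (w - z) <= s -> r - s <= nm (u - w).
Proof.
move=> ub /nm_square[/andP[? ?] /andP[? ?]].
by apply: (border_far ub); apply/andP; split; slra.
Qed.

Lemma oint_type_cdiff (phi : C -> C) a b c d w :
  a < complex.Re w < b -> c < complex.Im w < d -> border_cont phi a b c d ->
  cdiff (fun v => oint (fun u => phi u / (u - v)) a b c d) w.
Proof.
move=> /andP[w1 w2] /andP[w3 w4] cphi.
pose r := Num.min (Num.min (complex.Re w - a) (b - complex.Re w))
                  (Num.min (complex.Im w - c) (d - complex.Im w)).
have r0 : 0 < r by rewrite /r !lt_min; slra.
have rP : [/\ a + r <= complex.Re w, complex.Re w <= b - r, c + r <= complex.Im w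
    & complex.Im w <= d - r].
  have : r <= r by []. rewrite {2}/r !le_min => /andP[/andP[? ?] /andP[? ?]].
  by split; slra.
have far u : on_border a b c d u -> r <= nm (u - w).
  by case: rP => ? ? ? ? ub; apply: (border_far ub); apply/andP; split; slra.
have ab : a <= b by slra.
have cd : c <= d by slra.
have cR t : ccont (fun x : R => x%:C%C) t.
  by move=> e e0; exists e => // s; rewrite -rmorphB nmR.
have chx (y t : R) : ccont (fun x : R => Complex x y) t.
  by move=> e e0; exists e => // s; rewrite (_ : _ - _ = (s - t)%:C%C) ?nmR//;
    congr Complex; rewrite subrr.
have cvy (x t : R) : ccont (fun y : R => Complex x y) t.
  by move=> e e0; exists e => // s; rewrite (_ : _ - _ = Complex 0 (s - t)) ?nm_iR//;
    congr Complex; rewrite subrr.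
have b1 x : a <= x <= b -> on_border a b c d (Complex x c).
  by move=> xab; split; [split=> //=; rewrite lexx|constructor 3].
have b2 x : a <= x <= b -> on_border a b c d (Complex x d).
  by move=> xab; split; [split=> //=; rewrite lexx andbT|constructor 4].
have b3 x : c <= x <= d -> on_border a b c d (Complex a x).
  by move=> xab; split; [split=> //=; rewrite lexx|constructor 1].
have b4 x : c <= x <= d -> on_border a b c d (Complex b x).
  by move=> xab; split; [split=> //=; rewrite lexx andbT|constructor 2].
apply: cdiffB; [apply: cdiffB; [apply: cdiffD; last apply: cdiffZ|]|apply: cdiffZ].
- apply: (@cauchy_type_cdiff _ (fun x => phi (Complex x c)) (fun x => Complex x c) _ _ _ r) => //.
  + exact: border_h1 cphi.
  + by move=> x /b1; exact: far.
- apply: (@cauchy_type_cdiff _ (fun x => phi (Complex b x)) (fun x => Complex b x) _ _ _ r) => //.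
  + exact: border_v2 cphi.
  + by move=> x /b4; exact: far.
- apply: (@cauchy_type_cdiff _ (fun x => phi (Complex x d)) (fun x => Complex x d) _ _ _ r) => //.
  + exact: border_h2 cphi.
  + by move=> x /b2; exact: far.
- apply: (@cauchy_type_cdiff _ (fun x => phi (Complex a x)) (fun x => Complex a x) _ _ _ r) => //.
  + exact: border_v1 cphi.
  + by move=> x /b3; exact: far.
Qed.

Lemma holo1P f z : holo1 f z <->
  exists2 r : R, 0 < r & forall w, square z r w -> cdiff f w.
Proof.
split=> [/near_nm[e e0 eP]|[r r0 rP]].
  exists (e / 3) => [|w /square_nm wr]; first slra.
  by apply: eP; slra.
by apply/near_nm; exists r => // w /ltW /nm_square; exact: rP.
Qed.

Lemma holo1_nm f z : holo1 f z <->
  exists2 r : R, 0 < r & forall w, nm (w - z) < r -> cdiff f w.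
Proof. exact: near_nm. Qed.

Lemma sq_cauchy f z (r : R) w : (forall u, square z r u -> cdiff f u) ->
  nm (w - z) < r -> sq_oint (fun u => f u / (u - w)) z r = kappa * f w.
Proof.
move=> df wr; have := Re_nm (w - z); have := Im_nm (w - z); rewrite !raddfB/= => h1 h2.
have := le_lt_trans h1 wr; have := le_lt_trans h2 wr; rewrite !ltr_norml =>
  /andP[? ?] /andP[? ?].
by apply: cauchy_formula; [slra|slra|slra|slra|exact: df].
Qed.

Lemma sq_type_cdiff (phi : C -> C) z (r : R) w : nm (w - z) < r ->
  (forall u, square z r u -> czcont phi u) ->
  cdiff (fun v => sq_oint (fun u => phi u / (u - v)) z r) w.
Proof.
move=> wr cphi.
have := Re_nm (w - z); have := Im_nm (w - z); rewrite !raddfB/= => h1 h2.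
have := le_lt_trans h1 wr; have := le_lt_trans h2 wr; rewrite !ltr_norml =>
  /andP[? ?] /andP[? ?].
apply: oint_type_cdiff; try (apply/andP; split; slra).
by move=> u [ur _]; exact: cphi.
Qed.

Definition sq_border z (r : R) : C -> Prop :=
  on_border (complex.Re z - r) (complex.Re z + r) (complex.Im z - r) (complex.Im z + r).

Lemma sq_border_far z (r : R) u : sq_border z r u -> r <= nm (u - z).
Proof.
move=> ub; have := @square_border_far z r 0 u z ub.
by rewrite subrr nm0 subr0; apply.
Qed.

Lemma sq_oint_norm f z (r M : R) : 0 <= r ->
  (forall u, sq_border z r u -> czcont f u) ->
  (forall u, sq_border z r u -> nm (f u) <= M) ->
  nm (sq_oint f z r) <= 16 * M * r.
Proof.
move=> r0 cf fM.
apply: le_trans (@oint_norm _ f _ _ _ _ _ _ cf M fM) _; [slra|slra|].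
slra.
Qed.

Lemma sub_id_cdiff z w : cdiff (fun u => u - z) w.
Proof. by apply: cdiffB; [exact: cdiff_id | exact: cdiff_cst]. Qed.

(* The divided difference is again a Cauchy integral. *)
Lemma divided_difference f z : holo1 f z -> exists c : C,
  holo1 (fun w => if w == z then c else (f w - f z) / (w - z)) z.
Proof.
move=> /holo1P[r r0 df].
pose g w := kappa^-1 * sq_oint (fun u => (f u - f z) / (u - z) / (u - w)) z r.
have cphi u : square z r u -> u != z -> czcont (fun u => (f u - f z) / (u - z)) u.
  move=> ur uz; apply/cdiff_czcont/cdiffM; last exact: inv_cdiff.
  by apply: cdiffB; [exact: df | exact: cdiff_cst].
have neb u : on_border (complex.Re z - r)
    (complex.Re z + r) (complex.Im z - r) (complex.Im z + r) u -> u != z.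
  by move=> [_ ub]; apply/eqP => uz; subst u; case: ub; slra.
have dg w : nm (w - z) < r -> cdiff g w.
  move=> wr; apply: cdiffZ.
  have := Re_nm (w - z); have := Im_nm (w - z); rewrite !raddfB/= => h1 h2.
  have := le_lt_trans h1 wr; have := le_lt_trans h2 wr; rewrite !ltr_norml =>
    /andP[? ?] /andP[? ?].
  apply: oint_type_cdiff; try (apply/andP; split; slra).
  by move=> u ub; apply: cphi; [case: ub | exact: neb].
have gE w : nm (w - z) < r -> w != z -> g w = (f w - f z) / (w - z).
  move=> wr wz.
  have zr : nm (z - z) < r by rewrite subrr nm0.
  pose h u := f u - f z.
  have dh u : square z r u -> cdiff h u.
    by move=> ur; apply: cdiffB; [exact: df | exact: cdiff_cst].
  have ew := sq_cauchy dh wr; have ez := sq_cauchy dh zr.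
  have hz : h z = 0 by rewrite /h subrr.
  have neb' u : on_border (complex.Re z - r) (complex.Re z + r)
      (complex.Im z - r) (complex.Im z + r) u -> u != w.
    move=> ub; have far := @square_border_far z r _ u w ub (lexx _).
    by apply/eqP => uw; subst u; move: far; rewrite [w - w]subrr nm0; slra.
  (* Cauchy's formula for [h] is used at [w] and at [z], where [h] vanishes; the two kernels differ
     by (w - z) / ((u - z) (u - w)). *)
  have E : (w - z) * sq_oint (fun u => (f u - f z) / (u - z) / (u - w)) z r =
      kappa * h w.
    rewrite -ew -[RHS]subr0 -(mulr0 kappa) -hz -ez.
    have rr : complex.Re z - r <= complex.Re z + r by slra.
    have ii : complex.Im z - r <= complex.Im z + r by slra.
    rewrite /sq_oint -ointZ// -?ointB//.
    - apply: eq_oint => // u ub; rewrite /h; field.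
      by rewrite !subr_eq0 neb// neb'.
    - move=> u ub; apply/cdiff_czcont/cdiffM; first by apply: dh; case: ub.
      by apply: inv_cdiff; exact: neb'.
    - move=> u ub; apply/cdiff_czcont/cdiffM; first by apply: dh; case: ub.
      by apply: inv_cdiff; exact: neb.
    - move=> u ub; apply/cdiff_czcont/cdiffM; last by apply: inv_cdiff; exact: neb'.
      apply: cdiffM; first by apply: dh; case: ub.
      by apply: inv_cdiff; exact: neb.
  have wz0 : w - z != 0 by rewrite subr_eq0.
  apply: (mulfI wz0); rewrite /g mulrCA E mulrA mulVf ?kappa_neq0// mul1r.
  by rewrite mulrC divfK.
exists (g z); apply/holo1_nm; exists r => // w wr.
apply: (@cdiff_ext _ g); last exact: dg.
apply/near_nm; exists (r - nm (w - z)); first by rewrite subr_gt0.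
move=> v vw; have vr : nm (v - z) < r by have := nm_tri v z w; slra.
by case: eqVneq => [->//|vz]; exact: gE.
Qed.

(** A Lipschitz bound that depends on [f] only through [M], as equicontinuity requires. The 32 is
    the 4 of [oint_norm], times [4 * r] for the two side lengths, times the bound [2 / r ^+ 2] of
    the kernel. *)
Lemma cauchy_estimate f z (r M : R) w : 0 < r ->
  (forall u, square z r u -> cdiff f u) ->
  (forall u, square z r u -> nm (f u) <= M) -> nm (w - z) <= r / 2 ->
  nm (f w - f z) <= 32 / nm (kappa : C) * M / r * nm (w - z).
Proof.
move=> r0 df fM wr2.
have k0 : 0 < nm (kappa : C) by rewrite nm_gt0 kappa_neq0.
have wr : nm (w - z) < r by slra.
have zr : nm (z - z) < r by rewrite subrr nm0.
have M0 : 0 <= M by apply: le_trans (fM z _); [exact: nm_ge0|apply: nm_square; slra].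
have far u : on_border (complex.Re z - r) (complex.Re z + r)
      (complex.Im z - r) (complex.Im z + r) u -> r / 2 <= nm (u - w).
  by move=> ub; have := square_border_far ub wr2; slra.
have farz u : on_border (complex.Re z - r) (complex.Re z + r)
      (complex.Im z - r) (complex.Im z + r) u -> r <= nm (u - z).
  by move=> ub; have := @square_border_far z r 0 u z ub; rewrite subrr nm0 subr0; apply.
have neb u : on_border (complex.Re z - r) (complex.Re z + r)
      (complex.Im z - r) (complex.Im z + r) u -> u - w != 0.
  by move=> /far uw; rewrite -nm_gt0; slra.
have nebz u : on_border (complex.Re z - r) (complex.Re z + r)
      (complex.Im z - r) (complex.Im z + r) u -> u - z != 0.
  by move=> /farz uw; rewrite -nm_gt0; slra.
have rr : complex.Re z - r <= complex.Re z + r by slra.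
have ii : complex.Im z - r <= complex.Im z + r by slra.
have E : kappa * (f w - f z) = sq_oint (fun u => f u * ((w - z) / ((u - w) * (u - z)))) z r.
  rewrite mulrBr -(sq_cauchy df wr) -(sq_cauchy df zr) /sq_oint -ointB//.
  - by apply: eq_oint => // u ub; field; rewrite neb// nebz.
  - move=> u ub; apply/cdiff_czcont/cdiffM; first by apply: df; case: ub.
    by apply: inv_cdiff; rewrite -subr_eq0 neb.
  - move=> u ub; apply/cdiff_czcont/cdiffM; first by apply: df; case: ub.
    by apply: inv_cdiff; rewrite -subr_eq0 nebz.
have bnd u : on_border (complex.Re z - r) (complex.Re z + r)
      (complex.Im z - r) (complex.Im z + r) u ->
    nm (f u * ((w - z) / ((u - w) * (u - z)))) <= M * (nm (w - z) * (2 / r ^+ 2)).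
  move=> ub; rewrite nmM; apply: ler_pM; rewrite ?nm_ge0//; first by apply: fM; case: ub.
  rewrite nmM; apply: ler_wpM2l; first exact: nm_ge0.
  rewrite nmV nmM -[2 / _]invrK invf_div lef_pV2 ?posrE ?mulr_gt0 ?nm_gt0 ?neb ?nebz//.
  - rewrite (_ : r ^+ 2 / 2 = r / 2 * r); last by field.
    by apply: ler_pM; [slra|slra|exact: far|exact: farz].
have H : nm (kappa * (f w - f z)) <= 4 * (M * (nm (w - z) * (2 / r ^+ 2))) *
    ((complex.Re z + r - (complex.Re z - r)) + (complex.Im z + r - (complex.Im z - r))).
  rewrite E; apply: oint_norm => // u ub; apply/cdiff_czcont/cdiffM.
    by apply: df; case: ub.
  apply: cdiffZ; apply: cdiffV; last by rewrite mulf_neq0 ?neb ?nebz.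
  by apply: cdiffM; exact: sub_id_cdiff.
rewrite nmM mulrC -ler_pdivlMr// in H.
apply: le_trans H _; rewrite [X in X <= _](_ : _ = 32 / nm kappa * M / r * nm (w - z))//.
by field; rewrite !gt_eqF.
Qed.

Lemma czcontM f g z : czcont f z -> czcont g z -> czcont (fun w => f w * g w) z.
Proof.
move=> cf cg e e0; have := nm_ge0 (f z); have := nm_ge0 (g z) => g0 f0.
have e1 : 0 < Num.min 1 (e / (nm (f z) + nm (g z) + 2)).
  by rewrite lt_min ltr01/=; apply: divr_gt0; slra.
have [d d0 dP] := cf _ e1; have [d' d0' dP'] := cg _ e1.
exists (Num.min d d'); first by rewrite lt_min d0.
move=> y; rewrite lt_min => /andP[/dP h1 /dP' h2].
set r := Num.min _ _ in e1 h1 h2.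
have r1 : r <= 1 by rewrite ge_min lexx.
have re : r * (nm (f z) + nm (g z) + 2) <= e.
  by rewrite -ler_pdivlMr ?ge_min ?lexx ?orbT//; slra.
have -> : f y * g y - f z * g z = (f y - f z) * (g y - g z) +
  (f z * (g y - g z) + g z * (f y - f z)) by ring.
have b1 : nm ((f y - f z) * (g y - g z)) <= r * 1.
  rewrite nmM; apply: ler_pM; rewrite ?nm_ge0//; slra.
have b2 : nm (f z * (g y - g z)) <= r * nm (f z).
  by rewrite nmM mulrC; apply: ler_wpM2r => //; exact: ltW.
have b3 : nm (g z * (f y - f z)) <= r * nm (g z).
  by rewrite nmM mulrC; apply: ler_wpM2r => //; exact: ltW.
apply: le_lt_trans (nmD _ _) _; have := nmD (f z * (g y - g z)) (g z * (f y - f z)).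
move: re b1 b2 b3; rewrite !mulrDr !mulr1; slra.
Qed.

(** The limit is continuous and Cauchy's formula survives uniform limits; so near each point [f] is
    a Cauchy-type integral of a continuous density, hence differentiable. *)
Lemma uniform_limit f (A : C -> Prop) :
  (forall z, A z -> exists2 r : R, 0 < r & forall w, nm (w - z) < r -> A w) ->
  (forall e : R, 0 < e -> exists2 g, forall w, A w -> cdiff g w &
     forall w, A w -> nm (f w - g w) <= e) ->
  forall z, A z -> cdiff f z.
Proof.
move=> oA lim z Az.
have cf u : A u -> czcont f u.
  move=> Au e e0; have e4 : 0 < e / 4 by slra.
  have [g dg fg] := lim _ e4; have [r r0 rP] := oA _ Au.
  have [d d0 dP] := cdiff_cvg (dg _ Au) e4.
  exists (Num.min r d) => [|w]; first by rewrite lt_min r0.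
  rewrite lt_min => /andP[/rP Aw /dP wd].
  have -> : f w - f u = (f w - g w) + (g w - g u) - (f u - g u) by ring.
  have := fg _ Aw; have := fg _ Au.
  have := nmB ((f w - g w) + (g w - g u)) (f u - g u).
  by have := nmD (f w - g w) (g w - g u); slra.
have [r0 r00 r0P] := oA _ Az.
pose r := r0 / 3; have rp : 0 < r by rewrite /r; slra.
have sA u : square z r u -> A u.
  by move=> /square_nm ur; apply: r0P; rewrite /r in ur; slra.
have rr : complex.Re z - r <= complex.Re z + r by slra.
have ii : complex.Im z - r <= complex.Im z + r by slra.
have E w : nm (w - z) < r -> sq_oint (fun u => f u / (u - w)) z r = kappa * f w.
  move=> wr; have wr0 : 0 < r - nm (w - z) by slra.
  have k0 := nm_ge0 (kappa : C).
  have neb u : on_border (complex.Re z - r) (complex.Re z + r)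
      (complex.Im z - r) (complex.Im z + r) u -> r - nm (w - z) <= nm (u - w).
    by move=> ub; have := square_border_far ub (lexx _).
  have nez u : on_border (complex.Re z - r) (complex.Re z + r)
      (complex.Im z - r) (complex.Im z + r) u -> u != w.
    by move=> /neb uw; rewrite -subr_eq0 -nm_gt0; slra.
  apply/eqP; rewrite -subr_eq0 -nm_eq0 eq_le nm_ge0 andbT.
  apply/ler_addgt0Pl => e e0; rewrite addr0.
  pose K := 16 * r / (r - nm (w - z)) + nm (kappa : C).
  have K0 : 0 < K + 1.
    rewrite /K; have : 0 <= 16 * r / (r - nm (w - z)) by rewrite divr_ge0//; slra.
    slra.
  have eK : 0 < e / (K + 1) by rewrite divr_gt0.
  have [g dg fg] := lim _ eK.
  have dgs u : square z r u -> cdiff g u by move=> /sA; exact: dg.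
  have cwf u : on_border (complex.Re z - r) (complex.Re z + r)
      (complex.Im z - r) (complex.Im z + r) u -> czcont (fun u => f u / (u - w)) u.
    move=> ub; apply: czcontM; first by apply: cf; apply: sA; case: ub.
    by apply/cdiff_czcont/inv_cdiff; exact: nez.
  have cwg u : on_border (complex.Re z - r) (complex.Re z + r)
      (complex.Im z - r) (complex.Im z + r) u -> czcont (fun u => g u / (u - w)) u.
    move=> ub; apply/cdiff_czcont/cdiffM; first by apply: dgs; case: ub.
    by apply: inv_cdiff; exact: nez.
  rewrite (_ : _ - _ = (sq_oint (fun u => f u / (u - w)) z r -
     sq_oint (fun u => g u / (u - w)) z r) - kappa * (f w - g w)); last first.
    by rewrite (sq_cauchy dgs wr); ring.
  rewrite /sq_oint -ointB//.
  have Aw : A w by apply: r0P; rewrite /r in wr; slra.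
  have bnd u : on_border (complex.Re z - r) (complex.Re z + r)
      (complex.Im z - r) (complex.Im z + r) u ->
    nm (f u / (u - w) - g u / (u - w)) <= e / (K + 1) * (r - nm (w - z))^-1.
    move=> ub; rewrite -mulrBl nmM; apply: ler_pM; rewrite ?nm_ge0//.
      by apply: fg; apply: sA; case: ub.
    by rewrite nmV lef_pV2 ?posrE ?neb// nm_gt0 subr_eq0 nez.
  apply: le_trans (nmB _ _) _.
  apply: le_trans (lerD (oint_norm rr ii _ bnd) (_ : _ <= nm kappa * (e / (K + 1)))) _.
  - by move=> u ub; apply: czcontB; [exact: cwf | exact: cwg].
  - by rewrite nmM; apply: ler_wpM2l => //; exact: fg.
  set q := e / (K + 1).
  rewrite [X in X <= _](_ : _ = q * K); last by rewrite /K; field; rewrite gt_eqF.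
  rewrite /q.
  by rewrite mulrAC ler_pdivrMr// ler_wpM2l//; slra.
apply: (@cdiff_ext _ (fun w => kappa^-1 * sq_oint (fun u => f u / (u - w)) z r)).
  apply/near_nm; exists r => // w wr.
  by rewrite E// mulrA mulVf ?kappa_neq0// mul1r.
apply: cdiffZ; apply: sq_type_cdiff; first by rewrite subrr nm0.
by move=> u /sA; exact: cf.
Qed.

Lemma border_bounded f a b c d : a <= b -> c <= d -> border_cont f a b c d ->
  exists2 M : R, 0 < M & forall z, on_border a b c d z -> nm (f z) <= M.
Proof.
move=> ab cd cf.
have [M1 M10 M1P] := ccont_on_bounded (border_h1 cd cf).
have [M2 M20 M2P] := ccont_on_bounded (border_h2 cd cf).
have [M3 M30 M3P] := ccont_on_bounded (border_v1 ab cf).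
have [M4 M40 M4P] := ccont_on_bounded (border_v2 ab cf).
exists (M1 + M2 + M3 + M4) => [|[x y] [[/= xab ycd]]]; first slra.
case=> [xE|xE|yE|yE].
- have := M3P y ycd; rewrite -xE; slra.
- have := M4P y ycd; rewrite -xE; slra.
- have := M1P x xab; rewrite -yE; slra.
- have := M2P x xab; rewrite -yE; slra.
Qed.

Lemma exp_small (q e : R) : 0 <= q -> q <= 1 / 2 -> 0 < e -> exists n, q ^+ n < e.
Proof.
move=> q0 q2 e0; have [n nP] := halving_small 1 e0; exists n.
apply: le_lt_trans nP; rewrite div1r -exprVn.
by apply: lerXn2r; rewrite ?nnegrE//; slra.
Qed.

(* If [f] vanishes to every order at [z], then the Cauchy formula for
   [f u / (u - z) ^ k] bounds [f] by a multiple of [4 ^ -k]. *)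
Lemma factor_zero f z : holo1 f z ->
  (\forall w \near (z : C^o), f w = 0) \/
  exists k g, [/\ holo1 g z, g z != 0 & \forall w \near (z : C^o), f w = (w - z) ^+ k * g w].
Proof.
move=> hf; have [[k [g [h1 h2 h3]]]|nog] := pselect (exists k g,
  [/\ holo1 g z, g z != 0 & \forall w \near (z : C^o), f w = (w - z) ^+ k * g w]).
  by right; exists k, g.
left.
(* If the quotient by some power did not vanish at [z], it would be the excluded factorization;
   hence division by [w - z] can be repeated for ever. *)
have all_k k : exists2 g, holo1 g z & \forall w \near (z : C^o), f w = (w - z) ^+ k * g w.
  elim: k => [|k [g hg fg]].
    by exists f => //; near=> w; rewrite expr0 mul1r.
  have [gz|gz] := eqVneq (g z) 0; last by exfalso; apply: nog; exists k, g.
  have [c hc] := divided_difference hg.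
  eexists; first exact: hc.
  near=> w; rewrite /=.
  have -> : f w = (w - z) ^+ k * g w by near: w.
  case: eqVneq => [->|wz]; first by rewrite gz subrr exprS mul0r mulr0 mul0r.
  by rewrite gz subr0 exprSr -mulrA; congr (_ * _); rewrite mulrC divfK// subr_eq0.
move: hf => /holo1P[r r0 df].
have [M M0 fM] : exists2 M : R, 0 < M & forall u, sq_border z r u -> nm (f u) <= M.
  by apply: border_bounded; [slra|slra|move=> u [ur _]; exact/cdiff_czcont/df].
apply/near_nm; exists (r / 4) => [|w wr]; first slra.
have [->|wz] := eqVneq w z.
  have [g _ /nbhs_singleton] := all_k 1%N; by rewrite /= subrr expr1 mul0r.
apply/eqP; rewrite -nm_eq0 eq_le nm_ge0 andbT; apply/ler_addgt0Pl => e e0; rewrite addr0.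
have k0 : 0 < nm (kappa : C) by rewrite nm_gt0 kappa_neq0.
(* The bound 16 M r of a square integral with integrand at most (M / r^n) (2 / r), divided by the
   modulus of [kappa], is [K / r ^+ n]; on the disc of radius [r / 4] the factor (w - z)^n then
   leaves [K] times 4^-n. *)
pose K : R := 32 * M / nm (kappa : C).
have K0 : 0 < K by rewrite /K divr_gt0 ?mulr_gt0.
have [n nP] : exists n, (1 / 4 : R) ^+ n < e / K by apply: exp_small; rewrite ?divr_gt0//; slra.
have [g hg fg] := all_k n.
(* The quotient of [f] by the n-th power, completed at [z] by the repeated division so that it is
   differentiable on the whole square. *)
pose G u := if u == z then g z else f u / (u - z) ^+ n.
have dG u : square z r u -> cdiff G u.
  move=> ur; have [->|uz] := eqVneq u z.
    apply: (@cdiff_ext _ g); last exact: holo1W.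
    near=> v; rewrite /G; case: eqVneq => [->//|vz].
    have -> : f v = (v - z) ^+ n * g v by near: v.
    by rewrite mulrAC mulfV ?mul1r// expf_neq0// subr_eq0.
  apply: (@cdiff_ext _ (fun v => f v / (v - z) ^+ n)).
    apply/near_nm; exists (nm (u - z)); first by rewrite nm_gt0 subr_eq0.
    move=> v vu; rewrite /G; case: eqVneq => // vz.
    by move: vu; rewrite vz nm_distC ltxx.
  apply: cdiffM; first exact: df.
  apply: cdiffV; last by rewrite expf_neq0// subr_eq0.
  by apply: cdiffX; exact: sub_id_cdiff.
have wr' : nm (w - z) < r by slra.
have E := sq_cauchy dG wr'.
have bnd : nm (sq_oint (fun u => G u / (u - w)) z r) <= 16 * (M / r ^+ n * (2 / r)) * r.
  have far u : sq_border z r u -> r / 2 <= nm (u - w).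
    by move=> /sq_border_far ur; have := nm_tri u z w; slra.
  apply: sq_oint_norm; first slra.
    move=> u uz; apply/cdiff_czcont/cdiffM; first by apply: dG; case: uz.
    apply: inv_cdiff; rewrite -subr_eq0 -nm_gt0; have := far _ uz; slra.
  move=> u uz; have ur := sq_border_far uz.
  rewrite nmM; have uz0 : u != z by rewrite -subr_eq0 -nm_gt0; slra.
  rewrite /G (negPf uz0); apply: ler_pM; rewrite ?nm_ge0//.
    rewrite nmM; apply: ler_pM; rewrite ?nm_ge0//; first exact: fM.
    rewrite nmV nmX lef_pV2 ?posrE ?exprn_gt0 ?nm_gt0 ?subr_eq0//.
    by apply: lerXn2r; rewrite ?nnegrE ?nm_ge0//; slra.
  rewrite nmV -[2 / r]invrK invf_div lef_pV2 ?posrE; [exact: far| |slra].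
  by have := far _ uz; slra.
have fE : f w = (w - z) ^+ n * G w.
  by rewrite /G (negPf wz) mulrC divfK// expf_neq0// subr_eq0.
rewrite fE nmM nmX.
have GE : nm (G w) <= K / r ^+ n.
  rewrite E nmM in bnd.
  have -> : K / r ^+ n = (16 * (M / r ^+ n * (2 / r)) * r) / nm (kappa : C).
    by rewrite /K; field; rewrite expf_neq0 !gt_eqF.
  by rewrite ler_pdivlMr// mulrC.
have q0 : nm (w - z) ^+ n <= (1 / 4) ^+ n * r ^+ n.
  by rewrite -exprMn; apply: lerXn2r; rewrite ?nnegrE ?nm_ge0//; slra.
apply: le_trans (ler_pM _ _ q0 GE) _; rewrite ?exprn_ge0 ?nm_ge0//.
rewrite -mulrA [r ^+ n * _]mulrC divfK; last by rewrite expf_neq0// gt_eqF.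
by rewrite -ler_pdivlMr// ltW.
Unshelve. all: by end_near.
Qed.

(** Otherwise f - f(z) = (w - z)^k u with u(z) nonzero. In the direction of [zeta], a k-th root of
    f(z) / u(z), the value at distance parameter [t] is (1 + t^k) f(z) up to an error of half the
    gain, so the modulus exceeds that at [z]. When f(z) = 0 every direction does. *)
Lemma max_modulus_local f z : holo1 f z ->
  (\forall w \near (z : C^o), nm (f w) <= nm (f z)) ->
  \forall w \near (z : C^o), f w = f z.
Proof.
move=> hf fmax.
have hg : holo1 (fun w => f w - f z) z.
  by near=> w; apply: cdiffB; [near: w; exact: hf | exact: cdiff_cst].
have [|[k [u [hu uz fu]]]] := factor_zero hg.
  by move=> h; near=> w; apply/eqP; rewrite -subr_eq0; apply/eqP; near: w.
exfalso.
have k0 : (0 < k)%N.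
  case: k fu => // /nbhs_singleton; rewrite /= subrr expr0 mul1r => h.
  by rewrite -h eqxx in uz.
pose zeta := k.-root (f z / u z).
have zk : zeta ^+ k * u z = f z by rewrite rootCK// divfK.
have [/near_nm[d1 d10 d1P] /near_nm[d2 d20 d2P]] := (fu, fmax).
have [fz|fz] := eqVneq (f z) 0.
  have /near_nm[d3 d30 d3P] := cdiff_neq0 (holo1W hu) uz.
  pose t : R := Num.min d1 (Num.min d2 d3) / 2.
  have t0 : 0 < t by rewrite divr_gt0// !lt_min d10 d20.
  have [t1 t2 t3] : [/\ t < d1, t < d2 & t < d3].
    have : t * 2 <= Num.min d1 (Num.min d2 d3) by rewrite divfK.
    by rewrite !le_min => /and3P[? ? ?]; split; slra.
  pose w : C := z + t%:C%C.
  have wt : nm (w - z) = t by rewrite /w addrC addKr nmR gtr0_norm.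
  have := d2P w; rewrite wt fz nm0 => /(_ t2).
  have := d1P w; rewrite wt fz subr0 => /(_ t1) ->.
  have := d3P w; rewrite wt => /(_ t3) uw.
  rewrite nmM nmX wt leNgt mulr_gt0 ?exprn_gt0// nm_gt0//.
have z0 : 0 < nm zeta.
  by rewrite nm_gt0; apply: contra fz => /eqP zz; rewrite -zk zz expr0n gtn_eqF// mul0r.
have fz0 : 0 < nm (f z) by rewrite nm_gt0.
have e0 : 0 < nm (f z) / (2 * nm zeta ^+ k) by rewrite divr_gt0// mulr_gt0// exprn_gt0.
have [d3 d30 d3P] := cdiff_cvg (holo1W hu) e0.
pose t : R := Num.min d1 (Num.min d2 d3) / (2 * nm zeta).
have t0 : 0 < t by rewrite divr_gt0// ?mulr_gt0// !lt_min d10 d20.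
have [t1 t2 t3] : [/\ t * nm zeta < d1, t * nm zeta < d2 & t * nm zeta < d3].
  have : t * nm zeta * 2 <= Num.min d1 (Num.min d2 d3).
    by rewrite -mulrA [_ * 2]mulrC divfK// gt_eqF// mulr_gt0.
  have := mulr_gt0 t0 z0.
  by rewrite !le_min => h /and3P[? ? ?]; split; slra.
pose w : C := z + t%:C%C * zeta.
have wt : nm (w - z) = t * nm zeta by rewrite /w addrC addKr nmM nmR gtr0_norm.
have := d2P w; rewrite wt => /(_ t2); apply/negP; rewrite -ltNge.
have := d1P w; rewrite wt => /(_ t1) fw.
have := d3P w; rewrite wt => /(_ t3) uw.
have T0 : 0 < t ^+ k by rewrite exprn_gt0.
have -> : f w = (1 + t%:C%C ^+ k) * f z + (t%:C%C ^+ k * zeta ^+ k) * (u w - u z).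
  rewrite mulrBr -[_ * _ * u z]mulrA zk mulrDl mul1r addrA addrAC addrK.
  rewrite -exprMn (_ : t%:C%C * zeta = w - z); last by rewrite /w addrC addKr.
  by rewrite -fw addrC subrK.
set A := (1 + _) * _; set B := _ * (_ - _).
have nA : nm A = (1 + t ^+ k) * nm (f z).
  rewrite /A nmM; congr (_ * _).
  rewrite (_ : 1 + _ = (1 + t ^+ k)%:C%C); last by rewrite rmorphD rmorph1 rmorphXn.
  by rewrite nmR ger0_norm//; slra.
have nB : nm B <= t ^+ k * (nm (f z) / 2).
  rewrite /B !nmM !nmX nmR gtr0_norm// -mulrA; apply: ler_wpM2l; first exact: ltW.
  have zk0 : 0 < nm zeta ^+ k by rewrite exprn_gt0.
  rewrite mulrC -ler_pdivlMr// -mulrA -invfM; exact: ltW.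
have := nmB (A + B) B; rewrite addrK nA => h.
have : 0 < t ^+ k * nm (f z) by rewrite mulr_gt0.
move: nB h; rewrite mulrDl mul1r mulrA => nB h p0; slra.
Unshelve. all: by end_near.
Qed.

End LocalTheory.

Opaque nm cint cdiff kappa.

(** * Additive Cousin problem on a rectangle *)

Section PlanarSplitting.
Context {R : realType} {I : Type}.
Local Notation C := R[i].
Implicit Types (a b c d : R) (z w u : C) (A : I -> C -> Prop).

Definition enlarged a b c d (e : R) z : Prop :=
  a - e < complex.Re z < b + e /\ c - e < complex.Im z < d + e.

Definition planar_cocycle A (f : I -> I -> C -> C) (m : R) : Prop :=
  (forall i j z, A i z -> A j z -> cdiff (f i j) z /\ nm (f i j z) <= m) /\
  (forall i j k z, A i z -> A j z -> A k z -> f i j z + f j k z = f i k z).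

(** The solution lives on an enlarged rectangle, so that neighbouring rectangles overlap, and [e],
    [K] depend on the cover alone: the splitting is bounded uniformly in the cocycle. *)
Definition splits A a b c d : Prop := exists e K : R, [/\ 0 < e, 0 <= K,
  forall z, enlarged a b c d e z -> exists i, A i z &
  forall f m, 0 <= m -> planar_cocycle A f m -> exists g : I -> C -> C,
    (forall i z, enlarged a b c d e z -> A i z ->
       cdiff (g i) z /\ nm (g i z) <= K * m) /\
    (forall i j z, enlarged a b c d e z -> A i z -> A j z ->
       g i z - g j z = f i j z)].

Lemma enlarged_open a b c d (e : R) z : enlarged a b c d e z ->
  \forall w \near (z : C^o), enlarged a b c d e w.
Proof.
move=> [/andP[h1 h2] /andP[h3 h4]]; apply/near_nm.
exists (Num.min (Num.min (complex.Re z - (a - e)) (b + e - complex.Re z))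
  (Num.min (complex.Im z - (c - e)) (d + e - complex.Im z))).
  by rewrite !lt_min; slra.
move=> w; rewrite !lt_min => /andP[/andP[k1 k2] /andP[k3 k4]].
have := Re_nm (w - z); have := Im_nm (w - z).
rewrite !raddfB/= !ler_norml => /andP[m1 m2] /andP[m3 m4].
by clear -k1 k2 k3 k4 m1 m2 m3 m4; split; apply/andP; split; lra.
Qed.

Lemma splits_scale A (k k' : C) a b c d a' b' c' d' : k * k' = 1 ->
  (forall (e : R) z, enlarged a' b' c' d' e z -> enlarged a b c d e (k * z)) ->
  splits A a b c d -> splits (fun i z => A i (k * z)) a' b' c' d'.
Proof.
move=> kk enl [e [K [e0 K0 cov sol]]]; exists e, K; split=> //.
  by move=> z /enl/cov.
move=> f m m0 [f1 f2].
have cm (l : C) z : cdiff (fun u => l * u) z by apply: cdiffZ; exact: cdiff_id.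
have kz z : k * (k' * z) = z by rewrite mulrA kk mul1r.
have kz' z : k' * (k * z) = z by rewrite mulrA [k' * k]mulrC kk mul1r.
have [|g [g1 g2]] := sol (fun i j z => f i j (k' * z)) m m0.
  split=> [i j z Ai Aj|i j l z Ai Aj Al].
    have [|| df fm] := f1 i j (k' * z).
    - by rewrite kz.
    - by rewrite kz.
    - split; last exact: fm.
      exact: (@cdiff_comp _ (fun u => k' * u) (f i j) z (cm _ _) df).
  by apply: f2; rewrite kz.
exists (fun i z => g i (k * z)); split=> [i z /enl ze Ai|i j z /enl ze Ai Aj].
  have [dg gm] := g1 _ _ ze Ai; split; last exact: gm.
  exact: (@cdiff_comp _ (fun u => k * u) (g i) z (cm _ _) dg).
by rewrite g2 ?kz'.
Qed.

(** A quarter turn exchanges horizontal and vertical cuts, so merging across a vertical edge is the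
    only case to treat. *)
Lemma splits_rot A a b c d : splits A a b c d ->
  splits (fun i z => A i (- 'i%C * z)) (- d) (- c) a b.
Proof.
apply: (@splits_scale _ _ 'i%C); first by rewrite mulNr -expr2 sqr_i opprK.
move=> e [x y] [/= /andP[h1 h2] /andP[h3 h4]].
by split; apply/andP; split; rewrite /= ?oppr0 ?mul0r ?mulN1r ?sub0r ?add0r ?opprK; slra.
Qed.

Lemma hpath_type_cdiff (phi : C -> C) y a b (r : R) z : a <= b -> 0 < r ->
  (forall x, a <= x <= b -> czcont phi (Complex x y)) ->
  (forall x, a <= x <= b -> r <= nm (Complex x y - z)) ->
  cdiff (fun v => hpath (fun u => phi u / (u - v)) y a b) z.
Proof.
move=> ab r0 cphi far.
apply: (@cauchy_type_cdiff _ (fun x => phi (Complex x y)) (fun x => Complex x y) _ _ _ r) => //.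
  by move=> x xab; apply: czcont_h; exact: cphi.
by move=> x xab; apply: (@czcont_h _ id); apply/cdiff_czcont/cdiff_id.
Qed.

Lemma vpath_type_cdiff (phi : C -> C) x a b (r : R) z : a <= b -> 0 < r ->
  (forall y, a <= y <= b -> czcont phi (Complex x y)) ->
  (forall y, a <= y <= b -> r <= nm (Complex x y - z)) ->
  cdiff (fun v => vpath (fun u => phi u / (u - v)) x a b) z.
Proof.
move=> ab r0 cphi far.
apply: (@cauchy_type_cdiff _ (fun y => phi (Complex x y)) (fun y => Complex x y) _ _ _ r) => //.
  by move=> y xab; apply: czcont_v; exact: cphi.
by move=> y xab; apply: (@czcont_v _ id); apply/cdiff_czcont/cdiff_id.
Qed.

Lemma quot_czcont (phi : C -> C) u (r : R) z : 0 < r -> r <= nm (u - z) ->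
  czcont phi u -> czcont (fun u => phi u / (u - z)) u.
Proof.
move=> r0 far cphi; apply: czcontM => //; apply/cdiff_czcont/inv_cdiff.
by rewrite -subr_eq0 -nm_gt0; exact: lt_le_trans far.
Qed.

Lemma hpath_type_norm (phi : C -> C) y a b (r M : R) z : a <= b -> 0 < r ->
  (forall x, a <= x <= b -> czcont phi (Complex x y)) ->
  (forall x, a <= x <= b -> nm (phi (Complex x y)) <= M) ->
  (forall x, a <= x <= b -> r <= nm (Complex x y - z)) ->
  nm (hpath (fun u => phi u / (u - z)) y a b) <= 2 * (M / r) * (b - a).
Proof.
move=> ab r0 cphi phiM far; apply: cint_norm => // x xab.
  apply: (@czcont_h _ (fun u => phi u / (u - z))); apply: (@quot_czcont _ _ r) => //.
    exact: far.
  exact: cphi.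
rewrite nmM; apply: ler_pM; rewrite ?nm_ge0//; first exact: phiM.
by rewrite nmV lef_pV2 ?posrE//; [exact: far | apply: lt_le_trans (far _ xab)].
Qed.

Lemma vpath_type_norm (phi : C -> C) x a b (r M : R) z : a <= b -> 0 < r ->
  (forall y, a <= y <= b -> czcont phi (Complex x y)) ->
  (forall y, a <= y <= b -> nm (phi (Complex x y)) <= M) ->
  (forall y, a <= y <= b -> r <= nm (Complex x y - z)) ->
  nm (vpath (fun u => phi u / (u - z)) x a b) <= 2 * (M / r) * (b - a).
Proof.
move=> ab r0 cphi phiM far; apply: cint_norm => // y yab.
  apply: (@czcont_v _ (fun u => phi u / (u - z))); apply: (@quot_czcont _ _ r) => //.
    exact: far.
  exact: cphi.
rewrite nmM; apply: ler_pM; rewrite ?nm_ge0//; first exact: phiM.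
by rewrite nmV lef_pV2 ?posrE//; [exact: far | apply: lt_le_trans (far _ yab)].
Qed.

Lemma nm_ge_Re (r x y : R) z : r <= `|x - complex.Re z| -> r <= nm (Complex x y - z).
Proof.
by move=> h; have := Re_nm (Complex x y - z); rewrite raddfB/=; exact: le_trans h.
Qed.

Lemma nm_ge_Im (r x y : R) z : r <= `|y - complex.Im z| -> r <= nm (Complex x y - z).
Proof.
by move=> h; have := Im_nm (Complex x y - z); rewrite raddfB/=; exact: le_trans h.
Qed.

(* Additive Cousin splitting across a vertical edge: the Cauchy integral of [f]
   over the boundary of a neighbourhood of the edge is cut in two. *)
Lemma strip_splitting (s m c d : R) : 0 < s -> c <= d -> exists2 K : R, 0 <= K &
  forall (f : C -> C) (M : R), 0 <= M ->
   (forall z, m - s <= complex.Re z <= m + s -> c - s <= complex.Im z <= d + s ->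
      cdiff f z /\ nm (f z) <= M) ->
   exists f1 f2 : C -> C,
   [/\ forall z, complex.Re z < m + s / 2 -> c - s / 2 < complex.Im z < d + s / 2 ->
         cdiff f1 z /\ nm (f1 z) <= K * M,
       forall z, m - s / 2 < complex.Re z -> c - s / 2 < complex.Im z < d + s / 2 ->
         cdiff f2 z /\ nm (f2 z) <= K * M
     & forall z, m - s / 2 < complex.Re z < m + s / 2 ->
         c - s / 2 < complex.Im z < d + s / 2 -> f z = f1 z - f2 z].
Proof.
move=> s0 cd.
have k0 : 0 < nm (kappa : C) by rewrite nm_gt0 kappa_neq0.
pose L : R := 8 * (s + s) + 4 * (d + s - (c - s)).
have L0 : 0 <= L by rewrite /L; slra.
exists ((nm (kappa : C))^-1 * (L / s)); first by rewrite mulr_ge0 ?invr_ge0 ?divr_ge0//; exact: ltW.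
move=> f M M0 fP.
have h1 : m - s <= m + s by slra.
have h2 : c - s <= d + s by slra.
have s2 : 0 < s / 2 by slra.
have c1 y x : c - s <= y <= d + s -> m - s <= x <= m + s -> czcont f (Complex x y).
  by move=> ym xm; apply/cdiff_czcont; apply: (fP _ _ _).1.
have b1 y x : c - s <= y <= d + s -> m - s <= x <= m + s -> nm (f (Complex x y)) <= M.
  by move=> ym xm; apply: (fP _ _ _).2.
pose b z := hpath (fun u => f u / (u - z)) (c - s) (m - s) (m + s).
pose t z := hpath (fun u => f u / (u - z)) (d + s) (m - s) (m + s).
pose r z := vpath (fun u => f u / (u - z)) (m + s) (c - s) (d + s).
pose l z := vpath (fun u => f u / (u - z)) (m - s) (c - s) (d + s).
have bP z : c - s / 2 < complex.Im z < d + s / 2 ->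
    cdiff b z /\ nm (b z) <= 2 * (M / (s / 2)) * (m + s - (m - s)).
  move=> /andP[z1 z2].
  have far x : m - s <= x <= m + s -> s / 2 <= nm (Complex x (c - s) - z).
    by move=> _; apply: nm_ge_Im; rewrite ler0_norm; slra.
  split; first by apply: (hpath_type_cdiff h1 s2) => // x; apply: c1; rewrite lexx.
  by apply: (hpath_type_norm h1 s2) => // x; [apply: c1|apply: b1]; rewrite lexx.
have tP z : c - s / 2 < complex.Im z < d + s / 2 ->
    cdiff t z /\ nm (t z) <= 2 * (M / (s / 2)) * (m + s - (m - s)).
  move=> /andP[z1 z2].
  have far x : m - s <= x <= m + s -> s / 2 <= nm (Complex x (d + s) - z).
    by move=> _; apply: nm_ge_Im; rewrite ger0_norm; slra.
  split; first by apply: (hpath_type_cdiff h1 s2) => // x; apply: c1; rewrite lexx andbT.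
  by apply: (hpath_type_norm h1 s2) => // x; [apply: c1|apply: b1]; rewrite lexx andbT.
have rP z : complex.Re z < m + s / 2 ->
    cdiff r z /\ nm (r z) <= 2 * (M / (s / 2)) * (d + s - (c - s)).
  move=> z1.
  have far y : c - s <= y <= d + s -> s / 2 <= nm (Complex (m + s) y - z).
    by move=> _; apply: nm_ge_Re; rewrite ger0_norm; slra.
  split; first by apply: (vpath_type_cdiff h2 s2) => // x xx; apply: c1; rewrite ?lexx ?andbT.
  by apply: (vpath_type_norm h2 s2) => // x xx; [apply: c1|apply: b1]; rewrite ?lexx ?andbT.
have lP z : m - s / 2 < complex.Re z ->
    cdiff l z /\ nm (l z) <= 2 * (M / (s / 2)) * (d + s - (c - s)).
  move=> z1.
  have far y : c - s <= y <= d + s -> s / 2 <= nm (Complex (m - s) y - z).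
    by move=> _; apply: nm_ge_Re; rewrite ler0_norm; slra.
  split; first by apply: (vpath_type_cdiff h2 s2) => // x xx; apply: c1; rewrite ?lexx ?andbT.
  by apply: (vpath_type_norm h2 s2) => // x xx; [apply: c1|apply: b1]; rewrite ?lexx ?andbT.
have LE : L / s * M = 2 * (M / (s / 2)) * (m + s - (m - s)) +
    2 * (M / (s / 2)) * (d + s - (c - s)) + 2 * (M / (s / 2)) * (m + s - (m - s)).
  by rewrite /L; field; rewrite gt_eqF.
have p1 : 0 <= 2 * (M / (s / 2)) * (m + s - (m - s)).
  apply: mulr_ge0; last slra.
  by rewrite mulr_ge0// divr_ge0// ltW.
(* The first part takes the bottom, right and top sides and is holomorphic left of the right side;
   the second takes the left side. Their difference is Cauchy's formula. *)
exists (fun z => kappa^-1 * (b z + 'i%C * r z - t z)), (fun z => kappa^-1 * ('i%C * l z)).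
split=> z.
- move=> z1 z2; have [db nb] := bP _ z2; have [dt nt] := tP _ z2; have [dr nr] := rP _ z1.
  split; first exact: cdiffZ (cdiffB (cdiffD db (cdiffZ _ dr)) dt).
  rewrite nmM nmV -mulrA; apply: ler_wpM2l; first by rewrite invr_ge0 ltW.
  rewrite LE; apply: le_trans (nmB _ _) _; apply: lerD => //.
  by apply: le_trans (nmD _ _) _; apply: lerD => //; rewrite nmM nm_i mul1r.
- move=> z1 z2; have [dl nl] := lP _ z1.
  split; first exact: cdiffZ (cdiffZ _ dl).
  rewrite nmM nmV -mulrA; apply: ler_wpM2l; first by rewrite invr_ge0 ltW.
  by rewrite nmM nm_i mul1r LE; slra.
- move=> /andP[z1 z2] /andP[z3 z4].
  have := @cauchy_formula _ f (m - s) (m + s) (c - s) (d + s) z.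
  move=> /(_ ltac:(slra) ltac:(slra) ltac:(slra) ltac:(slra)) H.
  have {}H : b z + 'i%C * r z - t z - 'i%C * l z = kappa * f z.
    by apply: H => w [wr wi]; apply: (fP _ _ _).1.
  by rewrite -mulrBr H mulrA mulVf ?mul1r// kappa_neq0.
Qed.

(** Near the common edge [g1 i - g2 i] does not depend on [i], since both families split the same
    cocycle. [strip_splitting] writes this function as [f1 - f2], and then [g1 i - f1] and
    [g2 i - f2] agree there and glue. *)
Lemma splits_merge A a m b c d : (forall i z, A i z -> \forall w \near (z : C^o), A i w) ->
  a < m -> m < b -> c < d -> splits A a m c d -> splits A m b c d -> splits A a b c d.
Proof.
move=> oA am mb cd [e1 [K1 [e10 K10 cov1 sol1]]] [e2 [K2 [e20 K20 cov2 sol2]]].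
pose s := Num.min e1 e2 / 2.
have s0 : 0 < s by rewrite divr_gt0// lt_min e10.
have [s1 s2] : s < e1 /\ s < e2.
  have : s * 2 <= Num.min e1 e2 by rewrite divfK.
  by rewrite le_min => /andP[? ?]; split; slra.
have [K K0 KP] := @strip_splitting s m c d s0 (ltW cd).
exists (s / 2), (K1 + K2 + K * (K1 + K2)); split.
- by slra.
- by rewrite addr_ge0 ?mulr_ge0// addr_ge0.
- move=> z [/andP[h1 h2] h3]; have [zm|zm] := ltP (complex.Re z) m.
    by apply: cov1; split; apply/andP; split; slra.
  by apply: cov2; split; apply/andP; split; slra.
move=> f M M0 fc.
have [g1 [g1P g1E]] := sol1 f M M0 fc; have [g2 [g2P g2E]] := sol2 f M M0 fc.
pose pick z : C := if pselect (exists i, A i z) is left p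
  then g1 (projT1 (cid p)) z - g2 (projT1 (cid p)) z else 0.
have pickE i z : enlarged a m c d e1 z -> enlarged m b c d e2 z -> A i z ->
    pick z = g1 i z - g2 i z.
  move=> z1 z2 Ai; rewrite /pick; case: pselect => [p|np]; last by exfalso; apply: np; exists i.
  case: cid => j /= Aj; apply/eqP; rewrite -subr_eq0.
  rewrite (_ : _ - _ = (g1 j z - g1 i z) - (g2 j z - g2 i z)); last by ring.
  by rewrite g1E// g2E// subrr.
have strip z : m - s <= complex.Re z <= m + s -> c - s <= complex.Im z <= d + s ->
    enlarged a m c d e1 z /\ enlarged m b c d e2 z.
  move=> /andP[q1 q2] /andP[q3 q4].
  by clear -q1 q2 q3 q4 s0 s1 s2 am mb; split; split; apply/andP; split; lra.
have [||f1 [f2 [f1P f2P f12]]] := KP pick ((K1 + K2) * M).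
- by rewrite mulr_ge0// addr_ge0.
- move=> z zr zi; have [z1 z2] := strip _ zr zi.
  have [i Ai] := cov1 _ z1.
  have [d1 n1] := g1P _ _ z1 Ai; have [d2 n2] := g2P _ _ z2 Ai.
  split; last first.
    rewrite (pickE i)//; apply: le_trans (nmB _ _) _.
    by rewrite mulrDl; apply: lerD.
  apply: (@cdiff_ext _ (fun w => g1 i w - g2 i w)); last exact: cdiffB.
  near=> w; rewrite (pickE i)//; near: w; try exact: enlarged_open.
  exact: oA.
exists (fun i z => if complex.Re z < m then g1 i z - f1 z else g2 i z - f2 z).
have KM : 0 <= K1 * M by rewrite mulr_ge0.
have KM2 : 0 <= K2 * M by rewrite mulr_ge0.
have KE : (K1 + K2 + K * (K1 + K2)) * M = K1 * M + K2 * M + K * ((K1 + K2) * M) by ring.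
split=> [i z [/andP[h1 h2] /andP[h3 h4]] Ai|i j z [/andP[h1 h2] /andP[h3 h4]] Ai Aj].
  have zi : c - s / 2 < complex.Im z < d + s / 2 by apply/andP.
  have [zm|zm] := ltP (complex.Re z) m.
    have z1 : enlarged a m c d e1 z.
      by clear -h1 h2 h3 h4 zm s0 s1 e10; split; apply/andP; split; lra.
    have [dg ng] := g1P _ _ z1 Ai; have [df nf] := f1P z ltac:(slra) zi.
    split; last by rewrite KE; apply: le_trans (nmB _ _) _; slra.
    apply: (@cdiff_ext _ (fun w => g1 i w - f1 w)); last exact: cdiffB.
    apply/near_nm; exists (m - complex.Re z); first by slra.
    move=> w wz; have := Re_nm (w - z); rewrite raddfB/= => wz'.
    have := ler_norm (complex.Re w - complex.Re z) => wz''.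
    by have -> : complex.Re w < m by slra.
  have z2 : enlarged m b c d e2 z.
    by clear -h1 h2 h3 h4 zm s0 s2 e20; split; apply/andP; split; lra.
  have [dg ng] := g2P _ _ z2 Ai; have [df nf] := f2P z ltac:(slra) zi.
  split; last by rewrite KE; apply: le_trans (nmB _ _) _; slra.
  apply: (@cdiff_ext _ (fun w => g2 i w - f2 w)); last exact: cdiffB.
  have oAz := oA _ _ Ai.
  have ez : enlarged m b c d (s / 2) z.
    by clear -h1 h2 h3 h4 zm s0; split; apply/andP; split; lra.
  near=> w; case: ifPn => // wm.
  have Aw : A i w by near: w; exact: oA.
  have [/andP[w1 w2] wi] : enlarged m b c d (s / 2) w.
    by near: w; exact: enlarged_open.
  have wr : m - s / 2 < complex.Re w < m + s / 2.
    by rewrite w1 /=; clear -wm s0; lra.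
  have [k1 k2] : enlarged a m c d e1 w /\ enlarged m b c d e2 w.
    move/andP: wi wr => [q1 q2] /andP[q3 q4]; apply: strip; apply/andP;
      by clear -q1 q2 q3 q4 s0; split; lra.
  have := f12 w wr wi; rewrite (pickE i)// => E.
  apply/eqP; rewrite -subr_eq0.
  have -> : g2 i w - f2 w - (g1 i w - f1 w) = (f1 w - f2 w) - (g1 i w - g2 i w) by ring.
  by rewrite E subrr.
case: ifPn => [zm|zm].
  have -> : g1 i z - f1 z - (g1 j z - f1 z) = g1 i z - g1 j z by ring.
  apply: g1E => //; clear -h1 h2 h3 h4 zm s0 s1 e10.
  by split; apply/andP; split; lra.
have -> : g2 i z - f2 z - (g2 j z - f2 z) = g2 i z - g2 j z by ring.
apply: g2E => //.
rewrite -leNgt in zm; clear -h1 h2 h3 h4 zm s0 s2 e20.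
by split; apply/andP; split; lra.
Unshelve. all: by end_near.
Qed.

Theorem planar_splitting A a b c d :
  (forall i z, A i z -> \forall w \near (z : C^o), A i w) -> a < b -> c < d ->
  (forall z, in_rect a b c d z -> exists i, A i z) -> splits A a b c d.
Proof.
move=> oA ab cd cov.
apply: (@rect_bisect _ (splits A)) => //.
- by move=> a' m b' c' d' _ h1 h2 _ _ h3 _; exact: splits_merge.
- move=> a' b' c' m d' _ h1 _ _ h2 h3 _ /splits_rot s1 /splits_rot s2.
  have oA' i z : A i (- 'i%C * z) -> \forall w \near (z : C^o), A i (- 'i%C * w).
    move=> /oA Aw; apply: (@cdiff_near _ (fun u => - 'i%C * u) z (A i)) Aw.
    by apply: cdiffZ; exact: cdiff_id.
  have := @splits_merge _ (-d') (-m) (-c') a' b' oA' ltac:(slra) ltac:(slra) h1 s2 s1.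
  (* Three more quarter turns complete the full turn. *)
  move=> /splits_rot/splits_rot/splits_rot.
  rewrite !opprK (_ : (fun i z => _) = A)//.
  apply/funext => i; apply/funext => z; congr (A i _).
  have i2 : - 'i%C * (- 'i%C * z) = - z by rewrite mulrA mulrNN -expr2 sqr_i mulN1r.
  by rewrite i2 !mulrA mulrNN -expr2 sqr_i mulrN mulN1r opprK.
- move=> x y xab ycd; have [i Ai] : exists i, A i (Complex x y) by apply: cov.
  have /near_nm[r r0 rP] := oA _ _ Ai.
  exists (r / 4); first slra.
  move=> a' b' c' d' _ /andP[h1 h2] _ _ /andP[h3 h4] _ _ _ h5 h6 _.
  have inA z : enlarged a' b' c' d' (r / 4) z -> A i z.
    move=> [/andP[k1 k2] /andP[k3 k4]]; apply: rP.
    apply: le_lt_trans (nm_ReIm _) _; rewrite !raddfB/=.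
    have : `|complex.Re z - x| < r / 2 by rewrite ltr_norml; apply/andP; split; slra.
    have : `|complex.Im z - y| < r / 2 by rewrite ltr_norml; apply/andP; split; slra.
    slra.
  exists (r / 4), 1; split=> // [|z /inA|f m m0 [f1 f2]]; first slra.
    by exists i.
  (* On a rectangle inside one member [A i] of the cover the cocycle relation itself is a
     splitting. *)
  exists (fun j => f j i); split=> [j z /inA zi Aj|j k z /inA zi Aj Ak].
    by rewrite mul1r; exact: f1.
  by rewrite -(f2 j k i)// addrK.
Qed.

End PlanarSplitting.

(** * Charts and germs *)

Section HolAlgebra.
Context {R : realType} {Y : cspace R}.
Local Notation C := R[i].
Implicit Types (y : Y) (f g : Y -> C).

Lemma coord_cdiff N (v : affine N) (i : 'I_N.+1) :
  differentiable (fun v : affine N => v 0 i : C^o) v.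
Proof. exact: differentiable_coord. Qed.

Lemma hol_ext y f g : hol y f -> (\forall y' \near y, f y' = g y') -> hol y g.
Proof.
move=> hf fg.
apply: (@hol_comp _ Y y 0%N (fun=> f) (fun v : 'rV[C]_1 => v 0 0 : C^o) g).
- by move=> _.
- by near=> v; exact: coord_cdiff.
- by apply: filterS fg => y' ->; rewrite mxE.
Unshelve. all: by end_near.
Qed.

Lemma hol_comp2 y f g (F : C -> C -> C) :
  (forall v : affine 1, differentiable (fun v : affine 1 => F (v 0 0) (v 0 1) : C^o) v) ->
  hol y f -> hol y g -> hol y (fun y' => F (f y') (g y')).
Proof.
move=> dF hf hg.
apply: (@hol_comp _ Y y 1%N (fun i => if i == 0 then f else g)
  (fun v : 'rV[C]_2 => F (v 0 0) (v 0 1) : C^o)).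
- by move=> i; case: ifP.
- by near=> v; exact: dF.
- by near=> y'; rewrite !mxE.
Unshelve. all: by end_near.
Qed.

Lemma holD y f g : hol y f -> hol y g -> hol y (fun y' => f y' + g y').
Proof.
apply: (@hol_comp2 y f g (fun a b => a + b)) => v.
by apply: differentiableD; exact: coord_cdiff.
Qed.

Lemma holM y f g : hol y f -> hol y g -> hol y (fun y' => f y' * g y').
Proof.
apply: (@hol_comp2 y f g (fun a b => a * b)) => v.
by apply: (@differentiableM _ (affine 1)); exact: coord_cdiff.
Qed.

Lemma holN y f : hol y f -> hol y (fun y' => - f y').
Proof.
move=> hf; apply: (@hol_ext y (fun y' => (-1) * f y')).
  exact: holM (hol_cst y _) hf.
by near=> y'; rewrite mulN1r.
Unshelve. all: by end_near.
Qed.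

Lemma holB y f g : hol y f -> hol y g -> hol y (fun y' => f y' - g y').
Proof. by move=> hf hg; exact: holD hf (holN hg). Qed.

Lemma holV y f : hol y f -> f y != 0 -> hol y (fun y' => (f y')^-1).
Proof.
move=> hf fy.
apply: (@hol_comp _ Y y 0%N (fun=> f) (fun v : 'rV[C]_1 => (v 0 0)^-1 : C^o)).
- by move=> _.
- have cc := differentiable_continuous (@coord_cdiff 0 (\row_i f y) 0).
  near=> v.
  apply: (@differentiableV _ (affine 0) (fun v => v 0 0) v (coord_cdiff v 0)).
  by near: v; apply: (cvgr_neq0 _ cc); rewrite mxE.
- by near=> y'; rewrite mxE.
Unshelve. all: by end_near.
Qed.

Lemma holX y f n : hol y f -> hol y (fun y' => f y' ^+ n).
Proof.
move=> hf; elim: n => [|n IH]; first exact: hol_cst.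
apply: (@hol_ext y (fun y' => f y' * f y' ^+ n)); first exact: holM.
by near=> y'; rewrite exprS.
Unshelve. all: by end_near.
Qed.

Lemma hol_sum (I : Type) (r : seq I) (P : pred I) (F : I -> Y -> C) y :
  (forall i, P i -> hol y (F i)) -> hol y (fun y' => \sum_(i <- r | P i) F i y').
Proof.
move=> hF; elim: r => [|i r IH].
  apply: (@hol_ext y (fun=> 0)); first exact: hol_cst.
  by near=> y'; rewrite big_nil.
apply: (@hol_ext y (fun y' => if P i then F i y' + \sum_(j <- r | P j) F j y'
                              else \sum_(j <- r | P j) F j y')).
  by case: (boolP (P i)) => [Pi|//]; exact: holD (hF _ Pi) IH.
by near=> y'; rewrite big_cons.
Unshelve. all: by end_near.
Qed.

Lemma hol_prod (I : Type) (r : seq I) (P : pred I) (F : I -> Y -> C) y :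
  (forall i, P i -> hol y (F i)) -> hol y (fun y' => \prod_(i <- r | P i) F i y').
Proof.
move=> hF; elim: r => [|i r IH].
  apply: (@hol_ext y (fun=> 1)); first exact: hol_cst.
  by near=> y'; rewrite big_nil.
apply: (@hol_ext y (fun y' => if P i then F i y' * \prod_(j <- r | P j) F j y'
                              else \prod_(j <- r | P j) F j y')).
  by case: (boolP (P i)) => [Pi|//]; exact: holM (hF _ Pi) IH.
by near=> y'; rewrite big_cons.
Unshelve. all: by end_near.
Qed.

Lemma holmx_cst y m n (A : 'M[C]_(m, n)) : holmx y (fun=> A).
Proof. by move=> i j; exact: hol_cst. Qed.

Lemma holmx_ext y m n (A B : Y -> 'M[C]_(m, n)) : holmx y A ->
  (\forall y' \near y, A y' = B y') -> holmx y B.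
Proof.
move=> hA AB i j; apply: hol_ext (hA i j) _.
by apply: filterS AB => y' ->.
Qed.

Lemma holmxM y m n p (A : Y -> 'M[C]_(m, n)) (B : Y -> 'M[C]_(n, p)) :
  holmx y A -> holmx y B -> holmx y (fun y' => A y' *m B y').
Proof.
move=> hA hB i j; apply: (@hol_ext y (fun y' => \sum_k A y' i k * B y' k j)).
  by apply: hol_sum => k _; exact: holM.
by near=> y'; rewrite mxE.
Unshelve. all: by end_near.
Qed.

Lemma holmxT y m n (A : Y -> 'M[C]_(m, n)) : holmx y A -> holmx y (fun y' => (A y')^T).
Proof.
move=> hA i j; apply: hol_ext (hA j i) _.
by near=> y'; rewrite mxE.
Unshelve. all: by end_near.
Qed.

Lemma holmxZ y m n (f : Y -> C) (A : Y -> 'M[C]_(m, n)) : hol y f -> holmx y A ->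
  holmx y (fun y' => f y' *: A y').
Proof.
move=> hf hA i j; apply: hol_ext (holM hf (hA i j)) _.
by near=> y'; rewrite mxE.
Unshelve. all: by end_near.
Qed.

Lemma holmx_det y n (A : Y -> 'M[C]_n) : holmx y A -> hol y (fun y' => \det (A y')).
Proof.
move=> hA; apply: hol_sum => s _; apply: holM; first exact: hol_cst.
by apply: hol_prod => i _; exact: hA.
Qed.

Lemma holmx_inv y n (A : Y -> 'M[C]_n) : holmx y A ->
  (\forall y' \near y, A y' \in unitmx) -> holmx y (fun y' => invmx (A y')).
Proof.
move=> hA uA i j.
have Ay : A y \in unitmx by exact: (nbhs_singleton uA).
apply: (@hol_ext y (fun y' => (\det (A y'))^-1 * cofactor (A y') j i)).
  apply: holM.
    apply: holV; first exact: holmx_det.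
    by rewrite -unitfE -unitmxE.
  apply: holM; first exact: hol_cst.
  apply: holmx_det => k l.
  by apply: hol_ext (hA (lift j k) (lift i l)) _; near=> y'; rewrite !mxE.
near=> y'; have uA' : A y' \in unitmx by near: y'.
by rewrite /invmx uA' !mxE.
Unshelve. all: by end_near.
Qed.

Lemma holmx_block_col y m1 m2 n (A : Y -> 'M[C]_(m1, n)) (B : Y -> 'M[C]_(m2, n)) :
  holmx y A -> holmx y B -> holmx y (fun y' => col_mx (A y') (B y')).
Proof.
move=> hA hB i j; rewrite -(splitK i); case: (fintype.split i) => k /=.
  by apply: hol_ext (hA k j) _; near=> y'; rewrite col_mxEu.
by apply: hol_ext (hB k j) _; near=> y'; rewrite col_mxEd.
Unshelve. all: by end_near.
Qed.

End HolAlgebra.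

(** * Finite subcovers by neighbourhoods *)

Section Compactness.

Lemma finite_cover_pointed (T : ptopologicalType) (N : T -> set T) :
  compact [set: T] -> (forall x, nbhs x (N x)) ->
  exists s : seq T, forall y, exists2 x, x \in s & N x y.
Proof.
rewrite compact_cover => cT nN.
have [|y _|D _ sD] := cT T setT (fun x => interior (N x)).
- by move=> i _; exact: open_interior.
- by exists y => //; exact: nN.
exists (finmap.enum_fset D) => y.
by have [x xD /interior_subset yN] := sD y I; exists x.
Qed.

Lemma finite_cover (T : topologicalType) (N : T -> set T) : compact [set: T] ->
  (forall x, nbhs x (N x)) -> exists s : seq T, forall y, exists2 x, x \in s & N x y.
Proof.
move=> cT nN; have [[x0 _]|T0] := pselect (exists x : T, True); last first.
  by exists [::] => y; exfalso; apply: T0; exists y.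
pose pT : ptopologicalType := HB.pack T (isPointed.Build T x0).
exact: (@finite_cover_pointed pT N cT nN).
Qed.

End Compactness.

(** * Normalized coordinates *)

Section Charts.
Context {R : realType} (X : cspace R).
Hypothesis hX : compact_riemann_surface X.
Local Notation C := R[i].
Implicit Types (x y : X) (U V O : set X) (f g : X -> C).

Definition box (r : R) : set C := [set w | `|complex.Re w| < r /\ `|complex.Im w| < r].

Lemma box_nbhs r (w : C^o) : box r w -> \forall v \near w, box r v.
Proof.
move=> [h1 h2]; apply/near_nm.
exists (Num.min (r - `|complex.Re w|) (r - `|complex.Im w|)).
  by rewrite lt_min !subr_gt0 h1.
move=> v; rewrite lt_min => /andP[v1 v2].
have := Re_nm (v - w); have := Im_nm (v - w); rewrite !raddfB/= => k1 k2.
have := ler_normD (complex.Re v - complex.Re w) (complex.Re w).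
have := ler_normD (complex.Im v - complex.Im w) (complex.Im w).
by rewrite !subrK => k3 k4; split; lra.
Qed.

(* A coordinate centred at [x] with image the open square of half-width 3,
   together with its inverse. *)
Record good_chart x U (z : X -> C) (psi : C -> X) : Prop := GoodChart {
  gc_coord : coordinate U z;
  gc_in : U x;
  gc_0 : z x = 0;
  gc_box : forall y, U y -> box 3 (z y);
  gc_U : forall w, box 3 w -> U (psi w);
  gc_K : forall w, box 3 w -> z (psi w) = w;
  gc_K' : forall y, U y -> psi (z y) = y;
  gc_cont : forall y, U y -> forall P, nbhs (z y : C^o) P -> nbhs y (fun y' => P (z y'));
  gc_cont' : forall w, box 3 w -> forall P, nbhs (psi w) P -> nbhs (w : C^o) (fun v => P (psi v));
  gc_hol : forall y, U y -> forall f, hol y f <-> holo1 (f \o psi) (z y) }.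

(** The affine relation between [z'] and the given [z] is kept in the conclusion because [order_at]
    refers to an arbitrary coordinate, which has to be compared with a normalized one. *)
Lemma coordinate_chart x U z O : coordinate U z -> U x -> open O -> O x ->
  exists V (z' : X -> C) (psi : C -> X) (l : C), [/\ good_chart x V z' psi, V `<=` O `&` U,
    l != 0 & forall y, z' y = l * (z y - z x)].
Proof.
move=> [[oU injz cz omz hz] oz] Ux oO Ox.
have om V : open V -> V `<=` U -> open (z @` V).
  by move=> oV VU; have [B oB ->] := omz V oV VU; exact: openI.
have oUO : open (U `&` O) by exact: openI.
have /open_nm/(_ (z x)) : open (z @` (U `&` O)) by apply: om => // y [].
case=> [|e e0 eP]; first by exists x.
(* Points of [box 3] have modulus below 6, so division by [7 / e] brings them into the disc of
   radius [e] contained in the image. *)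
pose l : C := (7 / e)%:C%C.
have l0 : l != 0 by rewrite -nm_gt0 nmR normr_gt0 gt_eqF// divr_gt0.
pose z' y : C := l * (z y - z x).
have scaleE y : z' y / l + z x = z y by rewrite /z' mulrC mulKf// subrK.
pose V := [set y | (U `&` O) y /\ box 3 (z' y)].
have lV w : l * (w / l) = w by rewrite mulrC divfK.
have boxV w : box 3 w -> exists y, V y /\ z' y = w.
  move=> [w1 w2].
  have : nm ((w / l + z x) - z x) < e.
    rewrite addrK nmM nmV nmR ger0_norm; last by rewrite divr_ge0// ltW.
    rewrite invf_div mulrA ltr_pdivrMr// mulrC ltr_pM2l//.
    by apply: le_lt_trans (nm_ReIm _) _; lra.
  move=> /eP[y [Uy Oy] zy]; exists y.
  have E : z' y = w by rewrite /z' zy addrK lV.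
  by split=> //; split=> //; rewrite E.
have inj y y' : U y -> U y' -> z' y = z' y' -> y = y'.
  move=> Uy Uy' /(mulfI l0)/addIr; apply: injz; exact: mem_set.
have cz' y : U y -> forall P, nbhs (z' y : C^o) P -> nbhs y (fun y' => P (z' y')).
  move=> Uy P /near_nm[d d0 dP].
  have nl : 0 < nm l by rewrite nm_gt0.
  have : nbhs y (fun y' => nm (z y' - z y) < d / nm l).
    apply: (cz y Uy [set w : C^o | nm (w - z y) < d / nm l]); apply/near_nm.
    by exists (d / nm l) => //; rewrite divr_gt0.
  apply: filterS => y' y'd; apply: dP; rewrite -mulrBr opprB addrA subrK nmM mulrC.
  by rewrite -ltr_pdivlMr.
have oV : open V.
  rewrite openE => y [[Uy Oy] b].
  have h1 : nbhs y (U `&` O) by apply: open_nbhs_nbhs.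
  have h2 : nbhs y (fun y' => box 3 (z' y')) by apply: (cz' y Uy); exact: box_nbhs.
  by near=> y'; split; near: y'.
have VU : V `<=` U by move=> y [[]].
have om' W : open W -> W `<=` U -> open (z' @` W : set C^o).
  move=> oW WU; apply/open_nm => _ [y Wy <-].
  have /open_nm/(_ (z y)) := om _ oW WU; case=> [|d d0 dP]; first by exists y.
  have nl : 0 < nm l by rewrite nm_gt0.
  exists (nm l * d); first by rewrite mulr_gt0.
  move=> w wd; have : nm (w / l + z x - z y) < d.
    have -> : w / l + z x - z y = (w - z' y) / l.
      by rewrite /z' mulrBl [l * _]mulrC mulfK// opprB addrA.
    by rewrite nmM nmV ltr_pdivrMr// mulrC.
  by move=> /dP[y' Wy' E]; exists y' => //; rewrite /z' E addrK lV.
pose psi w := if pselect (exists y, V y /\ z' y = w) is left p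
  then projT1 (cid p) else x.
have psiP w : box 3 w -> V (psi w) /\ z' (psi w) = w.
  move=> /boxV ex; rewrite /psi; case: pselect => [p|//].
  by case: cid.
have psiK y : V y -> psi (z' y) = y.
  move=> Vy; have [Vp zp] := psiP _ Vy.2.
  by apply: inj => //; exact: VU.
have cpsi w : box 3 w -> forall P, nbhs (psi w) P -> nbhs (w : C^o) (fun v => P (psi v)).
  move=> bw P nP; have [Vw zw] := psiP _ bw.
  have nP' : nbhs (psi w) (P^° `&` V).
    by apply: filterI; [exact: nbhs_interior | exact: open_nbhs_nbhs].
  have : open (z' @` (P^° `&` V) : set C^o).
    apply: om' => [|y []]; last by move=> _ /VU.
    by apply: openI => //; exact: open_interior.
  move=> /open_nm/(_ w); case.
    by exists (psi w) => //; exact: nbhs_singleton nP'.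
  move=> d d0 dP; apply/near_nm; exists d => // v /dP[y [/interior_subset Py Vy] <-].
  by rewrite psiK.
have hz' y : V y -> forall f, hol y f <-> holo1 (f \o psi) (z' y).
  move=> Vy f; have Uy := VU _ Vy; split.
    move=> /(hz y Uy f)[F hF fF].
    apply: (@holo1_ext _ (fun w => F (w / l + z x))).
      have := cpsi _ Vy.2 _; rewrite psiK// => /(_ _ fF).
      move=> h; have bz := box_nbhs Vy.2; near=> w.
      have -> : (f \o psi) w = F (z (psi w)) by near: w; exact: h.
      have bw : box 3 w by near: w.
      have [_ zw] := psiP w bw.
      by congr F; rewrite -(scaleE (psi w)) zw.
    have aff w : cdiff (fun w => w / l + z x) w.
      apply: cdiffD; last exact: cdiff_cst.
      by apply: cdiffM; [exact: cdiff_id | exact: cdiff_cst].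
    have nF : \forall w \near (z' y : C^o), cdiff F (w / l + z x).
      apply: (@cdiff_near _ _ _ (cdiff F) (aff _)).
      by rewrite scaleE.
    by near=> w; apply: cdiff_comp; [exact: aff | near: w].
  move=> hf; apply/(hz y Uy f).
  have aff w : cdiff (fun w => l * (w - z x)) w.
    by apply: cdiffZ; apply: cdiffB; [exact: cdiff_id | exact: cdiff_cst].
  exists (fun w => f (psi (l * (w - z x)))).
    have nF := @cdiff_near _ _ _ (cdiff (f \o psi)) (aff (z y)) hf.
    near=> w; apply: (@cdiff_comp _ (fun w => l * (w - z x)) (f \o psi)).
      exact: aff.
    by near: w; exact: nF.
  have nV : nbhs y V by exact: open_nbhs_nbhs.
  by near=> y'; rewrite -/(z' y') psiK//; near: y'.
have Vx : V x by split=> //; rewrite /z' subrr mulr0; split; rewrite /= normr0; lra.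
exists V, z', psi, l; split=> //; last by move=> y [[]].
have imV : z' @` V = box 3.
  apply/seteqP; split=> [_ [y [_ b] <-]//|w /boxV[y [Vy <-]]]; by exists y.
split=> //.
- split.
  + split=> //.
    * by move=> y y' /set_mem/VU Vy /set_mem/VU Vy'; exact: inj.
    * by move=> y /VU Vy; exact: cz'.
    * move=> W oW WV; exists (z' @` W); first by apply: om' => // y /WV/VU.
      by apply/seteqP; split=> [w [y Wy <-]|w []//]; split; exists y => //; exact: WV.
    * move=> y Vy f; rewrite hz'//; split=> [hf|[F hF fF]].
        exists (f \o psi) => //.
        have nV : nbhs y V by exact: open_nbhs_nbhs.
        by near=> y'; rewrite /= psiK//; near: y'.
      apply: holo1_ext hF.
      have := cpsi _ Vy.2 _; rewrite psiK// => /(_ _ fF) h.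
      have bz := box_nbhs Vy.2; near=> w.
      have -> : (f \o psi) w = F (z' (psi w)) by near: w; exact: h.
      by rewrite (psiP w _).2//; near: w.
  + by rewrite imV; apply/open_nm => w /box_nbhs/near_nm.
- by rewrite /z' subrr mulr0.
- by move=> y [].
- by move=> w /psiP[].
- by move=> w /psiP[].
- by move=> y /VU; exact: cz'.
Unshelve. all: by end_near.
Qed.

Lemma exists_chart x O : open O -> O x ->
  exists U (z : X -> C) (psi : C -> X), good_chart x U z psi /\ U `<=` O.
Proof.
move=> oO Ox; have [_ _ _ /(_ x)[U [z [Ux cz]]]] := hX.
have [V [z' [psi [l [gc VO _ _]]]]] := coordinate_chart cz Ux oO Ox.
by exists V, z', psi; split=> // y /VO[].
Qed.

End Charts.

(** * Germs of holomorphic and meromorphic functions *)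

Section Germs.
Context {R : realType} (X : cspace R).
Hypothesis hX : compact_riemann_surface X.
Local Notation C := R[i].
Implicit Types (x y : X) (U V O : set X) (f g u v : X -> C).

Lemma punctP x (P : set X) : (\forall y \near x^', P y) <->
  \forall y \near x, y != x -> P y.
Proof. by []. Qed.

Lemma punctW x (P : set X) : (\forall y \near x, P y) -> \forall y \near x^', P y.
Proof. by move=> nP; apply/punctP; apply: filterS nP. Qed.

Lemma neq_near x y : y != x -> \forall y' \near y, y' != x.
Proof.
move=> yx; have [hs _ _ _] := hX.
apply: (@open_nbhs_nbhs _ y [set y' | y' != x]); split=> //.
rewrite (_ : [set y' | _] = ~` [set x]); last first.
  by apply/seteqP; split=> t /= /eqP.
by apply: closed_openC; apply: compact_closed => //; exact: compact_set1.
Qed.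

Section InChart.
Variables (x : X) (U : set X) (z : X -> C) (psi : C -> X).
Hypothesis gc : good_chart x U z psi.

Lemma gc_open : open U.
Proof. by case: (gc_coord gc) => -[]. Qed.

Lemma gc_nbhs y : U y -> nbhs y U.
Proof. by move=> Uy; apply: open_nbhs_nbhs; split => //; exact: gc_open. Qed.

Lemma gc_psi0 : psi 0 = x.
Proof. by rewrite -(gc_0 gc) (gc_K' gc)//; exact: gc_in gc. Qed.

Lemma box0 (r : R) : 0 < r -> box r (0 : C).
Proof. by move=> r0; split; rewrite /= normr0. Qed.

Lemma near_box3 : \forall w \near (0 : C^o), box 3 w.
Proof. by apply: box_nbhs; apply: box0; rewrite ltr0n. Qed.

Lemma gc_z_eq0 y : U y -> (z y == 0) = (y == x).
Proof.
move=> Uy; apply/eqP/eqP => [zy|->]; last exact: gc_0 gc.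
by rewrite -(gc_K' gc Uy) zy gc_psi0.
Qed.

Lemma gc_near (P : set X) : (\forall y \near x, P y) <->
  \forall w \near (0 : C^o), P (psi w).
Proof.
split=> [nP|nP].
  apply: (gc_cont' gc); first exact: box0.
  by rewrite gc_psi0.
have nU := gc_nbhs (gc_in gc).
have := gc_cont gc (gc_in gc) (P := fun w => P (psi w)); rewrite (gc_0 gc) => /(_ nP) nP'.
by near=> y; rewrite -(gc_K' gc (y := y)); near: y.
Unshelve. all: by end_near.
Qed.

Lemma gc_punct (P : set X) : (\forall y \near x^', P y) <->
  \forall w \near (0 : C^o), w != 0 -> P (psi w).
Proof.
rewrite punctP gc_near.
have b3 := near_box3.
split=> nP; near=> w.
  move=> w0; have bw : box 3 w by near: w.
  have nw : psi w != x -> P (psi w) by near: w.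
  by apply: nw; rewrite -(gc_z_eq0 (gc_U gc bw)) (gc_K gc bw).
have bw : box 3 w by near: w.
have nw : w != 0 -> P (psi w) by near: w.
by rewrite -(gc_z_eq0 (gc_U gc bw)) (gc_K gc bw).
Unshelve. all: by end_near.
Qed.

Lemma gc_zhol y : U y -> hol y z.
Proof.
move=> Uy; apply/(gc_hol gc Uy).
have bz := box_nbhs (gc_box gc Uy).
apply: (@holo1_ext _ id); last by near=> w; exact: cdiff_id.
by near=> w; rewrite /= (gc_K gc)//; near: w.
Unshelve. all: by end_near.
Qed.

Lemma gc_hol_comp (F : C -> C) : holo1 F 0 -> hol x (F \o z).
Proof.
move=> hF; apply/(gc_hol gc (gc_in gc)); rewrite (gc_0 gc).
have bz := near_box3.
apply: holo1_ext hF.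
by near=> w; rewrite /= (gc_K gc)//; near: w.
Unshelve. all: by end_near.
Qed.

Lemma gc_hol0 f : hol x f <-> holo1 (f \o psi) 0.
Proof. by rewrite (gc_hol gc (gc_in gc)) (gc_0 gc). Qed.

Lemma hol_factor f : hol x f -> (\forall y \near x, f y = 0) \/
  exists (k : nat) u, [/\ hol x u, u x != 0 & \forall y \near x, f y = z y ^+ k * u y].
Proof.
move=> /gc_hol0 /factor_zero[f0|[k [g [hg g0 fg]]]].
  by left; apply/gc_near.
right; exists k, (g \o z); split; first exact: gc_hol_comp.
  by rewrite /= (gc_0 gc).
apply/gc_near.
have bz := near_box3.
near=> w; rewrite /= (gc_K gc); last by near: w.
have -> : f (psi w) = (w - 0) ^+ k * g w by near: w.
by rewrite subr0.
Unshelve. all: by end_near.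
Qed.

End InChart.

Lemma chart_at x : exists U (z : X -> C) (psi : C -> X), good_chart x U z psi.
Proof.
have [U [z [psi [gc _]]]] := exists_chart hX (@openT X) (I : setT x).
by exists U, z, psi.
Qed.

Lemma hol_cvg x f (P : set C) : hol x f -> (\forall w \near (f x : C^o), P w) ->
  \forall y \near x, P (f y).
Proof.
move=> hf nP; have [U [z [psi gc]]] := chart_at x.
move/(gc_hol0 gc) : hf => hf.
apply/(gc_near gc); apply: (@cdiff_near _ (f \o psi) 0 P (holo1W hf)).
by rewrite /= (gc_psi0 gc).
Qed.

Lemma hol_near x f : hol x f -> \forall y \near x, hol y f.
Proof.
move=> hf; have [U [z [psi gc]]] := chart_at x.
move/(gc_hol0 gc) : hf => hf; have := holo1_near hf => nh.
have nU := gc_nbhs gc (gc_in gc).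
have := gc_cont gc (gc_in gc) (P := holo1 (f \o psi)); rewrite (gc_0 gc) => /(_ nh) nh'.
near=> y; have Uy : U y by near: y.
have hy : holo1 (f \o psi) (z y) by near: y.
exact: (gc_hol gc Uy f).2 hy.
Unshelve. all: by end_near.
Qed.

Lemma hol_neq0 x f : hol x f -> f x != 0 -> \forall y \near x, f y != 0.
Proof.
move=> hf fx; apply: (@hol_cvg x f (fun w => w != 0) hf).
by apply: (@cdiff_neq0 _ id); [exact: cdiff_id | exact: fx].
Qed.

(** No point is isolated. Two contradictory statements on punctured neighbourhoods are refuted by
    evaluating both at a common point. *)
Lemma punct_exists x (P : set X) : (\forall y \near x^', P y) ->
  exists2 y, y != x & P y.
Proof.
have [U [z [psi gc]]] := chart_at x.
move=> /(gc_punct gc)/near_nm[e e0 eP].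
pose t : R := Num.min e 1 / 2.
have t0 : 0 < t by rewrite divr_gt0// lt_min e0 ltr01.
have [te t1] : t < e /\ t < 1.
  have tE : t * 2 = Num.min e 1 by rewrite /t divfK.
  have : Num.min e 1 <= Num.min e 1 by [].
  by rewrite -{1}tE le_min => /andP[? ?]; split; lra.
have T0 : t%:C%C != 0 :> C by rewrite -nm_gt0 nmR gtr0_norm.
have tb : box 3 (t%:C%C : C) by split; rewrite /= ?normr0 ?gtr0_norm//; lra.
exists (psi t%:C%C).
  by rewrite -(gc_z_eq0 gc (gc_U gc tb)) (gc_K gc tb).
by apply: eP => //; rewrite subr0 nmR gtr0_norm.
Qed.

Lemma hol_punct0 x f : hol x f -> (\forall y \near x^', f y = 0) -> f x = 0.
Proof.
move=> hf nf; apply/eqP; apply/negPn/negP => fx.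
have n2 := punctW (hol_neq0 hf fx).
have [y _ []] : exists2 y, y != x & f y = 0 /\ f y != 0.
  by apply: punct_exists; near=> y; split; near: y.
by move=> ->; rewrite eqxx.
Unshelve. all: by end_near.
Qed.

Lemma hol_punct_eq x f g : hol x f -> hol x g -> (\forall y \near x^', f y = g y) -> f x = g x.
Proof.
move=> hf hg fg; apply/eqP; rewrite -subr_eq0; apply/eqP.
apply: (@hol_punct0 x (fun y => f y - g y)); first exact: holB.
by apply: filterS fg => y ->; rewrite subrr.
Qed.

Lemma holXz x f (k : int) : hol x f -> f x != 0 -> hol x (fun y => f y ^ k).
Proof.
move=> hf fx; case: k => k; first exact: holX.
by apply: holV; [exact: holX | rewrite expf_neq0].
Qed.

(** Independence of the coordinate: two coordinates centred at [x] divide each other, z' = z^a u1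
    and z = z'^b u2, whence 1 = z^(ab - 1) times a holomorphic germ; if [a] exceeded 1 the right
    side would vanish at [x]. So their quotient is a unit and can be absorbed into [u]. *)
Lemma order_chart x U (z : X -> C) (psi : C -> X) f k : good_chart x U z psi ->
  order_at x f k <-> exists u,
    [/\ hol x u, u x != 0 & \forall y \near x^', f y = u y * z y ^ k].
Proof.
move=> gc; split; last first.
  move=> [u [hu ux fu]]; exists U, z, u; split.
  - exact: gc_coord gc.
  - exact: gc_in gc.
  - exact: hu.
  - exact: ux.
  - by apply: filterS fu => y ->; rewrite (gc_0 gc) subr0.
move=> [V [z1 [u [cV Vx hu ux fu]]]].
have [W [z' [psi' [l [gc' _ l0 z'E]]]]] := coordinate_chart cV Vx openT (I : setT x).
have nU := punctW (gc_nbhs gc (gc_in gc)); have nW := punctW (gc_nbhs gc' (gc_in gc')).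
have hz := gc_zhol gc (gc_in gc); have hz' := gc_zhol gc' (gc_in gc').
have nz : \forall y \near x^', z y != 0.
  by near=> y; rewrite (gc_z_eq0 gc); [near: y; exact: nbhs_dnbhs_neq | near: y].
have nz' : \forall y \near x^', z' y != 0.
  by near=> y; rewrite (gc_z_eq0 gc'); [near: y; exact: nbhs_dnbhs_neq | near: y].
have notz (h : X -> C) : (\forall y \near x, h y = 0) -> ~ \forall y \near x^', h y != 0.
  move=> /punctW h0 h1.
  have [y _ []] : exists2 y, y != x & h y = 0 /\ h y != 0.
    by apply: punct_exists; near=> y; split; near: y.
  by move=> ->; rewrite eqxx.
have [/notz//|[a [u1 [hu1 u1x zu1]]]] := hol_factor gc hz'.
have [/notz//|[b [u2 [hu2 u2x zu2]]]] := hol_factor gc' hz.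
have a1 : a = 1%N.
  have a0 : (0 < a)%N.
    rewrite lt0n; apply: contra u1x => /eqP a0.
    have := nbhs_singleton zu1; rewrite a0 /= expr0 mul1r => <-.
    by rewrite (gc_0 gc').
  have b0 : (0 < b)%N.
    rewrite lt0n; apply: contra u2x => /eqP b0.
    have := nbhs_singleton zu2; rewrite b0 /= expr0 mul1r => <-.
    by rewrite (gc_0 gc).
  apply/eqP; rewrite eqn_leq a0 andbT leqNgt; apply/negP => a2.
  pose c := (a * b).-1.
  have cE : (a * b = c.+1)%N by rewrite prednK// muln_gt0 a0.
  have c0 : (0 < c)%N by rewrite -ltnS -cE (leq_trans a2)// leq_pmulr.
  have zu1' := punctW zu1; have zu2' := punctW zu2.
  have : 1 = z x ^+ c * (u1 x ^+ b * u2 x).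
    apply: (@hol_punct_eq x (fun=> 1) (fun y => z y ^+ c * (u1 y ^+ b * u2 y))).
    - exact: hol_cst.
    - by apply: holM; [exact: holX | apply: holM => //; exact: holX].
    near=> y; have zy : z y != 0 by near: y.
    apply: (mulfI zy); rewrite mulr1.
    have z'y : z' y = z y ^+ a * u1 y by near: y.
    have zzy : z y = z' y ^+ b * u2 y by near: y.
    by rewrite {1}zzy z'y exprMn -exprM cE exprS; ring.
  by rewrite (gc_0 gc) expr0n gtn_eqF// mul0r => /eqP; rewrite oner_eq0.
have zu1' := punctW zu1.
exists (fun y => u y * (u1 y / l) ^ k); split.
- apply: holM => //; apply: holXz; last by rewrite mulf_neq0// invr_neq0.
  by apply: holM => //; exact: hol_cst.
- by rewrite mulf_neq0// expfz_neq0// mulf_neq0// invr_neq0.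
near=> y.
have -> : f y = u y * (z1 y - z1 x) ^ k by near: y.
have -> : z1 y - z1 x = z' y / l by rewrite z'E mulrC mulKf.
have -> : z' y = z y ^+ a * u1 y by near: y.
by rewrite a1 expr1 -mulrA -mulrA -expfzMl [_ / l * _]mulrC.
Unshelve. all: by end_near.
Qed.

Lemma gc_zneq0 x U (z : X -> C) (psi : C -> X) : good_chart x U z psi ->
  \forall y \near x^', z y != 0.
Proof.
move=> gc; have nU := punctW (gc_nbhs gc (gc_in gc)).
by near=> y; rewrite (gc_z_eq0 gc); [near: y; exact: nbhs_dnbhs_neq | near: y].
Unshelve. all: by end_near.
Qed.

Lemma order_unique x f k l : order_at x f k -> order_at x f l -> k = l.
Proof.
have [U [z [psi gc]]] := chart_at x.
wlog : k l / (k <= l).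
  move=> H hk hl; case: (leP k l) => [kl|/ltW lk]; first exact: H.
  by symmetry; exact: H.
move=> kl /(order_chart _ _ gc)[u [hu ux fu]] /(order_chart _ _ gc)[v [hv vx fv]].
move: kl; rewrite le_eqVlt => /predU1P[//|kl].
have : exists m : nat, l - k = m.+1.
  have : 0 < l - k by rewrite subr_gt0.
  by case: (l - k) => [[|m]|m]//; exists m.
move=> [m mE]; exfalso.
have zn := gc_zneq0 gc.
have : u x = v x * z x ^+ m.+1.
  apply: (@hol_punct_eq x u (fun y => v y * z y ^+ m.+1)) => //.
    exact: holM hv (holX _ (gc_zhol gc (gc_in gc))).
  near=> y; have zy : z y != 0 by near: y.
  have zk : z y ^ k != 0 by rewrite expfz_neq0.
  apply: (mulIf zk); rewrite -mulrA -[z y ^+ m.+1]/(z y ^ Posz m.+1) -mE -expfzDr// subrK.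
  have <- : f y = u y * z y ^ k by near: y.
  by near: y.
by rewrite (gc_0 gc) exprS mul0r mulr0 => /eqP; rewrite (negPf ux).
Unshelve. all: by end_near.
Qed.

Lemma order_ext x f g k : (\forall y \near x^', f y = g y) -> order_at x f k -> order_at x g k.
Proof.
move=> fg [U [z [u [h1 h2 h3 h4 h5]]]]; exists U, z, u; split=> //.
near=> y; have <- : f y = g y by near: y.
by near: y.
Unshelve. all: by end_near.
Qed.

Lemma order_mul x f g k l : order_at x f k -> order_at x g l ->
  order_at x (fun y => f y * g y) (k + l).
Proof.
have [U [z [psi gc]]] := chart_at x.
move=> /(order_chart _ _ gc)[u [hu ux fu]] /(order_chart _ _ gc)[v [hv vx fv]].
apply/(order_chart _ _ gc); exists (fun y => u y * v y); split.
- exact: holM.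
- by rewrite mulf_neq0.
have zn := gc_zneq0 gc; near=> y.
have -> : f y = u y * z y ^ k by near: y.
have -> : g y = v y * z y ^ l by near: y.
have zy : z y != 0 by near: y.
by rewrite expfzDr// mulrACA.
Unshelve. all: by end_near.
Qed.

Lemma order_inv x f k : order_at x f k -> order_at x (fun y => (f y)^-1) (- k).
Proof.
have [U [z [psi gc]]] := chart_at x.
move=> /(order_chart _ _ gc)[u [hu ux fu]].
apply/(order_chart _ _ gc); exists (fun y => (u y)^-1); split.
- exact: holV.
- by rewrite invr_neq0.
near=> y; have -> : f y = u y * z y ^ k by near: y.
by rewrite invfM invr_expz.
Unshelve. all: by end_near.
Qed.

Lemma order_unit x f : hol x f -> f x != 0 -> order_at x f 0.
Proof.
have [U [z [psi gc]]] := chart_at x => hf fx.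
apply/(order_chart _ _ gc); exists f; split=> //.
by near=> y; rewrite expr0z mulr1.
Unshelve. all: by end_near.
Qed.

Lemma order_exp x f k (n : nat) : order_at x f k ->
  order_at x (fun y => f y ^+ n) (k * n%:Z).
Proof.
move=> fk; elim: n => [|n IH].
  by rewrite mulr0; apply: order_unit; [exact: hol_cst | rewrite expr0 oner_neq0].
rewrite intS mulrDr mulr1 addrC; apply: order_ext (order_mul IH fk).
by near=> y; rewrite exprSr.
Unshelve. all: by end_near.
Qed.

Lemma order_hol x f : hol x f -> (\forall y \near x, f y = 0) \/
  exists k : nat, order_at x f k /\ (k == 0%N) = (f x != 0).
Proof.
have [U [z [psi gc]]] := chart_at x.
move=> hf; have [|[k [u [hu ux fu]]]] := hol_factor gc hf; [by left|right].
exists k; split.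
  apply/(order_chart _ _ gc); exists u; split=> //.
  by apply: punctW; near=> y; rewrite mulrC; near: y.
have := nbhs_singleton fu; rewrite /= => ->; rewrite (gc_0 gc).
by case: k fu => [|k] _; rewrite ?expr0 ?mul1r ?ux// exprS !mul0r eqxx.
Unshelve. all: by end_near.
Qed.

Lemma order_ge0 x f (k : nat) : order_at x f k ->
  exists g, [/\ hol x g, \forall y \near x^', f y = g y & (g x != 0) = (k == 0%N)].
Proof.
have [U [z [psi gc]]] := chart_at x.
move=> /(order_chart _ _ gc)[u [hu ux fu]].
exists (fun y => u y * z y ^+ k); split=> //.
  exact: holM hu (holX _ (gc_zhol gc (gc_in gc))).
by rewrite (gc_0 gc) mulf_eq0 (negPf ux) expf_eq0 eqxx andbT; case: (k).
Qed.

Lemma order_neq0 x f k : order_at x f k -> \forall y \near x^', f y != 0.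
Proof.
have [U [z [psi gc]]] := chart_at x.
move=> /(order_chart _ _ gc)[u [hu ux fu]].
have zn := gc_zneq0 gc; have un := punctW (hol_neq0 hu ux).
near=> y; have -> : f y = u y * z y ^ k by near: y.
by rewrite mulf_neq0 ?expfz_neq0//; near: y.
Unshelve. all: by end_near.
Qed.

Lemma order_punct x f k : order_at x f k ->
  \forall y \near x^', hol y f /\ f y != 0.
Proof.
have [U [z [psi gc]]] := chart_at x.
move=> fk; have fn := order_neq0 fk.
move: fk => /(order_chart _ _ gc)[u [hu ux fu]].
have fu' := nbhs_interior ((punctP _ _).1 fu).
have nU := punctW (gc_nbhs gc (gc_in gc)).
have nh := punctW (hol_near hu); have zn := gc_zneq0 gc.
have hd : \forall y \near x^', \forall y' \near y, y' != x.
  by apply/punctP; near=> y; exact: neq_near.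
near=> y; split; last by near: y.
apply: (@hol_ext _ _ y (fun y => u y * z y ^ k)).
  apply: holM; first by near: y.
  apply: holXz; last by near: y.
  by apply: (gc_zhol gc); near: y.
have h1 : \forall y' \near y, y' != x by near: y.
have h2 : \forall y' \near y, y' != x -> f y' = u y' * z y' ^ k.
  by near: y; exact: punctW fu'.
near=> y'; symmetry; have : y' != x by near: y'.
by near: y'.
Unshelve. all: by end_near.
Qed.

Lemma order_support_finite f (m : X -> int) : (forall x, order_at x f (m x)) ->
  finite_set [set x | m x != 0].
Proof.
move=> fm; have [_ _ cX _] := hX.
have [|s sP] := @finite_cover X (fun x => [set y | y != x -> m y = 0]) cX.
  move=> x; have := order_punct (fm x) => /punctP.
  apply: filterS => y h /h[hf fy].
  exact: order_unique (fm y) (order_unit hf fy).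
apply: (@sub_finite_set _ _ [set` s]); last exact: finite_seq.
move=> y /= my; have [x xs xy] := sP y.
have [<-//|yx] := eqVneq x y.
have y0 : m y = 0 by apply: xy; rewrite eq_sym.
by rewrite y0 eqxx in my.
Unshelve. all: by end_near.
Qed.

(** Each alternative holds on an open set, the two sets are disjoint, and [X] is connected. Besides
    giving the identity theorem, this is applied to indicator functions that are not holomorphic, of
    a generic rank and of the existence of a square root. *)
Lemma germ_dichotomy f : (forall x, (\forall y \near x^', f y = 0) \/ (\forall y \near x^', f y != 0)) ->
  (exists x, \forall y \near x^', f y != 0) -> forall x, \forall y \near x^', f y != 0.
Proof.
move=> fd [x0 fx0]; have [hs coX _ _] := hX.
have spread (Q : C -> Prop) x : (\forall y \near x^', Q (f y)) ->
    \forall y \near x, \forall y' \near y^', Q (f y').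
  move=> /punctP h; have := nbhs_interior h; apply: filterS => y hy.
  have [->|yx] := eqVneq y x; first exact/punctP.
  have nyx := neq_near yx.
  apply: punctW; near=> y'; have : y' != x by near: y'.
  by near: y'.
pose A := [set x | \forall y \near x^', f y != 0].
pose B := [set x | \forall y \near x^', f y = 0].
have oA : open A by rewrite openE => x /(spread (fun w => w != 0)).
have oB : open B by rewrite openE => x /(spread (fun w => w = 0)).
have AB : A = ~` B.
  apply/seteqP; split=> [x Ax Bx|x nB]; last by have [/nB|] := fd x.
  have [y _ []] : exists2 y, y != x & f y != 0 /\ f y = 0.
    by apply: punct_exists; near=> y; split; near: y.
  by move=> + fy; rewrite fy eqxx.
move=> x.
suff AT : A = setT by have : A x by rewrite AT.
apply: coX; first by exists x0.
  by exists A => //; rewrite setTI.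
by exists A; [rewrite AB; exact: open_closedC | rewrite setTI].
Unshelve. all: by end_near.
Qed.

(** By compactness the modulus has a maximum, at [c] say; the set where [f = f c] is open by the
    local maximum principle and closed by continuity. *)
Lemma hol_constant f : (forall x, hol x f) -> forall x y, f x = f y.
Proof.
move=> hf x1 y1; have [hs coX cX _] := hX.
have cn : {within [set: X], continuous (fun y => nm (f y))}.
  apply: continuous_subspaceT => x; apply/cvgrPdist_lt => e e0.
  have nn : \forall w \near (f x : C^o), nm (w - f x) < e by exact: near_disc.
  have := hol_cvg (hf x) nn; apply: filterS => y fy.
  apply: le_lt_trans fy; rewrite ler_norml.
  have := nmD (f y - f x) (f x); have := nmD (f x - f y) (f y).
  by rewrite !subrK (nm_distC (f x)); lra.
have [c _ cmax] := compact_EVT_max (ex_intro _ x1 I) cX cn.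
pose A := [set x | f x = f c].
have AT : A = setT.
  apply: coX; first by exists c.
    exists A; last by rewrite setTI.
    rewrite openE => x /= fx.
    have [U [z [psi gc]]] := chart_at x.
    move/(gc_hol0 gc) : (hf x) => hfx.
    have : \forall w \near (0 : C^o), (f \o psi) w = (f \o psi) 0.
      apply: max_modulus_local => //.
      by near=> w; rewrite /= (gc_psi0 gc) fx; apply: cmax; rewrite inE.
    rewrite /= (gc_psi0 gc) fx => h.
    exact: ((gc_near gc (fun y => f y = f c)).2 h).
  exists A; last by rewrite setTI.
  rewrite -[A]setCK; apply: open_closedC; rewrite openE => x /= fx.
  have fx0 : f x - f c != 0 by rewrite subr_eq0; apply/eqP.
  have := hol_neq0 (holB (hf x) (hol_cst x (f c))) fx0.
  by apply: filterS => y; rewrite /= subr_eq0 => /eqP.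
have E x : f x = f c by have : A x by rewrite AT.
by rewrite !E.
Unshelve. all: by end_near.
Qed.

End Germs.

(** * Finiteness of the first cohomology *)

Section Atlas.
Context {R : realType} (X : cspace R).
Hypothesis hX : compact_riemann_surface X.
Local Notation C := R[i].
Implicit Types (x y : X) (m : R).

Lemma compact_closed_box (r : R) :
  compact ([set w : C | `|complex.Re w| <= r /\ `|complex.Im w| <= r] : set C^o).
Proof.
have -> : ([set w : C | `|complex.Re w| <= r /\ `|complex.Im w| <= r] : set C^o) =
    (fun p : R * R => Complex p.1 p.2 : C^o) @` (`[- r, r] `*` `[- r, r]).
  apply/seteqP; split=> [[a b] /= [ha hb]|_ [[a b] [/= ha hb] <-]/=].
    by exists (a, b) => //=; split; rewrite /= in_itv/= -ler_norml.
  by move: ha hb; rewrite /= !in_itv/= -!ler_norml.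
apply: continuous_compact; last first.
  by apply: compact_setX; exact: segment_compact.
apply: continuous_subspaceT => -[a b]; apply/cvgrPdist_lt => e e0.
have e1 : 0 < complex.Re e by move: e0; rewrite ltcE => /andP[].
have eE : e = (complex.Re e)%:C%C.
  by move: e0; rewrite ltcE/= => /andP[/eqP]; case: (e) => u v /= ->.
have e2 : 0 < complex.Re e / 2 by rewrite divr_gt0.
near=> p.
rewrite eE normE ltcR; apply: le_lt_trans (nm_ReIm _) _; rewrite !raddfB/=.
have h1 : `|a - p.1| < complex.Re e / 2.
  near: p; apply: (@cvgr_dist_lt _ R^o _ _ _ (fun p : R * R => p.1) a); [exact: cvg_fst | exact: e2].
have h2 : `|b - p.2| < complex.Re e / 2.
  near: p; apply: (@cvgr_dist_lt _ R^o _ _ _ (fun p : R * R => p.2) b); [exact: cvg_snd | exact: e2].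
lra.
Unshelve. all: by end_near.
Qed.

(** The [e k] are frames of a line bundle over the charts, written in the arbitrary fibre
    coordinates; only their quotients are holomorphic. *)
Variables (J : finType) (ctr : J -> X) (U : J -> set X) (z : J -> X -> C)
  (psi : J -> C -> X) (e : J -> X -> C).
Hypothesis gcs : forall k, good_chart (ctr k) (U k) (z k) (psi k).
Hypothesis e_neq0 : forall k y, U k y -> e k y != 0.
Hypothesis e_hol : forall k l y, U k y -> U l y -> hol y (fun y' => e k y' / e l y').

(** The radii form a ladder inside the charts of radius 3: cells of radius 1 cover, improved
    cocycles live at radius 2, and 5/2 leaves a margin on which transition functions are bounded. *)
Definition cell (r : R) k : set X := [set y | U k y /\ box r (z k y)].

Hypothesis cells_cover : forall y, exists k, cell 1 k y.

Lemma cell_sub (r r' : R) k y : r <= r' -> cell r k y -> cell r' k y.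
Proof. by move=> rr [Uy [h1 h2]]; split=> //; split; apply: lt_le_trans rr. Qed.

Lemma cellU r k y : cell r k y -> U k y. Proof. by case. Qed.

Lemma cell_near r k y : cell r k y -> \forall y' \near y, cell r k y'.
Proof.
move=> [Uy b]; have nU := gc_nbhs (gcs k) Uy.
have nb := gc_cont (gcs k) Uy (box_nbhs b).
by near=> y'; split; near: y'.
Unshelve. all: by end_near.
Qed.

(** The closed box of half-width [r] is compact, so its image is closed in the Hausdorff space [X]
    even though the chart itself is only open. *)
Lemma cell_sep (r r' : R) k x : r < r' -> r' <= 3 -> ~ cell r' k x ->
  \forall y \near x, ~ cell r k y.
Proof.
move=> rr r3 nx; have [hs _ _ _] := hX.
pose K : set X := psi k @` [set w | `|complex.Re w| <= r /\ `|complex.Im w| <= r].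
have b3 w : `|complex.Re w| <= r /\ `|complex.Im w| <= r -> box 3 w.
  by move=> [h1 h2]; split; lra.
have cK : compact K.
  apply: (@continuous_compact C^o (points X) (psi k)); last exact: compact_closed_box.
  apply: continuous_in_subspaceT => w /set_mem/b3 bw P nP.
  exact: (gc_cont' (gcs k) bw nP).
have clK : closed K by exact: compact_closed.
have Kx : (~` K) x.
  move=> [w wr E]; apply: nx; rewrite -E; have bw := b3 _ wr.
  split; first exact: (gc_U (gcs k) bw).
  by rewrite (gc_K (gcs k) bw); case: wr => h1 h2; split; lra.
have : nbhs x (~` K) by apply: open_nbhs_nbhs; split=> //; exact: closed_openC.
apply: filterS => y nKy [Uy [h1 h2]]; apply: nKy; exists (z k y).
  by split; exact: ltW.
exact: (gc_K' (gcs k) Uy).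
Qed.

(** Near a point of both charts the quotient is continuous; near any other point one of the two
    smaller cells is absent by [cell_sep]. Compactness of [X] collects the local bounds. *)
Lemma transition_bound : exists2 M : R, 0 < M & forall k l y,
  cell (5 / 2) k y -> cell (5 / 2) l y -> nm (e k y / e l y) <= M.
Proof.
have [_ _ cX _] := hX.
have loc x : exists M : R, 0 < M /\ \forall y \near x, forall kl : J * J,
    cell (5 / 2) kl.1 y -> cell (5 / 2) kl.2 y -> nm (e kl.1 y / e kl.2 y) <= M.
  have lockl (kl : J * J) : exists M : R, 0 < M /\ \forall y \near x,
      cell (5 / 2) kl.1 y -> cell (5 / 2) kl.2 y -> nm (e kl.1 y / e kl.2 y) <= M.
    case: kl => k l /=.
    have [h1|h1] := pselect (cell 3 k x); last first.
      exists 1; split=> //; have n1 := @cell_sep (5 / 2) 3 k x ltac:(lra) ltac:(lra) h1.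
      by near=> y => h; exfalso; move: h; near: y.
    have [h2|h2] := pselect (cell 3 l x); last first.
      exists 1; split=> //; have n1 := @cell_sep (5 / 2) 3 l x ltac:(lra) ltac:(lra) h2.
      by near=> y => _ h; exfalso; move: h; near: y.
    have hh := e_hol (cellU h1) (cellU h2).
    exists (nm (e k x / e l x) + 1); split; first by rewrite ltr_pwDr// nm_ge0.
    have := hol_cvg hX hh (near_disc (e k x / e l x) ltr01).
    apply: filterS => y yy _ _.
    by have := nmD (e k y / e l y - e k x / e l x) (e k x / e l x); rewrite subrK; lra.
  have [Mf MfP] := choice lockl.
  exists (\sum_kl Mf kl + 1); split.
    by rewrite ltr_pwDr// sumr_ge0// => kl _; case: (MfP kl) => /ltW.
  have : \forall y \near x, forall kl : J * J, cell (5 / 2) kl.1 y ->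
      cell (5 / 2) kl.2 y -> nm (e kl.1 y / e kl.2 y) <= Mf kl.
    by apply: filter_forall => kl; case: (MfP kl).
  apply: filterS => y H kl h1 h2; apply: le_trans (H kl h1 h2) _.
  rewrite (bigD1 kl)//= -addrA lerDl addr_ge0// sumr_ge0// => kl' _.
  by case: (MfP kl') => /ltW.
have [Mx MxP] := choice loc.
have [s sP] := finite_cover cX (fun x => (MxP x).2).
exists (\sum_(x <- s) Mx x + 1).
  by rewrite ltr_pwDr// sumr_ge0// => x _; case: (MxP x) => /ltW.
move=> k l y h1 h2; have [x xs /(_ (k, l) h1 h2)/= H] := sP y.
apply: le_trans H _; rewrite (big_rem x)//= -addrA lerDl addr_ge0// sumr_ge0// => x' _.
by case: (MxP x') => /ltW.
Unshelve. all: by end_near.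
Qed.

(** [f] is a section in the fibre coordinates, and its coefficient in the frame [e k] is
    holomorphic. *)
Definition sec_hol k y (f : X -> C) : Prop := hol y (fun y' => f y' / e k y').

Lemma sec_hol_change k l y f : U k y -> U l y -> sec_hol k y f -> sec_hol l y f.
Proof.
move=> Uk Ul hf; apply: hol_ext (holM hf (e_hol Uk Ul)) _.
have nk := gc_nbhs (gcs k) Uk.
near=> y'; have Uk' : U k y' by near: y'.
by rewrite mulrA divfK// e_neq0.
Unshelve. all: by end_near.
Qed.

Lemma sec_holB k y f g : sec_hol k y f -> sec_hol k y g -> sec_hol k y (fun y' => f y' - g y').
Proof.
move=> hf hg; apply: hol_ext (holB hf hg) _.
by near=> y'; rewrite mulrBl.
Unshelve. all: by end_near.
Qed.


Lemma sec_holZ k y c f : sec_hol k y f -> sec_hol k y (fun y' => c * f y').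
Proof.
move=> hf; apply: hol_ext (holM (hol_cst y c) hf) _.
by near=> y'; rewrite mulrA.
Unshelve. all: by end_near.
Qed.

Definition cocycle_on (r : R) (f : J -> J -> X -> C) m : Prop :=
  (forall k l y, cell r k y -> cell r l y ->
     sec_hol k y (f k l) /\ nm (f k l y / e k y) <= m) /\
  (forall j k l y, cell r j y -> cell r k y -> cell r l y ->
     f j k y + f k l y = f j l y).

Lemma chart_splitting k (M : R) : 0 <= M ->
  (forall k l y, cell (5 / 2) k y -> cell (5 / 2) l y -> nm (e k y / e l y) <= M) ->
  exists2 K : R, 0 <= K & forall f m, 0 <= m -> cocycle_on 1 f m ->
  exists G : J -> X -> C,
    (forall i y, cell 2 k y -> cell 1 i y ->
       sec_hol k y (G i) /\ nm (G i y / e k y) <= K * m) /\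
    (forall i j y, cell 2 k y -> cell 1 i y -> cell 1 j y ->
       G i y - G j y = f i j y).
Proof.
move=> M0 MP.
have gc := gcs k.
(* The unit cells, seen in the chart [k]. The cover reaches past the square of half-width 2 because
   [splits] works on an enlargement of it. *)
pose A i w := box (5 / 2) w /\ cell 1 i (psi k w).
have b53 (w : C) : box (5 / 2) w -> box 3 w by move=> [h1 h2]; split; lra.
have oA i w : A i w -> \forall v \near (w : C^o), A i v.
  move=> [bw cw]; have n1 := box_nbhs bw.
  have n2 := gc_cont' gc (b53 _ bw) (cell_near cw).
  by near=> v; split; near: v.
have [|eps [K [eps0 K0 _ sol]]] :=
    @planar_splitting R J A (-2) 2 (-2) 2 oA ltac:(lra) ltac:(lra).
  move=> w [/andP[w1 w2] /andP[w3 w4]]; have [i ci] := cells_cover (psi k w).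
  by exists i; split=> //; split; rewrite ltr_norml; apply/andP; split; lra.
exists (K * M); first by rewrite mulr_ge0.
move=> f m m0 [fP fE].
have [||g [gP gE]] := sol (fun i j w => f i j (psi k w) / e k (psi k w)) (M * m).
- by rewrite mulr_ge0.
- split=> [i j w [bw ci] [_ cj]|i j l w [bw ci] [_ cj] [_ cl]]; last first.
    by rewrite -mulrDl fE.
  have Uw : U k (psi k w) by exact: (gc_U gc (b53 _ bw)).
  have [hf nf] := fP _ _ _ ci cj.
  have := sec_hol_change (cellU ci) Uw hf.
  move=> /(gc_hol gc Uw); rewrite (gc_K gc (b53 _ bw)) => hh.
  split; first exact: (holo1W hh).
  have -> : f i j (psi k w) / e k (psi k w) =
      (f i j (psi k w) / e i (psi k w)) * (e i (psi k w) / e k (psi k w)).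
    by rewrite mulrA divfK// e_neq0//; exact: cellU ci.
  rewrite nmM mulrC; apply: ler_pM; rewrite ?nm_ge0//.
  apply: MP; first by apply: cell_sub ci; lra.
  by split=> //; rewrite (gc_K gc (b53 _ bw)).
have enl y : cell 2 k y -> enlarged (-2) 2 (-2) 2 eps (z k y) /\ box (5 / 2) (z k y).
  move=> [_ [h1 h2]]; split; last by split; lra.
  by move: h1 h2; rewrite !ltr_norml => /andP[? ?] /andP[? ?];
    split; apply/andP; split; lra.
have inA i y : cell 2 k y -> cell 1 i y -> A i (z k y).
  by move=> ck ci; split; [exact: (enl _ ck).2 | rewrite (gc_K' gc (cellU ck))].
exists (fun i y => e k y * g i (z k y)); split=> [i y ck ci|i j y ck ci cj]; last first.
  rewrite -mulrBr gE; [|exact: (enl _ ck).1|exact: inA|exact: inA].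
  by rewrite (gc_K' gc (cellU ck)) mulrC divfK// e_neq0//; exact: cellU ck.
have Uy := cellU ck; have ey := e_neq0 Uy.
have [_ ng] := gP _ _ (enl _ ck).1 (inA _ _ ck ci).
split; last by rewrite mulrAC mulfV// mul1r -mulrA.
apply: (@hol_ext _ _ y (fun y' => g i (z k y'))); last first.
  have nU := gc_nbhs gc Uy; near=> y'.
  by rewrite mulrAC mulfV ?mul1r// e_neq0//; near: y'.
apply/(gc_hol gc Uy).
have n1 := oA _ _ (inA _ _ ck ci); have n2 := enlarged_open (enl _ ck).1.
apply: (@holo1_ext _ (g i)).
  have nb := box_nbhs (gc_box gc Uy); near=> w.
  by rewrite /= (gc_K gc)//; near: w.
near=> w; have [] // := gP i w; near: w; [exact: n2 | exact: n1].
Unshelve. all: by end_near.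
Qed.

(** On the cell of radius 2 of each chart [k] the cocycle splits as [G k i - G k j]. The difference
    [G l i - G k i] is then independent of [i]: it is a cocycle defined at radius 2 and cohomologous
    to [f]. The gain in domain, with bounds, is what makes compactness arguments available. *)
Lemma cocycle_improvement : exists2 K : R, 0 <= K & forall f m, 0 <= m ->
  cocycle_on 1 f m -> exists (h : J -> X -> C) f',
  [/\ forall k y, cell 1 k y -> sec_hol k y (h k) /\ nm (h k y / e k y) <= K * m,
      cocycle_on 2 f' (K * m)
    & forall k l y, cell 1 k y -> cell 1 l y -> f k l y = h k y - h l y + f' k l y].
Proof.
have [M M0 MP] := transition_bound.
have sk k : exists K : R, 0 <= K /\ forall f m, 0 <= m -> cocycle_on 1 f m ->
  exists G : J -> X -> C,
    (forall i y, cell 2 k y -> cell 1 i y ->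
       sec_hol k y (G i) /\ nm (G i y / e k y) <= K * m) /\
    (forall i j y, cell 2 k y -> cell 1 i y -> cell 1 j y ->
       G i y - G j y = f i j y).
  by have [K K0 KP] := chart_splitting k (ltW M0) MP; exists K.
have [Kf KfP] := choice sk.
pose K0 := \sum_k Kf k.
have Kle k : Kf k <= K0.
  by rewrite /K0 (bigD1 k)//= lerDl sumr_ge0// => l _; case: (KfP l).
have K00 : 0 <= K0 by rewrite sumr_ge0// => k _; case: (KfP k).
exists (K0 + M * K0); first by rewrite addr_ge0// mulr_ge0// ltW.
move=> f m m0 fc.
have [G GP] := choice (fun k => (KfP k).2 f m m0 fc).
(* A unit cell through each point serves to evaluate the expressions that do not depend on the
   cell. *)
have [idx idxP] := choice cells_cover.
have c12 k y : cell 1 k y -> cell 2 k y by apply: cell_sub; lra.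
have Gb k i y : cell 2 k y -> cell 1 i y -> nm (G k i y / e k y) <= K0 * m.
  move=> ck ci; have [_ H] := (GP k).1 i y ck ci; apply: le_trans H _.
  by apply: ler_wpM2r.
have f'E k l i y : cell 2 k y -> cell 2 l y -> cell 1 i y ->
    G l (idx y) y - G k (idx y) y = G l i y - G k i y.
  move=> ck cl ci; apply/eqP; rewrite -subr_eq0.
  have -> : G l (idx y) y - G k (idx y) y - (G l i y - G k i y) =
    (G l (idx y) y - G l i y) - (G k (idx y) y - G k i y) by ring.
  by rewrite (GP l).2// (GP k).2// subrr.
exists (fun k => G k k), (fun k l y => G l (idx y) y - G k (idx y) y); split.
- move=> k y ck; have [h1 h2] := (GP k).1 k y (c12 _ _ ck) ck; split=> //.
  apply: le_trans (Gb k k y (c12 _ _ ck) ck) _.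
  by apply: ler_wpM2r => //; rewrite lerDl mulr_ge0// ltW.
- split=> [k l y ck cl|j k l y _ _ _]; last by ring.
  have ci := idxP y; set i := idx y in ci *.
  have [h1 _] := (GP k).1 i y ck ci; have [h2 _] := (GP l).1 i y cl ci.
  split.
    have := sec_holB (sec_hol_change (cellU cl) (cellU ck) h2) h1.
    move=> hh; apply: hol_ext hh _.
    have n1 := cell_near ck; have n2 := cell_near cl; have n3 := cell_near ci.
    by near=> y'; rewrite (f'E k l i y')//; near: y'.
  rewrite mulrBl; apply: le_trans (nmB _ _) _; rewrite mulrDl addrC; apply: lerD.
    exact: Gb.
  have -> : G l i y / e k y = (G l i y / e l y) * (e l y / e k y).
    by rewrite mulrA divfK// e_neq0//; exact: cellU cl.
  rewrite nmM mulrC -mulrA; apply: ler_pM; rewrite ?nm_ge0//; last exact: Gb.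
  by apply: MP; [apply: cell_sub cl | apply: cell_sub ck]; lra.
- move=> k l y ck cl; rewrite (f'E k l l y (c12 _ _ ck) (c12 _ _ cl) cl).
  by rewrite -((GP k).2 k l y (c12 _ _ ck) ck cl); ring.
Unshelve. all: by end_near.
Qed.

End Atlas.

(** * Approximation of cocycles by finitely many *)

Section Finiteness.
Context {R : realType} (X : cspace R).
Hypothesis hX : compact_riemann_surface X.
Local Notation C := R[i].
Implicit Types (x y : X) (m : R).

(** [q n] bounds the tail, so the intervals of radius [q n] around the partial sums are nested and
    [nested_point] yields the sum. *)
Lemma dyadic_sum_real (u : nat -> R) (B : R) : (forall i, `|u i| <= B) ->
  exists S : R, forall n, `|S - \sum_(i < n) u i / 2 ^+ i| <= 2 * B / 2 ^+ n.
Proof.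
move=> uB; have B0 : 0 <= B := le_trans (normr_ge0 _) (uB 0%N).
pose q n : R := 2 * B / 2 ^+ n.
have qS n : q n = 2 * q n.+1.
  by rewrite /q exprS invfM; set t := (2 ^+ n)^-1; lra.
have uq n : `|u n / 2 ^+ n| <= q n.+1.
  rewrite normrM normfV (@ger0_norm _ (2 ^+ n))//.
  have t0 : 0 <= (2 ^+ n : R)^-1 by rewrite invr_ge0 exprn_ge0.
  have := ler_wpM2r t0 (uB n); rewrite /q exprS invfM.
  set t := (2 ^+ n)^-1; set v := `|_| * t; lra.
have [|||S SP] := @nested_point R (fun n => \sum_(i < n) u i / 2 ^+ i - q n)
    (fun n => 2 * q n).
- move=> n; rewrite big_ord_recr/=; have := uq n; rewrite ler_norml => /andP[h _].
  by have := qS n; lra.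
- move=> n; rewrite big_ord_recr/=; have := uq n; rewrite ler_norml => /andP[_ h].
  by have := qS n; lra.
- by move=> n; rewrite mulr_ge0// divr_ge0 ?mulr_ge0 ?exprn_ge0.
exists S => n; have /andP[h1 h2] := SP n; rewrite ler_norml -/(q n).
by apply/andP; split; lra.
Qed.

Lemma dyadic_sum (u : nat -> C) (B : R) : (forall i, nm (u i) <= B) ->
  exists S : C, forall n, nm (S - \sum_(i < n) u i / 2 ^+ i) <= 4 * B / 2 ^+ n.
Proof.
move=> uB.
have [a aP] := @dyadic_sum_real (fun i => complex.Re (u i)) B
  (fun i => le_trans (Re_nm _) (uB i)).
have [b bP] := @dyadic_sum_real (fun i => complex.Im (u i)) B
  (fun i => le_trans (Im_nm _) (uB i)).
exists (Complex a b) => n; apply: le_trans (nm_ReIm _) _.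
have E i : u i / 2 ^+ i = Complex (complex.Re (u i) / 2 ^+ i) (complex.Im (u i) / 2 ^+ i).
  have -> : (2 ^+ i : C)^-1 = ((2 ^+ i)^-1 : R)%:C%C.
    by rewrite fmorphV rmorphXn/= rmorph_nat.
  by case: (u i) => p q; apply/eqP; rewrite eq_complex/= !mulr0 subr0 add0r !eqxx.
have -> : \sum_(i < n) u i / 2 ^+ i =
    Complex (\sum_(i < n) complex.Re (u i) / 2 ^+ i) (\sum_(i < n) complex.Im (u i) / 2 ^+ i).
  by apply/eqP; rewrite eq_complex/= !raddf_sum/=; apply/andP; split;
    apply/eqP; apply: eq_bigr => i _; rewrite E.
have := aP n; have := bP n => /= h1 h2.
apply: le_trans (lerD h2 h1) _; rewrite -mulrDl -mulrDl.
by rewrite (_ : 2 + 2 = 4 :> R)//; lra.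
Qed.

Lemma dyadic_small (B e : R) : 0 < e -> exists n, B / 2 ^+ n < e.
Proof.
move=> e0; have B1 : 0 < `|B| + 1 by rewrite ltr_wpDl.
have [|||n nP] := @exp_small R (1 / 2) (e / (`|B| + 1)); [by lra|by lra|by rewrite divr_gt0|].
exists n; move: nP; rewrite ltr_pdivlMr// expr_div_n expr1n div1r mulrC.
have t0 : 0 <= (2 ^+ n : R)^-1 by rewrite invr_ge0 exprn_ge0.
have := ler_wpM2r t0 (ler_norm B); rewrite mulrDl; lra.
Qed.

Lemma dyadic_zero (a : C) (B : R) : (forall n, nm a <= B / 2 ^+ n) -> a = 0.
Proof.
move=> H; apply/eqP; rewrite -[_ == _]negbK -nm_gt0; apply/negP => a0.
by have [n] := dyadic_small B a0; have := H n; lra.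
Qed.

Variables (J : finType) (ctr : J -> X) (U : J -> set X) (z : J -> X -> C)
  (psi : J -> C -> X) (e : J -> X -> C).
Hypothesis gcs : forall k, good_chart (ctr k) (U k) (z k) (psi k).
Hypothesis e_neq0 : forall k y, U k y -> e k y != 0.
Hypothesis e_hol : forall k l y, U k y -> U l y -> hol y (fun y' => e k y' / e l y').
Local Notation cell := (cell U z).
Local Notation sec_hol := (sec_hol e).
Local Notation cocycle_on := (cocycle_on U z e).
Hypothesis cells_cover : forall y, exists k, cell 1 k y.

Lemma cell_psi (r : R) k w : r <= 3 -> box r w -> cell r k (psi k w).
Proof.
move=> r3 bw; have b3 : box 3 w by case: bw => h1 h2; split; exact: lt_le_trans r3.
by split; [exact: (gc_U (gcs k) b3) | rewrite (gc_K (gcs k) b3)].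
Qed.

Lemma sec_hol_series k (h : nat -> X -> C) (H : X -> C) (B : R) :
  (forall i y, cell 1 k y -> sec_hol k y (h i)) ->
  (forall n y, cell 1 k y ->
     nm (H y - \sum_(i < n) h i y / 2 ^+ i) <= B * nm (e k y) / 2 ^+ n) ->
  forall y, cell 1 k y -> sec_hol k y H.
Proof.
move=> hh HP y [Uy by1]; have gc := gcs k.
apply/(gc_hol gc Uy).
have lim : forall w, box 1 w -> cdiff ((fun y' => H y' / e k y') \o psi k) w.
  apply: uniform_limit => [w bw|eps eps0].
    by have /near_nm[r r0 rP] := box_nbhs bw; exists r.
  have [n nP] := dyadic_small B eps0.
  exists (fun w => \sum_(i < n) (h i (psi k w) / e k (psi k w)) * (2 ^+ i)^-1) => w bw.
    have [Uw _] := @cell_psi 1 k w ltac:(lra) bw.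
    have b3 : box 3 w by case: bw => h1 h2; split; lra.
    apply: cdiff_sum => i; apply: cdiffM; last exact: cdiff_cst.
    apply: holo1W; rewrite -(gc_K gc b3).
    apply/(@gc_hol _ _ _ _ _ _ gc _ Uw (fun y' => h i y' / e k y')).
    by apply: hh; apply: cell_psi => //; lra.
  have cw : cell 1 k (psi k w) by apply: cell_psi => //; lra.
  have ew := e_neq0 (cellU cw).
  rewrite /= (_ : \sum_(i < n) _ = (\sum_(i < n) h i (psi k w) / 2 ^+ i) / e k (psi k w)).
    rewrite -mulrBl nmM nmV ler_pdivrMr ?nm_gt0//.
    apply: le_trans (HP n _ cw) _; rewrite mulrAC ler_wpM2r ?nm_ge0//.
    exact: ltW.
  by rewrite mulr_suml; apply: eq_bigr => i _; rewrite mulrAC.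
have := box_nbhs by1; apply: filterS => w bw; exact: lim.
Qed.

(** The neighbourhood comes from [cauchy_estimate] and therefore depends on the bound [K] but not on
    the cocycle. *)
Lemma equicontinuity (K eps : R) x k l : 0 <= K -> 0 < eps ->
  cell 2 k x -> cell 2 l x ->
  \forall y \near x, forall f, cocycle_on 2 f K ->
    nm (f k l y / e k y - f k l x / e k x) <= eps.
Proof.
move=> K0 eps0 ck cl; have gc := gcs k; have Ux := cellU ck.
have b3 := gc_box gc Ux.
have ncell : \forall w \near (z k x : C^o), [/\ cell 2 k (psi k w), cell 2 l (psi k w) & box 3 w].
  have nb := box_nbhs b3.
  have n1 := cell_near gcs ck; have n2 := cell_near gcs cl.
  have := gc_cont' gc b3; rewrite (gc_K' gc Ux) => cc.
  have m1 := cc _ n1; have m2 := cc _ n2.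
  by near=> w; split; near: w.
have /near_nm[r' r'0 rP] := ncell.
pose r := r' / 4; have r0 : 0 < r by rewrite divr_gt0.
have sqP w : square (z k x) r w -> [/\ cell 2 k (psi k w), cell 2 l (psi k w) & box 3 w].
  by move=> /square_nm h; apply: rP; apply: le_lt_trans h _; rewrite /r; lra.
pose c := 32 / nm (kappa : C) * K / r.
have c0 : 0 <= c.
  by rewrite /c divr_ge0 ?mulr_ge0 ?invr_ge0 ?nm_ge0// ltW.
pose dl := Num.min (r / 2) (eps / (c + 1)).
have c1 : 0 < c + 1 by lra.
have dl0 : 0 < dl by rewrite lt_min !divr_gt0.
have nz := gc_cont gc Ux (near_disc (z k x : C^o) dl0).
have nU := gc_nbhs gc Ux.
near=> y => f [fP _].
have Uy : U k y by near: y.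
have : nm (z k y - z k x) < dl by near: y.
rewrite lt_min => /andP[d1 d2].
have := @cauchy_estimate R (fun w => f k l (psi k w) / e k (psi k w)) (z k x) r K (z k y) r0.
rewrite (gc_K' gc Uy) (gc_K' gc Ux) -/c => /(_ _ _ (ltW d1)) est.
apply: le_trans (est _ _) _.
- move=> w /sqP[ck' cl' bw]; have [hf _] := fP _ _ _ ck' cl'.
  by move/(gc_hol gc (cellU ck')): hf; rewrite (gc_K gc bw); exact: holo1W.
- by move=> w /sqP[ck' cl' _]; case: (fP _ _ _ ck' cl').
- move: d2; rewrite ltr_pdivlMr// mulrC => d2.
  by apply: le_trans (ltW d2); rewrite ler_wpM2r ?nm_ge0//; lra.
Unshelve. all: by end_near.
Qed.

Lemma grid_close (K a b : R) : `|a| <= K -> `|b| <= K ->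
  Num.truncn (16 * (a + K)) = Num.truncn (16 * (b + K)) -> `|a - b| <= 1 / 16.
Proof.
rewrite !ler_norml => /andP[a1 a2] /andP[b1 b2] E.
have := @truncn_itv R (16 * (a + K)) ltac:(lra).
have := @truncn_itv R (16 * (b + K)) ltac:(lra).
rewrite -E; set t := Num.truncn _; rewrite -(natr1 t) => /andP[h1 h2] /andP[h3 h4].
by apply/andP; split; lra.
Qed.

(* Montel's theorem as total boundedness: a cocycle on the larger cells is
   determined up to 1/2 on the smaller cells by finitely many approximate values. *)
Lemma montel_net (K : R) : 0 <= K ->
  exists (D : finType) (beta : D -> J -> J -> X -> C),
  (forall d, cocycle_on 2 (beta d) K) /\
  forall f, cocycle_on 2 f K -> exists d, forall k l y, cell 1 k y -> cell 1 l y ->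
    nm ((f k l y - beta d k l y) / e k y) <= 1 / 2.
Proof.
move=> K0; have [_ _ cX _] := hX.
(* The error budget: 1/8 for each of the two cocycles when [y] is replaced by a net point [x], and
   1/16 each for the real and imaginary parts of the values at [x], sorted by a grid of mesh 1/16.
   The sum 3/8 is below 1/2. *)
have loc x : \forall y \near x, forall kl : J * J, cell 1 kl.1 y -> cell 1 kl.2 y ->
    [/\ cell 2 kl.1 x, cell 2 kl.2 x & forall f, cocycle_on 2 f K ->
    nm (f kl.1 kl.2 y / e kl.1 y - f kl.1 kl.2 x / e kl.1 x) <= 1 / 8].
  apply: filter_forall => -[k l] /=.
  have [ck|nk] := pselect (cell 2 k x); last first.
    have n1 := @cell_sep _ _ hX _ _ _ _ _ gcs 1 2 k x ltac:(lra) ltac:(lra) nk.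
    by apply: filterS n1 => y n1 /n1.
  have [cl|nl] := pselect (cell 2 l x); last first.
    have n1 := @cell_sep _ _ hX _ _ _ _ _ gcs 1 2 l x ltac:(lra) ltac:(lra) nl.
    by apply: filterS n1 => y n1 _ /n1.
  by have := @equicontinuity K (1 / 8) x k l K0 ltac:(lra) ck cl; apply: filterS.
have [s sP] := finite_cover cX loc.
pose N := Num.truncn (16 * (K + K)).
pose grid (a : R) : 'I_N.+1 := inord (Num.truncn (16 * (a + K))).
have gridP a b : `|a| <= K -> `|b| <= K -> grid a = grid b -> `|a - b| <= 1 / 16.
  have gN (t : R) : `|t| <= K -> (Num.truncn (16 * (t + K)) < N.+1)%N.
    rewrite ler_norml => /andP[_ t2]; rewrite ltnS; apply: le_truncn; lra.
  move=> ha hb E; apply: (@grid_close K) => //.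
  by have := congr1 (@nat_of_ord _) E; rewrite /grid !inordK ?gN.
pose Q := ('I_(size s) * J * J)%type.
pose val f (q : Q) : C :=
  let x := tnth (in_tuple s) q.1.1 in f q.1.2 q.2 x / e q.1.2 x.
pose code f : {ffun Q -> 'I_N.+1 * 'I_N.+1} :=
  [ffun q => (grid (complex.Re (val f q)), grid (complex.Im (val f q)))].
have zc : cocycle_on 2 (fun _ _ _ => 0) K.
  split=> [k l y _ _|j k l y _ _ _]; last by rewrite addr0.
  by rewrite mul0r nm0; split=> //; apply: (hol_ext (hol_cst y 0));
    apply: nearW => y'; rewrite mul0r.
(* One cocycle for every code that occurs; the zero cocycle fills the codes that do not. *)
have [beta betaP] := choice (fun d : {ffun Q -> 'I_N.+1 * 'I_N.+1} =>
  match pselect (exists2 f, cocycle_on 2 f K & code f = d) return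
    exists b, cocycle_on 2 b K /\ ((exists2 f, cocycle_on 2 f K & code f = d) -> code b = d) with
  | left h => let: ex_intro2 f h1 h2 := h in ex_intro _ f (conj h1 (fun _ => h2))
  | right h => ex_intro _ (fun _ _ _ => 0) (conj zc (fun h' => False_ind _ (h h')))
  end).
exists _, beta; split=> [d|f fc]; first by case: (betaP d).
exists (code f) => k l y ck cl.
have [bc] := betaP (code f); set b := beta _ in bc *.
move=> /(_ (ex_intro2 _ _ f fc erefl)) E.
have [x xs /(_ (k, l) ck cl)/= [ckx clx H]] := sP y.
have [i xE] := seq_tnthP xs.
have := congr1 (fun F : {ffun Q -> 'I_N.+1 * 'I_N.+1} => F (i, k, l)) E.
rewrite !ffunE => -[]; rewrite /val/= -xE => E1 E2.
have [_ nb] := bc.1 _ _ _ ckx clx; have [_ nf] := fc.1 _ _ _ ckx clx.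
have h1 := gridP _ _ (le_trans (Re_nm _) nb) (le_trans (Re_nm _) nf) E1.
have h2 := gridP _ _ (le_trans (Im_nm _) nb) (le_trans (Im_nm _) nf) E2.
have h3 : nm (b k l x / e k x - f k l x / e k x) <= 1 / 8.
  by apply: le_trans (nm_ReIm _) _; rewrite !raddfB/=; lra.
have h4 := H f fc; have h5 := H b bc.
rewrite mulrBl; set p := f k l y / _ in h4 *; set q := b k l y / _ in h5 *.
set p' := f k l x / _ in h3 h4; set q' := b k l x / _ in h3 h5.
apply: le_trans (nm_tri p q p') _.
have := nm_tri p' q q'; rewrite (nm_distC p' q') (nm_distC q' q); lra.
Qed.

(** The net shows that the first cohomology is spanned by the finitely many [beta d]. One step
    writes a cocycle bounded by 1 as a coboundary plus some [beta d] plus half of another cocycle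
    bounded by 1. Iteration gives series with weights 2^-i: [H] sums the cochains, and [c d] sums
    the weights of the steps at which [d] was chosen. *)
Lemma cocycle_decomposition : exists (D : finType) (beta : D -> J -> J -> X -> C),
  forall f m, 0 < m -> cocycle_on 1 f m -> exists (c : D -> C) (H : J -> X -> C),
  (forall k y, cell 1 k y -> sec_hol k y (H k)) /\
  (forall k l y, cell 1 k y -> cell 1 l y ->
     f k l y = H k y - H l y + \sum_d c d * beta d k l y).
Proof.
have [K K0 KP] := cocycle_improvement hX gcs e_neq0 e_hol cells_cover.
have [D [beta [betaP net]]] := montel_net K0.
exists D, beta.
suff main f : cocycle_on 1 f 1 -> exists (c : D -> C) (H : J -> X -> C),
  (forall k y, cell 1 k y -> sec_hol k y (H k)) /\
  (forall k l y, cell 1 k y -> cell 1 l y ->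
     f k l y = H k y - H l y + \sum_d c d * beta d k l y).
  move=> f m m0 [fP fE].
  have mC : (m%:C%C : C) != 0 by rewrite -nm_gt0 nmR gtr0_norm.
  have [|c [H [HP HE]]] := main (fun k l y => (m%:C%C)^-1 * f k l y).
    split=> [k l y ck cl|j k l y cj ck cl]; last by rewrite -mulrDr fE.
    have [h1 h2] := fP _ _ _ ck cl; split; first exact: sec_holZ.
    by rewrite -mulrA nmM nmV nmR gtr0_norm// mulrC ler_pdivrMr// mul1r.
  exists (fun d => m%:C%C * c d), (fun k y => m%:C%C * H k y); split.
    by move=> k y ck; apply: sec_holZ; exact: HP.
  move=> k l y ck cl; have := HE k l y ck cl => /(congr1 ( *%R m%:C%C)).
  rewrite mulrA mulfV// mul1r => ->; rewrite mulrDr mulrBr mulr_sumr.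
  by congr (_ + _); apply: eq_bigr => d _; rewrite mulrA.
have c12 k y : cell 1 k y -> cell 2 k y by apply: cell_sub; lra.
pose good g (t : (J -> X -> C) * (J -> J -> X -> C) * D) := 
  [/\ forall k y, cell 1 k y -> sec_hol k y (t.1.1 k) /\ nm (t.1.1 k y / e k y) <= K,
      cocycle_on 1 t.1.2 1
    & forall k l y, cell 1 k y -> cell 1 l y ->
      g k l y = t.1.1 k y - t.1.1 l y + beta t.2 k l y + t.1.2 k l y / 2].
have step g : cocycle_on 1 g 1 -> exists t, good g t.
  move=> gc; have [h [f' [h1 h2 h3]]] := KP _ _ ler01 gc.
  rewrite mulr1 in h1 h2.
  have [d dP] := net _ h2.
  exists (h, (fun k l y => 2 * (f' k l y - beta d k l y)), d); split=> //=; last first.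
    by move=> k l y ck cl; rewrite h3//; field.
  split=> [k l y ck cl|j k l y cj ck cl].
    have [p1 _] := h2.1 _ _ _ (c12 _ _ ck) (c12 _ _ cl).
    have [p2 _] := (betaP d).1 _ _ _ (c12 _ _ ck) (c12 _ _ cl).
    split; first exact: (sec_holZ 2 (sec_holB p1 p2)).
    have := dP _ _ _ ck cl; rewrite -mulrA (nmM 2).
    rewrite nm2.
    by lra.
  rewrite -(h2.2 j k l) -?((betaP d).2 j k l); try exact: c12.
  by ring.
move=> fc.
have [d0 _] : exists d : D, True by have [t _] := step f fc; exists t.2.
have [stp stpP] := choice (fun g => match pselect (cocycle_on 1 g 1) return
    exists t, cocycle_on 1 g 1 -> good g t with
  | left h => let: ex_intro t ht := step g h in ex_intro _ t (fun _ => ht)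
  | right h => ex_intro _ ((fun _ _ => 0), (fun _ _ _ => 0), d0) (fun h' => False_ind _ (h h'))
  end).
pose g n := iter n (fun g => (stp g).1.2) f.
have gP n : cocycle_on 1 (g n) 1.
  by elim: n => [//|n IH]; have [_ ] := stpP _ IH.
pose h n := (stp (g n)).1.1; pose d n := (stp (g n)).2.
have hP n k y : cell 1 k y -> sec_hol k y (h n k) /\ nm (h n k y / e k y) <= K.
  by have [H _ _] := stpP _ (gP n); exact: H.
have gE n k l y : cell 1 k y -> cell 1 l y ->
    g n k l y = h n k y - h n l y + beta (d n) k l y + g n.+1 k l y / 2.
  by have [_ _ H] := stpP _ (gP n); exact: H.
have sumE n k l y : cell 1 k y -> cell 1 l y -> f k l y =
    \sum_(i < n) h i k y / 2 ^+ i - \sum_(i < n) h i l y / 2 ^+ i +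
    \sum_(i < n) beta (d i) k l y / 2 ^+ i + g n k l y / 2 ^+ n.
  move=> ck cl; elim: n => [|n IH].
    by rewrite !big_ord0 subrr !add0r expr0 divr1.
  rewrite {1}IH !big_ord_recr/= (gE n k l y ck cl) exprS.
  have t0 : (2 ^+ n : C) != 0 by rewrite expf_neq0// pnatr_eq0.
  by change (stp (g n)).1.2 with (g n.+1); field.
have Hex k y : exists S, cell 1 k y -> forall n,
    nm (S - \sum_(i < n) h i k y / 2 ^+ i) <= 4 * K * nm (e k y) / 2 ^+ n.
  have [ck|nk] := pselect (cell 1 k y); last by exists 0 => /nk.
  have [|S SP] := @dyadic_sum (fun i => h i k y) (K * nm (e k y)).
    move=> i; have [_] := hP i k y ck.
    by rewrite nmM nmV ler_pdivrMr// nm_gt0 e_neq0//; exact: cellU ck.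
  by exists S => _ n; rewrite -(mulrA 4); exact: SP.
have [Hf HfP] := choice (fun ky : J * X => Hex ky.1 ky.2).
pose H k y := Hf (k, y).
have HP k y : cell 1 k y -> forall n,
  nm (H k y - \sum_(i < n) h i k y / 2 ^+ i) <= 4 * K * nm (e k y) / 2 ^+ n := HfP (k, y).
have cex (d' : D) : exists S : C, forall n,
    nm (S - \sum_(i < n) (d i == d')%:R / 2 ^+ i) <= 4 / 2 ^+ n.
  have [|S SP] := @dyadic_sum (fun i => (d i == d')%:R) 1.
    by move=> i; case: eqP; rewrite ?nm1 ?nm0.
  by exists S => n; have := SP n; rewrite mulr1.
have [c cP] := choice cex.
exists c, H; split=> [k y ck|k l y ck cl].
  by apply: (sec_hol_series (fun i y' c1 => (hP i k y' c1).1) (fun n y' c1 => HP k y' c1 n)).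
apply/eqP; rewrite -subr_eq0; apply/eqP.
pose B := 4 * K * nm (e k y) + 4 * K * nm (e l y) +
  \sum_d' 4 * nm (beta d' k l y) + nm (e k y).
apply: (@dyadic_zero _ B) => n.
have -> : f k l y - (H k y - H l y + \sum_d c d * beta d k l y) =
    - (H k y - \sum_(i < n) h i k y / 2 ^+ i) + (H l y - \sum_(i < n) h i l y / 2 ^+ i)
    - \sum_d' (c d' - \sum_(i < n) (d i == d')%:R / 2 ^+ i) * beta d' k l y
    + g n k l y / 2 ^+ n.
  rewrite (sumE n k l y ck cl).
  have -> : \sum_d' (c d' - \sum_(i < n) (d i == d')%:R / 2 ^+ i) * beta d' k l y =
      \sum_d' c d' * beta d' k l y - \sum_(i < n) beta (d i) k l y / 2 ^+ i.
    under eq_bigr => d' _ do rewrite mulrBl mulr_suml.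
    rewrite sumrB exchange_big/=; congr (_ - _); apply: eq_bigr => i _.
    rewrite (bigD1 (d i))//= eqxx mul1r mulrC big1 ?addr0// => d' nd.
    by rewrite eq_sym (negPf nd) !mul0r.
  by ring.
have -> : B / 2 ^+ n = 4 * K * nm (e k y) / 2 ^+ n + 4 * K * nm (e l y) / 2 ^+ n +
    (\sum_d' 4 * nm (beta d' k l y)) / 2 ^+ n + nm (e k y) / 2 ^+ n by rewrite /B; ring.
apply: le_trans (nmD _ _) _; apply: lerD.
  apply: le_trans (nmB _ _) _; apply: lerD.
    apply: le_trans (nmD _ _) _; rewrite nmN; apply: lerD; exact: HP.
  rewrite mulr_suml; apply: le_trans (nm_sum _ _ _) _.
  apply: ler_sum => d' _; rewrite nmM mulrAC; apply: ler_pM; rewrite ?nm_ge0//; exact: cP.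
have [_] := (gP n).1 k l y ck cl; rewrite nmM nmV ler_pdivrMr; last first.
  by rewrite nm_gt0 e_neq0//; exact: cellU ck.
rewrite mul1r => hg; rewrite nmM nmV nmX.
rewrite nm2.
by rewrite ler_wpM2r// invr_ge0 exprn_ge0.
Qed.

End Finiteness.

Lemma linear_dependence (F : fieldType) (A B : finType) (M : A -> B -> F) :
  (#|B| < #|A|)%N ->
  exists2 v : A -> F, exists a, v a != 0 & forall b, \sum_a v a * M a b = 0.
Proof.
move=> BA; pose N := \matrix_(i < #|A|, j < #|B|) M (enum_val i) (enum_val j).
have : kermx N != 0.
  rewrite kermx_eq0 -row_leq_rank; apply/negP => h.
  by have := leq_trans h (rank_leq_col N); rewrite leqNgt BA.
case/matrix0Pn => i [j nz].
exists (fun a => kermx N i (enum_rank a)); first by exists (enum_val j); rewrite enum_valK.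
move=> b; have := mulmx_ker N => /matrixP/(_ i (enum_rank b)).
rewrite !mxE; apply: etrans.
rewrite (reindex_onto _ _ (fun (a : A) _ => enum_rankK a))/=.
apply: eq_big => [k|k _]; first by rewrite enum_valK eqxx.
by rewrite !mxE enum_valK enum_rankK.
Qed.

(** * Isolated points and Taylor expansions *)

Section LocalExpansion.
Context {R : realType} (X : cspace R).
Hypothesis hX : compact_riemann_surface X.
Local Notation C := R[i].

Lemma finite_of_isolated (S : set X) : (forall x, \forall y \near x^', ~ S y) ->
  finite_set S.
Proof.
have [_ _ cX _] := hX.
move=> H; have [s sP] := @finite_cover X (fun x => [set y | y != x -> ~ S y]) cX
  (fun x => (punctP x (fun y => ~ S y)).1 (H x)).
apply: sub_finite_set (finite_seq s) => y Sy.
have [x xs h] := sP y; have [<-//|/eqP ne] := eqVneq x y.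
by exfalso; apply: h => //; apply/eqP => E; apply: ne; rewrite E.
Qed.

Lemma hol_slope q U (z : X -> C) psi f : good_chart q U z psi -> hol q f ->
  exists2 g, hol q g & \forall y \near q, f y = f q + z y * g y.
Proof.
move=> gc hf; have [E|[[|k] [u [hu u0 E]]]] := hol_factor gc (holB hf (hol_cst q (f q))).
- exists (fun=> 0); first exact: hol_cst.
  by apply: filterS E => y /eqP; rewrite subr_eq0 => /eqP ->; rewrite mulr0 addr0.
- have := nbhs_singleton E; rewrite subrr expr0 mul1r => /esym/eqP.
  by rewrite (negPf u0).
- exists (fun y => z y ^+ k * u y).
    by apply: holM hu; apply: holX; exact: gc_zhol gc _ (gc_in gc).
  by apply: filterS E => y /eqP; rewrite subr_eq => /eqP ->; rewrite exprS mulrA addrC.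
Qed.

Lemma taylor q U (z : X -> C) psi f (n : nat) : good_chart q U z psi -> hol q f ->
  exists (t : nat -> C) g, hol q g /\
    \forall y \near q, f y = \sum_(i < n) t i * z y ^+ i + z y ^+ n * g y.
Proof.
move=> gc hf; elim: n => [|n [t [g [hg E]]]].
  exists (fun=> 0), f; split=> //; apply: nearW => y.
  by rewrite big_ord0 add0r expr0 mul1r.
have [h hh E'] := hol_slope gc hg.
exists (fun i => if i == n then g q else t i), h; split=> //.
near=> y; have -> : f y = \sum_(i < n) t i * z y ^+ i + z y ^+ n * g y by near: y.
have -> : g y = g q + z y * h y by near: y.
rewrite big_ord_recr/= eqxx -addrA; congr (_ + _).
  by apply: eq_bigr => i _; rewrite ltn_eqF.
by rewrite exprSr; ring.
Unshelve. all: by end_near.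
Qed.

End LocalExpansion.

(** * Sections with prescribed poles and zeros *)

Section MittagLeffler.
Context {R : realType} (X : cspace R).
Hypothesis hX : compact_riemann_surface X.
Local Notation C := R[i].
Implicit Types (x y : X).
Variables (J : finType) (ctr : J -> X) (U : J -> set X) (z : J -> X -> C)
  (psi : J -> C -> X) (e : J -> X -> C).
Hypothesis gcs : forall k, good_chart (ctr k) (U k) (z k) (psi k).
Hypothesis e_neq0 : forall k y, U k y -> e k y != 0.
Hypothesis e_hol : forall k l y, U k y -> U l y -> hol y (fun y' => e k y' / e l y').
Local Notation cell := (cell U z).
Local Notation sec_hol := (sec_hol e).
Local Notation cocycle_on := (cocycle_on U z e).
Hypothesis cells_cover : forall y, exists k, cell 1 k y.

Definition principal_part (k0 : J) (j : nat) (k : J) y : C :=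
  if k == k0 then e k y * (z k y ^+ j)^-1 else 0.

(** If the pole lies in no other chart, the principal part placed in chart [k0] and 0 elsewhere
    differ holomorphically on all overlaps. *)
Definition exclusive (k0 : J) : Prop := forall l, l != k0 -> ~ U l (ctr k0).

Lemma principal_part_hol k0 j k y : y != ctr k0 -> U k y ->
  sec_hol k y (principal_part k0 j k).
Proof.
move=> yp Uy; rewrite /principal_part.
have [kk0|_] := eqVneq k k0; last first.
  apply: hol_ext (hol_cst y 0) _; apply: nearW => y'; by rewrite mul0r.
rewrite -kk0 in yp; have gc := gcs k.
have zy : z k y != 0 by rewrite (gc_z_eq0 gc).
apply: (@hol_ext _ _ y (fun y' => (z k y' ^+ j)^-1)).
  by apply: holV; [apply: holX; exact: gc_zhol gc _ Uy | rewrite expf_neq0].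
have nU := gc_nbhs gc Uy; near=> y'.
by rewrite mulrAC mulfV ?mul1r// e_neq0//; near: y'.
Unshelve. all: by end_near.
Qed.

(** The other unit cells keep a distance [dl] from the pole, because by [cell_sep] they avoid a
    neighbourhood of it; this bounds z^-j on overlaps. *)
Lemma principal_cocycle k0 j : exclusive k0 -> exists2 m : R, 0 < m &
  cocycle_on 1 (fun k l y => principal_part k0 j k y - principal_part k0 j l y) m.
Proof.
move=> ex; have [M M0 MP] := transition_bound hX gcs e_hol.
have gc := gcs k0.
have : \forall y \near ctr k0, forall l, l != k0 -> ~ cell 1 l y.
  apply: filter_forall => l; have [_|lk] := eqVneq l k0; first exact: nearW.
  have nl : ~ cell 2 l (ctr k0) by move=> /cellU; exact: ex.
  have := @cell_sep _ _ hX _ _ _ _ _ gcs 1 2 l (ctr k0) ltac:(lra) ltac:(lra) nl.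
  by apply: filterS.
move=> /(gc_near gc) /near_nm[dl dl0 dlP].
have far l y : l != k0 -> cell 1 k0 y -> cell 1 l y -> dl <= nm (z k0 y).
  move=> lk ck cl; rewrite leNgt; apply/negP => h.
  have := dlP (z k0 y); rewrite subr0 (gc_K' gc (cellU ck)) => /(_ h l lk); exact.
have b0 : 0 < (dl ^+ j)^-1 by rewrite invr_gt0 exprn_gt0.
have zb l y : l != k0 -> cell 1 k0 y -> cell 1 l y -> nm ((z k0 y ^+ j)^-1) <= (dl ^+ j)^-1.
  move=> lk ck cl; have h := far _ _ lk ck cl.
  rewrite nmV nmX lef_pV2 ?posrE ?exprn_gt0//; last exact: lt_le_trans h.
  by apply: lerXn2r; rewrite ?nnegrE ?nm_ge0// ltW.
have np l y : l != k0 -> U l y -> y != ctr k0.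
  by move=> lk Ul; apply/eqP => E; apply: (ex l lk); rewrite -E.
exists ((1 + M) * (dl ^+ j)^-1); first by rewrite mulr_gt0// addr_gt0.
split=> [k l y ck cl|j' k l y _ _ _]; last by ring.
have bM : (dl ^+ j)^-1 <= (1 + M) * (dl ^+ j)^-1.
  by rewrite ler_peMl ?(ltW b0)//; lra.
have bM' : M * (dl ^+ j)^-1 <= (1 + M) * (dl ^+ j)^-1.
  by rewrite ler_wpM2r ?(ltW b0)//; lra.
have [->|kl] := eqVneq k l.
  split.
    apply: hol_ext (hol_cst y 0) _; apply: nearW => y'; by rewrite subrr mul0r.
  by rewrite subrr mul0r nm0 (le_trans _ bM)// ltW.
have yp : y != ctr k0.
  have [kk|/np] := eqVneq k k0; last by apply; exact: cellU ck.
  by apply: (np l); [rewrite -kk eq_sym | exact: cellU cl].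
split.
  apply: sec_holB; first exact: principal_part_hol yp (cellU ck).
  apply: (sec_hol_change gcs e_neq0 e_hol (cellU cl) (cellU ck)).
  exact: principal_part_hol yp (cellU cl).
rewrite /principal_part.
have [kk|kk] := eqVneq k k0.
  have lk : l != k0 by rewrite -kk eq_sym.
  rewrite (negPf lk) subr0 mulrAC mulfV ?mul1r; last exact: e_neq0 (cellU ck).
  by apply: (le_trans _ bM); rewrite kk; apply: (zb l y lk _ cl); rewrite -kk.
have [lk|lk] := eqVneq l k0; last first.
  by rewrite subr0 mul0r nm0 (le_trans _ bM)// ltW.
rewrite sub0r mulNr nmN mulrAC nmM; apply: (le_trans _ bM').
apply: ler_pM; rewrite ?nm_ge0//.
  by apply: MP; [apply: cell_sub cl | apply: cell_sub ck]; lra.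
by rewrite lk; apply: (zb k) => //; rewrite -lk.
Qed.

(* The number [N] of linear conditions needed to solve the Mittag-Leffler problem
   does not depend on the orders of the poles. *)
Lemma mittag_leffler : exists N : nat,
  forall (A Q : finType) (own : A -> J) (ord : A -> nat) (q : Q -> X) (m : Q -> nat),
  (forall a, exclusive (own a)) ->
  (forall a b, own a = own b -> ord a = ord b -> a = b) ->
  (forall a, 0 < ord a)%N ->
  (forall a i, q i != ctr (own a)) ->
  (N + \sum_i m i < #|A|)%N ->
  exists s : X -> C,
  [/\ forall k y, cell 1 k y -> (forall a, y != ctr (own a)) -> sec_hol k y s,
      forall k j, (forall a, own a = k -> (ord a <= j)%N) -> exists2 F, hol (ctr k) F &
        \forall y \near (ctr k)^', s y / e k y = (z k y ^+ j)^-1 * F y,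
      forall i, exists k V w phi g, [/\ cell 1 k (q i), good_chart (q i) V w phi,
        hol (q i) g & \forall y \near q i, s y / e k y = w y ^+ m i * g y]
    & exists a, \forall y \near (ctr (own a))^', s y != 0].
Proof.
have [D [beta dec]] := cocycle_decomposition hX gcs e_neq0 e_hol cells_cover.
exists #|D| => A Q own ord q m ex inj ord0 qP cardA.
pose sg a k y := principal_part (own a) (ord a) k y.
have decA a : exists t : (D -> C) * (J -> X -> C),
    (forall k y, cell 1 k y -> sec_hol k y (t.2 k)) /\
    (forall k l y, cell 1 k y -> cell 1 l y ->
     sg a k y - sg a l y = t.2 k y - t.2 l y + \sum_d t.1 d * beta d k l y).
  have [m0 m00 mP] := @principal_cocycle (own a) (ord a) (ex a).
  by have [c [H HP]] := dec _ _ m00 mP; exists (c, H).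
have [t tP] := choice decA.
pose c a := (t a).1; pose H a := (t a).2.
have HP a k y : cell 1 k y -> sec_hol k y (H a k) by case: (tP a) => h _; exact: h.
have HE a k l y : cell 1 k y -> cell 1 l y ->
  sg a k y - sg a l y = H a k y - H a l y + \sum_d c a d * beta d k l y.
  by case: (tP a) => _ h; exact: h.
have [idx idxP] := choice cells_cover.
have sgh a k y : cell 1 k y -> y != ctr (own a) ->
    sec_hol k y (fun y' => sg a k y' - H a k y').
  move=> ck ya; apply: sec_holB; last exact: HP.
  exact: principal_part_hol ya (cellU ck).
have chartQ i : exists ch : set X * (X -> C) * (C -> X), good_chart (q i) ch.1.1 ch.1.2 ch.2.
  by have [V [w [phi gc]]] := chart_at hX (q i); exists (V, w, phi).
have [ch chP] := choice chartQ; pose w i := (ch i).1.2.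
have taylorA (ai : A * Q) : exists tr : (nat -> C) * (X -> C),
    hol (q ai.2) tr.2 /\ \forall y \near q ai.2,
      (sg ai.1 (idx (q ai.2)) y - H ai.1 (idx (q ai.2)) y) / e (idx (q ai.2)) y =
      \sum_(j < m ai.2) tr.1 j * w ai.2 y ^+ j + w ai.2 y ^+ m ai.2 * tr.2 y.
  case: ai => a i /=.
  have [t' [g [hg E]]] := taylor (m i) (chP i) (sgh a _ _ (idxP (q i)) (qP a i)).
  by exists (t', g).
have [tr trP] := choice taylorA.
(* The linear conditions on the coefficients [v a]: one for each [beta d], to kill the obstruction
   to gluing, and one for each Taylor coefficient that must vanish at a point [q i]. *)
pose B := (D + {i : Q & 'I_(m i)})%type.
pose Mx a (b : B) : C := match b with
  | inl d => c a d | inr ij => (tr (a, tag ij)).1 (tagged ij) end.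
have [|v [a0 va0] vE] := @linear_dependence C A B Mx.
  rewrite card_sum card_tagged sumnE big_map big_enum/=.
  by under eq_bigr => i _ do rewrite card_ord.
(* With the obstruction gone, the local sections agree on overlaps, so the choice [idx y] does not
   matter. *)
pose s y := \sum_a v a * (sg a (idx y) y - H a (idx y) y).
have sE k y : cell 1 k y -> s y = \sum_a v a * (sg a k y - H a k y).
  move=> ck; have cl := idxP y; rewrite /s; set l := idx y in cl *.
  apply/eqP; rewrite -subr_eq0 -sumrB; apply/eqP.
  transitivity (\sum_a \sum_d v a * c a d * beta d l k y).
    apply: eq_bigr => a _; rewrite -mulrBr.
    have := HE a l k y cl ck => E.
    have -> : sg a l y - H a l y - (sg a k y - H a k y) =
      (sg a l y - sg a k y) - (H a l y - H a k y) by ring.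
    rewrite E addrC addKr mulr_sumr.
    by apply: eq_bigr => d _; rewrite mulrA.
  rewrite exchange_big/= big1// => d _.
  by rewrite -mulr_suml; have := vE (inl d) => /= ->; rewrite mul0r.
have polar k : exists2 h, hol (ctr k) h & \forall y \near (ctr k)^',
    s y / e k y = \sum_(a | own a == k) v a * (z k y ^+ ord a)^-1 - h y.
  have gc := gcs k.
  have ck : cell 1 k (ctr k).
    by split; [exact: gc_in gc | rewrite (gc_0 gc); exact: box0].
  exists (fun y => \sum_a v a * (H a k y / e k y)).
    apply: hol_sum => a _; apply: holM; [exact: hol_cst | exact: HP].
  apply: punctW; have nc := cell_near gcs ck; near=> y.
  have cy : cell 1 k y by near: y.
  rewrite (sE k y cy) mulr_suml.
  under eq_bigr => a _ do rewrite -mulrA mulrBl mulrBr.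
  rewrite sumrB; congr (_ - _).
  rewrite [RHS]big_mkcond/=; apply: eq_bigr => a _; rewrite /sg /principal_part eq_sym.
  case: eqP => _; last by rewrite mul0r mulr0.
  by rewrite mulrAC mulfV ?mul1r// e_neq0//; exact: cellU cy.
exists s; split.
- move=> k y ck ya; apply: (@hol_ext _ _ y
    (fun y' => \sum_a v a * ((sg a k y' - H a k y') / e k y'))).
    apply: hol_sum => a _; apply: holM; [exact: hol_cst | exact: sgh].
  have nc := cell_near gcs ck; near=> y'.
  have cy : cell 1 k y' by near: y'.
  by rewrite (sE k y' cy) mulr_suml; apply: eq_bigr => a _; rewrite mulrA.
- move=> k j jP; have gc := gcs k; have [h hh hE] := polar k.
  have zh := gc_zhol gc (gc_in gc).
  exists (fun y => \sum_(a | own a == k) v a * z k y ^+ (j - ord a) - z k y ^+ j * h y).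
    apply: holB; last by apply: holM hh; exact: holX.
    by apply: hol_sum => a _; apply: holM; [exact: hol_cst | exact: holX].
  have nz := gc_zneq0 gc; near=> y.
  have zy : z k y != 0 by near: y.
  have -> : s y / e k y = \sum_(a | own a == k) v a * (z k y ^+ ord a)^-1 - h y by near: y.
  have zj : z k y ^+ j != 0 by rewrite expf_neq0.
  rewrite mulrBr mulKf//; congr (_ - _); rewrite mulr_sumr.
  apply: eq_bigr => a /eqP/jP oj; rewrite mulrCA; congr (_ * _).
  rewrite -{1}(subnK oj) exprD invfM mulrAC mulVf ?mul1r//.
  by rewrite expf_neq0.
- move=> i; exists (idx (q i)), (ch i).1.1, (w i), (ch i).2.
  exists (fun y => \sum_a v a * (tr (a, i)).2 y); split.
  + exact: idxP.
  + exact: chP.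
  + apply: hol_sum => a _; apply: holM; first exact: hol_cst.
    by case: (trP (a, i)).
  + have nc := cell_near gcs (idxP (q i)).
    have nt : \forall y \near q i, forall a,
        (sg a (idx (q i)) y - H a (idx (q i)) y) / e (idx (q i)) y =
        \sum_(j < m i) (tr (a, i)).1 j * w i y ^+ j + w i y ^+ m i * (tr (a, i)).2 y.
      by apply: filter_forall => a; case: (trP (a, i)).
    near=> y; have cy : cell 1 (idx (q i)) y by near: y.
    have ty : forall a, (sg a (idx (q i)) y - H a (idx (q i)) y) / e (idx (q i)) y =
        \sum_(j < m i) (tr (a, i)).1 j * w i y ^+ j + w i y ^+ m i * (tr (a, i)).2 y by near: y.
    rewrite (sE _ y cy) mulr_suml.
    under eq_bigr => a _ do rewrite -mulrA ty mulrDr.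
    rewrite big_split/= mulr_sumr [X in X + _](_ : _ = 0); last first.
      under eq_bigr => a _ do rewrite mulr_sumr.
      rewrite exchange_big/= big1// => j _.
      have := vE (inr (Tagged (fun i => 'I_(m i)) j)); rewrite /= => E.
      by under eq_bigr => a _ do rewrite mulrA; rewrite -mulr_suml E mul0r.
    by rewrite add0r; apply: eq_bigr => a _; rewrite mulrCA.
- exists a0; set k := own a0; have gc := gcs k; have [h hh hE] := polar k.
  have zh := gc_zhol gc (gc_in gc).
  pose Pk a := (own a == k) && (v a != 0).
  have Pa0 : Pk a0 by rewrite /Pk eqxx.
  (* Among the poles at this centre with nonzero coefficient, the one of highest order is unique and
     dominates; it is a genuine pole because orders are positive. Hence [s] is not zero there. *)
  case: (arg_maxnP ord Pa0) => a1 /andP[/eqP o1 v1] a1P; pose j := ord a1.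
  pose G y := \sum_(a | own a == k) v a * z k y ^+ (j - ord a) - z k y ^+ j * h y.
  have hG : hol (ctr k) G.
    apply: holB; last by apply: holM hh; exact: holX.
    by apply: hol_sum => a _; apply: holM; [exact: hol_cst | exact: holX].
  have G0 : G (ctr k) != 0.
    rewrite /G (gc_0 gc) expr0n eqn0Ngt ord0 mul0r subr0.
    rewrite (bigD1 a1)/=; last by rewrite o1.
    rewrite subnn expr0 mulr1 big1 ?addr0// => a /andP[/eqP oa na].
    have [->|va] := eqVneq (v a) 0; first by rewrite mul0r.
    have le : (ord a <= j)%N by apply: a1P; rewrite /Pk oa eqxx.
    have lt : (ord a < j)%N.
      rewrite ltn_neqAle le andbT; apply: contra na => /eqP E; apply/eqP.
      by apply: inj; rewrite // oa o1.
    by rewrite expr0n subn_eq0 leqNgt lt mulr0.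
  have nG := punctW (hol_neq0 hX hG G0).
  have nz := gc_zneq0 gc; near=> y.
  have zy : z k y != 0 by near: y.
  have Ey : s y / e k y = \sum_(a | own a == k) v a * (z k y ^+ ord a)^-1 - h y by near: y.
  have Gy : G y != 0 by near: y.
  apply/eqP => s0; move: Gy; suff -> : G y = z k y ^+ j * (s y / e k y).
    by rewrite s0 mul0r mulr0 eqxx.
  rewrite Ey mulrBr; congr (_ - _); rewrite mulr_sumr.
  apply: eq_bigr => a /eqP oa; have [->|va] := eqVneq (v a) 0; first by rewrite !mul0r mulr0.
  have le : (ord a <= j)%N by apply: a1P; rewrite /Pk oa eqxx.
  rewrite mulrCA; congr (_ * _); rewrite -{2}(subnK le) exprD -mulrA mulfV ?mulr1//.
  by rewrite expf_neq0.
Unshelve. all: by end_near.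
Qed.

End MittagLeffler.

(** * Degrees *)

Arguments dom {R Y n} E i _ : rename.
Arguments frame {R Y n} E i _ : rename.

Section Frames.
Context {R : realType} (Y : cspace R).
Local Notation C := R[i].

Lemma dom_nbhs n (E : bundle Y n) i y : dom E i y -> nbhs y (dom E i).
Proof. by move=> Ei; apply: open_nbhs_nbhs; split=> //; exact: dom_open. Qed.

Lemma det_frame_neq0 n (E : bundle Y n) i y : dom E i y -> \det (frame E i y) != 0.
Proof. by move/(@frame_unit _ _ _ E); rewrite unitmxE unitfE. Qed.

Lemma det_frame_trans n (E : bundle Y n) i j y : dom E i y -> dom E j y ->
  hol y (fun y' => \det (frame E i y') / \det (frame E j y')).
Proof.
move=> Ei Ej; apply: hol_ext (holmx_det (@frame_trans _ _ _ E _ _ _ Ei Ej)) _.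
by apply: nearW => y'; rewrite det_mulmx det_inv.
Qed.

Lemma line_trans (K : bundle Y 1) i j y : dom K i y -> dom K j y ->
  hol y (fun y' => frame K i y' 0 0 / frame K j y' 0 0).
Proof.
move=> Ki Kj; apply: hol_ext (det_frame_trans Ki Kj) _.
by apply: nearW => y'; rewrite !det_mx11.
Qed.

Lemma line_neq0 (K : bundle Y 1) i y : dom K i y -> frame K i y 0 0 != 0.
Proof. by move/det_frame_neq0; rewrite det_mx11. Qed.

Section Line.
Variables (I : Type) (D : I -> set Y) (k : I -> Y -> C).
Hypotheses (oD : forall i, open (D i)) (cD : forall y, exists i, D i y)
  (k0 : forall i y, D i y -> k i y != 0)
  (ktr : forall i j y, D i y -> D j y -> hol y (fun y' => k i y' / k j y')).

Lemma line_unit i y : D i y -> (k i y)%:M \in (unitmx : pred 'M[C]_1).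
Proof. by move=> Dy; rewrite unitmxE det_scalar1 unitfE k0. Qed.

Lemma line_holmx i j y : D i y -> D j y ->
  holmx y (fun y' => (k i y')%:M *m invmx (k j y')%:M : 'M[C]_1).
Proof.
move=> Di Dj a b; apply: hol_ext (ktr Di Dj) _; apply: nearW => y'.
by rewrite !ord1 invmx_scalar -scalar_mxM mxE eqxx mulr1n.
Qed.

Definition line : bundle Y 1 :=
  @Bundle _ Y 1 I D (fun i y => (k i y)%:M) oD cD line_unit line_holmx.

Lemma line_frame i y : frame line i y 0 0 = k i y.
Proof. by rewrite /= mxE eqxx mulr1n. Qed.

End Line.

End Frames.

Lemma int_sum_split (T : Type) (S : seq T) (m : T -> int) :
  \sum_(x <- S) m x = (\sum_(x <- S | (0 < m x)%R) `|m x|)%N%:Z -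
                      (\sum_(x <- S | (m x < 0)%R) `|m x|)%N%:Z.
Proof.
elim: S => [|x S IH]; first by rewrite !big_nil.
by rewrite !big_cons IH; case: (ltrgt0P (m x)) => h; lia.
Qed.

(** * Existence and uniqueness of the degree *)

Section Degree.
Context {R : realType} (X : cspace R).
Hypothesis hX : compact_riemann_surface X.
Local Notation C := R[i].
Implicit Types (x y : X).

(** Every chart avoids the points of [P] other than its own centre. This makes the chart centred at
    a point of [P] the only one containing it, as needed to place a pole there. *)
Lemma bundle_atlas n (E : bundle X n) (P : seq X) :
  exists (J : finType) (ctr : J -> X) U (z : J -> X -> C) psi (fr : J -> frame_index E),
  [/\ forall k, good_chart (ctr k) (U k) (z k) (psi k),
      forall k y, U k y -> dom E (fr k) y,
      forall y, exists k, cell U z 1 k y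
    & forall p, p \in P -> exists k, ctr k = p /\ exclusive ctr U k].
Proof.
have [_ _ cX _] := hX.
pose away x := [set y | forall p, p \in P -> p != x -> y != p].
have away_open x : open (away x).
  rewrite /away; elim: (P) => [|p P' IH].
    by rewrite (_ : [set _ | _] = setT); [exact: openT | apply/seteqP; split].
  have [->|px] := eqVneq p x.
    rewrite (_ : [set _ | _] = [set y | forall q, q \in P' -> q != x -> y != q])//.
    apply/seteqP; split=> y h q.
      by move=> qP qx; apply: h => //; rewrite inE qP orbT.
    by rewrite inE => /orP[/eqP ->|]; [rewrite eqxx | exact: h].
  rewrite (_ : [set _ | _] = [set y | y != p] `&` [set y | forall q, q \in P' -> q != x -> y != q]).
    by apply: openI => //; rewrite openE => y; exact: (neq_near hX).
  apply/seteqP; split=> y.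
    move=> h; split; first by apply: h; rewrite // inE eqxx.
    by move=> q qP qx; apply: h => //; rewrite inE qP orbT.
  by move=> [h1 h2] q; rewrite inE => /orP[/eqP -> //|]; exact: h2.
have [i0 i0P] := choice (fun x => @dom_cover _ _ _ E x).
have chx x : exists ch : set X * (X -> C) * (C -> X),
    good_chart x ch.1.1 ch.1.2 ch.2 /\ ch.1.1 `<=` dom E (i0 x) `&` away x.
  have [||] := @exists_chart _ _ hX x (dom E (i0 x) `&` away x).
  - by apply: openI => //; exact: dom_open.
  - by split=> // p _; rewrite eq_sym.
  by move=> U [z [psi [gc UO]]]; exists (U, z, psi).
have [ch chP] := choice chx.
have [|s sP] := @finite_cover X (fun x => [set y | (ch x).1.1 y /\ box 1 ((ch x).1.2 y)]) cX.
  move=> x; have [gc _] := chP x.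
  have n1 := gc_nbhs gc (gc_in gc).
  have b0 : box 1 ((ch x).1.2 x) by rewrite (gc_0 gc); exact: box0.
  have n2 := gc_cont gc (gc_in gc) (box_nbhs b0).
  by near=> y; split; near: y.
exists (seq_sub (P ++ s)), (fun k => ssval k), (fun k => (ch (ssval k)).1.1),
  (fun k => (ch (ssval k)).1.2), (fun k => (ch (ssval k)).2), (fun k => i0 (ssval k)).
split=> [k|k y|y|p pP].
- by case: (chP (ssval k)).
- by move=> Uy; have [_ /(_ y Uy)[]] := chP (ssval k).
- have [x xs xy] := sP y; have xPs : x \in P ++ s by rewrite mem_cat xs orbT.
  by exists (SeqSub xPs).
- have pPs : p \in P ++ s by rewrite mem_cat pP.
  exists (SeqSub pPs); split=> // l lp Ul.
  have [_ /(_ _ Ul)[_ /(_ p pP)]] := chP (ssval l); rewrite eqxx => h.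
  have : p != ssval l by apply: contra lp => /eqP E'; apply/eqP; exact: val_inj.
  by move/h.
Unshelve. all: by end_near.
Qed.

Lemma order_zX (k : int) U (z : X -> C) psi x : good_chart x U z psi ->
  order_at x (fun y => z y ^ k) k.
Proof.
move=> gc; apply/(order_chart hX _ _ gc); exists (fun=> 1); split.
- exact: hol_cst.
- exact: oner_neq0.
- by apply: nearW => y; rewrite mul1r.
Qed.

Lemma order_dichotomy x f : hol x f -> (\forall y \near x^', f y = 0) \/ exists k, order_at x f k.
Proof.
move=> /(order_hol hX)[h|[k [h _]]]; first by left; exact: punctW.
by right; exists k%:Z.
Qed.

Definition degree_data n (E : bundle X n) (s : X -> C) (m : X -> int) : Prop :=
  forall i x, dom E i x -> order_at x (fun y => s y / \det (frame E i y)) (m x).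

Lemma degree_data_finite n (E : bundle X n) s m : degree_data E s m ->
  finite_set [set x | m x != 0].
Proof.
move=> mP; apply: finite_of_isolated => // x.
have [i Ei] := @dom_cover _ _ _ E x.
have := order_punct hX (mP i x Ei); have nE := punctW (dom_nbhs Ei).
move=> np; near=> y; have Ey : dom E i y by near: y.
have [h1 h2] : hol y (fun y => s y / \det (frame E i y)) /\ s y / \det (frame E i y) != 0 by near: y.
by rewrite /= (order_unique hX (mP i y Ey) (order_unit hX h1 h2)) eqxx.
Unshelve. all: by end_near.
Qed.

Lemma degree_exists n (E : bundle X n) : exists d, is_degree E d.
Proof.
have [[x0 _]|noX] := pselect (exists x : X, True); last first.
  exists 0, (fun=> 0), (fun=> 0); split.
  - by move=> i x _; case: noX; exists x.
  - rewrite (_ : [set _ | _] = set0)//; apply/seteqP; split=> // x /=; by rewrite eqxx.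
  - by rewrite fsbig1.
have [J [ctr [U [z [psi [fr [gcs Ufr cov exc]]]]]]] := bundle_atlas E [:: x0].
have [k0 [k0c exk0]] := exc x0 (mem_head _ _).
pose e k y := \det (frame E (fr k) y).
have e0 k y : U k y -> e k y != 0 by move=> /Ufr; exact: det_frame_neq0.
have eh k l y : U k y -> U l y -> hol y (fun y' => e k y' / e l y').
  by move=> /Ufr h1 /Ufr h2; exact: det_frame_trans.
have [N NP] := mittag_leffler hX gcs e0 eh cov.
(* Pole orders from 1 to [N.+1] at a single point and no imposed zeros: one unknown more than there
   are conditions. *)
have [|||||s [s1 s2 _ [a s4]]] := NP 'I_N.+1 void (fun=> k0)
   (fun a => (a : nat).+1) (fun v : void => match v with end) (fun=> 0%N).
- by [].
- by move=> a b _ [] /val_inj.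
- by [].
- by [].
- by rewrite big1// addn0 card_ord.
have local x : exists k, U k x /\
    ((\forall y \near x^', s y / e k y = 0) \/ exists m, order_at x (fun y => s y / e k y) m).
  have [->|xc] := eqVneq x (ctr k0).
    have gc := gcs k0; exists k0; split; first exact: gc_in gc.
    have [|F hF FE] := s2 k0 N.+1; first by move=> a' _; rewrite ltn_ord.
    have [F0|[m Fm]] := order_dichotomy hF.
      by left; near=> y; have -> : s y / e k0 y = (z k0 y ^+ N.+1)^-1 * F y by [near: y];
        rewrite (_ : F y = 0) ?mulr0//; near: y.
    right; exists (- N.+1%:Z + m).
    apply: order_ext (order_mul hX (order_inv hX (order_zX N.+1 gc)) Fm).
    by near=> y; apply/esym; near: y.
  have [k ck] := cov x; exists k; split; first exact: cellU ck.
  by apply: order_dichotomy; apply: s1.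
have nz : forall x, \forall y \near x^', s y != 0.
  apply: (germ_dichotomy hX); last by exists (ctr k0).
  move=> x; have [k [Uk [h|[m h]]]] := local x; [left|right].
    have nU := punctW (gc_nbhs (gcs k) Uk); near=> y.
    have Uy : U k y by near: y.
    have /eqP : s y / e k y = 0 by near: y.
    by rewrite mulf_eq0 invr_eq0 (negPf (e0 _ _ Uy)) orbF => /eqP.
  have := order_neq0 hX h; apply: filterS => y.
  by apply: contra => /eqP ->; rewrite mul0r.
have ord x : exists m, forall i, dom E i x -> order_at x (fun y => s y / \det (frame E i y)) m.
  have [k [Uk [h|[m h]]]] := local x.
    have nU := punctW (gc_nbhs (gcs k) Uk).
    have [//|y _ []] := @punct_exists _ _ hX x (fun y => False).
    have sn := nz x; near=> y; have Uy : U k y by near: y.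
    have /eqP : s y / e k y = 0 by near: y.
    have sy : s y != 0 by near: y.
    by rewrite mulf_eq0 invr_eq0 (negPf (e0 _ _ Uy)) (negPf sy).
  exists m => i Ei; rewrite -[m]addr0.
  apply: order_ext (order_mul hX h (@order_unit _ _ hX x (fun y => e k y / \det (frame E i y)) _ _)).
  - have nU := punctW (gc_nbhs (gcs k) Uk); near=> y; have Uy : U k y by near: y.
    by rewrite mulrA divfK// e0.
  - by apply: det_frame_trans => //; exact: Ufr.
  - by rewrite mulf_neq0 ?invr_eq0 ?e0 ?det_frame_neq0.
have [m mP] := choice ord.
have dm : degree_data E s m by move=> i x; exact: mP.
exists (\sum_(x \in [set: X]) m x), s, m; split=> //.
exact: degree_data_finite dm.
Unshelve. all: by end_near.
Qed.

Lemma removable_singularities (f : X -> C) :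
  (forall x, exists2 g, hol x g & \forall y \near x^', f y = g y) ->
  exists2 F, forall x, hol x F & forall x g, hol x g -> (\forall y \near x^', f y = g y) -> F x = g x.
Proof.
move=> H.
have H' x : exists g, hol x g /\ \forall y \near x^', f y = g y by have [g] := H x; exists g.
have [G GP] := choice H'.
have GE x g : hol x g -> (\forall y \near x^', f y = g y) -> G x x = g x.
  move=> hg fg; have [h1 h2] := GP x; apply: (hol_punct_eq hX) => //.
  by near=> y; rewrite -(_ : f y = G x y); near: y.
exists (fun x => G x x) => // x; have [h1 h2] := GP x.
apply: hol_ext h1 _.
have n1 := hol_near hX (GP x).1.
have n2 := nbhs_interior ((punctP _ _).1 h2).
near=> y; have hy : hol y (G x) by near: y.
apply/esym; apply: GE => //.
have [->//|yx] := eqVneq y x.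
have ny := neq_near hX yx; apply: punctW.
have := (_ : nbhs y [set y | y != x -> f y = G x y]).
have n3 : nbhs y [set y | y != x -> f y = G x y] by near: y.
by move=> _; near=> y'; have : y' != x by [near: y']; near: y'.
Unshelve. all: by end_near.
Qed.


Lemma principal_sum_le0 f (m : X -> int) (S : seq X) : uniq S ->
  (forall x, order_at x f (m x)) -> (forall x, m x != 0 -> x \in S) ->
  \sum_(x <- S) m x <= 0.
Proof.
move=> uS fm mS; rewrite leNgt; apply/negP => pos.
pose Pos := [seq x <- S | 0 < m x]; pose Neg := [seq x <- S | m x < 0].
have PosP x : (x \in Pos) = (0 < m x).
  rewrite mem_filter; have [h|//] := boolP (0 < m x).
  by rewrite (mS x) //; rewrite gt_eqF.
have NegP x : (x \in Neg) = (m x < 0).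
  rewrite mem_filter; have [h|//] := boolP (m x < 0).
  by rewrite (mS x) //; rewrite lt_eqF.
pose tP := tnth (in_tuple Pos); pose tN := tnth (in_tuple Neg).
have tPP i : 0 < m (tP i) by rewrite -PosP mem_tnth.
have tNP i : m (tN i) < 0 by rewrite -NegP mem_tnth.
pose wP i := `|m (tP i)|%N; pose wN i := `|m (tN i)|%N.
have sumS : \sum_(x <- S) m x = (\sum_i wP i)%:Z - (\sum_i wN i)%:Z.
  rewrite /wP /wN -(@big_tnth _ 0%N addn _ Pos xpredT (fun x => `|m x|%N)).
  rewrite -(@big_tnth _ 0%N addn _ Neg xpredT (fun x => `|m x|%N)).
  by rewrite !big_filter; exact: int_sum_split.
have [i0 _] : exists i0 : 'I_(size Pos), true.
  case: (pickP (fun i : 'I_(size Pos) => true)) => [i _|no]; first by exists i.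
  by move: pos; rewrite sumS (big_pred0 _ _ _ _ no); lia.
have [J [ctr [U [z [psi [fr [gcs Ufr cov exc]]]]]]] := bundle_atlas (trivial_bundle X) Pos.
pose e (k : J) (y : X) : C := 1.
have e0 k y : U k y -> e k y != 0 by move=> _; exact: oner_neq0.
have eh k l y : U k y -> U l y -> hol y (fun y' => e k y' / e l y').
  by move=> _ _; exact: hol_cst.
have [N NP] := mittag_leffler hX gcs e0 eh cov.
(* The zeros exceed the poles by at least 1, so in the M-th power by at least N + 2. One unit is
   given up at [i0], which still leaves more than [N] unknowns beyond the imposed zeros. *)
pose M := N.+2.
(* The pole allowed at [tP i0] is one order smaller than the zero of f^M, which forces the product
   to vanish there. *)
pose w i := (M * wP i - (i == i0))%N.
have own i : exists k, ctr k = tP i /\ exclusive ctr U k by apply: exc; exact: mem_tnth.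
have [ow owP] := choice own.
pose A := {i : 'I_(size Pos) & 'I_(w i)}.
have uPos : uniq Pos by exact: filter_uniq.
have ow_inj : injective ow.
  move=> i j E; apply: ((tuple_uniqP (in_tuple Pos)) uPos).
  by have [h1 _] := owP i; have [h2 _] := owP j; rewrite -/tP -h1 -h2 E.
have w_gt0 : (0 < wP i0)%N by have := tPP i0; rewrite /wP; lia.
have [|||||s [s1 s2 s3 [a s4]]] := NP A 'I_(size Neg) (fun a => ow (tag a))
  (fun a => (tagged a : nat).+1) tN (fun i => M * wN i)%N.
- by move=> a; case: (owP (tag a)).
- move=> [i j] [i' j'] /= /ow_inj E; subst i' => -[E].
  by congr existT; exact: ord_inj.
- by [].
- move=> a i; have [-> _] := owP (tag a).
  by apply/eqP => E; have := tNP i; have := tPP (tag a); rewrite E; lia.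
- rewrite card_tagged sumnE big_map big_enum/=.
  under [X in (_ < X)%N]eq_bigr => i _ do rewrite card_ord.
  have -> : (\sum_i w i = M * (\sum_i wP i) - 1)%N.
    rewrite (bigD1 i0)//= [in RHS](bigD1 i0)//= /w eqxx mulnDr big_distrr/=.
    rewrite (eq_bigr (fun i => M * wP i)%N); last first.
      by move=> i /negPf ->; rewrite subn0.
    by rewrite -addnBAC// muln_gt0.
  rewrite -big_distrr/=; move: pos; rewrite sumS.
  set a := (\sum_i wP i)%N; set b := (\sum_i wN i)%N => ab.
  have {}ab : (b < a)%N by lia.
  have : (M * b.+1 <= M * a)%N by rewrite leq_mul2l ab orbT.
  by rewrite mulnS /M; lia.
have fMP x := order_exp hX M (fm x).
have sing x : exists2 g, hol x g & (\forall y \near x^', s y * f y ^+ M = g y) /\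
    (x = tP i0 -> g x = 0).
  have [px|npx] := boolP (0 < m x).
    have xPos : x \in Pos by rewrite PosP.
    have [i xE] := seq_tnthP xPos; rewrite -/tP in xE.
    have [ki _] := owP i; have gc := gcs (ow i).
    have [|F hF FE] := s2 (ow i) (w i).
      by move=> b /ow_inj <-; exact: ltn_ord.
    move: gc hF FE; rewrite ki -xE => gc hF FE.
    have [u [hu u0 uE]] := (order_chart hX _ _ gc).1 (fMP x).
    have mx : m x * M%:Z = (w i + (M * wP i - w i))%N%:Z.
      rewrite subnKC ?leq_subr// /wP -xE PoszM; lia.
    exists (fun y => F y * u y * z (ow i) y ^+ (M * wP i - w i)).
      by apply: holM; [exact: holM | apply: holX; exact: gc_zhol gc _ (gc_in gc)].
    split.
      have nz := gc_zneq0 gc; near=> y.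
      have zy : z (ow i) y != 0 by near: y.
      have := (_ : s y / e (ow i) y = (z (ow i) y ^+ w i)^-1 * F y).
      have -> : f y ^+ M = u y * z (ow i) y ^ (m x * M%:Z) by near: y.
      move=> /(_ ltac:(by near: y)); rewrite /e divr1 => ->.
      rewrite mx -exprnP exprD.
      have zw : z (ow i) y ^+ w i != 0 by rewrite expf_neq0.
      by field.
    move=> xE0; have ii : i = i0.
      by apply: ((tuple_uniqP (in_tuple Pos)) uPos); rewrite -/tP -xE -xE0.
    rewrite (gc_0 gc) /w ii eqxx subKn ?muln_gt0//.
    by rewrite expr1 mulr0.
  have xi0 : x <> tP i0 by move=> E; move: npx; rewrite E tPP.
  have [nx|nnx] := boolP (m x < 0).
    have xNeg : x \in Neg by rewrite NegP.
    have [i xE] := seq_tnthP xNeg; rewrite -/tN in xE.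
    have [k [V [v [phi [g [ck gc hg gE]]]]]] := s3 i.
    move: ck gc hg gE; rewrite -xE => ck gc hg gE.
    have [u [hu u0 uE]] := (order_chart hX _ _ gc).1 (fMP x).
    exists (fun y => g y * u y); first exact: holM.
    split=> // {xi0}; have nz := gc_zneq0 gc; have gE' := punctW gE; near=> y.
    have vy : v y != 0 by near: y.
    have -> : f y ^+ M = u y * v y ^ (m x * M%:Z) by near: y.
    have : s y / e k y = v y ^+ (M * wN i) * g y by near: y.
    rewrite /e divr1 => ->.
    have -> : m x * M%:Z = - (M * wN i)%:Z by rewrite /wN -xE PoszM; lia.
    rewrite -exprnN.
    have zw : v y ^+ (M * wN i) != 0 by rewrite expf_neq0.
    by field.
  have m0 : m x = 0 by move: npx nnx; lia.
  have [k ck] := cov x.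
  have hs : hol x s.
    apply: hol_ext (s1 k x ck _) _ => [b|].
      have [-> _] := owP (tag b); apply/eqP => E.
      by have := tPP (tag b); rewrite -E m0.
    by apply: nearW => y; rewrite /e divr1.
  have := fMP x; rewrite m0 mul0r => /(order_ge0 hX)[g [hg gE _]].
  exists (fun y => s y * g y); first exact: holM.
  split=> //; near=> y; congr (_ * _); by near: y.
have [F hF FE] := removable_singularities (fun x => let: ex_intro2 g hg gP := sing x in
  ex_intro2 _ _ g hg gP.1).
have F0 x : F x = 0.
  rewrite (hol_constant hX hF x (tP i0)).
  by have [g hg [gE g0]] := sing (tP i0); rewrite (FE _ _ hg gE) g0.
(* The product is constant and vanishes at [tP i0], yet near the pole [p] neither [s] nor [f] is
   0. *)
pose p := ctr (ow (tag a)).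
have [//|y _ []] := @punct_exists _ _ hX p (fun y => False).
have fn := order_neq0 hX (fm p).
have [g hg [gE _]] := sing p.
have gF : \forall y \near p^', g y = 0.
  have := hol_near hX hg => /punctW hgn.
  have gE2 := punctW (nbhs_interior ((punctP _ _).1 gE)).
  near=> y; rewrite -(F0 y); apply/esym; apply: FE; first by near: y.
  have n3 : nbhs y [set y | y != p -> s y * f y ^+ M = g y] by near: y.
  have yp : y != p by near: y; apply/punctP; exact: nearW.
  have ny := neq_near hX yp; apply: punctW.
  by near=> y'; have : y' != p by [near: y']; near: y'.
near=> y.
have sy : s y != 0 by near: y.
have fy : f y != 0 by near: y.
have : s y * f y ^+ M = g y by near: y.
have -> : g y = 0 by near: y.
by move=> /eqP; rewrite mulf_eq0 (negPf sy) expf_eq0 (negPf fy) andbF.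
Unshelve. all: by end_near.
Qed.

Lemma principal_sum0 f (m : X -> int) (S : seq X) : uniq S ->
  (forall x, order_at x f (m x)) -> (forall x, m x != 0 -> x \in S) ->
  \sum_(x <- S) m x = 0.
Proof.
move=> uS fm mS; apply/eqP; rewrite eq_le (principal_sum_le0 uS fm mS)/=.
rewrite -oppr_le0 -sumrN.
apply: (@principal_sum_le0 (fun y => (f y)^-1) (fun x => - m x)) => // x.
  exact: order_inv.
by rewrite oppr_eq0; exact: mS.
Qed.

Lemma finite_support_sum (m m' : X -> int) (a b : int) :
  finite_set [set x | m x != 0] -> finite_set [set x | m' x != 0] ->
  \sum_(x \in [set: X]) (a * m x + b * m' x) =
  a * \sum_(x \in [set: X]) m x + b * \sum_(x \in [set: X]) m' x /\
  exists S : seq X, [/\ uniq S, \sum_(x \in [set: X]) m x = \sum_(x <- S) m x,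
    forall x, m x != 0 -> x \in S & forall x, m' x != 0 -> x \in S].
Proof.
move=> f1 f2; have f12 : finite_set ([set x | m x != 0] `|` [set x | m' x != 0]).
  by rewrite finite_setU.
have [S0 SE] := (finite_seqP _).1 f12; pose S := undup S0.
have uS : uniq S by exact: undup_uniq.
have SP x : ([set x | m x != 0] `|` [set x | m' x != 0]) x -> x \in S.
  by rewrite SE mem_undup.
have S1 x : m x != 0 -> x \in S by move=> h; apply: SP; left.
have S2 x : m' x != 0 -> x \in S by move=> h; apply: SP; right.
have N1 x : x \notin S -> m x = 0 by move=> xS; apply/eqP; apply: contraNT xS; exact: S1.
have N2 x : x \notin S -> m' x = 0 by move=> xS; apply/eqP; apply: contraNT xS; exact: S2.
have E0 (F : X -> int) : (forall x, x \notin S -> F x = 0) ->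
    \sum_(x \in [set: X]) F x = \sum_(x <- S) F x.
  move=> FS; rewrite (fsbigE S)//; last by move=> x _; exact: FS.
  by apply: eq_bigl => x; rewrite in_setT.
split; last by exists S; split=> //; exact: E0.
rewrite !E0//; first by rewrite big_split/= !big_distrr.
by move=> x xS; rewrite N1// N2// !mulr0.
Qed.

Lemma degree_unique n (E : bundle X n) d d' : is_degree E d -> is_degree E d' -> d = d'.
Proof.
move=> [s [m [sm fm ->]]] [s' [m' [sm' fm' ->]]].
have [lin _] := finite_support_sum 1 (-1) fm fm'.
apply/eqP; rewrite -subr_eq0; apply/eqP.
have -> : \sum_(x \in [set: X]) m x - \sum_(x \in [set: X]) m' x =
  \sum_(x \in [set: X]) (1 * m x + -1 * m' x) by rewrite lin mul1r mulN1r.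
have od x : order_at x (fun y => s y / s' y) (1 * m x + -1 * m' x).
  have [i Ei] := @dom_cover _ _ _ E x; rewrite mul1r mulN1r.
  apply: order_ext (order_mul hX (sm i x Ei) (order_inv hX (sm' i x Ei))).
  have nE := punctW (dom_nbhs Ei); near=> y.
  have /det_frame_neq0 dy : dom E i y by near: y.
  by rewrite invf_div mulrA divfK.
have fd := order_support_finite hX od.
have [_ [S [uS -> mS _]]] := finite_support_sum 0 0 fd fd.
exact: (principal_sum0 uS od mS).
Unshelve. all: by end_near.
Qed.

Lemma degP n (E : bundle X n) : is_degree E (deg E).
Proof. by have [d dP] := degree_exists E; exact: (xgetPex 0 (ex_intro _ d dP)). Qed.

Lemma deg_data n (E : bundle X n) s m : degree_data E s m ->
  deg E = \sum_(x \in [set: X]) m x.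
Proof.
move=> dm; apply: (degree_unique (degP E)); exists s, m; split=> //.
exact: degree_data_finite dm.
Qed.

Lemma degree_dataP n (E : bundle X n) : exists s m, degree_data E s m.
Proof. by have [s [m [sm _ _]]] := degP E; exists s, m. Qed.

Lemma deg_rank0 (E : bundle X 0) : deg E = 0.
Proof.
rewrite (@deg_data _ E (fun=> 1) (fun=> 0)) ?fsbig1// => i x Ei.
apply: order_unit => //; last by rewrite det_mx00 divr1 oner_neq0.
by apply: hol_ext (hol_cst x 1) _; apply: nearW => y; rewrite det_mx00 divr1.
Qed.

(** A holomorphic section of the determinant has only zeros, so the degree is a sum of natural
    numbers, and a sum equal to 0 leaves no zero. This is the source of the inequality between
    degrees in [kernel_degree]. *)
Lemma section_deg n (E : bundle X n) (phi : X -> C) :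
  (forall i x, dom E i x -> hol x (fun y => phi y / \det (frame E i y))) ->
  (exists x, phi x != 0) -> 0 <= deg E /\ (deg E = 0 -> forall x, phi x != 0).
Proof.
move=> hphi [x0 phi0].
have loc x : exists i, dom E i x /\ ((\forall y \near x, phi y = 0) \/
    exists k : nat, order_at x (fun y => phi y / \det (frame E i y)) k /\ (k == 0%N) = (phi x != 0)).
  have [i Ei] := @dom_cover _ _ _ E x; exists i; split=> //.
  have dx := det_frame_neq0 Ei.
  have [h|[k [h1 h2]]] := order_hol hX (hphi i x Ei); [left|right].
    have nE := dom_nbhs Ei; near=> y.
    have /det_frame_neq0 dy : dom E i y by near: y.
    have /eqP : phi y / \det (frame E i y) = 0 by near: y.
    by rewrite mulf_eq0 invr_eq0 (negPf dy) orbF => /eqP.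
  exists k; split=> //; rewrite h2 mulf_eq0 negb_or invr_eq0 dx andbT//.
have nz : forall x, \forall y \near x^', phi y != 0.
  apply: (germ_dichotomy hX) => [x|].
    have [i [Ei [h|[k [h _]]]]] := loc x; [by left; exact: punctW|right].
    have := order_neq0 hX h; apply: filterS => y.
    by apply: contra => /eqP ->; rewrite mul0r.
  exists x0; have [i [Ei [h|[k [h _]]]]] := loc x0.
    by have := nbhs_singleton h; move/eqP; rewrite /= (negPf phi0).
  have := order_neq0 hX h; apply: filterS => y.
  by apply: contra => /eqP ->; rewrite mul0r.
have ord x : exists k : nat, (forall i, dom E i x ->
    order_at x (fun y => phi y / \det (frame E i y)) k) /\ (k == 0%N) = (phi x != 0).
  have [i [Ei [h|[k [h hk]]]]] := loc x.
    have [//|y _ []] := @punct_exists _ _ hX x (fun y => False).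
    have h' := punctW h; have nx := nz x; near=> y.
    have : phi y != 0 by near: y.
    have -> : phi y = 0 by near: y.
    by rewrite eqxx.
  exists k; split; last exact: hk.
  move=> j Ej; rewrite -[_%:Z]addr0.
  apply: order_ext (order_mul hX h (@order_unit _ _ hX x (fun y => \det (frame E i y) / \det (frame E j y)) _ _)).
  - have nE := punctW (dom_nbhs Ei); near=> y.
    have /det_frame_neq0 dy : dom E i y by near: y.
    by rewrite mulrA divfK.
  - exact: det_frame_trans.
  - by rewrite mulf_neq0 ?invr_eq0 ?det_frame_neq0.
have [k kP] := choice ord.
have dk : degree_data E phi (fun x => (k x)%:Z) by move=> i x; case: (kP x) => h _; exact: h.
have fin := degree_data_finite dk.
have [_ [S [uS E1 SP _]]] := finite_support_sum 0 0 fin fin.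
rewrite (deg_data dk) E1; split; first by apply: sumr_ge0.
rewrite -(big_morph Posz PoszD (erefl _)) => -[s0] x.
have [_ <-] := kP x; have [xS|xS] := boolP (x \in S); last first.
  by apply: contraNT xS => kx; apply: SP; rewrite eqz_nat.
by move/eqP: s0; rewrite sum_nat_seq_eq0 => /allP/(_ x xS).
Unshelve. all: by end_near.
Qed.

Lemma order_expz x f (k l : int) : order_at x f k -> order_at x (fun y => f y ^ l) (k * l).
Proof.
case: l => n h; first exact: order_exp.
rewrite NegzE mulrN; apply: order_ext (order_inv hX (order_exp hX n.+1 h)).
by apply: nearW => y; rewrite exprnN.
Qed.

Section Twist.
Variables (n1 n2 : nat) (E1 : bundle X n1) (E2 : bundle X n2) (a b : int).

Let tdom (t : frame_index E1 * frame_index E2) : set X := dom E1 t.1 `&` dom E2 t.2.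
Let tval (t : frame_index E1 * frame_index E2) y : C :=
  \det (frame E1 t.1 y) ^ a * \det (frame E2 t.2 y) ^ b.

Lemma twist_open t : open (tdom t).
Proof. by apply: openI; exact: dom_open. Qed.

Lemma twist_cover y : exists t, tdom t y.
Proof.
by have [i Ei] := @dom_cover _ _ _ E1 y; have [j Ej] := @dom_cover _ _ _ E2 y; exists (i, j).
Qed.

Lemma twist_neq0 t y : tdom t y -> tval t y != 0.
Proof. by move=> [h1 h2]; rewrite mulf_neq0// expfz_neq0// det_frame_neq0. Qed.

Lemma twist_hol t u y : tdom t y -> tdom u y -> hol y (fun y' => tval t y' / tval u y').
Proof.
move=> [t1 t2] [u1 u2].
have h : hol y (fun y' => (\det (frame E1 t.1 y') / \det (frame E1 u.1 y')) ^ a *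
      (\det (frame E2 t.2 y') / \det (frame E2 u.2 y')) ^ b).
  by apply: holM; apply: holXz; rewrite ?mulf_neq0 ?invr_eq0 ?det_frame_neq0//;
     exact: det_frame_trans.
apply: hol_ext h _; apply: nearW => y'.
by rewrite !expfzMl !exprz_inv /tval invfM mulrACA !invr_expz.
Qed.

(** The line bundle det(E1)^a (x) det(E2)^b. A relation between degrees becomes a statement about
    one section of such a bundle. *)
Definition twist : bundle X 1 := line twist_open twist_cover twist_neq0 twist_hol.

Lemma deg_twist : deg twist = a * deg E1 + b * deg E2.
Proof.
have [s1 [m1 h1]] := degree_dataP E1; have [s2 [m2 h2]] := degree_dataP E2.
have [E _] := finite_support_sum a b (degree_data_finite h1) (degree_data_finite h2).
rewrite (deg_data h1) (deg_data h2) -E.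
apply: (@deg_data _ _ (fun y => s1 y ^ a * s2 y ^ b)) => t x [t1 t2].
have := order_mul hX (order_expz a (h1 _ _ t1)) (order_expz b (h2 _ _ t2)).
rewrite (mulrC (m1 x)) (mulrC (m2 x)); apply: order_ext.
apply: nearW => y; rewrite /= det_scalar1 !expfzMl !exprz_inv /tval invfM.
by rewrite mulrACA !invr_expz.
Qed.
End Twist.

End Degree.

(** * Square roots of line bundles *)

Section SquareRoot.
Context {R : realType}.
Local Notation C := R[i].

Lemma right_root (w : C) : 0 < complex.Re w ->
  exists s : C, s * s = w /\ 0 < complex.Re s.
Proof.
move=> w0; have [s sw] : exists s : C, s * s = w.
  by exists (sqrtC w); rewrite -expr2 sqrtCK.
have Rs : complex.Re s != 0.
  apply/eqP => s0; move: w0; rewrite -sw; case: s s0 {sw} => a b /= ->.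
  by rewrite mulr0 sub0r oppr_gt0 -expr2 ltNge sqr_ge0.
case: (ltrgt0P (complex.Re s)) Rs => // h _; first by exists s.
by exists (- s); rewrite mulrNN; split=> //; rewrite raddfN oppr_gt0.
Qed.


(** The branch with positive real part. For roots a of w and b of v the remainder b - a - (v - w)/(2
    a) equals -(v - w)^2 / (2 a (a + b)^2), and a + b stays away from 0 because real parts add;
    continuity of the root need not be shown beforehand. *)
Lemma root_cdiff : exists rt : C -> C, forall w, 0 < complex.Re w ->
  [/\ rt w * rt w = w, rt w != 0 & cdiff rt w].
Proof.
have rtex (w : C) : exists s : C, 0 < complex.Re w -> s * s = w /\ 0 < complex.Re s.
  by have [/right_root[s sP]|h] := boolP (0 < complex.Re w); [exists s | by exists 0 => w0; case/negP: h].
have [rt rtP] := choice rtex.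
exists rt => w w0; have [E r0] := rtP w w0.
set a := rt w in E r0 *; pose rho := complex.Re a.
have an : rho <= nm a by apply: le_trans (Re_nm _); exact: ler_norm.
have a0 : a != 0 by rewrite -nm_gt0; exact: lt_le_trans an.
split=> //; apply/cdiffP; exists (2 * a)^-1 => e e0.
have rho3 : 0 < rho * (rho * rho) by rewrite !mulr_gt0.
pose d := Num.min (complex.Re w) (2 * e * (rho * (rho * rho))).
have d0 : 0 < d by rewrite lt_min w0 !mulr_gt0.
exists d => // v; rewrite lt_min => /andP[v1 v2].
have v0 : 0 < complex.Re v.
  have := le_lt_trans (Re_nm (v - w)) v1; rewrite raddfB/= ltr_norml; lra.
have [Ev b0] := rtP v v0; set b := rt v in Ev b0 *.
have sn : rho <= nm (a + b).
  apply: le_trans (Re_nm _); apply: le_trans (ler_norm _).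
  by rewrite raddfD/= lerDl ltW.
have ab0 : a + b != 0 by rewrite -nm_gt0; exact: lt_le_trans sn.
have -> : b - a - (2 * a)^-1 * (v - w) = - ((v - w) * (v - w)) / (2 * a * ((a + b) * (a + b))).
  by rewrite -E -Ev; field; rewrite a0 ab0.
rewrite nmM nmN nmM nmV mulrAC ler_wpM2r ?nm_ge0//.
have n2 := @nm2 R.
have big : rho * (rho * rho) * 2 <= nm (2 * a * ((a + b) * (a + b))).
  have l0 : 0 <= rho := ltW r0.
  have q : rho * rho <= nm (a + b) * nm (a + b) := ler_pM l0 l0 sn sn.
  have := ler_pM l0 (mulr_ge0 l0 l0) an q; rewrite !nmM n2.
  set u := nm a * _; set v' := rho * _; rewrite -(mulrA 2) -/u; lra.
rewrite ler_pdivrMr; last by apply: lt_le_trans big; rewrite mulr_gt0.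
apply: le_trans (ltW v2) _; apply: le_trans (ler_wpM2l (ltW e0) big).
by rewrite le_eqVlt; apply/orP; left; apply/eqP; ring.
Qed.

End SquareRoot.

(** * Divisors that are squares of line bundles *)

Section HalfDivisors.
Context {R : realType} (X : cspace R).
Hypothesis hX : compact_riemann_surface X.
Local Notation C := R[i].
Implicit Types (x y p q : X) (m : X -> int).

(* [K^2] is O(-m): the squares of the frames of [K] have divisor [m]. *)
Definition half m : Prop := exists K : bundle X 1, forall i j x, dom K i x -> dom K j x ->
  order_at x (fun y => frame K i y 0 0 * frame K j y 0 0) (m x).

Lemma half_line I (D : I -> set X) (k : I -> X -> C) m :
  (forall i, open (D i)) -> (forall y, exists i, D i y) ->
  (forall i y, D i y -> k i y != 0) ->
  (forall i j y, D i y -> D j y -> hol y (fun y' => k i y' / k j y')) ->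
  (forall i j x, D i x -> D j x -> order_at x (fun y => k i y * k j y) (m x)) -> half m.
Proof.
move=> oD cD k0 ktr H; exists (line oD cD k0 ktr) => i j x Di Dj.
by apply: order_ext (H i j x Di Dj); apply: nearW => y; rewrite !line_frame.
Qed.

Lemma half_ext m m' : half m -> (forall x, m x = m' x) -> half m'.
Proof. by move=> h E; have <- : m = m' by apply/funext. Qed.

Lemma half0 : half (fun=> 0).
Proof.
apply: (@half_line unit (fun=> setT) (fun _ _ => 1)).
- by move=> _; exact: openT.
- by move=> y; exists tt.
- by move=> _ y _; exact: oner_neq0.
- by move=> _ _ y _ _; exact: hol_cst.
- by move=> _ _ x _ _; rewrite mulr1; exact: (order_unit hX (hol_cst x 1) (oner_neq0 _)).
Qed.

Lemma halfD m m' : half m -> half m' -> half (fun x => m x + m' x).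
Proof.
move=> [K hK] [K' hK'].
apply: (@half_line (frame_index K * frame_index K') (fun t => dom K t.1 `&` dom K' t.2)
  (fun t y => frame K t.1 y 0 0 * frame K' t.2 y 0 0)).
- by move=> t; apply: openI; exact: dom_open.
- move=> y; have [i Ki] := @dom_cover _ _ _ K y; have [j Kj] := @dom_cover _ _ _ K' y.
  by exists (i, j).
- by move=> t y [h1 h2]; rewrite mulf_neq0// line_neq0.
- move=> t u y [t1 t2] [u1 u2]; apply: hol_ext (holM (line_trans t1 u1) (line_trans t2 u2)) _.
  by apply: nearW => y'; rewrite invfM mulrACA.
- move=> t u x [t1 t2] [u1 u2]; apply: order_ext (order_mul hX (hK _ _ _ t1 u1) (hK' _ _ _ t2 u2)).
  by apply: nearW => y'; rewrite mulrACA.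
Qed.

Lemma halfN m : half m -> half (fun x => - m x).
Proof.
move=> [K hK].
apply: (@half_line (frame_index K) (dom K) (fun i y => (frame K i y 0 0)^-1)).
- by move=> t; exact: dom_open.
- by move=> y; exact: dom_cover.
- by move=> t y h1; rewrite invr_eq0 line_neq0.
- move=> t u y t1 u1; apply: hol_ext (line_trans u1 t1) _.
  by apply: nearW => y'; rewrite invrK mulrC.
- move=> t u x t1 u1; apply: order_ext (order_inv hX (hK _ _ _ t1 u1)).
  by apply: nearW => y'; rewrite invfM.
Qed.

Definition point p : X -> int := fun x => (x == p)%:Z.

Lemma order_sub U (z : X -> C) psi c x q : good_chart c U z psi -> U x -> U q ->
  order_at x (fun y => z y - z q) (point q x).
Proof.
move=> gc Ux Uq; rewrite /point; have [->|xq] := eqVneq x q.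
  exists U, z, (fun=> 1); split=> //.
  - exact: gc_coord gc.
  - exact: hol_cst.
  - by apply: nearW => y; rewrite mul1r expr1z.
apply: order_unit => //; first by apply: holB; [exact: gc_zhol gc _ Ux | exact: hol_cst].
rewrite subr_eq0; apply: contra xq => /eqP E.
by rewrite -(gc_K' gc Ux) -(gc_K' gc Uq) E.
Qed.

Lemma half_point2 p : half (fun x => 2 * point p x).
Proof.
have [U [z [psi gc]]] := chart_at hX p.
pose D (b : bool) : set X := if b then U else [set y | y != p].
(* The bundle O(-p), with frame [z] near [p]. A frame has to be invertible, so at [p] itself its
   value is set to 1; orders are read off on punctured neighbourhoods and the other frame is not
   defined at [p]. *)
pose k (b : bool) y : C := if b then if y == p then 1 else z y else 1.
have zp y : U y -> y != p -> z y != 0 by move=> Uy yp; rewrite (gc_z_eq0 gc Uy).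
have k0 b y : D b y -> k b y != 0.
  case: b => Dy; rewrite /k ?oner_neq0//.
  by case: (eqVneq _ p) => [_|yp]; [exact: oner_neq0 | exact: zp].
apply: (@half_line bool D k).
- case; first exact: gc_open gc.
  by rewrite /D openE => y; exact: neq_near.
- move=> y; have [->|yp] := eqVneq y p; first by exists true; exact: gc_in gc.
  by exists false.
- exact: k0.
- move=> b b' y Db Db'; have [E|bb] := eqVneq b b'.
    apply: hol_ext (hol_cst y 1) _; rewrite E.
    have nD : \forall y' \near y, D b' y'.
      move: Db'; rewrite /D; case: b' {Db E}; [exact: gc_nbhs gc _ | exact: neq_near].
    near=> y'; have Dy : D b' y' by near: y'.
    by rewrite mulfV// k0.
  have [Uy yp] : U y /\ y != p by move: Db Db' bb; case: b; case: b'.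
  have ny := neq_near hX yp.
  have hz := gc_zhol gc Uy.
  case: b b' bb {Db Db'} => [] [] // _.
    apply: hol_ext hz _; near=> y'; have : y' != p by near: y'.
    by rewrite /k => /negPf ->; rewrite divr1.
  apply: hol_ext (holV hz (zp _ Uy yp)) _; near=> y'; have : y' != p by near: y'.
  by rewrite /k => /negPf ->; rewrite div1r.
- move=> b b' x Db Db'; have [xp|xp] := eqVneq x p.
    have [-> ->] : b = true /\ b' = true.
      by move: Db Db'; rewrite xp /D; case: b; case: b' => //=; rewrite eqxx.
    have o1 := order_sub gc (gc_in gc) (gc_in gc).
    rewrite xp mulr_natl mulr2n; apply: order_ext (order_mul hX o1 o1).
    apply/punctP; apply: nearW => y /negPf yp.
    by rewrite /k yp (gc_0 gc) subr0.
  rewrite /point (negPf xp) mulr0.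
  have kb c : D c x -> hol x (k c) /\ k c x != 0.
    case: c => Dc; last by split; [exact: hol_cst | exact: oner_neq0].
    split; last by rewrite /k (negPf xp) zp.
    apply: hol_ext (gc_zhol gc Dc) _; have nx := neq_near hX xp.
    by near=> y; have : y != p by [near: y]; rewrite /k => /negPf ->.
  have [h1 h2] := kb _ Db; have [h3 h4] := kb _ Db'.
  by apply: order_unit => //; [exact: holM | exact: mulf_neq0].
Unshelve. all: by end_near.
Qed.

(* On the part of the chart with [|z| > 1] the function [z / (z - z q)] is close
   to 1 and has a holomorphic square root; elsewhere the fibre identification of
   the bundle is arbitrary, so any square root will do. *)
Lemma half_near p : \forall q \near p, half (fun x => point p x - point q x).
Proof.
have [hs _ _ _] := hX.
have [U [z [psi gc]]] := chart_at hX p.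
have nU := gc_nbhs gc (gc_in gc).
have b4 : box (1 / 4) (z p) by rewrite (gc_0 gc); apply: box0; lra.
have nb := gc_cont gc (gc_in gc) (box_nbhs b4).
near=> q; have Uq : U q by near: q.
have [q1 q2] : box (1 / 4) (z q) by near: q.
pose Kc : set X := psi @` [set w | `|complex.Re w| <= 1 /\ `|complex.Im w| <= 1].
have clK : closed Kc.
  apply: compact_closed => //.
  apply: (@continuous_compact C^o (points X) psi); last exact: compact_closed_box.
  apply: continuous_in_subspaceT => w /set_mem[h1 h2] P nP.
  by apply: (gc_cont' gc _ nP); split; lra.
have KcP y : U y -> ~ Kc y -> 1 < nm (z y).
  move=> Uy nK; rewrite ltNge; apply/negP => h; apply: nK; exists (z y).
    by split; apply: le_trans h; [exact: Re_nm | exact: Im_nm].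
  exact: gc_K' gc _ Uy.
have inK y : U y -> box 1 (z y) -> Kc y.
  by move=> Uy [h1 h2]; exists (z y); [split; exact: ltW | exact: gc_K' gc _ Uy].
have Kp : Kc p by apply: inK (gc_in gc) _; rewrite (gc_0 gc); exact: box0.
have Kq : Kc q by apply: inK Uq _; split; lra.
have zq2 : nm (z q) < 1 / 2 by apply: le_lt_trans (nm_ReIm _) _; lra.
have [rt rtP] := @root_cdiff R.
pose D (b : bool) : set X := if b then U else ~` Kc.
(* Off [Kc] the modulus of [z y] exceeds 1 while that of [z q] is below 1/2, so the quotient is 1 /
   (1 - t) with t of modulus below 1/2 and has positive real part. *)
have out y : U y -> ~ Kc y -> [/\ z y != 0, z y - z q != 0 & 0 < complex.Re (z y / (z y - z q))].
  move=> Uy nK; have h := KcP _ Uy nK.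
  have z0 : z y != 0 by rewrite -nm_gt0; apply: lt_trans h.
  have zq : z y - z q != 0.
    by rewrite subr_eq0; apply/eqP => E; move: h; rewrite E; lra.
  split=> //; pose t := z q / z y.
  have t1 : nm t < 1 / 2.
    rewrite nmM nmV ltr_pdivrMr; last by rewrite nm_gt0.
    by apply: lt_trans zq2 _; lra.
  have t0 : 1 - t != 0.
    by rewrite subr_eq0; apply/eqP => E; move: t1; rewrite -E nm1; lra.
  have -> : z y / (z y - z q) = (1 - t)^-1 by rewrite /t; field; rewrite z0 zq.
  have Rt : 0 < complex.Re (1 - t).
    have := Re_nm t; rewrite raddfB/= ler_norml => /andP[_]; lra.
  have N0 : 0 < nm (1 - t) by rewrite nm_gt0.
  case: (1 - t) Rt t0 => a b /= Ra t0; rewrite divr_gt0//.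
  by rewrite ltr_pwDl ?exprn_gt0 ?sqr_ge0.
pose phi y := z y / (z y - z q).
(* The holomorphic branch is forced off [Kc]; inside, any root will do, and at [p] and [q], where
   the quotient has its zero and pole, the value 1 keeps the frame invertible. *)
have kex y : exists k : C, k != 0 /\ (U y ->
    (y != p -> y != q -> k * k = phi y) /\ (~ Kc y -> k = rt (phi y))).
  have [Uy|nUy] := pselect (U y); last by exists 1; split; [exact: oner_neq0|].
  have [Ky|nKy] := pselect (Kc y); last first.
    have [z0 zq R0] := out _ Uy nKy; have [r1 r2 _] := rtP _ R0.
    by exists (rt (phi y)); split.
  have [yp|yp] := eqVneq y p.
    by exists 1; split; [exact: oner_neq0|move=> _; split=> //].
  have [yq|yq] := eqVneq y q.
    by exists 1; split; [exact: oner_neq0|move=> _; split=> //].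
  have pn : phi y != 0.
    rewrite /phi mulf_neq0 ?invr_eq0 ?(gc_z_eq0 gc)// subr_eq0.
    by apply: contra yq => /eqP E; rewrite -(gc_K' gc Uy) -(gc_K' gc Uq) E.
  exists (sqrtC (phi y)); split; first by rewrite sqrtC_eq0.
  by move=> _; split=> // _ _; rewrite -expr2 sqrtCK.
have [kap kapP] := choice kex.
have kap0 y : kap y != 0 by case: (kapP y).
have kapE y : U y -> y != p -> y != q -> kap y * kap y = phi y.
  by move=> Uy; case: (kapP y) => _ /(_ Uy)[].
have kaph y : U y -> ~ Kc y -> hol y kap.
  move=> Uy nK; have hphi : hol y phi.
    by apply: holM; [exact: gc_zhol gc _ Uy |
      apply: holV; [apply: holB; [exact: gc_zhol gc _ Uy | exact: hol_cst] |
      case: (out _ Uy nK)]].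
  have [_ _ R0] := out _ Uy nK.
  have hc : hol y (rt \o phi).
    apply/(gc_hol gc Uy).
    have h1 : holo1 (phi \o psi) (z y) by apply/(gc_hol gc Uy).
    have b3 := gc_box gc Uy; have nb3 := box_nbhs b3.
    have := gc_cont' gc b3; rewrite (gc_K' gc Uy) => cc.
    have noK : \forall w \near (z y : C^o), ~ Kc (psi w).
      by apply: (cc (~` Kc)); apply: open_nbhs_nbhs; split=> //; exact: closed_openC.
    near=> w.
    have cw : cdiff (phi \o psi) w by near: w; exact: h1.
    have bw : box 3 w by near: w.
    have nKw : ~ Kc (psi w) by near: w.
    have [_ _ Rw] := out _ (gc_U gc bw) nKw.
    have [_ _ rw] := rtP _ Rw.
    exact: (@cdiff_comp _ (phi \o psi) rt w cw rw).
  apply: hol_ext hc _.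
  have n1 := gc_nbhs gc Uy.
  have n2 : nbhs y (~` Kc) by apply: open_nbhs_nbhs; split=> //; exact: closed_openC.
  near=> y'; have Uy' : U y' by near: y'.
  have nK' : ~ Kc y' by near: y'.
  by have [_ /(_ Uy')[_ /(_ nK')]] := kapP y'.
pose k (b : bool) y : C := if b then kap y else 1.
have khol y b : ~ Kc y -> D b y -> hol y (k b) /\ k b y != 0.
  case: b => nK Dy; split; rewrite /k ?oner_neq0//; [exact: kaph | exact: hol_cst].
apply: (@half_line bool D k).
- case; [exact: gc_open gc | exact: closed_openC].
- move=> y; have [Ky|nK] := pselect (Kc y); last by exists false.
  by exists true; case: Ky => w [h1 h2] <-; apply: (gc_U gc); split; lra.
- by case=> y Dy; rewrite /k ?oner_neq0.
- move=> b b' y Db Db'; have [Ky|nK] := pselect (Kc y).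
    have [-> ->] : b = true /\ b' = true.
      by move: Db Db'; rewrite /D; case: b; case: b' => //= *; exfalso; auto.
    apply: hol_ext (hol_cst y 1) _; apply: nearW => y'; by rewrite /k mulfV.
  have [h1 _] := khol y b nK Db; have [h2 h3] := khol y b' nK Db'.
  by apply: holM h1 _; exact: holV.
- move=> b b' x Db Db'; have [Kx|nK] := pselect (Kc x).
    have [bE b'E] : b = true /\ b' = true.
      by move: Db Db'; rewrite /D; case: b; case: b' => //= *; exfalso; auto.
    move: Db; rewrite bE b'E /D => Ux.
    have o1 := order_sub gc Ux (gc_in gc); have o2 := order_sub gc Ux Uq.
    have pq : \forall y \near x^', y != p /\ y != q.
      have isol (c : X) : \forall y \near x^', y != c.
        have [->|xc] := eqVneq x c; first by apply/punctP; exact: nearW.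
        by apply: punctW; exact: neq_near.
      by have i1 := isol p; have i2 := isol q; near=> y; split; near: y.
    have nUx := punctW (gc_nbhs gc Ux).
    apply: order_ext (order_mul hX o1 (order_inv hX o2)); near=> y.
    have [y1 y2] : y != p /\ y != q by near: y.
    by rewrite /k kapE// ?(gc_0 gc) ?subr0//; near: y.
  have px : x != p by apply/eqP => E; apply: nK; rewrite E.
  have qx : x != q by apply/eqP => E; apply: nK; rewrite E.
  rewrite /point (negPf px) (negPf qx) subrr.
  have [h1 h2] := khol x b nK Db; have [h3 h4] := khol x b' nK Db'.
  by apply: order_unit => //; [exact: holM | exact: mulf_neq0].
Unshelve. all: by end_near.
Qed.

(** The relation is an equivalence and by [half_near] its classes are open; connectedness enters
    through [germ_dichotomy], applied to the indicator [f] of the class of [p]. *)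
Lemma half_points p q : half (fun x => point p x - point q x).
Proof.
pose f q : C := if pselect (half (fun x => point p x - point q x)) then 1 else 0.
have sub a b c : half (fun x => point a x - point b x) -> half (fun x => point b x - point c x) ->
    half (fun x => point a x - point c x).
  by move=> h1 h2; apply: half_ext (halfD h1 h2) _ => x; rewrite addrA subrK.
have inv a b : half (fun x => point a x - point b x) -> half (fun x => point b x - point a x).
  by move=> h; apply: half_ext (halfN h) _ => x; rewrite opprB.
have f1 c : half (fun x => point p x - point c x) -> f c != 0.
  by rewrite /f; case: pselect => // *; exact: oner_neq0.
have f0 c : ~ half (fun x => point p x - point c x) -> f c = 0.
  by rewrite /f; case: pselect.
have fN c : f c != 0 -> half (fun x => point p x - point c x).
  by move=> h; have [//|/f0 E] := pselect (half (fun x => point p x - point c x)); rewrite E eqxx in h.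
have nz := @germ_dichotomy _ _ hX f _ _.
have {}nz : forall x, \forall y \near x^', f y != 0.
  apply: nz => [x|].
    have [h|h] := pselect (half (fun x' => point p x' - point x x')); [right|left].
      apply: punctW; apply: filterS (half_near x) => y h'; apply: f1; exact: sub h h'.
    apply: punctW; apply: filterS (half_near x) => y h'; apply: f0 => h''.
    by apply: h; apply: sub h'' _; exact: inv.
  by exists p; apply: punctW; apply: filterS (half_near p) => y; exact: f1.
have np := punctW (half_near q); have nq := nz q.
have [|y _ [h1 h2]] := @punct_exists _ _ hX q (fun y => f y != 0 /\ half (fun x => point q x - point y x)).
  by near=> y; split; near: y.
by apply: sub (fN _ h1) _; exact: inv.
Unshelve. all: by end_near.
Qed.

(** A divisor of degree [2 * k] is the combination of the y - p0 with coefficients m(y), plus [k]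
    times the square 2 p0; each term is already known. *)
Lemma half_even (S : seq X) m (k : int) : uniq S -> (forall x, m x != 0 -> x \in S) ->
  \sum_(x <- S) m x = 2 * k -> half m.
Proof.
move=> uS mS mk.
have [[p0 _]|noX] := pselect (exists p0 : X, True); last first.
  by apply: half_ext half0 _ => x; case: noX; exists x.
have halfZ (t : int) m' : half m' -> half (fun x => t * m' x).
  have halfn (n : nat) : half m' -> half (fun x => n%:Z * m' x).
    move=> h; elim: n => [|n IH]; first by apply: half_ext half0 _ => x; rewrite mul0r.
    by apply: half_ext (halfD h IH) _ => x; rewrite intS mulrDl mul1r.
  case: t => n h; first exact: halfn.
  by apply: half_ext (halfN (halfn n.+1 h)) _ => x; rewrite NegzE mulNr.
have main (T : seq X) : half (fun x => \sum_(y <- T) m y * (point y x - point p0 x)).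
  elim: T => [|y T IH]; first by apply: half_ext half0 _ => x; rewrite big_nil.
  by apply: half_ext (halfD (halfZ (m y) _ (half_points y p0)) IH) _ => x; rewrite big_cons.
apply: half_ext (halfD (main S) (halfZ k _ (half_point2 p0))) _ => x.
under eq_bigr => y _ do rewrite mulrBr.
rewrite sumrB -mulr_suml mk mulrA (mulrC k) subrK.
have [xS|xS] := boolP (x \in S).
  rewrite (big_rem x)//= big_seq big1 => [|y]; first by rewrite /point eqxx mulr1 addr0.
  rewrite mem_rem_uniq// inE => /andP[/negPf yx _].
  by rewrite /point eq_sym yx mulr0.
rewrite big_seq big1 => [|y yS].
  by apply/esym/eqP; apply: contraNT xS; exact: mS.
by rewrite /point (_ : (x == y) = false) ?mulr0//; apply/negP => /eqP E; rewrite E yS in xS.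
Qed.

Lemma line_square_root (L : bundle X 1) : (2 %| deg L)%Z ->
  exists K : bundle X 1, forall i j a x, dom K i x -> dom K j x -> dom L a x ->
    hol x (fun y => frame K i y 0 0 * frame K j y 0 0 / frame L a y 0 0).
Proof.
move=> evL; have [s [m sm]] := degree_dataP hX L.
have fin := degree_data_finite hX sm.
have [_ [S [uS ES mS _]]] := finite_support_sum 0 0 fin fin.
have [K hK] : half (fun x => - m x).
  apply: (@half_even S _ (- (deg L %/ 2)%Z)) => // [x|].
    by rewrite oppr_eq0; exact: mS.
  by rewrite sumrN -ES -(deg_data hX sm) mulrN mulrC divzK.
pose P i j a y := frame K i y 0 0 * frame K j y 0 0 * (s y / frame L a y 0 0).
have oP i j a x : dom K i x -> dom K j x -> dom L a x -> order_at x (P i j a) 0.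
  move=> Ki Kj La; rewrite -(addNr (m x)).
  apply: order_ext (order_mul hX (hK i j x Ki Kj) (sm a x La)).
  by apply: nearW => y; rewrite det_mx11.
(* For a meromorphic section [s] of [L] with divisor [m], the products [P] have order 0. Rescaling
   the fibre of [K] at [y] by a root [c] of the missing factor makes the square of the fibre of [K]
   equal that of [L]. The root is chosen separately at each point, since [c] cancels from the
   transition functions. *)
have cex y : exists c : C, c != 0 /\ forall i j a g, dom K i y -> dom K j y -> dom L a y ->
    hol y g -> (\forall y' \near y^', P i j a y' = g y') ->
    c * frame K i y 0 0 * (c * frame K j y 0 0) / frame L a y 0 0 = g y.
  have [i Ki] := @dom_cover _ _ _ K y; have [a La] := @dom_cover _ _ _ L y.
  have [g [hg gE g0]] := order_ge0 hX (oP i i a y Ki Ki La).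
  have kn := line_neq0 Ki; have ln := line_neq0 La.
  pose w := g y * frame L a y 0 0 / (frame K i y 0 0 * frame K i y 0 0).
  have w0 : w != 0 by rewrite !mulf_neq0 ?invr_eq0 ?mulf_neq0// g0.
  have cc : sqrtC w * sqrtC w = w by rewrite -expr2 sqrtCK.
  exists (sqrtC w); split=> [|j j' b h Kj Kj' Lb hh hE]; first by rewrite sqrtC_eq0.
  have kn1 := line_neq0 Kj; have kn2 := line_neq0 Kj'; have ln1 := line_neq0 Lb.
  have -> : h y = g y * (frame K j y 0 0 / frame K i y 0 0) *
      (frame K j' y 0 0 / frame K i y 0 0) * (frame L a y 0 0 / frame L b y 0 0).
    apply: (hol_punct_eq hX hh (holM (holM (holM hg (line_trans Kj Ki)) (line_trans Kj' Ki))
      (line_trans La Lb))).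
    have n1 := punctW (dom_nbhs Ki); have n2 := punctW (dom_nbhs La).
    near=> y'; have /line_neq0 k1 : dom K i y' by near: y'.
    have /line_neq0 l1 : dom L a y' by near: y'.
    have <- : P j j' b y' = h y' by near: y'.
    have <- : P i i a y' = g y' by near: y'.
    rewrite /P; have [->|bn] := eqVneq (frame L b y' 0 0) 0; first by rewrite invr0 !mulr0.
    by field; rewrite k1 l1 bn.
  rewrite mulrACA cc /w; field.
  by rewrite kn ln1.
have [c cP] := choice cex.
pose k i y := c y * frame K i y 0 0.
have k0 i y : dom K i y -> k i y != 0.
  by move=> Ki; rewrite mulf_neq0 ?line_neq0//; case: (cP y).
have ktr i j y : dom K i y -> dom K j y -> hol y (fun y' => k i y' / k j y').
  move=> Ki Kj; apply: hol_ext (line_trans Ki Kj) _; apply: nearW => y'.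
  by rewrite /k invfM mulrACA mulfV ?mul1r//; case: (cP y').
exists (line (@dom_open _ _ _ K) (@dom_cover _ _ _ K) k0 ktr) => i j a x Ki Kj La.
have [g [hg gE _]] := order_ge0 hX (oP i j a x Ki Kj La).
apply: (hol_ext hg).
have n1 := hol_near hX hg; have n2 := nbhs_interior ((punctP _ _).1 gE).
have d1 := dom_nbhs (Ki : dom K i x); have d2 := dom_nbhs (Kj : dom K j x).
have d3 := dom_nbhs La.
near=> y; rewrite !line_frame /k.
have [_ H] := cP y; apply/esym; apply: H; try by near: y.
have [->//|yx] := eqVneq y x.
have ny := neq_near hX yx; apply: punctW.
have n3 : nbhs y [set y | y != x -> P i j a y = g y] by near: y.
by near=> y'; have : y' != x by [near: y']; near: y'.
Unshelve. all: by end_near.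
Qed.

End HalfDivisors.

(** * Kernels of holomorphic families of matrices *)

Section HolomorphicMatrices.
Context {R : realType} (X : cspace R).
Hypothesis hX : compact_riemann_surface X.
Local Notation C := R[i].
Implicit Types (x y : X).

Lemma holmx_near x m n (A : X -> 'M[C]_(m, n)) : holmx x A ->
  \forall y \near x, holmx y A.
Proof.
move=> hA; have : \forall y \near x, forall i : 'I_m, forall j : 'I_n, hol y (fun y' => A y' i j).
  by apply: filter_forall => i; apply: filter_forall => j; exact: hol_near (hA i j).
by apply: filterS.
Qed.

Lemma holmx_unit x n (A : X -> 'M[C]_n) : holmx x A -> A x \in unitmx ->
  \forall y \near x, A y \in unitmx.
Proof.
move=> hA Ax; have dx : \det (A x) != 0 by rewrite -unitfE -unitmxE.
by have := hol_neq0 hX (holmx_det hA) dx; apply: filterS => y; rewrite -unitfE -unitmxE.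
Qed.

Lemma holmxV x n (A : X -> 'M[C]_n) : holmx x A -> A x \in unitmx ->
  holmx x (fun y => invmx (A y)).
Proof. by move=> hA Ax; apply: holmx_inv => //; exact: holmx_unit. Qed.

(** A right inverse [D] of [A x] makes [A y *m D] invertible near [x], and the coefficients are then
    B D (A D)^-1. *)
Lemma holmx_quotient x r n (A B : X -> 'M[C]_(r, n)) (T : X -> 'M[C]_r) :
  holmx x A -> holmx x B -> row_free (A x) -> (\forall y \near x, T y *m A y = B y) ->
  holmx x T.
Proof.
move=> hA hB /row_freeP[D AD] TE.
have hAD : holmx x (fun y => A y *m D) by apply: holmxM => //; exact: holmx_cst.
have uAD : A x *m D \in unitmx by rewrite AD unitmx1.
apply: holmx_ext (holmxM (holmxM hB (holmx_cst x D)) (holmxV hAD uAD)) _.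
have nu := holmx_unit hAD uAD; near=> y.
have uy : A y *m D \in unitmx by near: y.
have <- : T y *m A y = B y by near: y.
by rewrite -(mulmxA (T y)) mulmxK.
Unshelve. all: by end_near.
Qed.


Section SubbundleOfFrames.
Variables (n r : nat) (E : bundle X n) (I : Type) (D : I -> set X) (J : I -> X -> 'M[C]_(r, n)).
Hypotheses (oD : forall i, open (D i)) (cD : forall y, exists i, D i y)
  (freeJ : forall i y, D i y -> row_free (J i y))
  (holJ : forall i a y, D i y -> dom E a y ->
     holmx y (fun y' => J i y' *m invmx (frame E a y')))
  (JJ : forall i j y, D i y -> D j y -> (J i y <= J j y)%MS).
Variables (i0 : X -> I) (i0P : forall y, D (i0 y) y).

(** The fibre at [y] is identified with C^r by an arbitrarily chosen local frame; the remaining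
    frames are expressed in it by [pinvmx], and only quotients of these expressions have to be
    holomorphic. *)
Let emb y := J (i0 y) y.
Let fr i y : 'M[C]_r := J i y *m pinvmx (emb y).

Let frE i y : D i y -> fr i y *m emb y = J i y.
Proof. by move=> Di; rewrite mulmxKpV//; exact: JJ. Qed.

Lemma sub_frame_unit i y : D i y -> fr i y \in unitmx.
Proof.
move=> Di; rewrite -row_free_unit -row_leq_rank.
have := freeJ Di; rewrite -row_leq_rank => /leq_trans; apply.
by rewrite -[in X in (X <= _)%N](frE Di) mxrankM_maxl.
Qed.

Lemma open_dom_nbhs i y : D i y -> nbhs y (D i).
Proof. by move=> Di; apply: open_nbhs_nbhs. Qed.

Lemma sub_frame_trans i j y : D i y -> D j y ->
  holmx y (fun y' => fr i y' *m invmx (fr j y')).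
Proof.
move=> Di Dj; have [a Ea] := @dom_cover _ _ _ E y.
apply: (holmx_quotient (holJ Dj Ea) (holJ Di Ea)).
  rewrite -row_leq_rank mxrankMfree; first by have := freeJ Dj; rewrite -row_leq_rank.
  by rewrite row_free_unit unitmx_inv; exact: frame_unit.
have n1 := open_dom_nbhs Di; have n2 := open_dom_nbhs Dj.
near=> y'; have Di' : D i y' by near: y'.
have Dj' : D j y' by near: y'.
have -> : J j y' = fr j y' *m emb y' by rewrite frE.
rewrite -[fr j y' *m emb y' *m _]mulmxA mulmxA (mulmxKV (sub_frame_unit Dj')).
by rewrite mulmxA (frE Di').
Unshelve. all: by end_near.
Qed.

Definition frames_bundle : bundle X r :=
  @Bundle _ X r I D fr oD cD sub_frame_unit sub_frame_trans.

Lemma frames_embed_hol : hol_hom frames_bundle E emb.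
Proof.
move=> i a y Di Ea; apply: holmx_ext (holJ Di Ea) _.
have n1 := open_dom_nbhs Di; near=> y'; have Di' : D i y' by near: y'.
by rewrite /= frE.
Unshelve. all: by end_near.
Qed.

Definition frames_subbundle : subbundle E r :=
  @Subbundle _ X n E r frames_bundle emb frames_embed_hol (fun y => freeJ (i0P y)).

End SubbundleOfFrames.

Lemma subbundle_of_frames n r (E : bundle X n) (I : Type) (D : I -> set X)
    (J : I -> X -> 'M[C]_(r, n)) :
  (forall i, open (D i)) -> (forall y, exists i, D i y) ->
  (forall i y, D i y -> row_free (J i y)) ->
  (forall i a y, D i y -> dom E a y -> holmx y (fun y' => J i y' *m invmx (frame E a y'))) ->
  (forall i j y, D i y -> D j y -> (J i y <= J j y)%MS) ->
  exists V : subbundle E r, forall y, exists i, D i y /\ embed V y = J i y.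
Proof.
move=> oD cD fJ hJ JJ; have [i0 i0P] := choice cD.
by exists (frames_subbundle oD cD fJ hJ JJ i0P) => y; exists (i0 y).
Qed.

Lemma holmx_block x m1 m2 n1 n2 (A : X -> 'M[C]_(m1, n1)) (B : X -> 'M[C]_(m1, n2))
    (D : X -> 'M[C]_(m2, n1)) (F : X -> 'M[C]_(m2, n2)) :
  holmx x A -> holmx x B -> holmx x D -> holmx x F ->
  holmx x (fun y => block_mx (A y) (B y) (D y) (F y)).
Proof.
move=> hA hB hD hF.
have row m (G : X -> 'M[C]_(m, n1)) (H : X -> 'M[C]_(m, n2)) : holmx x G -> holmx x H ->
    holmx x (fun y => row_mx (G y) (H y)).
  move=> hG hH; apply: holmx_ext (holmxT (holmx_block_col (holmxT hG) (holmxT hH))) _.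
  by apply: nearW => y; rewrite tr_col_mx !trmxK.
by apply: holmx_block_col; exact: row.
Qed.

Lemma rank_block_pivot m n (a : C) (b : 'rV[C]_n) (B : 'M[C]_(m, n)) : a != 0 ->
  \rank (block_mx a%:M b 0 B : 'M[C]_(1 + m, 1 + n)) = (1 + \rank B)%N.
Proof.
move=> a0; pose T : 'M[C]_(1 + n) := block_mx 1%:M (- a^-1 *: b) 0 1%:M.
have uT : T \in unitmx by rewrite unitmxE det_ublock !det1 mulr1 unitr1.
have -> : \rank (block_mx a%:M b 0 B) = \rank (block_mx a%:M b 0 B *m T).
  by rewrite mxrankMfree// row_free_unit.
rewrite mulmx_block !mulmx0 !mul0mx !mulmx1 !addr0 add0r.
rewrite -scalemxAr mul_scalar_mx scalerA mulNr mulVf// scaleN1r addNr.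
rewrite rank_diag_block_mx; congr (_ + _)%N.
by rewrite mxrank_unit// unitmxE det_scalar1 unitfE.
Qed.

Lemma rank_unit_mul n m (P : 'M[C]_n) (B : 'M[C]_(n, m)) : P \in unitmx ->
  \rank (P *m B) = \rank B.
Proof. by move=> uP; rewrite (eqmxMfull B (_ : row_full P)) ?row_full_unit. Qed.

Lemma row_pad n m (P : 'M[C]_n) (B : 'M[C]_(n, m)) i : row i (P *m B) = 0 ->
  row i (P *m (row_mx 0 B : 'M[C]_(n, 1 + m))) = 0.
Proof. by move=> E; rewrite mul_mx_row mulmx0 row_row_mx row0 E row_mx0. Qed.

Lemma rank_pad n m (B : 'M[C]_(n, m)) : \rank (row_mx 0 B : 'M[C]_(n, 1 + m)) = \rank B.
Proof. by rewrite rank_row_0mx. Qed.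

Lemma row_pad_block n m r (a : C) (b : 'rV[C]_m) (P : 'M[C]_n) (B : 'M[C]_(n, m)) (i : 'I_(1 + n)) :
  (forall j : 'I_n, (r <= j)%N -> row j (P *m B) = 0) -> (r < i)%N ->
  row i (block_mx 1%:M 0 0 P *m block_mx a%:M b 0 B) = 0.
Proof.
move=> H; rewrite mulmx_block !mul0mx !mulmx0 !mul1mx !add0r !addr0.
case: (fintype.splitP i) => j iE; rewrite iE ?ord1//= add1n ltnS => rj.
have -> : i = rshift 1 j by exact: val_inj.
by rewrite block_mxEv rowKd row_row_mx row0 H// row_mx0.
Qed.

(* Hermite form over the discrete valuation ring of germs at [x]. *)
Lemma germ_echelon x n m (A : X -> 'M[C]_(n, m)) : holmx x A ->
  exists (P : X -> 'M[C]_n) (r : nat), [/\ holmx x P, P x \in unitmx,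
    \forall y \near x, forall i : 'I_n, (r <= i)%N -> row i (P y *m A y) = 0
  & \forall y \near x^', \rank (A y) = r].
Proof.
have [U [z [psi gc]]] := chart_at hX x.
elim: m n A => [|m IH] n A hA.
  exists (fun=> 1%:M), 0%N; split.
  - exact: holmx_cst.
  - exact: unitmx1.
  - by apply: nearW => y i _; apply/rowP => -[].
  - by apply: nearW => y; apply/eqP; rewrite -leqn0 rank_leq_col.
pose j0 : 'I_m.+1 := ord0.
have fac i : exists t : bool * nat * (X -> C),
    if t.1.1 then [/\ hol x t.2, t.2 x != 0 & \forall y \near x, A y i j0 = z y ^+ t.1.2 * t.2 y]
    else \forall y \near x, A y i j0 = 0.
  have [h|[k [u [h1 h2 h3]]]] := hol_factor gc (hA i j0).
    by exists (false, 0%N, fun=> 0).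
  by exists (true, k, u).
have [t tP] := choice fac.
have [/existsP[i1 i1P]|none] := boolP [exists i, (t i).1.1]; last first.
  have hA' : holmx x (fun y => rsubmx (A y : 'M[C]_(n, 1 + m))).
    by move=> i j; apply: hol_ext (hA i (rshift 1 j)) _; apply: nearW => y; rewrite mxE.
  have [P [r [hP Px Pr rk]]] := IH _ _ hA'.
  have zc : \forall y \near x, lsubmx (A y : 'M[C]_(n, 1 + m)) = 0.
    have : \forall y \near x, forall i : 'I_n, A y i j0 = 0.
      apply: filter_forall => i; have := tP i.
      by move: none; rewrite negb_exists => /forallP/(_ i)/negPf ->.
    apply: filterS => y H; apply/matrixP => i j; rewrite !mxE -[RHS](H i).
    by congr (A y i _); apply: val_inj => /=; case: j => -[].
  have AE : \forall y \near x, A y = row_mx 0 (rsubmx (A y : 'M[C]_(n, 1 + m))) :> 'M[C]_(n, 1 + m).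
    by apply: filterS zc => y E; rewrite -{1}(@hsubmxK _ n 1 m (A y)) E.
  exists P, r; split=> //.
    near=> y => i ri; have -> : A y = row_mx 0 (rsubmx (A y : 'M[C]_(n, 1 + m))) :> 'M[C]_(n, 1 + m) by near: y.
    apply: row_pad; move: ri; move: i; near: y; exact: Pr.
  have AE' := punctW AE; near=> y.
  have -> : A y = row_mx 0 (rsubmx (A y : 'M[C]_(n, 1 + m))) :> 'M[C]_(n, 1 + m) by near: y.
  by apply: (etrans (rank_pad _)); near: y.
(* The pivot is the entry of the first column with the lowest order of vanishing; in the ring of
   germs it divides the others, with the holomorphic quotients [c]. *)
case: (@arg_minnP _ i1 (fun i => (t i).1.1) (fun i => (t i).1.2) i1P) => i2 i2P i2min {i1 i1P}.
case: n i2 A hA t tP i2P i2min {fac} => [[]//|n] i2 A hA t tP i2P i2min.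
have := tP i2; rewrite i2P => -[hu u0 uE].
set e := (t i2).1.2 in uE i2min; set u := (t i2).2 in hu u0 uE.
pose c i y := if (t i).1.1 then z y ^+ ((t i).1.2 - e) * (t i).2 y / u y else 0.
have zh := gc_zhol gc (gc_in gc).
have hc i : hol x (c i).
  rewrite /c; have := tP i; case: ifP => [_ [h _ _]|_ _]; last exact: hol_cst.
  by apply: holM; [apply: holM => //; exact: holX | exact: holV].
have cE : \forall y \near x, forall i, A y i j0 = c i y * A y i2 j0.
  apply: filter_forall => i; have nu := hol_neq0 hX hu u0.
  have := tP i; rewrite /c; case: ifP => [ti [_ _ E]|_ E]; near=> y; last first.
    by rewrite mul0r; near: y.
  have uy : u y != 0 by near: y.
  have -> : A y i j0 = z y ^+ (t i).1.2 * (t i).2 y by near: y.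
  have -> : A y i2 j0 = z y ^+ e * u y by near: y.
  have -> : z y ^+ (t i).1.2 = z y ^+ ((t i).1.2 - e) * z y ^+ e.
    by rewrite -exprD subnK// i2min.
  by field.
pose A1 y : 'M[C]_(1 + n, 1 + m) := xrow i2 ord0 (A y).
pose s := tperm i2 ord0.
have A1E y i j : A1 y i j = A y (s i) j by rewrite /A1 mxE.
pose cc y : 'cV[C]_n := \col_i c (s (rshift 1 i)) y.
pose P1 y : 'M[C]_(1 + n) := block_mx 1%:M 0 (- cc y) 1%:M.
pose A2 y : 'M[C]_(n, m) := drsubmx (A1 y) - cc y *m ursubmx (A1 y).
have hA1 : holmx x A1.
  by move=> i j; apply: hol_ext (hA (s i) j) _; apply: nearW => y; rewrite A1E.
have hcc : holmx x cc.
  by move=> i j; apply: hol_ext (hc (s (rshift 1 i))) _; apply: nearW => y; rewrite mxE.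
have hN a b (G : X -> 'M[C]_(a, b)) : holmx x G -> holmx x (fun y => - G y).
  by move=> hG i j; apply: hol_ext (holN (hG i j)) _; apply: nearW => y; rewrite mxE.
have hP1 : holmx x P1.
  by apply: holmx_block; [exact: holmx_cst | exact: holmx_cst | exact: hN | exact: holmx_cst].
have hA2 : holmx x A2.
  have hh : holmx x (fun y => cc y *m ursubmx (A1 y)).
    apply: holmxM => // i j; apply: hol_ext (hA1 (lshift n i) (rshift 1 j)) _.
    by apply: nearW => y; rewrite !mxE.
  move=> i j; apply: hol_ext (holB (hA1 (rshift 1 i) (rshift 1 j)) (hh i j)) _.
  by apply: nearW => y; rewrite !mxE.
have [P [r [hP Px Pr rk]]] := IH _ _ hA2.
have blk : \forall y \near x, P1 y *m A1 y =
    block_mx (A y i2 j0)%:M (ursubmx (A1 y)) 0 (A2 y) :> 'M[C]_(1 + n, 1 + m).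
  near=> y; have cy : forall i, A y i j0 = c i y * A y i2 j0 by near: y.
  have ul : ulsubmx (A1 y) = (A y i2 j0)%:M.
    apply/matrixP => i j; rewrite !ord1 !mxE eqxx mulr1n.
    congr (A y _ _); last exact: val_inj.
    by apply: etrans (tpermR i2 ord0); congr (tperm i2 ord0 _); exact: val_inj.
  rewrite -[A1 y]submxK mulmx_block !mul1mx !mul0mx !addr0 ul block_mxKur.
  congr block_mx; last by rewrite mulNmx addrC.
  apply/matrixP => i j; rewrite mulNmx !mxE !ord1 big_ord1 !mxE eqxx mulr1n.
  rewrite (_ : @lshift 1 m 0 = j0); last exact: val_inj.
  by rewrite (cy (s (rshift 1 i))) addNr.
pose P2 y : 'M[C]_(1 + n) := block_mx 1%:M 0 0 (P y).
have hP2 : holmx x P2.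
  by apply: holmx_block; [exact: holmx_cst | exact: holmx_cst | exact: holmx_cst | exact: hP].
have uP1 y : P1 y \in unitmx by rewrite unitmxE det_lblock !det1 mulr1 unitr1.
have uP : P2 x *m P1 x *m (tperm_mx i2 ord0 : 'M[C]_(1 + n)) \in unitmx.
  rewrite !unitmx_mul unitmx_perm uP1 !andbT.
  by rewrite unitmxE det_ublock det1 mul1r -unitmxE.
exists (fun y => P2 y *m P1 y *m (tperm_mx i2 ord0 : 'M[C]_(1 + n))), r.+1.
have A1T y : (tperm_mx i2 ord0 : 'M[C]_(1 + n)) *m A y = A1 y by rewrite /A1 xrowE.
split.
- exact: holmxM (holmxM hP2 hP1) (holmx_cst x _).
- exact: uP.
- near=> y => i ri; rewrite -!mulmxA A1T.
  have -> : P1 y *m A1 y = block_mx (A y i2 j0)%:M (ursubmx (A1 y)) 0 (A2 y) :> 'M[C]_(1 + n, 1 + m) by near: y.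
  by apply: (@row_pad_block n m r) => // j rj; move: j rj; near: y.
- have blk' := punctW blk; have nz := gc_zneq0 gc.
  have nu := punctW (hol_neq0 hX hu u0); have uE' := punctW uE.
  near=> y; have zy : z y != 0 by near: y.
  have uy : u y != 0 by near: y.
  have Ay : A y i2 j0 = z y ^+ e * u y by near: y.
  have -> : \rank (A y) = \rank (P1 y *m A1 y).
    rewrite -A1T mulmxA; apply/esym; apply: (@rank_unit_mul (1 + n)).
    by rewrite unitmx_mul unitmx_perm andbT uP1.
  have -> : P1 y *m A1 y = block_mx (A y i2 j0)%:M (ursubmx (A1 y)) 0 (A2 y) :> 'M[C]_(1 + n, 1 + m) by near: y.
  rewrite rank_block_pivot; last by rewrite Ay mulf_neq0// expf_neq0.
  by rewrite add1n; congr S; near: y.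
Unshelve. all: by end_near.
Qed.

End HolomorphicMatrices.

(** * Determinants relative to a complement *)

Section Complements.
Variable F : fieldType.

Lemma complement_rows k m (A : 'M[F]_(k, k + m)) : row_free A ->
  exists B : 'M[F]_(m, k + m), col_mx A B \in unitmx.
Proof.
rewrite -row_leq_rank => rA; have rk : \rank A = k by apply/eqP; rewrite eqn_leq rank_leq_row.
exists (dsubmx (row_ebase A)).
have -> : col_mx A (dsubmx (row_ebase A)) = block_mx (col_ebase A) 0 0 1%:M *m row_ebase A.
  rewrite -[in RHS](vsubmxK (row_ebase A)) mul_block_col !mul0mx mul1mx add0r addr0.
  congr col_mx; rewrite -{1}(mulmx_ebase A) rk pid_mx_row -mulmxA.
  by rewrite -{1}[row_ebase A]vsubmxK mul_row_col mul0mx mul1mx addr0.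
rewrite unitmx_mul row_ebase_unit andbT unitmxE det_ublock det1 mulr1 -unitmxE.
exact: col_ebase_unit.
Qed.

Lemma change_complement k m (A : 'M[F]_(k, k + m)) (B1 B2 : 'M[F]_(m, k + m)) :
  col_mx A B1 \in unitmx -> exists P D, B2 = P *m A + D *m B1 /\
    \det (col_mx A B2) = \det D * \det (col_mx A B1).
Proof.
move=> u; pose T := B2 *m invmx (col_mx A B1).
have E : B2 = lsubmx T *m A + rsubmx T *m B1.
  by rewrite -mul_row_col hsubmxK mulmxKV.
exists (lsubmx T), (rsubmx T); split=> //.
have -> : col_mx A B2 = block_mx 1%:M 0 (lsubmx T) (rsubmx T) *m col_mx A B1.
  by rewrite mul_block_col mul1mx mul0mx addr0 -E.
by rewrite det_mulmx det_lblock det1 mul1r.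
Qed.

(** The discriminant of the form induced on the quotient by the span of [A]. A second complement is
    P A + D B1; the part in [A] is killed by [G], and numerator and denominator both acquire the
    square of det D. *)
Lemma restricted_det_change k m (A : 'M[F]_(k, k + m)) (B1 B2 : 'M[F]_(m, k + m)) G :
  G^T = G -> A *m G = 0 -> col_mx A B1 \in unitmx -> col_mx A B2 \in unitmx ->
  \det (B1 *m G *m B1^T) / \det (col_mx A B1) ^+ 2 =
  \det (B2 *m G *m B2^T) / \det (col_mx A B2) ^+ 2.
Proof.
move=> GT AG u1 u2; have [P [D [E1 E2]]] := change_complement B2 u1.
have GA : G *m A^T = 0 by rewrite -GT -trmx_mul AG trmx0.
have -> : B2 *m G *m B2^T = D *m (B1 *m G *m B1^T) *m D^T.
  have -> : B2 *m G = D *m (B1 *m G) by rewrite E1 mulmxDl -!mulmxA AG mulmx0 add0r.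
  rewrite E1 raddfD/= mulmxDr !trmx_mul -[in X in X + _]mulmxA -[in X in X + _](mulmxA B1).
  by rewrite (mulmxA G) GA mul0mx !mulmx0 add0r !mulmxA.
rewrite E2 !det_mulmx det_tr.
have d1 : \det (col_mx A B1) != 0 by rewrite -unitfE -unitmxE.
have d2 : \det D != 0 by move: u2; rewrite unitmxE unitfE E2 mulf_eq0 negb_or => /andP[].
by field; rewrite d1 d2.
Qed.

(** The same for a pairing between the quotient and another space: now det D appears once on each
    side. *)
Lemma pairing_det_change k m (A : 'M[F]_(k, k + m)) (B1 B2 : 'M[F]_(m, k + m)) (H : 'M[F]_(k + m, m)) :
  A *m H = 0 -> col_mx A B1 \in unitmx -> col_mx A B2 \in unitmx ->
  \det (B1 *m H) / \det (col_mx A B1) = \det (B2 *m H) / \det (col_mx A B2).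
Proof.
move=> AH u1 u2; have [P [D [E1 E2]]] := change_complement B2 u1.
have -> : B2 *m H = D *m (B1 *m H) by rewrite E1 mulmxDl -!mulmxA AH mulmx0 add0r.
rewrite E2 !det_mulmx.
have d1 : \det (col_mx A B1) != 0 by rewrite -unitfE -unitmxE.
have d2 : \det D != 0 by move: u2; rewrite unitmxE unitfE E2 mulf_eq0 negb_or => /andP[].
by field; rewrite d1 d2.
Qed.

Lemma restricted_rank k m (A : 'M[F]_(k, k + m)) (B : 'M[F]_(m, k + m)) G :
  G^T = G -> A *m G = 0 -> col_mx A B \in unitmx ->
  (\det (B *m G *m B^T) != 0) = (\rank G == m).
Proof.
move=> GT AG u; rewrite -unitfE -unitmxE -row_free_unit.
have GA : G *m A^T = 0 by rewrite -GT -trmx_mul AG trmx0.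
suff -> : \rank G = \rank (B *m G *m B^T) by [].
have -> : \rank G = \rank (col_mx A B *m G *m (col_mx A B)^T).
  rewrite mxrankMfree ?row_free_unit ?unitmx_tr//.
  by rewrite (eqmxMfull G (_ : row_full (col_mx A B))) ?row_full_unit.
rewrite mul_col_mx AG tr_col_mx mul_mx_row mul_col_mx mul0mx -mulmxA GA mulmx0.
by rewrite mul_col_mx mul0mx -block_mxEh rank_diag_block_mx mxrank0.
Qed.

Lemma pairing_rank k m (A : 'M[F]_(k, k + m)) (B : 'M[F]_(m, k + m)) (H : 'M[F]_(k + m, m)) :
  A *m H = 0 -> col_mx A B \in unitmx -> \rank H = m -> \det (B *m H) != 0.
Proof.
move=> AH u rH; rewrite -unitfE -unitmxE -row_free_unit -row_leq_rank -{1}rH.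
rewrite -(eqmxMfull H (_ : row_full (col_mx A B))) ?row_full_unit//.
by rewrite mul_col_mx AH rank_col_0mx.
Qed.

Lemma rowsub1_free r n (f : 'I_r -> 'I_n) : injective f -> row_free (rowsub f (1%:M : 'M[F]_n)).
Proof.
move=> fi; apply/row_freeP; exists (rowsub f (1%:M : 'M[F]_n))^T.
apply/matrixP => i j; rewrite !mxE (bigD1 (f i))//= !mxE eqxx mul1r big1 ?addr0.
  by rewrite eq_sym (inj_eq fi).
by move=> k kf; rewrite !mxE eq_sym (negPf kf) mul0r.
Qed.

Lemma frame_pairing n r (Fr G : 'M[F]_n) (A : 'M[F]_(r, n)) : Fr \in unitmx ->
  Fr *m G *m Fr^T *m (A *m invmx Fr)^T = Fr *m G *m A^T.
Proof. by move=> u; rewrite trmx_mul mulmxA -(mulmxA _ Fr^T) -trmx_mul mulVmx// trmx1 mulmx1. Qed.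

End Complements.

(** * Saturated kernels and relations between degrees *)

Section KernelBundle.
Context {R : realType} (X : cspace R).
Hypothesis hX : compact_riemann_surface X.
Local Notation C := R[i].
Implicit Types (x y : X).

(** The rank of [A] may drop at isolated points, where the kernel is too large; the subbundle is the
    extension of the generic kernel across them. The matrix [U] allows [A] to be holomorphic only
    after a change of basis in its target. *)
Lemma kernel_subbundle (x0 : X) n m (E : bundle X n) (A : X -> 'M[C]_(n, m)) :
  (forall x, exists a (U : X -> 'M[C]_m), [/\ dom E a x, \forall y \near x, U y \in unitmx
     & holmx x (fun y => frame E a y *m A y *m U y)]) ->
  exists r (N : subbundle E (n - r)), [/\ (r <= n)%N, forall x, embed N x *m A x = 0
    & forall x, \forall y \near x^', \rank (A y) = r].
Proof.
move=> HA.
have loc x : exists t : frame_index E * (X -> 'M[C]_n) * nat,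
  [/\ dom E t.1.1 x,
     (\forall y \near x, [/\ t.1.2 y \in unitmx, holmx y t.1.2 & forall i : 'I_n, (t.2 <= i)%N ->
        row i (t.1.2 y *m (frame E t.1.1 y *m A y)) = 0])
   & \forall y \near x^', \rank (A y) = t.2].
  have [a [U [Ea nU hU]]] := HA x.
  have [P [r [hP Px Pr rk]]] := germ_echelon hX hU.
  exists (a, P, r); split=> //=.
    have n1 := holmx_unit hX hP Px; have n2 := holmx_near hX hP.
    near=> y; have uU : U y \in unitmx by near: y.
    have Py : forall i : 'I_n, (r <= i)%N -> row i (P y *m (frame E a y *m A y *m U y)) = 0 by near: y.
    split; [by near: y | by near: y | move=> i ri].
    have := Py i ri; rewrite mulmxA row_mul => /(congr1 (mulmx^~ (invmx (U y)))).
    by rewrite mulmxK// mul0mx.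
  have nE := punctW (dom_nbhs Ea); have nU' := punctW nU; near=> y.
  have uU : U y \in unitmx by near: y.
  have uF : frame E a y \in unitmx by apply: frame_unit; near: y.
  have <- : \rank (frame E a y *m A y *m U y) = r by near: y.
  by rewrite mxrankMfree ?row_free_unit// rank_unit_mul.
have [t tP] := choice loc.
pose r := (t x0).2.
have rk x : \forall y \near x^', \rank (A y) = r.
  pose f y : C := (\rank (A y) == r)%:R.
  have nz : forall x, \forall y \near x^', f y != 0.
    apply: (germ_dichotomy hX) => [x'|].
      have [_ _ H] := tP x'; have [E'|ne] := eqVneq (t x').2 r; [right|left].
        by apply: filterS H => y h; rewrite /f h E' eqxx oner_neq0.
      by apply: filterS H => y h; rewrite /f h (negPf ne).
    by exists x0; have [_ _ H] := tP x0; apply: filterS H => y h; rewrite /f h eqxx oner_neq0.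
  apply: filterS (nz x) => y h; apply/eqP; apply: contraNT h => /negPf E'.
  by rewrite /f E'.
have tr x : (t x).2 = r.
  have [_ _ H] := tP x; have rx := rk x.
  have [|y _ [<- <-]//] := @punct_exists _ _ hX x (fun y => \rank (A y) = (t x).2 /\ \rank (A y) = r).
  by near=> y; split; near: y.
have rn : (r <= n)%N.
  have [|y _ <-] := @punct_exists _ _ hX x0 (fun y => \rank (A y) = r); first exact: rk.
  exact: rank_leq_row.
pose P x := (t x).1.2; pose a x := (t x).1.1.
pose good x y := [/\ dom E (a x) y, P x y \in unitmx, holmx y (P x),
   forall i : 'I_n, (r <= i)%N -> row i (P x y *m (frame E (a x) y *m A y)) = 0
   & y != x -> \rank (A y) = r].
have ngood x : \forall y \near x, good x y.
  have [Ea H _] := tP x; rewrite tr in H; have nE := dom_nbhs Ea.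
  have rx := (punctP _ _).1 (rk x).
  near=> y; have [h1 h2 h3] : [/\ P x y \in unitmx, holmx y (P x) & forall i : 'I_n, (r <= i)%N ->
        row i (P x y *m (frame E (a x) y *m A y)) = 0] by near: y.
  by split=> //; near: y.
(* The last [n - r] rows of the transformed matrix vanish, so the corresponding rows of the
   transformation span the kernel at generic points and stay independent at all points. *)
pose f (j : 'I_(n - r)) : 'I_n := cast_ord (subnKC rn) (rshift r j).
have fi : injective f by move=> i j /cast_ord_inj /rshift_inj.
pose S : 'M[C]_(n - r, n) := rowsub f 1%:M.
have Sfree : row_free S by exact: rowsub1_free.
pose J x y := S *m (P x y *m frame E (a x) y).
have JA x y : good x y -> J x y *m A y = 0.
  move=> [_ _ _ H _]; rewrite /J -!mulmxA /S -rowsubE.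
  by apply/row_matrixP => j; rewrite row_rowsub row0 H// leq_addr.
have Jr x y : good x y -> \rank (J x y) = (n - r)%N.
  move=> [Ea uP _ _ _]; rewrite mxrankMfree ?row_free_unit ?unitmx_mul ?uP ?frame_unit//.
  by apply/eqP; move: Sfree; rewrite /row_free.
(* For different centres [y] differs from one of them, hence the rank at [y] is generic and both
   frames span the whole kernel by dimension. *)
have JJ x x' y : good x y -> good x' y -> (J x y <= J x' y)%MS.
  move=> gx gx'; have [->|xx] := eqVneq x x'; first exact: submx_refl.
  have rA : \rank (A y) = r.
    have [E'|yx] := eqVneq y x; last by case: gx => _ _ _ _; apply.
    by case: gx' => _ _ _ _; apply; rewrite E'.
  apply: submx_trans (_ : (kermx (A y) <= _)%MS); first by apply/sub_kermxP; exact: JA.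
  have := mxrank_leqif_sup (_ : (J x' y <= kermx (A y))%MS).
  case; first by apply/sub_kermxP; exact: JA.
  by rewrite mxrank_ker rA Jr// leqnn eqxx => _ <-.
pose D x : set X := interior [set y | good x y].
have Dg x y : D x y -> good x y by exact: interior_subset.
have [_ _ cX _] := hX.
have [s sP] := finite_cover cX (fun x => nbhs_interior (ngood x)).
pose c k := nth x0 s k.
pose Dk k : set X := if (k < size s)%N then D (c k) else set0.
have DkD k y : Dk k y -> D (c k) y by rewrite /Dk; case: ifP.
have [||||| N NP] := @subbundle_of_frames _ _ hX n (n - r) E nat Dk (fun k => J (c k)).
- by move=> k; rewrite /Dk; case: ifP => _; [exact: open_interior | exact: open0].
- move=> y; have [x xs Dy] := sP y; exists (index x s).
  by rewrite /Dk index_mem xs /c nth_index.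
- by move=> k y /DkD/Dg g; rewrite /row_free Jr.
- move=> k b y /DkD/Dg[Ea _ hP _ _] Eb.
  apply: holmx_ext (holmxM (holmx_cst y S) (holmxM hP (@frame_trans _ _ _ E _ _ _ Ea Eb))) _.
  by apply: nearW => y'; rewrite /J !mulmxA.
- by move=> k l y /DkD/Dg g /DkD/Dg g'; exact: JJ.
exists r, N; split=> // y.
by have [k [/DkD/Dg g ->]] := NP y; exact: JA.
Unshelve. all: by end_near.
Qed.

Lemma det_twist_frame n1 n2 (E1 : bundle X n1) (E2 : bundle X n2) a b t y :
  \det (frame (twist E1 E2 a b) t y) = \det (frame E1 t.1 y) ^ a * \det (frame E2 t.2 y) ^ b.
Proof. exact: det_scalar1. Qed.

Lemma section_deg0 n (E : bundle X n) (phi : X -> C) :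
  (forall i x, dom E i x -> hol x (fun y => phi y / \det (frame E i y))) ->
  (forall x, phi x != 0) -> deg E = 0.
Proof.
move=> h p0; rewrite (@deg_data _ _ hX _ E phi (fun=> 0)) ?fsbig1// => i x Ei.
apply: (order_unit hX (h i x Ei)).
by rewrite mulf_neq0 ?invr_eq0 ?det_frame_neq0.
Qed.

Section LocalComplement.
Variables (k m : nat) (E : bundle X (k + m)) (N : subbundle E k).

Lemma embed_frame_unit j y : dom N j y -> row_free (frame N j y *m embed N y).
Proof.
move=> Nj; rewrite -row_leq_rank rank_unit_mul; last exact: frame_unit.
by have := embed_free N y; rewrite -row_leq_rank.
Qed.

(** Sections of quotient determinants are written with a complement chosen separately at each point.
    Near [x] that choice is traded for a complement with constant coefficients in a frame, for which
    the ratio of determinants is a holomorphic unit. *)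
Lemma local_complement i j x : dom E i x -> dom N j x ->
  exists B : 'M[C]_(m, k + m),
    [/\ \forall y \near x, col_mx (embed N y) (B *m frame E i y) \in unitmx,
        hol x (fun y => \det (frame E i y) /
          (\det (frame N j y) * \det (col_mx (embed N y) (B *m frame E i y))))
      & \det (frame E i x) /
          (\det (frame N j x) * \det (col_mx (embed N x) (B *m frame E i x))) != 0].
Proof.
move=> Ei Nj; pose A0 y := frame N j y *m embed N y *m invmx (frame E i y).
have hA0 : holmx x A0 by exact: (@embed_hol _ _ _ _ _ N j i x Nj Ei).
have [|B uB] := @complement_rows _ k m (A0 x).
  rewrite /row_free mxrankMfree ?row_free_unit ?unitmx_inv ?frame_unit//.
  exact: embed_frame_unit.
have hc : holmx x (fun y => col_mx (A0 y) B) by apply: holmx_block_col => //; exact: holmx_cst.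
have nu := holmx_unit hX hc uB.
have key y : dom E i y -> dom N j y ->
    \det (frame N j y) * \det (col_mx (embed N y) (B *m frame E i y)) =
    \det (col_mx (A0 y) B) * \det (frame E i y).
  move=> Ey Ny; rewrite -det_mulmx mul_col_mx mulmxKV ?frame_unit//.
  have -> : col_mx (frame N j y *m embed N y) (B *m frame E i y) =
      block_mx (frame N j y) 0 0 1%:M *m col_mx (embed N y) (B *m frame E i y).
    by rewrite mul_block_col !mul0mx mul1mx addr0 add0r.
  by rewrite det_mulmx det_ublock det1 mulr1.
have nE := dom_nbhs Ei; have nN := dom_nbhs Nj.
have ratio y : dom E i y -> dom N j y -> col_mx (A0 y) B \in unitmx ->
    \det (frame E i y) / (\det (frame N j y) * \det (col_mx (embed N y) (B *m frame E i y))) =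
    (\det (col_mx (A0 y) B))^-1.
  move=> Ey Ny uy; rewrite key// invfM mulrCA mulfV ?mulr1//.
  exact: det_frame_neq0.
exists B; split.
- near=> y; have Ey : dom E i y by near: y.
  have Ny : dom N j y by near: y.
  have uy : col_mx (A0 y) B \in unitmx by near: y.
  move: uy; rewrite !unitmxE !unitfE => uy.
  have := key y Ey Ny => /eqP; apply: contraTneq => ->; rewrite mulr0 eq_sym.
  by rewrite mulf_neq0// det_frame_neq0.
- apply: hol_ext (holV (holmx_det hc) _) _; first by rewrite -unitfE -unitmxE.
  near=> y; apply/esym; apply: ratio; by near: y.
- by rewrite ratio// invr_eq0 -unitfE -unitmxE.
Unshelve. all: by end_near.
Qed.

End LocalComplement.

Lemma sym_form_hol (L : bundle X 1) n (Q : qpair X n) i a x : sym_form L Q ->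
  dom Q i x -> dom L a x -> holmx x (fun y => (\det (frame L a y))^-1 *:
      (frame Q i y *m qf Q y *m (frame Q i y)^T)).
Proof.
move=> [_ H] Qi La; apply: holmx_ext (H i a x Qi La) _.
by apply: nearW => y; rewrite det_mx11.
Qed.

Lemma kernel_degree k m (Q : qpair X (k + m)) (L : bundle X 1) (N : subbundle Q k) :
  sym_form L Q -> in_kernel N -> (exists x, \rank (qf Q x) = m) ->
  [/\ 2 * deg Q <= 2 * deg N + m%:Z * deg L,
     2 * deg Q = 2 * deg N + m%:Z * deg L -> forall x, \rank (qf Q x) = m
   & (forall x, \rank (qf Q x) = m) -> 2 * deg Q = 2 * deg N + m%:Z * deg L].
Proof.
move=> sQ kN [x0 rx0].
have [B BP] := choice (fun y => complement_rows (embed_free N y)).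
(* [restricted_det_change] makes [phi] independent of the complement [B y], so it can be computed
   with a local holomorphic one; it is a section of [T]. *)
pose phi y := \det (B y *m qf Q y *m (B y)^T) / \det (col_mx (embed N y) (B y)) ^+ 2.
have phi0 y : (phi y != 0) = (\rank (qf Q y) == m).
  rewrite -(restricted_rank (sQ.1 y) (kN y) (BP y)) /phi mulf_eq0 negb_or invr_eq0 expf_eq0/=.
  have -> : \det (col_mx (embed N y) (B y)) != 0 by rewrite -unitfE -unitmxE BP.
  by rewrite andbT.
pose T := twist (twist Q N (-2) 2) L 1 m%:Z.
have dT : deg T = - (2 * deg Q) + 2 * deg N + m%:Z * deg L.
  by rewrite /T !deg_twist// mul1r mulNr.
have hphi i x : dom T i x -> hol x (fun y => phi y / \det (frame T i y)).
  case: i => -[i j] a [[Qi Nj] La].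
  have {}Qi : dom Q i x := Qi. have {}Nj : dom N j x := Nj. have {}La : dom L a x := La.
  have dTf y : \det (frame T (i, j, a) y) = \det (frame Q i y) ^- 2 *
      \det (frame N j y) ^+ 2 * \det (frame L a y) ^+ m.
    by rewrite /T !det_twist_frame expr1z.
  have [B0 [uB hB _]] := local_complement Qi Nj.
  have hS := sym_form_hol sQ Qi La.
  have hD : hol x (fun y => \det (B0 *m ((\det (frame L a y))^-1 *:
      (frame Q i y *m qf Q y *m (frame Q i y)^T)) *m B0^T)).
    apply: holmx_det; apply: holmxM; last exact: holmx_cst.
    by apply: holmxM => //; exact: holmx_cst.
  apply: hol_ext (holM hD (holX 2 hB)) _.
  have nQ := dom_nbhs Qi; have nN := dom_nbhs (Nj : dom N j x); have nL := dom_nbhs (La : dom L a x).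
  near=> y; have uy : col_mx (embed N y) (B0 *m frame Q i y) \in unitmx by near: y.
  have dQ : \det (frame Q i y) != 0 by apply: det_frame_neq0; near: y.
  have dN : \det (frame N j y) != 0 by apply: det_frame_neq0; near: y.
  have dL : \det (frame L a y) != 0 by apply: det_frame_neq0; near: y.
  have pE : phi y = _ := restricted_det_change (sQ.1 y) (kN y) (BP y) uy.
  rewrite pE dTf {pE}.
  have -> : B0 *m frame Q i y *m qf Q y *m (B0 *m frame Q i y)^T =
      B0 *m (frame Q i y *m qf Q y *m (frame Q i y)^T) *m B0^T.
    by rewrite trmx_mul !mulmxA.
  rewrite -scalemxAr -scalemxAl detZ.
  have du : \det (col_mx (embed N y) (B0 *m frame Q i y)) != 0 by rewrite -unitfE -unitmxE.
  rewrite exprVn.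
  have lm : \det (frame L a y) ^+ m != 0 by rewrite expf_neq0.
  by field; rewrite du dQ dN lm.
have [|ge eq] := section_deg hX hphi; first by exists x0; rewrite phi0 rx0.
split.
- by move: ge; rewrite dT; lia.
- move=> E x; apply/eqP; rewrite -phi0; apply: eq.
  by rewrite dT E; lia.
- move=> rk; have : deg T = 0 by apply: (section_deg0 hphi) => x; rewrite phi0 rk.
  by rewrite dT; lia.
Unshelve. all: by end_near.
Qed.

(** The form pairs Q / W perfectly with [V], with values in [L]; its determinant is a section of
    det(W) det(V)^-1 L^r det(Q)^-1 without zeros, so this line bundle has degree 0. *)
Lemma perp_degree w r (Q : qpair X (w + r)) (L : bundle X 1) (V : subbundle Q r)
    (W : subbundle Q w) : sym_form L Q -> (forall x, qf Q x \in unitmx) ->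
  (forall x, embed W x *m qf Q x *m (embed V x)^T = 0) ->
  deg W = deg Q + deg V - r%:Z * deg L.
Proof.
move=> sQ uQ WV.
have [B BP] := choice (fun y => complement_rows (embed_free W y)).
pose H y := qf Q y *m (embed V y)^T.
have WH y : embed W y *m H y = 0 by rewrite mulmxA WV.
have rH y : \rank (H y) = r.
  rewrite /H rank_unit_mul// mxrank_tr; apply/eqP.
  by have := embed_free V y.
pose phi y := \det (B y *m H y) / \det (col_mx (embed W y) (B y)).
have phi0 y : phi y != 0.
  rewrite /phi mulf_neq0 ?invr_eq0 ?(pairing_rank (WH y) (BP y))//.
  by rewrite -unitfE -unitmxE BP.
pose T := twist (twist W V 1 (-1)) (twist L Q r%:Z (-1)) 1 1.
have dT : deg T = deg W - deg V + (r%:Z * deg L - deg Q).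
  by rewrite /T !deg_twist// !mul1r !mulN1r.
suff : deg T = 0 by rewrite dT; lia.
apply: (@section_deg0 _ T phi) => // i x.
case: i => -[j l] [a i] [[Wj Vl] [La Qi]].
have {}Qi : dom Q i x := Qi. have {}Wj : dom W j x := Wj.
have {}La : dom L a x := La. have {}Vl : dom V l x := Vl.
have dTf y : \det (frame T (j, l, (a, i)) y) = \det (frame W j y) * (\det (frame V l y))^-1 *
    (\det (frame L a y) ^+ r * (\det (frame Q i y))^-1).
  by rewrite /T !det_twist_frame !expr1z !exprN1.
have [B0 [uB hB _]] := local_complement Qi Wj.
have hS := sym_form_hol sQ Qi La.
have hV : holmx x (fun y => frame V l y *m embed V y *m invmx (frame Q i y)).
  exact: (@embed_hol _ _ _ _ _ V l i x Vl Qi).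
have hD : hol x (fun y => \det (B0 *m ((\det (frame L a y))^-1 *:
    (frame Q i y *m qf Q y *m (frame Q i y)^T)) *m
    (frame V l y *m embed V y *m invmx (frame Q i y))^T)).
  apply: holmx_det; apply: holmxM; last exact: holmxT.
  by apply: holmxM => //; exact: holmx_cst.
apply: hol_ext (holM hD hB) _.
have nQ := dom_nbhs (Qi : dom Q i x); have nW := dom_nbhs (Wj : dom W j x).
have nL := dom_nbhs (La : dom L a x); have nV := dom_nbhs (Vl : dom V l x).
near=> y; have uy : col_mx (embed W y) (B0 *m frame Q i y) \in unitmx by near: y.
have Qy : dom Q i y by near: y.
have dQ : \det (frame Q i y) != 0 by exact: det_frame_neq0.
have dW : \det (frame W j y) != 0 by apply: det_frame_neq0; near: y.
have dL : \det (frame L a y) != 0 by apply: det_frame_neq0; near: y.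
have dV : \det (frame V l y) != 0 by apply: det_frame_neq0; near: y.
have pE : phi y = _ := pairing_det_change (WH y) (BP y) uy.
rewrite pE dTf {pE}.
rewrite -scalemxAr -scalemxAl detZ.
have -> : B0 *m (frame Q i y *m qf Q y *m (frame Q i y)^T) *m
    (frame V l y *m embed V y *m invmx (frame Q i y))^T =
    (B0 *m frame Q i y *m H y) *m (frame V l y)^T.
  have uF : frame Q i y \in unitmx by exact: frame_unit.
  by rewrite -mulmxA frame_pairing// trmx_mul !mulmxA.
rewrite det_mulmx det_tr.
have du : \det (col_mx (embed W y) (B0 *m frame Q i y)) != 0 by rewrite -unitfE -unitmxE.
rewrite exprVn.
have lr : \det (frame L a y) ^+ r != 0 by rewrite expf_neq0.
by field; rewrite du dQ dW dV lr.
Unshelve. all: by end_near.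
Qed.

End KernelBundle.

(** * Comparison of the two stability conditions *)

Section Scaling.
Context {R : realType} (Y : cspace R).
Local Notation C := R[i].

Section Dual.
Variable K : bundle Y 1.

Lemma dual_neq0 i y : dom K i y -> (frame K i y 0 0)^-1 != 0.
Proof. by move=> Ki; rewrite invr_eq0 line_neq0. Qed.

Lemma dual_hol i j y : dom K i y -> dom K j y ->
  hol y (fun y' => (frame K i y' 0 0)^-1 / (frame K j y' 0 0)^-1).
Proof.
move=> Ki Kj; apply: hol_ext (line_trans Kj Ki) _; apply: nearW => y'.
by rewrite invrK mulrC.
Qed.

Definition dual : bundle Y 1 :=
  line (@dom_open _ _ _ K) (@dom_cover _ _ _ K) dual_neq0 dual_hol.

Lemma dual_frame i y : frame dual i y 0 0 = (frame K i y 0 0)^-1.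
Proof. exact: line_frame. Qed.

End Dual.

Section Scale.
Variables (n : nat) (E : bundle Y n) (K : bundle Y 1).

Let sdom (t : frame_index E * frame_index K) : set Y := dom E t.1 `&` dom K t.2.
Let sfr (t : frame_index E * frame_index K) y := frame K t.2 y 0 0 *: frame E t.1 y.

Lemma scale_open t : open (sdom t).
Proof. by apply: openI; exact: dom_open. Qed.

Lemma scale_cover y : exists t, sdom t y.
Proof.
by have [i Ei] := @dom_cover _ _ _ E y; have [j Kj] := @dom_cover _ _ _ K y; exists (i, j).
Qed.

Lemma scale_unit t y : sdom t y -> sfr t y \in unitmx.
Proof.
move=> [Ei Kj]; rewrite unitmxE detZ unitfE mulf_neq0 ?det_frame_neq0//.
by rewrite expf_neq0// line_neq0.
Qed.

Lemma scale_inv t y : sdom t y ->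
  invmx (sfr t y) = (frame K t.2 y 0 0)^-1 *: invmx (frame E t.1 y).
Proof.
move=> ty; have [Ei Kj] := ty; apply: (can_inj (mulKmx (scale_unit ty))).
rewrite mulmxV ?scale_unit// /sfr -scalemxAl -scalemxAr scalerA mulfV ?line_neq0//.
by rewrite scale1r mulmxV// frame_unit.
Qed.

Lemma scale_trans t u y : sdom t y -> sdom u y ->
  holmx y (fun y' => sfr t y' *m invmx (sfr u y')).
Proof.
move=> [t1 t2] [u1 u2].
apply: holmx_ext (holmxZ (line_trans t2 u2) (@frame_trans _ _ _ E _ _ _ t1 u1)) _.
have n1 := dom_nbhs u1; have n2 := dom_nbhs u2; near=> y'.
rewrite scale_inv; last by split; near: y'.
by rewrite /sfr -scalemxAl -scalemxAr scalerA.
Unshelve. all: by end_near.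
Qed.

(** The tensor product of [E] and [K]. The fibres remain C^n and only the frames are rescaled, so
    homomorphisms, embeddings and forms keep their matrices. *)
Definition scale : bundle Y n :=
  @Bundle _ Y n _ sdom sfr scale_open scale_cover scale_unit scale_trans.

End Scale.

Lemma scale_frame_inv n (E : bundle Y n) K t y : dom (scale E K) t y ->
  invmx (frame (scale E K) t y) = (frame K t.2 y 0 0)^-1 *: invmx (frame E t.1 y).
Proof. exact: scale_inv. Qed.

Lemma scale_hol_hom m n (E : bundle Y m) (F : bundle Y n) K f :
  hol_hom E F f -> hol_hom (scale E K) (scale F K) f.
Proof.
move=> hf t u y tt uu; have [t1 t2] := tt; have [u1 u2] := uu.
apply: holmx_ext (holmxZ (line_trans t2 u2) (hf _ _ _ t1 u1)) _.
have nu := dom_nbhs uu; near=> y'.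
rewrite scale_frame_inv; last by near: y'.
by rewrite /= -!scalemxAl -scalemxAr scalerA.
Unshelve. all: by end_near.
Qed.


Lemma unscale_embed_hol n (E : bundle Y n) K r (V : subbundle (scale E K) r) :
  hol_hom (scale V (dual K)) E (embed V).
Proof.
move=> t i y [t1 t2] Ei; have tK : dom K t.2 y := t2.
apply: holmx_ext (@embed_hol _ _ _ _ _ V t.1 (i, t.2) y t1 (conj Ei tK)) _.
have nE := dom_nbhs Ei; have nK := dom_nbhs tK; near=> y'.
rewrite scale_frame_inv; last by split; near: y'.
by rewrite /= mxE eqxx mulr1n -scalemxAr -!scalemxAl.
Unshelve. all: by end_near.
Qed.

Definition unscale_sub n (E : bundle Y n) K r (V : subbundle (scale E K) r) : subbundle E r :=
  @Subbundle _ Y n E r (scale V (dual K)) (embed V)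
    (@unscale_embed_hol n E K r V) (@embed_free _ _ _ _ _ V).

Definition qscale n (Q : qpair Y n) (K : bundle Y 1) : qpair Y n := QPair (scale Q K) (qf Q).

(** The hypothesis says that the identity of the fibres is a holomorphic map from K^2 (x) L to
    L'. *)
Lemma qscale_sym_form (L L' K : bundle Y 1) n (Q : qpair Y n) :
  (forall a c c' y, dom K a y -> dom L c y -> dom L' c' y ->
     hol y (fun y' => frame K a y' 0 0 * frame K a y' 0 0 * frame L c y' 0 0 /
                      frame L' c' y' 0 0)) ->
  sym_form L Q -> sym_form L' (qscale Q K).
Proof.
move=> hK [sQ hQ]; split=> // t c' y [t1 t2] Lc'.
have [c Lc] := @dom_cover _ _ _ L y.
apply: holmx_ext (holmxZ (hK _ _ _ _ t2 Lc Lc') (hQ _ _ _ t1 Lc)) _.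
have nL := dom_nbhs Lc; have nL' := dom_nbhs Lc'; near=> y'.
have ln' : frame L' c' y' 0 0 != 0 by apply: line_neq0; near: y'.
have ln : frame L c y' 0 0 != 0 by apply: line_neq0; near: y'.
rewrite /= scalerA -scalemxAl -scalemxAl [(_ *: _)^T]linearZ/= -scalemxAr !scalerA.
by congr (_ *: _); field; rewrite ln ln'.
Unshelve. all: by end_near.
Qed.

Lemma qscale_iso n (Q1 Q2 : qpair Y n) K : qiso Q1 Q2 -> qiso (qscale Q1 K) (qscale Q2 K).
Proof. by move=> [f [h1 h2 h3]]; exists f; split=> //; exact: scale_hol_hom. Qed.

Lemma qscale_qscale n (Q : qpair Y n) K K' :
  (forall a b y, dom K a y -> dom K' b y -> hol y (fun y' => frame K' b y' 0 0 * frame K a y' 0 0)) ->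
  qiso (qscale (qscale Q K) K') Q.
Proof.
move=> hK; exists (fun=> 1%:M); split=> [t i y [[t1 t2] t3] Qi|y|y]; last first.
- by rewrite trmx1 mulmx1 mul1mx.
- exact: unitmx1.
apply: holmx_ext (holmxZ (hK _ _ _ t2 t3) (@frame_trans _ _ _ Q _ _ _ t1 Qi)) _.
by apply: nearW => y'; rewrite /= mulmx1 scalerA -scalemxAl.
Qed.

End Scaling.

(** * Degrees under twisting and the two comparisons *)

Section Semistability.
Context {R : realType} (X : cspace R).
Hypothesis hX : compact_riemann_surface X.
Local Notation C := R[i].
Implicit Types (x y : X).

Lemma deg_scale n (E : bundle X n) (K : bundle X 1) : deg (scale E K) = deg E + n%:Z * deg K.
Proof.
have [s1 [m1 h1]] := degree_dataP hX E; have [s2 [m2 h2]] := degree_dataP hX K.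
have [E' _] := finite_support_sum 1 n%:Z (degree_data_finite hX h1) (degree_data_finite hX h2).
rewrite (deg_data hX h1) (deg_data hX h2) -[X in X + _]mul1r -E'.
apply: (@deg_data _ _ hX _ _ (fun y => s1 y * s2 y ^+ n)) => t x [t1 t2].
have := order_mul hX (h1 _ _ t1) (order_exp hX n (h2 _ _ t2)).
rewrite mul1r (mulrC (m2 x)); apply: order_ext.
by apply: nearW => y; rewrite /= detZ det_mx11 expr_div_n invfM mulrACA (mulrC (_ ^- n)).
Qed.

Lemma deg_trivial : deg (trivial_bundle X) = 0.
Proof.
apply: (@section_deg0 _ _ hX _ _ (fun=> 1)) => [i x _|x]; last exact: oner_neq0.
by apply: hol_ext (hol_cst x 1) _; apply: nearW => y; rewrite /= det1 divr1.
Qed.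

Lemma deg_dual (K : bundle X 1) : deg (dual K) = - deg K.
Proof.
have : deg (scale K (dual K)) = 0.
  apply: (@section_deg0 _ _ hX _ _ (fun=> 1)) => [t x [t1 t2]|x]; last exact: oner_neq0.
  apply: hol_ext (line_trans (t2 : dom K t.2 x) t1) _; apply: nearW => y.
  by rewrite /= detZ det_mx11 expr1 mxE eqxx mulr1n invfM invrK mul1r.
by rewrite deg_scale mul1r => /eqP; rewrite addrC addr_eq0 => /eqP.
Qed.

Lemma deg_rank_eq0 r (E : bundle X r) : r = 0%N -> deg E = 0.
Proof. by move=> r0; subst r; exact: deg_rank0. Qed.

Lemma sym_form_kernel (x0 : X) (L : bundle X 1) n (Q : qpair X n) : sym_form L Q ->
  exists r (N : subbundle Q (n - r)), [/\ (r <= n)%N, in_kernel N &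
    exists x, \rank (qf Q x) = r].
Proof.
move=> sQ; have [|r [N [rn kN rk]]] := kernel_subbundle hX x0 (E := Q) (A := qf Q).
  move=> x; have [i Qi] := @dom_cover _ _ _ Q x; have [a La] := @dom_cover _ _ _ L x.
  (* This factor completes the product to the matrix of the form in local frames of [Q] and [L], the
     only one known to be holomorphic. *)
  exists i, (fun y => (\det (frame L a y))^-1 *: (frame Q i y)^T); split=> //.
    have nQ := dom_nbhs Qi; have nL := dom_nbhs La; near=> y.
    rewrite unitmxE detZ unitfE mulf_neq0 ?expf_neq0 ?invr_eq0 ?det_tr//;
      by apply: det_frame_neq0; near: y.
  apply: holmx_ext (sym_form_hol sQ Qi La) _; apply: nearW => y.
  by rewrite -scalemxAr.
exists r, N; split=> //.
by have [|y _ ry] := @punct_exists _ _ hX x0 (fun y => \rank (qf Q y) = r); [exact: rk|exists y].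
Unshelve. all: by end_near.
Qed.

Lemma kernel_degree_cast n k m (Q : qpair X n) (L : bundle X 1) (N : subbundle Q k) :
  n = (k + m)%N ->
  sym_form L Q -> in_kernel N -> (exists x, \rank (qf Q x) = m) ->
  [/\ 2 * deg Q <= 2 * deg N + m%:Z * deg L,
     2 * deg Q = 2 * deg N + m%:Z * deg L -> forall x, \rank (qf Q x) = m
   & (forall x, \rank (qf Q x) = m) -> 2 * deg Q = 2 * deg N + m%:Z * deg L].
Proof. by move=> E; subst n; exact: kernel_degree. Qed.

Lemma perp_degree_cast n w r (Q : qpair X n) (L : bundle X 1) (V : subbundle Q r)
    (W : subbundle Q w) : n = (w + r)%N -> sym_form L Q -> (forall x, qf Q x \in unitmx) ->
  (forall x, embed W x *m qf Q x *m (embed V x)^T = 0) ->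
  deg W = deg Q + deg V - r%:Z * deg L.
Proof. by move=> E; subst n; exact: perp_degree. Qed.

Lemma orthogonal_ranks x n (Q : qpair X n) r1 r2 (V1 : subbundle Q r1) (V2 : subbundle Q r2) :
  qf Q x \in unitmx -> orthogonal_to V1 V2 -> (r1 + r2 <= n)%N.
Proof.
move=> u /(_ x) o.
have e1 : \rank (embed V1 x *m qf Q x) = r1.
  by rewrite mxrankMfree ?row_free_unit//; apply/eqP; exact: embed_free.
have e2 : \rank (embed V2 x) = r2 by apply/eqP; exact: embed_free.
have : (embed V1 x *m qf Q x <= kermx (embed V2 x)^T)%MS by apply/sub_kermxP.
move=> /mxrankS; rewrite e1 mxrank_ker mxrank_tr e2 => h.
have : (r2 <= n)%N by rewrite -{1}e2 rank_leq_col.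
by move=> h2; rewrite -(subnK h2) leq_add2r.
Qed.

Lemma orthogonal_complement (x0 : X) (L : bundle X 1) n (Q : qpair X n) r (V : subbundle Q r) :
  sym_form L Q -> (forall x, qf Q x \in unitmx) ->
  exists W : subbundle Q (n - r),
    [/\ forall x, embed W x *m qf Q x *m (embed V x)^T = 0,
        deg W = deg Q + deg V - r%:Z * deg L
      & orthogonal_to V V -> sub_le V W].
Proof.
move=> sQ uQ.
have rA x : \rank (qf Q x *m (embed V x)^T) = r.
  by rewrite rank_unit_mul// mxrank_tr; apply/eqP; exact: embed_free.
have rn : (r <= n)%N by rewrite -{1}(rA x0) rank_leq_row.
have [|r' [W [_ WV rk]]] := kernel_subbundle hX x0 (E := Q) (A := fun x => qf Q x *m (embed V x)^T).
  move=> x; have [i Qi] := @dom_cover _ _ _ Q x; have [a La] := @dom_cover _ _ _ L x.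
  have [j Vj] := @dom_cover _ _ _ V x.
  exists i, (fun y => (\det (frame L a y))^-1 *: (frame V j y)^T); split=> //.
    have nV := dom_nbhs Vj; have nL := dom_nbhs La; near=> y.
    rewrite unitmxE detZ unitfE mulf_neq0 ?expf_neq0 ?invr_eq0 ?det_tr//;
      by apply: det_frame_neq0; near: y.
  have hV := holmxT (@embed_hol _ _ _ _ _ V j i x Vj Qi).
  apply: holmx_ext (holmxM (sym_form_hol sQ Qi La) hV) _.
  have nQ := dom_nbhs Qi; near=> y.
  have uF : frame Q i y \in unitmx by apply: frame_unit; near: y.
  by rewrite -scalemxAl -scalemxAr frame_pairing// trmx_mul !mulmxA.
have r'r : r' = r.
  by have [y _ <-] := @punct_exists _ _ hX x0 _ (rk x0); exact: rA.
subst r'; exists W; split=> [x||o x].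
- by rewrite -mulmxA WV.
- by apply: perp_degree_cast => //; [rewrite subnK | move=> x; rewrite -mulmxA WV].
- apply: submx_trans (_ : (kermx (qf Q x *m (embed V x)^T) <= _)%MS).
    by apply/sub_kermxP; rewrite mulmxA o.
  have := mxrank_leqif_sup (_ : (embed W x <= kermx (qf Q x *m (embed V x)^T))%MS).
  case; first by apply/sub_kermxP; exact: WV.
  rewrite mxrank_ker rA (eqP (_ : \rank (embed W x) == (n - r)%N)); last exact: embed_free.
  by rewrite leqnn eqxx => _ <-.
Unshelve. all: by end_near.
Qed.

Section Comparison.
Variables (x0 : X) (L K : bundle X 1) (e : int) (n : nat) (alpha : R).
Hypothesis hK : forall i j a x, dom K i x -> dom K j x -> dom L a x ->
  hol x (fun y => frame K i y 0 0 * frame K j y 0 0 / frame L a y 0 0).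
Hypotheses (degL : deg L = e * 2) (n0 : (0 < n)%N) (alpha_lt : alpha < e%:~R).

Lemma deg_root : deg K = e.
Proof.
have : deg (twist L K 1 (-2)) = 0.
  apply: (@section_deg0 _ _ hX _ _ (fun=> 1)) => [[a i] x [La Ki]|x]; last exact: oner_neq0.
  apply: hol_ext (hK Ki Ki La) _; apply: nearW => y.
  rewrite det_twist_frame !det_mx11 expr1z -exprnN invfM invrK mul1r mulrC.
  by rewrite expr2.
by rewrite deg_twist// degL mul1r; lia.
Qed.

Lemma to_orthogonal_form (Q : qpair X n) : sym_form L Q ->
  sym_form (trivial_bundle X) (qscale Q (dual K)).
Proof.
apply: qscale_sym_form => a c c' y Ka Lc _.
have kn := line_neq0 (Ka : dom K a y); have ln := line_neq0 Lc.
have knl : frame K a y 0 0 * frame K a y 0 0 / frame L c y 0 0 != 0.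
  by rewrite !mulf_neq0 ?invr_eq0.
apply: hol_ext (holV (hK Ka Ka Lc) knl) _; apply: nearW => y'.
by rewrite !dual_frame /= !mxE eqxx !mulr1n divr1 invfM invrK invfM.
Qed.

Lemma from_orthogonal_form (W : qpair X n) : sym_form (trivial_bundle X) W ->
  sym_form L (qscale W K).
Proof.
apply: qscale_sym_form => a c c' y Ka _ Lc'.
apply: hol_ext (hK Ka Ka Lc') _; apply: nearW => y'.
by rewrite /= mxE eqxx mulr1n mulr1.
Qed.

Lemma semistable_unit (Q : qpair X n) : semistable L alpha Q -> deg Q = n%:Z * e ->
  forall x, qf Q x \in unitmx.
Proof.
move=> [[sQ [x1 q1]] _ h1 _] dQ.
have [r [N [rn kN [x2 rx2]]]] := sym_form_kernel x0 sQ.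
have nE : n = ((n - r) + r)%N by rewrite subnK.
have [ineq eq _] := kernel_degree_cast nE sQ kN (ex_intro _ x2 rx2).
(* The form is not zero, so the kernel is not everything and clause (1c) may be applied to it. *)
have r0 : (0 < r)%N.
  rewrite lt0n; apply: contra q1 => /eqP r0.
  have full : row_full (embed N x1).
    by rewrite /row_full (eqP (_ : \rank (embed N x1) == (n - r)%N)) ?r0 ?subn0//;
      exact: embed_free.
  have := eqmxMfull (qf Q x1) full; rewrite kN => E.
  by rewrite -mxrank_eq0 -E mxrank0.
have rn' : r = n.
  apply/eqP; rewrite eqn_leq rn/= leqNgt; apply/negP => rn1.
  have [|_ _ /(_ kN)] := h1 _ N; first by rewrite subn_gt0 rn1 ltn_subrL r0.
  (* The degree of [N] is at least its rank times [e], while (1c) bounds it by its rank times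
     [alpha], which is smaller. *)
  have Nge : (n - r)%N%:Z * e <= deg N by move: ineq; rewrite dQ degL; lia.
  move: Nge; rewrite -(ler_int R) intrM => Nge.
  have m0 : (0 : R) < (n - r)%N%:R by rewrite ltr0n subn_gt0.
  have := ltr_pM2l m0 alpha e%:~R; rewrite alpha_lt => lt1.
  by rewrite mulrC => le1; have := lt_le_trans lt1 (le_trans Nge le1); rewrite ltxx.
have N0 : deg N = 0 by apply: deg_rank_eq0; rewrite rn' subnn.
move=> x; rewrite -row_free_unit /row_free; apply/eqP; apply: (etrans _ rn'); apply: eq.
by rewrite N0 dQ degL rn'; lia.
Qed.

Lemma semistable_orthogonal (Q : qpair X n) : semistable L alpha Q -> deg Q = n%:Z * e ->
  orth_semistable (qscale Q (dual K)).
Proof.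
move=> ss dQ; have uQ := semistable_unit ss dQ.
case: (ss) => [[sQ _] _ h1 h2].
split=> [|r F oF]; first by split=> //; exact: to_orthogonal_form.
pose V : subbundle Q r := unscale_sub F.
have dV : deg V = deg F + r%:Z * e.
  have -> : deg V = deg (scale F (dual (dual K))) by [].
  by rewrite deg_scale !deg_dual opprK deg_root.
have oV : orthogonal_to V V by exact: oF.
have rr : (r + r <= n)%N := orthogonal_ranks (uQ x0) oV.
have [r0|r0] := posnP r; first by rewrite (deg_rank_eq0 _ r0).
have [W [WV dW sub]] := orthogonal_complement x0 V sQ uQ.
suff : deg V <= r%:Z * e by rewrite dV; lia.
have {rr}[rr|rr] : (r + r = n)%N \/ (r < n - r)%N by lia.
  have [|_ /(_ oV) h _] := h1 r V; first by rewrite r0 -rr -addn1 leq_add.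
  have nR : (n%:R : R) = r%:R + r%:R by rewrite -rr natrD.
  rewrite -(ler_int R) intrM; apply: le_trans h _; rewrite dQ intrM.
  have -> : ((n%:Z)%:~R : R) = r%:R + r%:R by rewrite -nR.
  by rewrite nR; set t : R := r%:R; rewrite le_eqVlt; apply/orP; left; apply/eqP; field.
have rn : (r < n)%N by lia.
have oVW : orthogonal_to V W.
  by move=> x; apply: trmx_inj; rewrite !trmx_mul trmxK (sQ.1 x) mulmxA WV trmx0.
have noWW : ~ orthogonal_to W W.
  by move=> /(orthogonal_ranks (uQ x0)); lia.
have := h2 _ _ V W _ _ (sub oV) oVW noWW.
rewrite r0 rr => /(_ isT) h; have {}h := h _.
have {}h : (deg V)%:~R + (deg W)%:~R <= (deg Q)%:~R + alpha * (r%:R + (n - r)%:R - n%:R) by apply: h; lia.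
(* The ranks [r] and [n - r] add up to [n], so [alpha] drops out of clause (2). *)
move: h; rewrite -natrD subnKC ?(ltnW rn)// subrr mulr0 addr0 -intrD ler_int dW dQ degL.
by lia.
Qed.

Lemma orthogonal_deg0 (W : qpair X n) : orthogonal_bundle W -> deg W = 0.
Proof.
move=> [sW uW]; have [r [N [rn kN [x2 rx2]]]] := sym_form_kernel x0 sW.
have rE x : \rank (qf W x) = n by apply/eqP; rewrite -/(row_free _) row_free_unit.
have r_n : r = n by rewrite -rx2.
have nE : n = ((n - r) + r)%N by rewrite subnK.
have [_ _ H] := kernel_degree_cast nE sW kN (ex_intro _ x2 rx2).
have := H (fun x => etrans (rE x) (esym r_n)).
by rewrite deg_trivial (deg_rank_eq0 N) ?r_n ?subnn//; lia.
Qed.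

(* The kernel of the form induced on [F] is isotropic in [W] and has at least the
   degree of [F]. *)
Lemma orth_semistable_sub (W : qpair X n) r (F : subbundle W r) : orth_semistable W ->
  deg F <= 0.
Proof.
move=> [[sW uW] iso].
pose QF := QPair (sub_bundle F) (fun x => embed F x *m qf W x *m (embed F x)^T).
have sQF : sym_form (trivial_bundle X) QF.
  split=> [y|j a y Fj _].
    by rewrite /= !trmx_mul trmxK (sW.1 y) mulmxA.
  have [i Wi] := @dom_cover _ _ _ W y.
  have hE := @embed_hol _ _ _ _ _ F j i y Fj Wi.
  have hW := sW.2 i tt y Wi I.
  apply: holmx_ext (holmxM (holmxM hE hW) (holmxT hE)) _.
  have nW := dom_nbhs Wi; near=> y'.
  have uF : frame W i y' \in unitmx by apply: frame_unit; near: y'.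
  rewrite /= mxE eqxx mulr1n invr1 !scale1r -mulmxA frame_pairing//.
  by rewrite !mulmxA mulmxKV// trmx_mul !mulmxA.
have [k [N [kr kN rk]]] := sym_form_kernel x0 sQF.
have rE : r = ((r - k) + k)%N by rewrite subnK.
have [ineq _ _] := kernel_degree_cast rE sQF kN rk.
have hN : hol_hom N W (fun x => embed N x *m embed F x).
  move=> l i y Nl Wi; have [j Fj] := @dom_cover _ _ _ F y.
  have h1 := @embed_hol _ _ _ _ _ N l j y Nl Fj.
  have h2 := @embed_hol _ _ _ _ _ F j i y Fj Wi.
  apply: holmx_ext (holmxM h1 h2) _.
  have nF := dom_nbhs Fj; near=> y'.
  have uF : frame F j y' \in unitmx by apply: frame_unit; near: y'.
  by rewrite !mulmxA mulmxKV.
have fN y : row_free (embed N y *m embed F y).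
  by rewrite /row_free mxrankMfree; exact: embed_free.
pose N' : subbundle W (r - k) := @Subbundle _ X n W (r - k) N _ hN fN.
have oN : orthogonal_to N' N'.
  move=> x; rewrite /= trmx_mul !mulmxA.
  by have := kN x; rewrite /= !mulmxA => ->; rewrite mul0mx.
have := iso _ N' oN; have -> : deg N' = deg N by [].
by move: ineq; rewrite deg_trivial; have -> : deg QF = deg F by []; lia.
Unshelve. all: by end_near.
Qed.

Lemma orthogonal_semistable (W : qpair X n) : orth_semistable W ->
  semistable L alpha (qscale W K) /\ deg (qscale W K) = n%:Z * e.
Proof.
move=> ss; have [[sW uW] iso] := ss.
have dQ : deg (qscale W K) = n%:Z * e.
  have -> : deg (qscale W K) = deg (scale W K) by [].
  by rewrite deg_scale deg_root orthogonal_deg0 ?add0r//; case: ss.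
split=> //; have sQ := from_orthogonal_form sW.
have nR : (0 : R) < n%:R by rewrite ltr0n.
(* After the twist, degree at most 0 reads as slope at most [e], for every subbundle and not only
   for the isotropic ones. *)
have sub_le r (V : subbundle (qscale W K) r) : ((deg V)%:~R : R) <= r%:R * e%:~R.
  have h := orth_semistable_sub (unscale_sub V : subbundle W r) ss.
  have dV : deg (unscale_sub V : subbundle W r) = deg V - r%:Z * e.
    have -> : deg (unscale_sub V : subbundle W r) = deg (scale V (dual K)) by [].
    by rewrite deg_scale deg_dual deg_root mulrN.
  move: h; rewrite dV subr_le0 -(ler_int R) intrM; exact.
have dR : ((deg (qscale W K))%:~R : R) = n%:R * e%:~R by rewrite dQ intrM.
(* In each clause the bound minus rank times [e] is [e - alpha] times a nonnegative number: n - r in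
   (1a), n / 2 - r in (1b), n - r1 - r2 in (2). Clause (1c) is void because the form is
   nondegenerate. *)
have ea : 0 <= e%:~R - alpha by rewrite subr_ge0 ltW.
split.
- split=> //; exists x0; apply/eqP => q0; have := uW x0.
  have -> : qf W x0 = 0 by exact: q0.
  by rewrite -row_free_unit /row_free mxrank0 eq_sym; move: n0; rewrite lt0n => /negPf ->.
- by rewrite dR mulrC mulKf ?ltW// gt_eqF.
- move=> r V /andP[r0 rn]; rewrite dR; have := sub_le _ V.
  have rnR : (r%:R : R) <= n%:R by rewrite ler_nat ltnW.
  split.
  + move=> _; have := mulr_ge0 (_ : 0 <= n%:R - r%:R) ea; rewrite subr_ge0 => /(_ rnR).
    by nra.
  + move=> oV; have := @orthogonal_ranks x0 n (qscale W K) r r V V (uW x0) oV.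
    rewrite -(ler_nat R) natrD => h.
    by have := mulr_ge0 (_ : 0 <= n%:R - (r%:R + r%:R)) ea; rewrite subr_ge0 => /(_ h); nra.
  + move=> kV; exfalso; have := kV x0 => E.
    move: r0; have : \rank (embed V x0 *m qf W x0) = r.
      by rewrite mxrankMfree ?row_free_unit//; apply/eqP; exact: embed_free.
    by have -> : embed V x0 *m qf W x0 = 0 by [exact: E]; rewrite mxrank0 => <-.
- move=> r1 r2 V1 V2 _ _ _ oV _; rewrite dR.
  have h1 := sub_le _ V1; have h2 := sub_le _ V2.
  have := @orthogonal_ranks x0 n (qscale W K) r1 r2 V1 V2 (uW x0) oV.
  rewrite -(ler_nat R) natrD => h.
  by have := mulr_ge0 (_ : 0 <= n%:R - (r1%:R + r2%:R)) ea; rewrite subr_ge0 => /(_ h); nra.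
Qed.

End Comparison.

End Semistability.

(** * Moduli spaces *)

Section Moduli.
Context {R : realType}.
Local Notation C := R[i].

Lemma bundle_eq (Y : cspace R) n I d f o1 c1 u1 t1 o2 c2 u2 t2 :
  @Bundle R Y n I d f o1 c1 u1 t1 = @Bundle R Y n I d f o2 c2 u2 t2.
Proof. by congr Bundle; exact: Prop_irrelevance. Qed.

Lemma hol_eq (Y : cspace R) (y : Y) f g : hol y f -> f =1 g -> hol y g.
Proof. by move=> hf /funext <-. Qed.

(** On an empty [X] all coefficient vectors represent the same form, against uniqueness as soon as
    [g] is positive. *)
Lemma genus_nonempty (X : cspace R) g : has_genus X g -> (0 < g)%N -> exists x : X, True.
Proof.
move=> [w w1 w2] g0; apply: contrapT => noX.
have [c [_ cu]] := w2 _ (w1 (Ordinal g0)).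
have := cu (c + const_mx 1) (fun _ _ x => False_ind _ (noX (ex_intro _ x I))).
move=> /matrixP/(_ 0 (Ordinal g0)) /eqP; rewrite !mxE -subr_eq0 opprD addrA subrr sub0r.
by rewrite oppr_eq0 oner_eq0.
Qed.

Definition scale_family (X T : cspace R) n (E : qpair (cprod X T) n) (K : bundle X 1) :
    qpair (cprod X T) n :=
  qscale E (pullback (hol_map_fst X T) K).

(** Both sides have the same frames, so they are equal and not merely isomorphic; a classifying map
    can be rewritten along the whole family. *)
Lemma fibre_scale_family (X T : cspace R) n (E : qpair (cprod X T) n) (K : bundle X 1) t :
  qpullback (hol_map_slice X t) (scale_family E K) =
  qscale (qpullback (hol_map_slice X t) E) K.
Proof. by congr QPair; exact: bundle_eq. Qed.

End Moduli.

Theorem proposition3p9 (R : realType) (X : cspace R) (g : nat)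
    (L : bundle X 1) (n : nat) (alpha : R)
    (hX : compact_riemann_surface X) (hg : has_genus X g) (g2 : (2 <= g)%N)
    (n1 : (1 <= n)%N) (evenL : (2 %| deg L)%Z)
    (halpha : alpha < (deg L)%:~R / 2)
    (N : cspace R) (clN : qpair X n -> N)
    (hN : @moduli_space R
            (quadric_moduli L alpha n ((n%:Z * deg L) %/ 2)%Z) N clN)
    (M : cspace R) (clM : qpair X n -> M)
    (hM : @moduli_space R (orthogonal_moduli X n) M clM) :
  biholomorphic N M.
Proof.
have [x0 _] := genus_nonempty hg (ltnW g2).
have [K hK] := line_square_root hX evenL.
pose e := (deg L %/ 2)%Z.
have degL : deg L = e * 2 by rewrite /e divzK.
have dE : ((n%:Z * deg L) %/ 2)%Z = n%:Z * e by rewrite degL mulrA mulzK.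
have alpha_lt : alpha < e%:~R.
  by move: halpha; rewrite degL intrM mulfK.
pose to (Q : qpair X n) := qscale Q (dual K).
pose from (W : qpair X n) := qscale W K.
rewrite dE in hN.
have [cN [isoN famN] univN _ surN] := hN; have [cM [isoM famM] univM _ surM] := hM.
have ssto Q : semistable L alpha Q /\ deg Q = n%:Z * e -> orth_semistable (to Q).
  by move=> [h1 h2]; exact: (semistable_orthogonal hX x0 hK degL n1 alpha_lt h1 h2).
have ssfrom W : orth_semistable W -> semistable L alpha (from W) /\ deg (from W) = n%:Z * e.
  exact: (orthogonal_semistable hX x0 hK degL n1 alpha_lt).
(* Twisting by the dual of [K] respects families, so classifying orthogonal bundles also classifies
   quadric bundles; the universal property of [N] then yields [h]. The opposite direction is the
   same with [K]. *)
have clsM : @classifies R (quadric_moduli L alpha n (n%:Z * e)) M (clM \o to).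
  split=> [a b sa sb ab|T E cT fE sE].
    by apply: isoM; [exact: ssto | exact: ssto | exact: qscale_iso].
  have -> : (fun t => (clM \o to) (@fibre _ (quadric_moduli L alpha n (n%:Z * e)) T E t)) =
      (fun t => clM (@fibre _ (orthogonal_moduli X n) T (scale_family E (dual K)) t)).
    by apply/funext => t; rewrite /= fibre_scale_family.
  apply: famM => // [|t]; last first.
    by rewrite /= fibre_scale_family; exact: ssto (sE t).
  move: fE; apply: qscale_sym_form => a c c' y Ka Lc _.
  have {}Ka : dom K a y.1 := Ka. have {}Lc : dom L c y.1 := Lc.
  have knl : frame K a y.1 0 0 * frame K a y.1 0 0 / frame L c y.1 0 0 != 0.
    by rewrite !mulf_neq0 ?invr_eq0 ?line_neq0.
  have := (hol_map_fst X T).2 y _ (holV (hK _ _ _ _ Ka Ka Lc) knl).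
  move=> h; apply: hol_eq h _ => y'.
  by rewrite /= !mxE eqxx !mulr1n divr1 !invfM invrK.
have clsN : @classifies R (orthogonal_moduli X n) N (clN \o from).
  split=> [a b sa sb ab|T E cT fE sE].
    by apply: isoN; [exact: ssfrom | exact: ssfrom | exact: qscale_iso].
  have -> : (fun t => (clN \o from) (@fibre _ (orthogonal_moduli X n) T E t)) =
      (fun t => clN (@fibre _ (quadric_moduli L alpha n (n%:Z * e)) T (scale_family E K) t)).
    by apply/funext => t; rewrite /= fibre_scale_family.
  apply: famN => // [|t]; last first.
    by rewrite /= fibre_scale_family; exact: ssfrom (sE t).
  move: fE; apply: qscale_sym_form => a c c' y Ka _ Lc'.
  have {}Ka : dom K a y.1 := Ka. have {}Lc' : dom L c' y.1 := Lc'.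
  have := (hol_map_fst X T).2 y _ (hK _ _ _ _ Ka Ka Lc').
  move=> h; apply: hol_eq h _ => y'.
  by rewrite /= mxE eqxx mulr1n mulr1.
have [h hh hE] := univN _ _ cM clsM; have [k kk kE] := univM _ _ cN clsN.
have tofrom W : qiso (to (from W)) W.
  apply: qscale_qscale => a b y Ka Kb.
  apply: hol_ext (line_trans Ka (Kb : dom K b y)) _; apply: nearW => y'.
  by rewrite dual_frame mulrC.
have fromto Q : qiso (from (to Q)) Q.
  apply: qscale_qscale => a b y Ka Kb.
  apply: hol_ext (line_trans Kb (Ka : dom K a y)) _; apply: nearW => y'.
  by rewrite dual_frame.
(* A point is the class of some object, and [h], [k] act on classes by the two twists, which are
   inverse up to isomorphism. *)
exists h, k; split=> // x.
  have [Q [[sQ _ _] dQ] <-] := surN x.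
  rewrite -hE//= -kE; last exact: ssto.
  apply: isoN => //; [apply: ssfrom; exact: ssto | exact: fromto].
have [W [sW _] <-] := surM x.
rewrite -kE//= -hE; last exact: ssfrom.
apply: isoM => //; [apply: ssto; exact: ssfrom | exact: tofrom].
Qed.
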